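(* Let $q$ be a prime power and let $F/\mathbb{F}_q$ be an algebraic function field with full constant field $\mathbb{F}_q$, of genus $g\geq 2$ and class number $h$. For $r\geq 1$ let $B_r$ denote the number of places of degree $r$ of $F/\mathbb{F}_q$ (so $B_1\geq 0$ is the number of rational places). Let $D_1\subseteq\{1,\dots,g-1\}$ and $D_2\subseteq\{1,\dots,g-2\}$ be sets such that $B_r\geq 1$ for every $r\in D_1$ and every $r\in D_2$. Let $(l_r)_{r\in D_1}$ and $(m_r)_{r\in D_2}$ be integers with $l_r\geq 0$, $\sum_{r\in D_1} r\,l_r\leq g-1$, and $m_r\geq 0$, $\sum_{r\in D_2} r\,m_r\leq g-2$. Then $h\geq h_{BRT}$, where $$h_{BRT}=\frac{(q-1)^2}{(g+1)(q+1)-B_1}\left(\prod_{r\in D_1}\binom{B_r+l_r}{l_r}+q^{g-1}\prod_{r\in D_2}\left[\left(\frac{q^r}{q^r-1}\right)^{B_r}-B_r\binom{B_r+m_r}{B_r}\int_0^{1/q^r}\frac{(\frac{1}{q^r}-t)^{m_r}}{(1-t)^{B_r+m_r+1}}\,dt\right]\right).$$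
   Context: The class number $h$ of $F/\mathbb{F}_q$ is the number of divisor classes of degree zero of $F$ (equivalently the number of $\mathbb{F}_q$-rational points of the Jacobian of a curve with function field $F$). An empty product equals $1$. *)

(* Defs.v *)
From Stdlib Require Import Reals.
From Coquelicot Require Import Coquelicot.
From HB Require Import structures.
From mathcomp Require Import all_boot all_order all_algebra.

Set Implicit Arguments.
Unset Strict Implicit.
Unset Printing Implicit Defensive.

Import GRing.Theory.

Section FunctionField.
Local Open Scope ring_scope.

Variables (K : finFieldType) (F : fieldType) (iota : {rmorphism K -> F}).

Definition peval (p : {poly K}) (x : F) : F := (map_poly iota p).[x].

Definition transcendental (x : F) : Prop :=
  forall p : {poly K}, peval p x = 0 -> p = 0.

Definition in_Kx (x z : F) : Prop :=
  exists p r : {poly K}, peval r x != 0 /\ z = peval p x / peval r x.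

Definition finite_over_Kx (x : F) : Prop :=
  exists s : seq F, forall z : F, exists c : seq F,
    [/\ size c = size s,
        (forall i, (i < size c)%N -> in_Kx x c`_i) &
        z = \sum_(i < size s) c`_i * s`_i].

Definition function_field : Prop :=
  exists x : F, transcendental x /\ finite_over_Kx x.

Definition full_constant_field : Prop :=
  forall z : F, (exists p : {poly K}, p != 0 /\ peval p z = 0) ->
    exists a : K, z = iota a.

(* valuation rings of F/K (places are identified with their valuation rings) *)
Definition valuation_ring (O : F -> Prop) : Prop :=
  [/\ (forall a : K, O (iota a)),
      (forall u v, O u -> O v -> O (u - v)),
      (forall u v, O u -> O v -> O (u * v)),
      (exists z, ~ O z) &
      (forall z, z != 0 -> O z \/ O z^-1)].

(* the place P = maximal ideal of O (its non-units) *)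
Definition in_place (O : F -> Prop) (z : F) : Prop :=
  O z /\ (z = 0 \/ ~ O z^-1).

Definition place_degree (O : F -> Prop) (n : nat) : Prop :=
  exists s : 'I_n -> F,
    [/\ (forall i, O (s i)),
        (forall c : 'I_n -> K,
            in_place O (\sum_i iota (c i) * s i) -> forall i, c i = 0) &
        (forall z, O z -> exists c : 'I_n -> K,
            in_place O (z - \sum_i iota (c i) * s i))].

Definition places_of_degree (r : nat) (O : F -> Prop) : Prop :=
  valuation_ring O /\ place_degree O r.

Definition vunit (O : F -> Prop) (u : F) : Prop := O u /\ u != 0 /\ O u^-1.

Definition uniformizer (O : F -> Prop) (t : F) : Prop :=
  [/\ in_place O t, t != 0 &
      forall z, in_place O z -> exists u, O u /\ z = t * u].

Definition val (O : F -> Prop) (z : F) (n : int) : Prop :=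
  exists t u, [/\ uniformizer O t, vunit O u & z = t ^ n * u].

Definition divisor (D : (F -> Prop) -> int) : Prop :=
  (forall O, ~ valuation_ring O -> D O = 0) /\
  (exists s : seq (F -> Prop), forall O, D O != 0 -> List.In O s).

Definition div_degree (D : (F -> Prop) -> int) (d : int) : Prop :=
  exists (s : seq (F -> Prop)) (n : seq nat),
    [/\ List.NoDup s, size n = size s,
        (forall O, D O != 0 -> List.In O s),
        (forall i, (i < size s)%N ->
            place_degree (nth (fun _ => False) s i) (nth 0%N n i)) &
        d = \sum_(i < size s) (nth 0%N n i)%:Z * D (nth (fun _ => False) s i)].

Definition lin_equiv (D1 D2 : (F -> Prop) -> int) : Prop :=
  exists z : F, z != 0 /\
    forall O, valuation_ring O -> val O z (D1 O - D2 O).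

Definition class_number (h : nat) : Prop :=
  exists Ds : 'I_h -> ((F -> Prop) -> int),
    [/\ (forall i, divisor (Ds i) /\ div_degree (Ds i) 0),
        (forall i j, lin_equiv (Ds i) (Ds j) -> i = j) &
        (forall D, divisor D -> div_degree D 0 ->
            exists i, lin_equiv D (Ds i))].

Definition RR_space (A : (F -> Prop) -> int) (z : F) : Prop :=
  z = 0 \/ forall O, valuation_ring O -> exists n, val O z n /\ - A O <= n.

Definition K_dim (S : F -> Prop) (l : nat) : Prop :=
  exists s : 'I_l -> F,
    [/\ (forall i, S (s i)),
        (forall c : 'I_l -> K, \sum_i iota (c i) * s i = 0 -> forall i, c i = 0) &
        (forall z, S z -> exists c : 'I_l -> K, z = \sum_i iota (c i) * s i)].

Definition genus (g : nat) : Prop :=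
  (forall A d l, divisor A -> div_degree A d -> K_dim (RR_space A) l ->
      d - l%:Z + 1 <= g%:Z) /\
  (exists A d l, [/\ divisor A, div_degree A d, K_dim (RR_space A) l &
      d - l%:Z + 1 = g%:Z]).

End FunctionField.

Definition has_card (T : Type) (A : T -> Prop) (n : nat) : Prop :=
  exists f : 'I_n -> T, [/\ injective f, (forall i, A (f i)) &
                           (forall x, A x -> exists i, f i = x)].

Section Bound.
Local Open Scope R_scope.

Definition prodR (s : seq nat) (f : nat -> R) : R :=
  foldr (fun r acc => f r * acc) 1 s.

Definition hBRT (q g : nat) (B : nat -> nat) (D1 D2 : seq nat)
    (l m : nat -> nat) : R :=
  let qR := INR q in
  (qR - 1) ^ 2 / (INR (g + 1)%N * (qR + 1) - INR (B 1%N)) *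
  (prodR D1 (fun r => INR 'C((B r + l r)%N, l r)) +
   qR ^ (g - 1)%N * prodR D2 (fun r =>
     let Q := qR ^ r in
     (Q / (Q - 1)) ^ (B r)
     - INR (B r) * INR 'C((B r + m r)%N, B r) *
       RInt (fun t => (/ Q - t) ^ (m r) / (1 - t) ^ (B r + m r + 1)%N) 0 (/ Q))).

End Bound.

(* Main.v *)
(** Write [A n] for the number of effective divisors of degree [n], [N n] for the number of points over
    the constant extension of degree [n], and
    [S = sum_(n < g) A n + sum_(n < g - 1) q ^ (g - 1 - n) * A n].

    Each bracket of the bound is, by Taylor's formula with integral remainder, the truncated binomial
    series [sum_(k <= m) C(B + k - 1, k) q ^ (- r k)], and [C(B + k - 1, k)] counts the effective divisors
    of degree [r k] supported on the [B] places of degree [r]; hence the two products are at most the two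
    parts of [S], and it suffices that [(q - 1)^2 S <= h ((g + 1) (q + 1) - B 1)].

    This follows from the Riemann hypothesis for the reciprocal roots [pi] of the numerator of the zeta
    function: [2 S = h sum 1 / |1 - pi|^2 <= h (q - 1)^(- 2) sum |1 + pi|^2].  No duality is needed: the
    equality [l(A) = deg A + 1 - g] for [deg A >= 2 g - 1] is proved with adeles, and the numerator takes
    the values [h] at [1] and [h q^(- g)] at [1 / q], which together with [|pi|^2 <= q] for all [pi]
    forces [|pi|^2 = q] and the functional equation.

    The estimate [N n = q^n + O(q^(n / 2))], for [n] a multiple of twice the degree [d] of some place, gives
    [|pi|^2 <= q].  It is obtained by Stepanov's method on a plane model of the constant extension of
    degree [d], in which that place splits into rational ones; the coordinates have poles of coprime orders
    at one of them and no other poles.  The points of the model correspond, up to finitely many, to the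
    homomorphisms to the algebraic closure of the ring of functions regular outside the place, and these
    to the pairs of a place [P'] and a conjugate of its residue map. *)

(* The constant [(g + 1) (q + 1) - B 1] is half of the sum of [|1 + pi|^2 = 1 + q + pi + q / pi]
   over the [2 g] roots, whose own sum is [q + 1 - B 1]; it enters because
   [|1 - pi| |1 + pi| = |1 - pi^2| >= q - 1].

   That some divisor has degree 1 is not known at the start. The zeta series is therefore written in
   [T ^ dl], with [dl] the least positive degree of a divisor, and the point estimate itself yields
   [dl = 1].

   Stepanov's method bounds numbers of points from above only. The lower bound comes from applying
   it also to the points whose abscissa is fixed by Frobenius while their ordinate is not: on a
   model of degree [n] over the x-line the two kinds together are almost [n] times as many as the
   fixed abscissas.

   The places of the constant extension are never classified. Only the [d] valuations above the
   chosen place are constructed, and functions are required to be regular elsewhere through their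
   coefficients. *)
Require Import Defs.
From Stdlib Require Import Reals Lra.
From Coquelicot Require Import Coquelicot.
From HB Require Import structures.
From mathcomp Require Import all_boot all_order all_fingroup all_solvable all_algebra all_field.
From mathcomp Require Import Rstruct zify.

Import Order.TTheory GRing.Theory Num.Theory.

(** * The Taylor remainder of (1 - t)^(- b) *)

Section TaylorRemainder.
Local Open Scope R_scope.
Variables (b : nat) (x : R).
Hypotheses (b0 : (0 < b)%N) (x0 : 0 <= x) (x1 : x < 1).

(** The Taylor coefficients of [(1 - t)^(- b)] at the point [t] are [c k / (1 - t)^(b + k)]. *)
Let c k := INR 'C(b + k - 1, k).
Let a k := INR (b + k)%N * c k.

Lemma negbin_coef k : INR k.+1 * c k.+1 = a k.
Proof.
rewrite /a /c -!mult_INR; congr INR; rewrite !multE.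
have -> : (b + k.+1 - 1 = b + k)%N by rewrite addnS subn1.
by rewrite -mul_bin_diag subn1.
Qed.

(** By [negbin_coef] the derivative of each term is a difference of consecutive expressions, so that
    the sum over [k] telescopes. *)
Lemma is_derive_term k t : t <> 1 ->
  is_derive (fun t => c k.+1 * ((x - t) ^ k.+1 / (1 - t) ^ (b + k.+1)%N)) t
    (a k.+1 * ((x - t) ^ k.+1 / (1 - t) ^ (b + k.+1 + 1)%N) - a k * ((x - t) ^ k / (1 - t) ^ (b + k + 1)%N)).
Proof.
move=> t1; have d0 : 1 - t <> 0 by lra.
have dn n : (1 - t) ^ n <> 0 by apply: pow_nonzero.
auto_derive; first exact: dn.
have -> : (match k with 0%N => 1 | _.+1 => INR k + 1 end) = INR k.+1 by [].
rewrite -(negbin_coef k) {1}/a addn1 addn1 addnS /= -![_ + - _]/(_ - _).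
have := dn (b + k)%N; move: ((1 - t) ^ (b + k)%N) ((x - t) ^ k) => u v u0.
by field.
Qed.

(** The sum is the Taylor polynomial of [(1 - s)^(- b)] at [t], evaluated at [x]. It equals
    [(1 - x)^(- b)] at [t = x] and the truncated binomial series at [t = 0], so integrating its
    derivative gives the remainder. *)
Lemma is_derive_sum m t : t <> 1 ->
  is_derive (fun t => sum_f_R0 (fun k => c k * ((x - t) ^ k / (1 - t) ^ (b + k)%N)) m) t
    (a m * ((x - t) ^ m / (1 - t) ^ (b + m + 1)%N)).
Proof.
move=> t1; have d0 : 1 - t <> 0 by lra.
have dn n : (1 - t) ^ n <> 0 by apply: pow_nonzero.
elim: m => [|m IH] /=.
  auto_derive; first exact: dn.
  rewrite /a !addn0 addn1; case: (b) b0 => // b' _ /=.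
  rewrite -/(INR b'.+1) -![_ + - _]/(_ - _).
  have := dn b'; move: ((1 - t) ^ b') => u u0.
  by field.
have h := is_derive_plus _ _ t _ _ IH (is_derive_term m t t1).
set v := (X in is_derive _ _ X).
have -> : v = plus (a m * ((x - t) ^ m / (1 - t) ^ (b + m + 1)%N))
    (a m.+1 * ((x - t) ^ m.+1 / (1 - t) ^ (b + m.+1 + 1)%N) - a m * ((x - t) ^ m / (1 - t) ^ (b + m + 1)%N)).
  by rewrite /v /plus /=; ring.
exact: h.
Qed.

Lemma negbin_lead m : a m = INR b * INR 'C(b + m, b).
Proof.
rewrite /a /c -!mult_INR; congr INR; rewrite !multE.
case: (b) b0 => // b' _; rewrite -mul_bin_diag; congr (_ * _)%N.
by rewrite subn1 -[in RHS]bin_sub ?leq_addr //= addKn.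
Qed.

Lemma taylor_remainder m :
  INR b * INR 'C(b + m, b) * RInt (fun t => (x - t) ^ m / (1 - t) ^ (b + m + 1)%N) 0 x =
  (/ (1 - x)) ^ b - sum_f_R0 (fun k => INR 'C(b + k - 1, k) * x ^ k) m.
Proof.
have hx : Rmin 0 x = 0 /\ Rmax 0 x = x by split; [apply: Rmin_left|apply: Rmax_right].
have tn t : Rmin 0 x <= t <= Rmax 0 x -> t <> 1 by case: hx => -> ->; lra.
have cont t : Rmin 0 x <= t <= Rmax 0 x -> continuous (fun t => (x - t) ^ m / (1 - t) ^ (b + m + 1)%N) t.
  move/tn => t1; apply: ex_derive_continuous; auto_derive.
  by apply: pow_nonzero; lra.
have I := is_RInt_derive _ _ _ _ (fun t h => is_derive_sum m t (tn t h)) (fun t h => continuous_scal_r (a m) _ _ (cont t h)).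
have E := RInt_scal _ 0 x (a m) (ex_RInt_continuous _ _ _ cont).
rewrite -negbin_lead; move: E; rewrite /scal /= /mult /= => <-.
rewrite (is_RInt_unique _ _ _ _ I) /minus /plus /opp /=; congr (_ + - _); last first.
  by apply: PartSum.sum_eq => k _; rewrite !Rminus_0_r pow1 /Rdiv Rinv_1 Rmult_1_r.
have -> : x - x = 0 by ring.
rewrite pow_inv; elim: m {cont I} => [|m IH] /=.
  by rewrite /c addn0 bin0 /=; field; apply: pow_nonzero; lra.
by rewrite IH; field; split; apply: pow_nonzero; lra.
Qed.

End TaylorRemainder.

Set Implicit Arguments.
Unset Strict Implicit.
Unset Printing Implicit Defensive.
Local Open Scope nat_scope.

(** * Exponent vectors of given weight *)

(** The coefficient of [T ^ n] in the product of [1 / (1 - T ^ r)] over [r] in [rs]. With [rs] the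
    degrees of a list of places it counts the effective divisors of degree [n] supported there. *)
Fixpoint cnt (rs : seq nat) (n : nat) : nat :=
  if rs is r :: rs' then \sum_(k < n.+1 | k * r <= n) cnt rs' (n - k * r) else (n == 0).

Lemma cnt_rec r rs n : 0 < r ->
  cnt (r :: rs) n = cnt rs n + (if r <= n then cnt (r :: rs) (n - r) else 0).
Proof.
move=> r0; rewrite [LHS]/= big_mkcond big_ord_recl /= mul0n subn0; congr (_ + _).
rewrite -big_mkcond /=; case: leqP => [le|lt]; last by rewrite big_pred0 // => i; rewrite /bump /=; nia.
rewrite (big_ord_widen_cond n (fun k => k * r <= n - r) (fun k => cnt rs (n - r - k * r))); last by lia.
by apply: eq_big => i; rewrite /bump /= add1n => *; [nia|congr (cnt rs _); nia].
Qed.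

Lemma cnt0 rs : cnt rs 0 = 1.
Proof. by elim: rs => //= r rs IH; rewrite big_mkcond big_ord1 /= mul0n subn0. Qed.

Definition divsum (rs : seq nat) (j : nat) := \sum_(r <- rs | r %| j) r.

(** The logarithmic derivative of the product of [1 / (1 - T ^ r)]: the factor of [r] contributes
    [r] to every multiple of [r]. For degrees of places, [divsum] becomes the number of points over
    an extension of the constants. *)
Lemma cnt_euler rs n : all (leq 1) rs ->
  n * cnt rs n = \sum_(i < n) divsum rs i.+1 * cnt rs (n - i.+1).
Proof.
elim: rs n => [|r rs IHr] n.
  by move=> _; rewrite big1 => [|i _]; [case: n => *; rewrite ?muln0|rewrite /divsum big_nil].
case/andP=> r0 hrs; pose b := cnt (r :: rs); pose a := cnt rs.
have ab m : b m = a m + (if r <= m then b (m - r) else 0) by exact: cnt_rec.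
pose T m := \sum_(i < m) divsum rs i.+1 * b (m - i.+1).
pose U m := \sum_(i < m) (if r %| i.+1 then r else 0) * b (m - i.+1).
have TU m : \sum_(i < m) divsum (r :: rs) i.+1 * b (m - i.+1) = T m + U m.
  rewrite -big_split /=; apply: eq_bigr => i _; rewrite -mulnDl; congr (_ * _).
  by rewrite /divsum big_cons; case: ifP; rewrite ?addn0 // addnC.
rewrite -/b TU; elim/ltn_ind: n => n IH; case: (ltnP n r) => [lt|le].
  have ba m : m < r -> b m = a m by move=> h; rewrite ab leqNgt h addn0.
  have -> : U n = 0.
    by apply: big1 => i _; rewrite gtnNdvd // (leq_ltn_trans (ltn_ord i)).
  rewrite addn0 ba // IHr //; apply: eq_bigr => i _; rewrite ba //.
  by rewrite (leq_ltn_trans (leq_subr _ _)).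
(* Both sums at [n] reduce to the same sums at [m = n - r], where the induction hypothesis on [n]
   applies. *)
have [m en] : exists m, n = m + r by exists (n - r); rewrite subnK.
have hT : T n = n * a n + T m.
  rewrite IHr // /T; under eq_bigr => i _ do rewrite ab mulnDr; rewrite big_split /=; congr (_ + _).
  rewrite en big_split_ord /= [X in _ + X]big1 ?addn0; last first.
    by move=> i _; rewrite ifN ?muln0 // -ltnNge; case: i => i /= hi; lia.
  apply: eq_bigr => i _; case: i => i /= hi; rewrite ifT; last by lia.
  by congr (_ * b _); lia.
have hU : U n = r * b m + U m.
  rewrite /U en addnC big_split_ord /=; congr (_ + _); last first.
    apply: eq_bigr => i _; rewrite -addnS dvdn_addr // ; congr (_ * b _); lia.
  move: {hT TU IH ab T U} b; case: r r0 {le en} => // r _ b; rewrite big_ord_recr big1 /= => [|i _].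
    by rewrite dvdnn add0n addKn.
  by rewrite gtnNdvd // ltnS; case: i.
have IHm := IH m; rewrite hT hU ab le {1}en (_ : n - r = m); last by lia.
move: IHm; rewrite en; move=> /(_ _); case: (ltnP m (m + r)) => [_ /(_ isT)|]; last by lia.
rewrite -/b; move: (T m) (U m) (a (m + r)) (b m) => t u x y; nia.
Qed.

Section Weighted.
Variables (R : numDomainType) (w : R).
Local Open Scope ring_scope.
Hypothesis w0 : 0 <= w.

Definition wcnt rs N : R := \sum_(n < N.+1) (cnt rs n)%:R * w ^+ n.
(** The binomial series of [(1 - w ^ r)^(- b)] truncated after [m + 1] terms. For [b = 0] the
    truncated subtraction still gives 1 at [k = 0] and 0 afterwards. *)
Definition negbin r b m : R := \sum_(k < m.+1) 'C(b + k - 1, k)%:R * w ^+ (r * k).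

Lemma wcnt_mono rs N N' : (N <= N')%N -> wcnt rs N <= wcnt rs N'.
Proof.
move=> le; rewrite /wcnt -(subnKC le) -addSn big_split_ord /= lerDl.
by apply: sumr_ge0 => n _; rewrite mulr_ge0 ?ler0n ?exprn_ge0.
Qed.

Lemma wcnt_rec r rs N : (0 < r)%N -> wcnt (r :: rs) (N + r) = wcnt rs (N + r) + w ^+ r * wcnt (r :: rs) N.
Proof.
move=> r0; rewrite /wcnt.
under eq_bigr => i _ do rewrite (cnt_rec _ _ r0) natrD mulrDl; rewrite big_split /=; congr (_ + _).
have -> : ((N + r).+1 = r + N.+1)%N by lia.
rewrite big_split_ord /= big1 ?add0r => [|i _]; last first.
  by rewrite ifN ?mul0r // -ltnNge; case: i.
by rewrite mulr_sumr; apply: eq_bigr => i _; rewrite leq_addr addKn exprD mulrCA.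
Qed.

Lemma wcnt_cons r rs N : (0 < r)%N -> wcnt rs N <= wcnt (r :: rs) N.
Proof.
move=> r0; apply: ler_sum => n _; rewrite ler_wpM2r ?exprn_ge0 // ler_nat (cnt_rec _ _ r0).
exact: leq_addr.
Qed.

Lemma negbin_rec r b m : negbin r b.+1 m.+1 = negbin r b m.+1 + w ^+ r * negbin r b.+1 m.
Proof.
rewrite /negbin ![\sum_(k < m.+2) _]big_ord_recl !bin0 -addrA; congr (_ + _).
rewrite mulr_sumr -big_split /=; apply: eq_bigr => k _; rewrite /bump /= add1n.
have -> : (b.+1 + k.+1 - 1 = (b + k).+1)%N by lia.
have -> : (b + k.+1 - 1 = b + k)%N by lia.
have -> : (b.+1 + k - 1 = b + k)%N by lia.
by rewrite binS natrD mulrDl mulnS exprD [in X in _ + X]mulrCA.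
Qed.

Lemma negbin0 r b : negbin r b 0 = 1.
Proof. by rewrite /negbin big_ord1 bin0 muln0 mulr1. Qed.

(** Combining exponents on [b] copies of [r] of total at most [m] with a vector of weight at most
    [N] on [rs] gives a vector of weight at most [N + m * r]. The double induction follows Pascal's
    recurrence, which both sides share by [negbin_rec] and [wcnt_rec]. *)
Lemma wcnt_nseq r b m rs N : (0 < r)%N -> negbin r b m * wcnt rs N <= wcnt (nseq b r ++ rs) (N + m * r).
Proof.
move=> r0; elim: b m => [|b IHb] m.
  rewrite /negbin big_ord_recl bin0 muln0 mulr1 big1 ?addr0 ?mul1r; last first.
    by move=> k _; rewrite lift0 bin_small ?mul0r // add0n subn1.
  by apply: wcnt_mono; exact: leq_addr.
elim: m => [|m IHm] /=.
  by rewrite negbin0 -(negbin0 r b) (le_trans (IHb 0%N)) // wcnt_cons.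
have -> : (N + m.+1 * r = N + m * r + r)%N by lia.
rewrite (wcnt_rec _ _ r0) negbin_rec mulrDl lerD //.
  by rewrite (le_trans (IHb m.+1)) // wcnt_mono //; lia.
by rewrite -mulrA ler_wpM2l ?exprn_ge0.
Qed.

Lemma wcnt_prod (B m : nat -> nat) (D : seq nat) N : (forall r, r \in D -> (0 < r)%N) ->
  (\sum_(r <- D) r * m r <= N)%N ->
  \prod_(r <- D) negbin r (B r) (m r) <= wcnt (flatten [seq nseq (B r) r | r <- D]) N.
Proof.
move=> hD le; apply: le_trans (wcnt_mono _ le); elim: D hD {le} => [|r D IH] hD.
  by rewrite !big_nil /wcnt big_ord1 cnt0 mulr1.
rewrite !big_cons /= addnC mulnC; apply: le_trans (wcnt_nseq _ _ _ _ _); last by apply: hD; rewrite mem_head.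
rewrite ler_wpM2l ?IH // => [|r' h]; last by apply: hD; rewrite in_cons h orbT.
by apply: sumr_ge0 => k _; rewrite mulr_ge0 ?ler0n ?exprn_ge0.
Qed.

End Weighted.

Lemma negbin1 (R : numDomainType) r b m : negbin (1 : R)%R r b m = 'C(b + m, m)%:R%R.
Proof.
rewrite /negbin; elim: m => [|m IH]; first by rewrite big_ord1 !bin0 expr1n mulr1.
rewrite big_ord_recr /= IH expr1n mulr1 -natrD addnS subn1 /= binS addnC; congr (_%:R)%R.
Qed.

Unset Implicit Arguments.
Set Strict Implicit.

(** * From inequalities between counts to the real bound *)

Lemma prodRE (s : seq nat) (f : nat -> R) : prodR s f = (\prod_(r <- s) f r)%R.
Proof. by elim: s => [|r s IH]; rewrite ?big_nil ?big_cons -?IH. Qed.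

Lemma sum_f_R0E (f : nat -> R) n : sum_f_R0 f n = (\sum_(k < n.+1) f k)%R.
Proof. by elim: n => [|n IH]; rewrite ?big_ord1 // big_ord_recr /= -IH. Qed.

Section RealBound.
Local Open Scope R_scope.

Lemma taylor_factor (q r b m : nat) : (1 < q)%N -> (0 < r)%N -> (0 < b)%N ->
  let Q := INR q ^ r in
  (Q / (Q - 1)) ^ b - INR b * INR 'C(b + m, b) *
     RInt (fun t => (/ Q - t) ^ m / (1 - t) ^ (b + m + 1)%N) 0 (/ Q) = negbin (/ INR q) r b m.
Proof.
move=> q1 r0 b0 Q.
have q1' : 1 < INR q by rewrite -[1]/(INR 1); apply: lt_INR; apply/ssrnat.ltP.
have Q1 : 1 < Q by apply: Rlt_pow_R1 => //; apply/ssrnat.ltP.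
have iQ : 0 < / Q by apply: Rinv_0_lt_compat; lra.
have iQ1 : / Q < 1 by rewrite -Rinv_1; apply: Rinv_lt_contravar; lra.
rewrite (taylor_remainder b (/ Q) b0 (Rlt_le _ _ iQ) iQ1).
have -> : / (1 - / Q) = Q / (Q - 1) by field; lra.
rewrite sum_f_R0E (_ : forall u v : R, u - (u - v) = v); last by move=> *; ring.
apply: eq_bigr => k _; have -> : (/ Q) ^ k = (/ INR q) ^ (r * k)%N by rewrite !pow_inv /Q -multE pow_mult.
by rewrite INRE RpowE.
Qed.

Lemma wcnt1 rs N : wcnt 1 rs N = INR (\sum_(n < N.+1) cnt rs n)%N.
Proof. by rewrite INRE natr_sum; apply: eq_bigr => n _; rewrite expr1n mulr1. Qed.

Lemma wcnt_inv (q : nat) rs N : (0 < q)%N ->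
  INR q ^ N.+1 * wcnt (/ INR q) rs N = INR (\sum_(n < N.+1) q ^ (N.+1 - n) * cnt rs n)%N.
Proof.
move=> q0; have q0' : INR q <> 0 by apply: not_0_INR => e; rewrite e in q0.
rewrite [RHS]INRE natr_sum [LHS]RmultE /wcnt mulr_sumr.
apply: eq_bigr => n _; have ln := ltn_ord n.
rewrite natrM natrX -!INRE -!RpowE pow_inv; set u := INR (cnt rs n).
have -> : INR q ^ N.+1 = INR q ^ (N.+1 - n)%N * INR q ^ n.
  by rewrite -pow_add; congr (_ ^ _); rewrite plusE subnK // ltnW.
rewrite -!RmultE.
by field; apply: pow_nonzero.
Qed.

(** The product [h * b] stands on the left of the hypothesis because subtraction on [nat] is
    truncated. *)
Lemma real_bound (q g h b S1 S2 : nat) (p1 p2 : R) : (2 <= q)%N ->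
  ((q - 1) ^ 2 * (S1 + S2) + h * b <= h * ((g + 1) * (q + 1)))%N ->
  0 <= p1 <= INR S1 -> 0 <= p2 <= INR S2 ->
  (INR q - 1) ^ 2 / (INR (g + 1)%N * (INR q + 1) - INR b) * (p1 + p2) <= INR h.
Proof.
move=> q2 H h1 h2; have h0 := pos_INR h.
have q1 : INR (q - 1)%N = INR q - 1 by rewrite -[1]/(INR 1) -minus_INR ?minusE //; apply/ssrnat.leP; exact: ltnW.
move/ssrnat.leP/le_INR: H; rewrite -!plusE -!multE plus_INR !mult_INR !plus_INR.
have -> : INR (q - 1)%N * INR (q - 1)%N = (INR q - 1) ^ 2 by rewrite q1 /=; ring.
rewrite -[INR 1]/1; set d := _ - INR b => H.
have num : 0 <= (INR q - 1) ^ 2 by apply: pow2_ge_0.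
have {}H : (INR q - 1) ^ 2 * (p1 + p2) <= INR h * d.
  have : (INR q - 1) ^ 2 * (p1 + p2) <= (INR q - 1) ^ 2 * (INR S1 + INR S2) by apply: Rmult_le_compat_l => //; lra.
  rewrite /d; lra.
(* If the denominator is not positive, neither is the quotient, where [/ 0 = 0]; the claim then
   follows from [0 <= h]. *)
have [d0|d0] := Rle_lt_dec d 0.
  have id : / d <= 0.
    case: d0 => [/Rinv_lt_0_compat/Rlt_le //|->]; rewrite Rinv_0; lra.
  apply: Rle_trans h0; rewrite /Rdiv Rmult_assoc -[0](Rmult_0_r ((INR q - 1) ^ 2)).
  apply: Rmult_le_compat_l => //; rewrite -[0](Rmult_0_l (p1 + p2)).
  by apply: Rmult_le_compat_r => //; lra.
have -> : (INR q - 1) ^ 2 / d * (p1 + p2) = (INR q - 1) ^ 2 * (p1 + p2) / d by field; lra.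
by apply/Rle_div_l.
Qed.

End RealBound.

From mathcomp Require Import boolp functions ring lra.

Set Implicit Arguments.
Unset Strict Implicit.
Unset Printing Implicit Defensive.
Local Open Scope ring_scope.

(** * Linear algebra relative to a subspace *)

(* [field] with its side conditions discharged by the non-nullity hypotheses at hand *)
Ltac fld := field; rewrite ?invr_eq0 ?mulf_eq0 ?negb_or;
  repeat match goal with H : is_true (_ != _) |- _ => rewrite H end; by [].

Lemma exists_left_kernel (K : fieldType) m n (M : 'M[K]_(m, n)) : (n < m)%N ->
  exists2 c : 'rV[K]_m, c != 0 & c *m M = 0.
Proof.
move=> lnm; have: kermx M != 0.
  rewrite -mxrank_eq0 mxrank_ker subn_eq0 -ltnNge.
  exact: leq_ltn_trans (rank_leq_col M) lnm.
case/rowV0Pn => c /sub_kermxP ck c0; by exists c.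
Qed.

Section RelativeDimension.
Variables (K : fieldType) (V : lmodType K).
Implicit Types U W X : V -> Prop.

Definition subsp U := U 0 /\ forall (a : K) u v, U u -> U v -> U (a *: u + v).

(** This says that the image of [U] modulo [W] has dimension at most [n], without forming a quotient
    or assuming that a dimension exists. [dimge] is the opposite bound, by an independent family. *)
Definition dimle U W n := forall s : 'I_n.+1 -> V, (forall i, U (s i)) ->
  exists2 c : 'rV[K]_n.+1, c != 0 & W (\sum_i c 0 i *: s i).

Definition indep_mod W n (s : 'I_n -> V) :=
  forall c : 'rV[K]_n, W (\sum_i c 0 i *: s i) -> c = 0.

Definition dimge U W n := exists2 s : 'I_n -> V, (forall i, U (s i)) & indep_mod W s.

Definition basis_mod U W n (s : 'I_n -> V) :=
  [/\ forall i, U (s i), indep_mod W s &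
      forall z, U z -> exists c : 'rV[K]_n, W (z - \sum_i c 0 i *: s i)].

Lemma subspD U u v : subsp U -> U u -> U v -> U (u + v).
Proof. by case=> _ h hu hv; have := h 1 u v hu hv; rewrite scale1r. Qed.

Lemma subspZ U a u : subsp U -> U u -> U (a *: u).
Proof. by case=> h0 h hu; have := h a u 0 hu h0; rewrite addr0. Qed.

Lemma subspN U u : subsp U -> U u -> U (- u).
Proof. by move=> hU hu; rewrite -scaleN1r; apply: subspZ. Qed.

Lemma subspB U u v : subsp U -> U u -> U v -> U (u - v).
Proof. by move=> hU hu hv; apply: subspD => //; apply: subspN. Qed.

Lemma subsp_sum U (I : Type) (r : seq I) (P : pred I) (f : I -> V) :
  subsp U -> (forall i, P i -> U (f i)) -> U (\sum_(i <- r | P i) f i).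
Proof.
move=> hU hf; apply: (big_ind U) => //; first by case: hU.
by move=> x y; apply: subspD.
Qed.

Lemma subsp_comb U n (s : 'I_n -> V) (c : 'rV[K]_n) :
  subsp U -> (forall i, U (s i)) -> U (\sum_i c 0 i *: s i).
Proof. by move=> hU hs; apply: subsp_sum => // i _; apply: subspZ. Qed.

Lemma lin_sum_mulmx m n (s : 'I_n -> V) (c : 'rV[K]_m) (M : 'M[K]_(m, n)) :
  \sum_i (c *m M) 0 i *: s i = \sum_j c 0 j *: (\sum_i M j i *: s i).
Proof.
under [RHS]eq_bigr => j _ do rewrite scaler_sumr.
rewrite exchange_big /=; apply: eq_bigr => i _.
by rewrite !mxE scaler_suml; apply: eq_bigr => j _; rewrite scalerA.
Qed.

Definition widmx m n (lmn : (m <= n)%N) : 'M[K]_(m, n) :=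
  \matrix_(i, j) (widen_ord lmn i == j)%:R.

Lemma widmx_sum m n (lmn : (m <= n)%N) (c : 'rV[K]_m) (s : 'I_n -> V) :
  \sum_i (c *m widmx lmn) 0 i *: s i = \sum_i c 0 i *: s (widen_ord lmn i).
Proof.
rewrite lin_sum_mulmx; apply: eq_bigr => j _; congr (_ *: _).
rewrite (bigD1 (widen_ord lmn j)) //= big1 ?addr0 => [|i ne].
  by rewrite mxE eqxx scale1r.
by rewrite mxE eq_sym (negPf ne) scale0r.
Qed.

Lemma widmx_eq0 m n (lmn : (m <= n)%N) (c : 'rV[K]_m) : c *m widmx lmn = 0 -> c = 0.
Proof.
move=> e0; apply/rowP => i; have /rowP/(_ (widen_ord lmn i)) := e0.
rewrite !mxE (bigD1 i) //= big1 ?addr0 => [|j ne].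
  by rewrite mxE eqxx mulr1.
rewrite mxE (_ : (_ == _) = false) ?mulr0 //.
by apply/eqP => /(congr1 val) /= /val_inj e; rewrite e eqxx in ne.
Qed.

Lemma dimge_dimle U W m n : dimge U W m -> dimle U W n -> (m <= n)%N.
Proof.
move=> [s hs inds] hle; rewrite leqNgt; apply/negP => lnm.
have [c c0 hc] := hle (fun i => s (widen_ord lnm i)) (fun i => hs _).
case/negP: c0; apply/eqP/(@widmx_eq0 _ _ lnm)/inds; by rewrite widmx_sum.
Qed.

Lemma dimle_leq U W m n : dimle U W m -> (m <= n)%N -> dimle U W n.
Proof.
move=> hle lmn s hs; have lmn' : (m.+1 <= n.+1)%N by [].
have [//|c c0 hc] := hle (fun i => s (widen_ord lmn' i)).
exists (c *m widmx lmn'); last by rewrite widmx_sum.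
by apply: contra c0 => /eqP/widmx_eq0 ->.
Qed.

Lemma dimge0 U W : dimge U W 0.
Proof.
by exists (fun i : 'I_0 => 0) => [[]//|c _]; apply/rowP => -[].
Qed.

Lemma not_dimge U W n : ~ dimge U W n.+1 -> dimle U W n.
Proof.
move=> h s hs; apply: contrapT => hn; apply: h; exists s => // c hc.
by apply/eqP; apply: contraT => c0; case: hn; exists c.
Qed.

Lemma dim_exact U W n : dimle U W n ->
  exists r, [/\ (r <= n)%N, dimge U W r & dimle U W r].
Proof.
elim: n => [|n IH] h; first by exists 0%N; split=> //; apply: dimge0.
case: (EM (dimge U W n.+1)) => [h1|h1]; first by exists n.+1.
by case: (IH (not_dimge h1)) => r [h2 h3 h4]; exists r; split=> //; apply: leqW.
Qed.

Lemma indep_basis U W n (s : 'I_n -> V) : subsp W -> dimle U W n ->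
  (forall i, U (s i)) -> indep_mod W s -> basis_mod U W s.
Proof.
move=> hW hle hs inds; split=> // z hz.
pose s' (i : 'I_n.+1) := if unlift ord0 i is Some j then s j else z.
have [|c c0 hc] := hle s'.
  by move=> i; rewrite /s'; case: unliftP.
rewrite big_ord_recl in hc.
have sE (i : 'I_n) : s' (lift ord0 i) = s i by rewrite /s' liftK.
have s0 : s' ord0 = z by rewrite /s' unlift_none.
have {}hc : W (c 0 ord0 *: z + \sum_i c 0 (lift ord0 i) *: s i).
  move: hc; rewrite s0; congr (W (_ + _)); apply: eq_bigr => i _.
  by rewrite -sE; congr (_ *: s' _); apply: val_inj.
have [e0|ne] := eqVneq (c 0 ord0) 0.
  case/negP: c0; apply/eqP/rowP => i; rewrite mxE.
  rewrite e0 scale0r add0r in hc.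
  have /rowP hc' : (\row_j c 0 (lift ord0 j)) = 0.
    by apply: inds; under eq_bigr => j _ do rewrite mxE.
  case: (unliftP ord0 i) => [j ->|->] //.
  by have := hc' j; rewrite !mxE.
exists (\row_j (- (c 0 ord0)^-1 * c 0 (lift ord0 j))).
have := subspZ (c 0 ord0)^-1 hW hc; rewrite scalerDr scalerA mulVf // scale1r.
congr (W (_ + _)); rewrite scaler_sumr -sumrN; apply: eq_bigr => i _.
by rewrite mxE scalerA mulNr scaleNr opprK.
Qed.

Lemma dim_basis U W n : subsp W -> dimle U W n ->
  exists r (s : 'I_r -> V), [/\ (r <= n)%N, dimle U W r & basis_mod U W s].
Proof.
move=> hW /dim_exact [r [hr [s hs inds] hle]]; exists r, s; split=> //.
exact: indep_basis.
Qed.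

Lemma basis_dimle U W n (s : 'I_n -> V) : subsp W -> basis_mod U W s -> dimle U W n.
Proof.
move=> hW [hs inds hspan] z hz.
have /choice[f hf] : forall i, exists c : 'rV[K]_n, W (z i - \sum_j c 0 j *: s j).
  by move=> i; apply: hspan.
have [c c0 hc] := @exists_left_kernel _ _ _ (\matrix_i f i) (ltnSn n).
exists c => //.
have -> : \sum_i c 0 i *: z i = \sum_i c 0 i *: (z i - \sum_j f i 0 j *: s j).
  under [RHS]eq_bigr => i _ do rewrite scalerBr.
  rewrite sumrB [X in _ - X](_ : _ = 0) ?subr0 //.
  transitivity (\sum_i (c *m \matrix_i f i) 0 i *: s i).
    rewrite lin_sum_mulmx; apply: eq_bigr => i _; congr (_ *: _).
    by apply: eq_bigr => j _; rewrite mxE.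
  by rewrite hc big1 // => i _; rewrite mxE scale0r.
exact: subsp_comb.
Qed.

Lemma dimle_trans U W X a b : subsp W -> (forall z, W z -> U z) ->
  dimle U W a -> dimle W X b -> dimle U X (a + b).
Proof.
move=> hW hWU hUW hWX.
have [r [s [lra _ [hs inds hspan]]]] := dim_basis hW hUW.
apply: (@dimle_leq _ _ (r + b)); last by rewrite leq_add2r.
move=> z hz.
have /choice[f hf] : forall i, exists c : 'rV[K]_r, W (z i - \sum_j c 0 j *: s j).
  by move=> i; apply: hspan.
(* The rows of [N] form a basis of the combinations of the [r + b + 1] vectors [z] that fall into
   [W]; there are more than [b] of them. *)
pose M := \matrix_i f i; pose N := row_base (kermx M).
have rk : (b < \rank (kermx M))%N.
  rewrite mxrank_ker ltn_subRL addnC -addSn.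
  have := rank_leq_col M; lia.
have hN : N *m M = 0.
  apply/sub_kermxP; by rewrite eq_row_base.
have WN i : W (\sum_j N i j *: z j).
  have -> : \sum_j N i j *: z j = \sum_j N i j *: (z j - \sum_k f j 0 k *: s k).
    under [RHS]eq_bigr => j _ do rewrite scalerBr.
    rewrite sumrB [X in _ - X](_ : _ = 0) ?subr0 //.
    transitivity (\sum_k (row i N *m M) 0 k *: s k).
      rewrite lin_sum_mulmx; apply: eq_bigr => j _; rewrite [row _ _ _ _]mxE; congr (_ *: _).
      by apply: eq_bigr => k _; rewrite mxE.
    by rewrite -row_mul hN row0 big1 // => k _; rewrite mxE scale0r.
  by apply: subsp_sum => // j _; apply: subspZ.
have [c c0 hc] := hWX (fun i => \sum_j N (widen_ord rk i) j *: z j) (fun i => WN _).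
have hN0 : c *m widmx rk *m N != 0.
  apply: contra c0 => /eqP e0; apply/eqP/(@widmx_eq0 _ _ rk).
  by apply: (row_free_inj (row_base_free (kermx M))); rewrite e0 mul0mx.
exists (c *m widmx rk *m N) => //.
by rewrite lin_sum_mulmx widmx_sum.
Qed.

Lemma dimge_trans U W X a b : subsp W -> (forall z, W z -> U z) -> (forall z, X z -> W z) ->
  dimge U W a -> dimge W X b -> dimge U X (a + b).
Proof.
move=> hW hWU hXW [s hs inds] [t ht indt].
exists (fun i => match fintype.split i with inl j => s j | inr j => t j end) => [i|c].
  by case: (fintype.split i) => j //; apply: hWU.
rewrite big_split_ord /=.
have -> : \sum_(i < a) c 0 (lshift b i) *: match fintype.split (lshift b i) with
   | inl j => s j | inr j => t j end = \sum_i (lsubmx c) 0 i *: s i.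
  by apply: eq_bigr => i _; rewrite (unsplitK (inl i)) mxE.
have -> : \sum_(i < b) c 0 (rshift a i) *: match fintype.split (rshift a i) with
   | inl j => s j | inr j => t j end = \sum_i (rsubmx c) 0 i *: t i.
  by apply: eq_bigr => i _; rewrite (unsplitK (inr i)) mxE.
move=> hc; have hc2 := hXW _ hc.
have e1 : lsubmx c = 0.
  apply: inds; rewrite -[X in W X](addrK (\sum_i rsubmx c 0 i *: t i)).
  by apply: subspB => //; apply: subsp_comb.
have e2 : rsubmx c = 0.
  apply: indt; move: hc; rewrite e1 big1 ?add0r // => i _.
  by rewrite mxE scale0r.
by rewrite -[c]hsubmxK e1 e2 row_mx0.
Qed.

Lemma dimle_sub U U' W W' n : (forall z, U z -> U' z) -> (forall z, W' z -> W z) ->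
  dimle U' W' n -> dimle U W n.
Proof.
move=> hU hW h s hs; have [i|c c0 hc] := h s; first exact: hU.
by exists c => //; apply: hW.
Qed.

Lemma dimge_sub U U' W W' n : (forall z, U z -> U' z) -> (forall z, W' z -> W z) ->
  dimge U W n -> dimge U' W' n.
Proof.
move=> hU hW [s hs inds]; exists s => [i|c hc]; first exact: hU.
by apply: inds; apply: hW.
Qed.

Lemma dimle_inj U W a : (forall z, U z -> W z) -> dimle U W a.
Proof.
move=> h s hs; exists (delta_mx 0 0).
  by apply/eqP => /rowP/(_ 0)/eqP; rewrite !mxE !eqxx oner_eq0.
rewrite (bigD1 0) //= big1 ?addr0 => [|i ne]; last by rewrite mxE (negPf ne) scale0r.
by rewrite mxE !eqxx scale1r; apply: h.
Qed.

Lemma dimge_gt0 U W z : subsp W -> U z -> ~ W z -> dimge U W 1.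
Proof.
move=> hW hz nz; exists (fun=> z) => // c; rewrite big_ord1 => hc.
apply/rowP => i; rewrite ord1 mxE; apply/eqP/negPn/negP => c0.
by apply: nz; have := subspZ (c 0 0)^-1 hW hc; rewrite scalerA mulVf // scale1r.
Qed.

Lemma dimge_quot U W X c b : subsp W -> (forall z, W z -> U z) ->
  dimge U X c -> dimle W X b -> dimge U W (c - b).
Proof.
move=> hW hWU hc hb; case E: (c - b)%N => [|n]; first exact: dimge0.
apply: contrapT => /not_dimge h.
have := dimge_dimle hc (dimle_trans hW hWU h hb); lia.
Qed.

Lemma dimle_quot U W X c b : subsp W -> (forall z, W z -> U z) -> (forall z, X z -> W z) ->
  dimle U X c -> dimge W X b -> dimle U W (c - b).
Proof.
move=> hW hWU hXW hc hb; apply: not_dimge => h.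
have := dimge_dimle (dimge_trans hW hWU hXW h hb) hc; lia.
Qed.

End RelativeDimension.

Section LinearMaps.
Variables (K : fieldType) (V V' : lmodType K) (f : V -> V').
Hypothesis flin : forall (a : K) u v, f (a *: u + v) = a *: f u + f v.

Lemma lin_comb n (s : 'I_n -> V) (c : 'rV[K]_n) :
  f (\sum_i c 0 i *: s i) = \sum_i c 0 i *: f (s i).
Proof.
have f0 : f 0 = 0 by have := flin (-1) 0 0; rewrite scaler0 addr0 scaleN1r addNr.
elim/big_rec2: _ => [|i y z _ <-]; first exact: f0.
by rewrite flin.
Qed.

Lemma dimle_preim (U W : V -> Prop) (Y Z : V' -> Prop) n :
  (forall z, U z -> Y (f z)) -> (forall z, U z -> Z (f z) -> W z) -> subsp U ->
  dimle Y Z n -> dimle U W n.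
Proof.
move=> hU hW sU h s hs; have [i|c c0 hc] := h (f \o s); first exact: hU.
exists c => //; apply: hW; first exact: subsp_comb.
by rewrite lin_comb.
Qed.

Lemma dimge_img (U W : V -> Prop) (Y Z : V' -> Prop) n :
  (forall z, U z -> Y (f z)) -> (forall z, U z -> Z (f z) -> W z) -> subsp U ->
  dimge U W n -> dimge Y Z n.
Proof.
move=> hU hW sU [s hs inds]; exists (f \o s) => [i|c hc]; first exact: hU.
by apply: inds; apply: hW; [exact: subsp_comb|rewrite lin_comb].
Qed.

End LinearMaps.

Lemma exists_dep (K : fieldType) (I J : finType) (a : I -> J -> K) : (#|J| < #|I|)%N ->
  exists2 c : I -> K, (exists i, c i != 0) & forall j, \sum_i c i * a i j = 0.
Proof.
move=> lJI.
have [c c0 hc] := @exists_left_kernel _ _ _ (\matrix_(i < #|I|, j < #|J|) a (enum_val i) (enum_val j)) lJI.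
exists (fun i => c 0 (enum_rank i)).
  by case/rV0Pn: c0 => i ci; exists (enum_val i); rewrite enum_valK.
move=> j; have /rowP/(_ (enum_rank j)) := hc; rewrite !mxE => e; apply: etrans e.
rewrite [RHS](reindex enum_rank) /=; last by apply/onW_bij/enum_rank_bij.
by apply: eq_bigr => i _; rewrite mxE !enum_rankK.
Qed.

(** [F] as a vector space through [iota]. The type mentions [iota], so that the scalar structure can
    be recovered from it. *)
Definition lmodF (K F : fieldType) (iota : {rmorphism K -> F}) : Type := F.

Section FieldAsModule.
Variables (K F : fieldType) (iota : {rmorphism K -> F}).
HB.instance Definition _ := GRing.Zmodule.on (lmodF iota).

Definition lmodF_scale (a : K) (z : lmodF iota) : lmodF iota := iota a * (z : F).

Fact lmodF_scaleA a b v : lmodF_scale a (lmodF_scale b v) = lmodF_scale (a * b) v.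
Proof. by rewrite /lmodF_scale rmorphM mulrA. Qed.
Fact lmodF_scale1 : left_id 1 lmodF_scale.
Proof. by move=> v; rewrite /lmodF_scale rmorph1 mul1r. Qed.
Fact lmodF_scaleDr : right_distributive lmodF_scale +%R.
Proof. by move=> a u v; rewrite /lmodF_scale mulrDr. Qed.
Fact lmodF_scaleDl v : {morph lmodF_scale^~ v : a b / a + b}.
Proof. by move=> a b; rewrite /lmodF_scale rmorphD mulrDl. Qed.

HB.instance Definition _ := GRing.Zmodule_isLmodule.Build K (lmodF iota)
  lmodF_scaleA lmodF_scale1 lmodF_scaleDr lmodF_scaleDl.

Lemma lmodF_scaleE (a : K) (z : lmodF iota) : a *: z = iota a * (z : F) :> F.
Proof. by []. Qed.

End FieldAsModule.

(** * Valuation rings *)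

Section Peval.
Variables (K : finFieldType) (F : fieldType) (iota : {rmorphism K -> F}).

Definition pev (z : F) : {poly K} -> F := horner_eval z \o map_poly iota.
HB.instance Definition _ z := GRing.RMorphism.on (pev z).
Arguments pev : simpl never.

Lemma pevE (p : {poly K}) z : peval iota p z = pev z p.
Proof. by []. Qed.

Lemma pevC z c : pev z c%:P = iota c.
Proof. by rewrite /pev /= map_polyC /horner_eval hornerC. Qed.

Lemma pevX z : pev z 'X = z.
Proof. by rewrite /pev /= map_polyX /horner_eval hornerX. Qed.

Lemma pevZ z c p : pev z (c *: p) = iota c * pev z p.
Proof. by rewrite -mul_polyC rmorphM /= pevC. Qed.

Lemma pev_poly z n (c : nat -> K) : pev z (\poly_(i < n) c i) = \sum_(i < n) iota (c i) * z ^+ i.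
Proof.
rewrite poly_def rmorph_sum /=; apply: eq_bigr => i _.
by rewrite pevZ rmorphXn /= pevX.
Qed.

Section FiniteOver.
Variables (x : F) (s : seq F).
Hypothesis hs : forall z : F, exists c : seq F,
    [/\ size c = size s, (forall i, (i < size c)%N -> in_Kx iota x c`_i) &
        z = \sum_(i < size s) c`_i * s`_i].

Let n := size s.
Let sv : 'cV[F]_n := \col_i s`_i.

(** Coordinates with respect to the generating family [s], over one common denominator [D]. *)
Lemma common_coord m (w : 'cV[F]_m) : exists2 D : {poly K}, pev x D != 0 &
  exists C : 'M[{poly K}]_(m, n), map_mx (pev x) C *m sv = pev x D *: w.
Proof.
have /choice[c hc] : forall l, exists c : 'I_n -> {poly K} * {poly K},
    (forall j, pev x (c j).2 != 0) /\
    w l 0 = \sum_j pev x (c j).1 / pev x (c j).2 * s`_j.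
  move=> l; have [c [sc cK wE]] := hs (w l 0).
  have /choice[f hf] : forall j : 'I_n, exists pr : {poly K} * {poly K},
     pev x pr.2 != 0 /\ c`_j = pev x pr.1 / pev x pr.2.
    move=> j; have [|p [r [h1 h2]]] := cK j; first by rewrite sc.
    by exists (p, r).
  exists f; split=> [j|]; first by case: (hf j).
  by rewrite wE; apply: eq_bigr => j _; case: (hf j) => _ ->.
pose R := \prod_(a : 'I_m * 'I_n) (c a.1 a.2).2.
exists R.
  by rewrite rmorph_prod prodf_seq_neq0; apply/allP => a _ /=; case: (hc a.1) => ->.
exists (\matrix_(l, j) ((c l j).1 * \prod_(a | a != (l, j)) (c a.1 a.2).2)).
apply/colP => l; rewrite !mxE; have [hc2 ->] := hc l; rewrite mulr_sumr.
apply: eq_bigr => j _; rewrite /R (bigD1 (l, j)) //= !mxE !rmorphM /=.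
by have := hc2 j; move: (pev x (c l j).2) => u u0; field.
Qed.

(** A dimension count replaces the degree of [F] over the field generated by [z]. Up to a common
    denominator, the products [z ^ i * w l] with [i <= m] have coordinates that are polynomials in
    [x] of degree at most [c0 + m * d], and for [n * d + 1] elements [w l] and large [m] these
    products outnumber the coefficients. *)
Lemma dep_bound_aux (z : F) : exists n', forall w : 'I_n' -> F,
  exists2 p : 'I_n' -> {poly K}, (exists l, p l != 0) & \sum_l pev z (p l) * w l = 0.
Proof.
have [D D0 [N hN]] := common_coord (z *: sv).
have [d hd] : exists d, (size D <= d.+1)%N /\ forall i j, (size (N i j) <= d.+1)%N.
  exists (size D + \sum_i \sum_j size (N i j))%N; split=> [|i j].
    by rewrite leqW ?leq_addr.
  rewrite (bigD1 i) //= (bigD1 j) //=; lia.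
exists (n * d).+1 => w.
have [Dw Dw0 [C hC]] := common_coord (\col_l w l).
have [c0 hc0] : exists c0, forall i j, (size (C i j) <= c0.+1)%N.
  exists (\sum_i \sum_j size (C i j))%N => i j.
  rewrite (bigD1 i) //= (bigD1 j) //=; lia.
pose Ci i := iter i (fun M => M *m N) C.
have hCi i : map_mx (pev x) (Ci i) *m sv = (pev x (D ^+ i * Dw) * z ^+ i) *: (\col_l w l).
  elim: i => [|i IH]; first by rewrite /Ci /= !expr0 mul1r mulr1 hC.
  rewrite /Ci iterS -/(Ci i) map_mxM -mulmxA hN -scalemxAr -scalemxAr IH !scalerA.
  by congr (_ *: _); rewrite !rmorphM !rmorphXn /= !exprS; ring.
have sCi i l j : (size (Ci i l j) <= (c0 + i * d).+1)%N.
  elim: i l j => [|i IH] l j; first by rewrite /Ci /= mul0n addn0.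
  rewrite /Ci iterS -/(Ci i) mxE; apply: (leq_trans (size_sum _ _ _)).
  apply/bigmax_leqP => k _; apply: (leq_trans (size_polyMleq _ _)).
  rewrite -subn1 leq_subLR (leq_trans (leq_add (IH l k) (hd.2 k j))) // mulSn; lia.
have sDi i : (size (D ^+ i) <= (i * d).+1)%N.
  elim: i => [|i IH]; first by rewrite expr0 size_poly1.
  rewrite exprS; apply: (leq_trans (size_polyMleq _ _)).
  by have := hd.1; rewrite mulSn; lia.
(* With this [m] the [(m + 1) (n d + 1)] products exceed the [n (c0 + m d + 1)] coefficients. *)
pose m := (n * c0.+1)%N.
pose Pil (a : 'I_m.+1 * 'I_(n * d).+1) j := D ^+ (m - a.1) * Ci a.1 a.2 j.
pose B := (c0 + m * d).+1.
have sP a j : (size (Pil a j) <= B)%N.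
  rewrite /Pil; apply: (leq_trans (size_polyMleq _ _)).
  have := sDi (m - a.1)%N; have := sCi a.1 a.2 j.
  have : ((m - a.1) * d + a.1 * d = m * d)%N.
    by rewrite -mulnDl subnK // -ltnS.
  rewrite /B; lia.
have [|c [a0 ca0] hc] := @exists_dep K _ _ (fun a (jb : 'I_n * 'I_B) => (Pil a jb.1)`_jb.2).
  rewrite !card_prod !card_ord /B /m; nia.
have hc2 j : \sum_a c a *: Pil a j = 0.
  apply/polyP => b; rewrite coef_sum coef0.
  case: (ltnP b B) => [ltb|leb]; last first.
    rewrite big1 // => a _; rewrite coefZ nth_default ?mulr0 //.
    exact: leq_trans (sP _ _) leb.
  by have := hc (j, Ordinal ltb); under eq_bigr => a _ do rewrite -coefZ.
have key : \sum_a iota (c a) * (z ^+ a.1 * w a.2) = 0.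
  have : pev x (D ^+ m * Dw) * (\sum_a iota (c a) * (z ^+ a.1 * w a.2)) = 0.
    transitivity (\sum_j (\sum_a iota (c a) * pev x (Pil a j)) * s`_j).
      under [RHS]eq_bigr => j _ do rewrite mulr_suml.
      rewrite exchange_big mulr_sumr; apply: eq_bigr => a _ /=.
      have /colP/(_ a.2) := hCi a.1; rewrite !mxE => e.
      transitivity (iota (c a) * pev x (D ^+ (m - a.1)) * (pev x (D ^+ a.1 * Dw) * z ^+ a.1 * w a.2)).
        have -> : D ^+ m = D ^+ (m - a.1) * D ^+ a.1 by rewrite -exprD subnK // -ltnS.
        by rewrite !rmorphM /=; ring.
      rewrite -e mulr_sumr; apply: eq_bigr => j _.
      by rewrite !mxE /Pil rmorphM /=; ring.
    rewrite big1 // => j _; under eq_bigr => a _ do rewrite -pevZ.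
    by rewrite -rmorph_sum hc2 rmorph0 mul0r.
  move/eqP; rewrite mulf_eq0 => /orP[|/eqP //].
  by rewrite rmorphM rmorphXn /= mulf_eq0 expf_eq0 (negPf D0) (negPf Dw0) andbF.
exists (fun l => \poly_(i < m.+1) (if insub i is Some i' then c (i', l) else 0)).
  exists a0.2; apply/eqP => /polyP/(_ a0.1); rewrite coef_poly ltn_ord coef0.
  case: insubP => [u _ /val_inj ->|/negP[]//]; move/eqP.
  by rewrite -surjective_pairing (negPf ca0).
have key2 : \sum_i \sum_l iota (c (i, l)) * (z ^+ i * w l) = 0.
  by rewrite pair_bigA /=; apply: etrans key; apply: eq_bigr => -[].
apply: etrans key2; rewrite [RHS]exchange_big /=.
apply: eq_bigr => l _; rewrite pev_poly mulr_suml; apply: eq_bigr => i _.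
case: insubP => [u _ /val_inj ->|/negP[]//]; by rewrite mulrA.
Qed.

End FiniteOver.

Lemma dep_bound (z : F) : function_field iota -> exists n', forall w : 'I_n' -> F,
  exists2 p : 'I_n' -> {poly K}, (exists l, p l != 0) & \sum_l pev z (p l) * w l = 0.
Proof. by case=> x [_ [s hs]]; apply: (dep_bound_aux hs). Qed.

End Peval.

Section ValuationRing.
Variables (K : finFieldType) (F : fieldType) (iota : {rmorphism K -> F}).
Hypothesis hFF : function_field iota.
Variable O : F -> Prop.
Hypothesis hO : valuation_ring iota O.

Local Notation VF := (lmodF iota).
Local Notation m := (in_place O).

Lemma vr_const a : O (iota a). Proof. by case: hO. Qed.
Lemma vr0 : O 0. Proof. by rewrite -(rmorph0 iota); apply: vr_const. Qed.
Lemma vr1 : O 1. Proof. by rewrite -(rmorph1 iota); apply: vr_const. Qed.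
Lemma vrB u v : O u -> O v -> O (u - v). Proof. by case: hO => _ h _ _ _; apply: h. Qed.
Lemma vrN u : O u -> O (- u). Proof. by move=> h; rewrite -sub0r; apply: vrB => //; apply: vr0. Qed.
Lemma vrD u v : O u -> O v -> O (u + v).
Proof. by move=> h1 h2; rewrite -[v]opprK; apply: vrB => //; apply: vrN. Qed.
Lemma vrM u v : O u -> O v -> O (u * v). Proof. by case: hO => _ _ h _ _; apply: h. Qed.
Lemma vrX u n : O u -> O (u ^+ n).
Proof. by move=> h; elim: n => [|n IH]; [apply: vr1|rewrite exprS; apply: vrM]. Qed.
Lemma vr_dich z : z != 0 -> O z \/ O z^-1. Proof. by case: hO => _ _ _ _ h; apply: h. Qed.
Lemma vr_sum (I : Type) (r : seq I) (P : pred I) (f : I -> F) :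
  (forall i, P i -> O (f i)) -> O (\sum_(i <- r | P i) f i).
Proof. by move=> h; apply: (big_ind O) => //; [exact: vr0|exact: vrD]. Qed.
Lemma vr_pev z p : O z -> O (pev iota z p).
Proof.
move=> hz; rewrite /pev /= /horner_eval horner_coef; apply: vr_sum => i _.
by apply: vrM; [rewrite coef_map; apply: vr_const|apply: vrX].
Qed.

Lemma pl_vr z : m z -> O z. Proof. by case. Qed.
Lemma pl0 : m 0. Proof. by split; [apply: vr0|left]. Qed.
Lemma vr_unit z : O z -> ~ m z -> z != 0 /\ O z^-1.
Proof.
move=> hz nm; split; first by apply: contra_notN nm => /eqP ->; apply: pl0.
by apply: contrapT => h; apply: nm; split=> //; right.
Qed.
Lemma plM u z : O u -> m z -> m (u * z).
Proof.
move=> hu [hz hm]; split; first exact: vrM.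
have [->|z0] := eqVneq z 0; first by left; rewrite mulr0.
have [->|u0] := eqVneq u 0; first by left; rewrite mul0r.
right=> h; case: hm => [/eqP|]; first by rewrite (negPf z0).
apply; have -> : z^-1 = u * (u * z)^-1 by fld.
exact: vrM.
Qed.
Lemma pl_not1 : ~ m 1.
Proof. by case=> _ [/eqP|]; [rewrite oner_eq0|apply; rewrite invr1; apply: vr1]. Qed.
Lemma plN z : m z -> m (- z).
Proof. by move=> h; rewrite -mulN1r; apply: plM => //; apply/vrN/vr1. Qed.
Lemma plD u v : m u -> m v -> m (u + v).
Proof.
move=> hu hv; have [->|u0] := eqVneq u 0; first by rewrite add0r.
have [->|v0] := eqVneq v 0; first by rewrite addr0.
have uv0 : u / v != 0 by rewrite mulf_neq0 ?invr_eq0.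
case: (vr_dich uv0) => h.
  have -> : u + v = (u / v + 1) * v by field.
  by apply: plM => //; apply: vrD => //; apply: vr1.
have -> : u + v = (1 + (u / v)^-1) * u by fld.
by apply: plM => //; apply: vrD => //; apply: vr1.
Qed.

Lemma subsp_vr : subsp (O : VF -> Prop).
Proof. by split=> [|a u v hu hv]; [apply: vr0|apply: vrD => //; apply: vrM => //; apply: vr_const]. Qed.
Lemma subsp_pl : subsp (m : VF -> Prop).
Proof. by split=> [|a u v hu hv]; [apply: pl0|apply: plD => //; apply: plM => //; apply: vr_const]. Qed.

Definition ideal_gen (z : F) : VF -> Prop := fun y => exists2 u, O u & y = z * u.

Lemma subsp_ideal z : subsp (ideal_gen z).
Proof.
split=> [|a u v [u' hu ->] [v' hv ->]]; first by exists 0; [apply: vr0|rewrite mulr0].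
exists (iota a * u' + v'); first by apply: vrD => //; apply: vrM => //; apply: vr_const.
by rewrite lmodF_scaleE; ring.
Qed.

Lemma ideal_sub z w : O w -> forall y, ideal_gen (z * w) y -> ideal_gen z y.
Proof. by move=> hw y [u hu ->]; exists (w * u); [apply: vrM|rewrite mulrA]. Qed.

(** A relation over the polynomials in [z], divided by the largest possible power of [z], has
    constant coefficients that are not all zero. As the [w l] lie in [O], these give a relation
    modulo [z O]. The induction is on the total size of the coefficients. *)
Lemma dimle_ideal_of n z : z != 0 -> O z ->
  (forall w : 'I_n.+1 -> F, exists2 p : 'I_n.+1 -> {poly K}, (exists l, p l != 0) &
     \sum_l pev iota z (p l) * w l = 0) ->
  dimle (O : VF -> Prop) (ideal_gen z) n.
Proof.
move=> z0 hz hn w hw; have [p hp sp] := hn w.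
suff: forall N (p : 'I_n.+1 -> {poly K}), (\sum_l size (p l) < N)%N ->
   (exists l, p l != 0) -> \sum_l pev iota z (p l) * w l = 0 ->
   exists2 c : 'rV[K]_n.+1, c != 0 & ideal_gen z (\sum_i c 0 i *: (w i : VF)).
  by move=> /(_ _ p (ltnSn _)); apply.
elim=> [//|N IH] {hp sp}p sN hp sp.
pose p' l := drop_poly 1 (p l).
have pE l : p l = p' l * 'X + ((p l)`_0)%:P.
  by rewrite -{1}[p l](poly_take_drop 1) expr1 addrC; congr (_ + _); apply/polyP => i;
     rewrite coef_take_poly coefC; case: i.
have hs : \sum_l iota (p l)`_0 * w l = - (z * \sum_l pev iota z (p' l) * w l).
  apply/eqP; rewrite -addr_eq0 mulr_sumr -big_split /=; apply/eqP.
  rewrite -[RHS]sp; apply: eq_bigr => l _.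
  by rewrite [in RHS](pE l) rmorphD rmorphM /= pevX pevC; ring.
case: (pselect (exists l, (p l)`_0 != 0)) => [[l hl]|no].
  exists (\row_l (p l)`_0); first by apply/rV0Pn; exists l; rewrite mxE.
  exists (- \sum_l pev iota z (p' l) * w l).
    by apply/vrN/vr_sum => i _; apply: vrM => //; apply: vr_pev.
  by rewrite mulrN -hs; apply: eq_bigr => i _; rewrite mxE.
have c0 l : (p l)`_0 = 0 by apply/eqP/negPn/negP => h; apply: no; exists l.
have pE' l : p l = p' l * 'X by rewrite [LHS]pE c0 addr0.
apply: (IH p').
- case: hp => l hl; rewrite -ltnS (leq_trans _ sN) // ltnS.
  have le i : (size (p' i) <= size (p i))%N by rewrite /p' size_drop_poly leq_subr.
  rewrite (bigD1 l) //= [X in (_ < X)%N](bigD1 l) //= -addSn leq_add ?leq_sum //.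
  by rewrite /p' size_drop_poly subn1 ltn_predL lt0n size_poly_eq0.
- case: hp => l hl; exists l; apply: contra hl => /eqP e; by rewrite pE' e mul0r.
- move/eqP: hs; rewrite big1 => [|i _]; last by rewrite c0 rmorph0 mul0r.
  by rewrite eq_sym oppr_eq0 mulf_eq0 (negPf z0) => /eqP.
Qed.

Lemma dimle_ideal z : z != 0 -> O z -> exists n, dimle (O : VF -> Prop) (ideal_gen z) n.
Proof.
move=> z0 hz; have [[|n] hn] := dep_bound z hFF.
  by have [? [[]//]] := hn (fun=> 0).
by exists n; apply: dimle_ideal_of.
Qed.

Lemma ideal_not z w : z != 0 -> m w -> ~ ideal_gen (z * w) z.
Proof.
move=> z0 hw [u hu e]; apply: pl_not1.
suff -> : 1 = u * w by apply: plM.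
by apply: (mulfI z0); rewrite mulr1 {1}e; ring.
Qed.

Lemma ideal_gen_self z : ideal_gen z z.
Proof. by exists 1; [apply: vr1|rewrite mulr1]. Qed.

(** As long as [t] does not generate the maximal ideal, an element [y] of that ideal outside [t O]
    satisfies [t O < y O], so passing from [t] to [y] decreases the finite codimension of the
    ideal. *)
Lemma exists_uniformizer : exists t, uniformizer O t.
Proof.
have [z hz] : exists z, ~ O z by case: hO.
have z0 : z != 0 by apply: contra_notN hz => /eqP ->; apply: vr0.
have mz : m z^-1.
  by split; [case: (vr_dich z0)|right; rewrite invrK].
have t0 : z^-1 != 0 by rewrite invr_eq0.
have [n hn] := dimle_ideal t0 (pl_vr mz).
elim: n (z^-1) mz t0 hn => [|n IH] t mt t0 hn.
  have [c c0] := hn (fun=> 1) (fun=> vr1); rewrite big_ord1 => h.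
  exfalso; have h1 : ideal_gen t 1.
    have := subspZ (c 0 0)^-1 (subsp_ideal t) h.
    rewrite scalerA mulVf ?scale1r //; apply: contra c0 => /eqP e.
    by apply/eqP/rowP => i; rewrite ord1 e mxE.
  have := @ideal_not 1 t (oner_neq0 _) mt; rewrite mul1r; exact.
case: (pselect (exists2 y, m y & ~ ideal_gen t y)) => [[y my ny]|no]; last first.
  exists t; split=> // z' hz'; apply: contrapT => h; apply: no; exists z' => //.
  by case=> u hu e; apply: h; exists u.
have y0 : y != 0.
  by apply: contra_notN ny => /eqP ->; exists 0; [apply: vr0|rewrite mulr0].
have ty : O (t / y).
  have : t / y != 0 by rewrite mulf_neq0 ?invr_eq0.
  case/vr_dich => // h; case: ny; exists (t / y)^-1 => //; by fld.
apply: (IH y) => //; apply: not_dimge => h.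
suff: dimge (O : VF -> Prop) (ideal_gen t) (n.+1 + 1).
  by move/dimge_dimle => /(_ _ hn); rewrite addn1 ltnn.
have tE : t = y * (t / y) by fld.
apply: (dimge_trans (W := ideal_gen y)) h _.
- exact: subsp_ideal.
- by move=> u [v hv ->]; apply: vrM => //; apply: pl_vr.
- by move=> u; rewrite {1}tE; apply: ideal_sub.
- by apply: dimge_gt0 (subsp_ideal t) (ideal_gen_self y) ny.
Qed.

End ValuationRing.

(** The point is that [n] is the same for all places; [fs_dv] needs this uniformity. *)
Lemma dimle_ideal_unif (K : finFieldType) (F : fieldType) (iota : {rmorphism K -> F}) (z : F) :
  function_field iota -> z != 0 -> exists n, forall O, valuation_ring iota O -> O z ->
  dimle (O : lmodF iota -> Prop) (ideal_gen (iota := iota) O z) n.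
Proof.
move=> hFF z0; have [[|n] hn] := dep_bound z hFF.
  by have [? [[]//]] := hn (fun=> 0).
by exists n => O hO hz; apply: dimle_ideal_of.
Qed.

(** * Orders and residue degrees *)

Section Order.
Variables (K : finFieldType) (F : fieldType) (iota : {rmorphism K -> F}).

(** The value at [z = 0] is the default 0, which is why [vge] treats zero separately. *)
Definition ord (O : F -> Prop) (z : F) : int :=
  if pselect (exists n, Defs.val O z n) is left h then sval (cid h) else 0.

Definition vge (O : F -> Prop) (n : int) : lmodF iota -> Prop :=
  fun z => z = 0 \/ n <= ord O z.

Definition pdeg (O : F -> Prop) : nat :=
  if pselect (exists n, place_degree iota O n) is left h then sval (cid h) else 0%N.

Hypothesis hFF : function_field iota.
Variable O : F -> Prop.
Hypothesis hO : valuation_ring iota O.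

Local Notation VF := (lmodF iota).
Local Notation m := (in_place O).

Lemma vunit1 : vunit O 1.
Proof. by split; [exact: vr1 hO|rewrite oner_neq0 invr1; split=> //; exact: vr1 hO]. Qed.
Lemma vunitM u v : vunit O u -> vunit O v -> vunit O (u * v).
Proof.
move=> [u1 [u2 u3]] [v1 [v2 v3]]; split; first exact: vrM hO _ _ u1 v1.
by rewrite mulf_neq0 // invfM; split=> //; apply: (vrM hO).
Qed.
Lemma vunitV u : vunit O u -> vunit O u^-1.
Proof. by move=> [u1 [u2 u3]]; split=> //; rewrite invr_eq0 invrK. Qed.
Lemma vunitXn u n : vunit O u -> vunit O (u ^+ n).
Proof.
by move=> h; elim: n => [|n IH]; [exact: vunit1|rewrite exprS; apply: vunitM].
Qed.
Lemma vunitX u (n : int) : vunit O u -> vunit O (u ^ n).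
Proof.
move=> h; case: n => n; first exact: vunitXn.
by rewrite NegzE -exprnN; apply/vunitV/vunitXn.
Qed.
Lemma vunit_pl u : vunit O u -> ~ m u.
Proof. by move=> [u1 [/eqP u2 u3]] [_ [|]]. Qed.
Lemma pl_unit u : O u -> ~ m u -> vunit O u.
Proof. by move=> h1 h2; have [h3 h4] := vr_unit hO h1 h2. Qed.

Lemma val_vr t u (n : int) : uniformizer O t -> vunit O u -> O (t ^ n * u) <-> 0 <= n.
Proof.
move=> [mt t0 ht] hu; split=> [h|]; last first.
  case: n => // n _; apply: (vrM hO); last by case: hu.
  by apply: (vrX hO); apply: pl_vr mt.
case: n h => // n; rewrite NegzE -exprnN => h.
case: (vunit_pl hu); have -> : u = t ^- n.+1 * u * t ^+ n * t.
  by rewrite exprS; field; rewrite t0 expf_neq0.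
apply: (plM hO) => //; apply: (vrM hO) => //.
by apply: (vrX hO); apply: pl_vr mt.
Qed.

Lemma unif_ratio t t' : uniformizer O t -> uniformizer O t' -> vunit O (t' / t).
Proof.
move=> [mt t0 ht] [mt' t0' ht'].
have [u [hu eu]] := ht _ mt'; have [v [hv ev]] := ht' _ mt.
have -> : t' / t = u by rewrite eu; fld.
split=> //; have u0 : u != 0.
  by apply: contraNneq t0' => e; rewrite eu e mulr0.
split=> //; suff -> : u^-1 = v by [].
apply: (mulIf u0); rewrite mulVf //; apply: (mulfI t0).
by rewrite mulr1 mulrCA -eu mulrC.
Qed.

Lemma val_uniq z n n' : Defs.val O z n -> Defs.val O z n' -> n = n'.
Proof.
move=> [t [u [ht hu ->]]] [t' [u' [ht' hu']]].
have hw := unif_ratio ht ht'; have [mt t0 _] := ht; have [_ t0' _] := ht'.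
have -> : t' = t * (t' / t) by fld.
rewrite expfzMl => e.
have u0 : u != 0 by case: hu => _ [].
have e2 : t ^ (n - n') * 1 = (t' / t) ^ n' * u' / u.
  rewrite mulr1 expfzDr // -invr_expz; apply: (mulIf u0); rewrite divfK //.
  by rewrite mulrAC e; have := expfz_neq0 n' t0 => ?; fld.
have hU : vunit O (t ^ (n - n') * 1).
  by rewrite e2; apply: vunitM; [apply: vunitM => //; apply: vunitX|apply: vunitV].
have h1 : 0 <= n - n' by apply/(val_vr _ ht vunit1); case: hU.
have h2 : 0 <= - (n - n').
  apply/(val_vr _ ht vunit1); rewrite mulr1 -invr_expz.
  by case: hU => _ []; rewrite mulr1.
lia.
Qed.

(** An element [y] of [O] divisible by all powers of [t] would leave an infinite strictly decreasing
    chain of ideals between [O] and [y O], against [dimle_ideal]. *)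
Lemma val_exists z : z != 0 -> exists n, Defs.val O z n.
Proof.
have [t ht] := exists_uniformizer hFF hO; have [mt t0 htz] := ht.
have key y : y != 0 -> O y -> exists k, exists2 u, vunit O u & y = t ^+ k * u.
  move=> y0 hy; apply: contrapT => no.
  have [n hn] := dimle_ideal hFF hO y0 hy.
  have hk k : exists2 w, O w & y = t ^+ k * w.
    elim: k => [|k [w hw e]]; first by exists y => //; rewrite expr0 mul1r.
    case: (pselect (m w)) => [mw|nm]; last first.
      by case: no; exists k, w => //; apply: pl_unit.
    have [u [hu eu]] := htz _ mw; exists u => //.
    by rewrite e eu exprSr mulrA.
  have hd k : dimge (O : VF -> Prop) (ideal_gen (iota := iota) O (t ^+ k)) k.
    elim: k => [|k IH]; first exact: dimge0.
    rewrite -addn1; apply: (dimge_trans (W := ideal_gen (iota := iota) O (t ^+ k))) IH _.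
    - exact: subsp_ideal hO _.
    - move=> u [v hv ->]; apply: (vrM hO) => //; apply: (vrX hO); exact: pl_vr mt.
    - by move=> u; rewrite addn1 exprSr; apply: ideal_sub => //; apply: pl_vr mt.
    - apply: (dimge_gt0 (subsp_ideal hO _) (ideal_gen_self hO (t ^+ k))).
      by rewrite addn1 exprSr; apply: ideal_not => //; rewrite expf_neq0.
  have : dimge (O : VF -> Prop) (ideal_gen (iota := iota) O y) n.+1.
    apply: dimge_sub (hd n.+1) => // u [v hv ->]; have [w hw ->] := hk n.+1.
    by exists (w * v); [apply: (vrM hO)|rewrite mulrA].
  by move/dimge_dimle => /(_ _ hn); rewrite ltnn.
move=> z0; case: (vr_dich hO z0) => hz.
  by have [k [u hu e]] := key _ z0 hz; exists k%:Z, t, u.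
have z0' : z^-1 != 0 by rewrite invr_eq0.
have [k [u hu e]] := key _ z0' hz; exists (- k%:Z), t, u^-1.
by split=> //; [apply: vunitV|rewrite -[z]invrK e invfM exprnN].
Qed.

Lemma ordP z : z != 0 -> Defs.val O z (ord O z).
Proof.
move=> z0; rewrite /ord; case: pselect => [h|no]; first by case: (cid h).
by case: no; apply: val_exists.
Qed.

Lemma val_ord z n : z != 0 -> Defs.val O z n -> ord O z = n.
Proof. by move=> z0; apply: val_uniq; apply: ordP. Qed.

Lemma ordM z w : z != 0 -> w != 0 -> ord O (z * w) = ord O z + ord O w.
Proof.
move=> z0 w0; apply: val_ord; first by rewrite mulf_neq0.
have [t [u [ht hu e]]] := ordP z0; have [t' [u' [ht' hu' e']]] := ordP w0.
have [_ t0 _] := ht.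
exists t, (u * ((t' / t) ^ ord O w * u')); split=> //.
  by apply: vunitM => //; apply: vunitM => //; apply/vunitX/unif_ratio.
have [_ t0' _] := ht'.
rewrite {1}e {1}e' {1}(_ : t' = t * (t' / t)); last by fld.
by rewrite expfzMl expfzDr //; ring.
Qed.

Lemma ord_one : ord O 1 = 0.
Proof. by have := @ordM 1 1 (oner_neq0 _) (oner_neq0 _); rewrite mulr1; lia. Qed.

Lemma ordV z : z != 0 -> ord O z^-1 = - ord O z.
Proof.
move=> z0; have := @ordM z z^-1 z0; rewrite invr_eq0 z0 => /(_ isT).
by rewrite mulfV // ord_one; lia.
Qed.

Lemma vr_ord z : z != 0 -> O z <-> 0 <= ord O z.
Proof. by move=> z0; have [t [u [ht hu e]]] := ordP z0; rewrite {1}e; apply: val_vr. Qed.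

Lemma ord_unit z : z != 0 -> O z -> O z^-1 -> ord O z = 0.
Proof.
move=> z0 /(vr_ord z0) h1; have z0' : z^-1 != 0 by rewrite invr_eq0.
by move/(vr_ord z0'); rewrite ordV //; lia.
Qed.

Lemma pl_ord z : z != 0 -> m z <-> 0 < ord O z.
Proof.
move=> z0; have z0' : z^-1 != 0 by rewrite invr_eq0.
split=> [[hz h]|h].
  have h1 := (vr_ord z0).1 hz.
  have : ord O z <> 0.
    move=> e; case: h => [/eqP|]; first by rewrite (negPf z0).
    by apply; apply/(vr_ord z0'); rewrite ordV // e.
  lia.
split; first by apply/(vr_ord z0); lia.
by right=> /(vr_ord z0'); rewrite ordV //; lia.
Qed.

Lemma ord_const a : a != 0 -> ord O (iota a) = 0.
Proof.
move=> a0; apply: ord_unit; rewrite ?fmorph_eq0 //; first exact: vr_const hO _.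
by rewrite -fmorphV; exact: vr_const hO _.
Qed.

Lemma ordX z n : z != 0 -> ord O (z ^+ n) = ord O z *+ n.
Proof.
move=> z0; elim: n => [|n IH]; first by rewrite expr0 ord_one.
by rewrite exprS ordM ?expf_neq0 // IH mulrS.
Qed.

Lemma ordN z : ord O (- z) = ord O z.
Proof.
have [->|z0] := eqVneq z 0; first by rewrite oppr0.
rewrite -mulN1r ordM ?oppr_eq0 ?oner_neq0 //.
rewrite (_ : -1 = iota (-1)); last by rewrite rmorphN rmorph1.
by rewrite ord_const ?add0r // oppr_eq0 oner_neq0.
Qed.

Lemma vge0 n : vge O n 0. Proof. by left. Qed.

Lemma vge_le n n' z : n' <= n -> vge O n z -> vge O n' z.
Proof. by move=> h [->|h2]; [left|right; apply: le_trans h2]. Qed.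

Lemma vge_vr z : vge O 0 z <-> O z.
Proof.
split=> [[->|h]|h]; first exact: vr0 hO.
  have [->|z0] := eqVneq z 0; first exact: vr0 hO.
  exact/(vr_ord z0).
by have [->|z0] := eqVneq z 0; [left|right; apply/(vr_ord z0)].
Qed.

Lemma vge_pl z : vge O 1 z <-> m z.
Proof.
split=> [[->|h]|h]; first exact: pl0 hO.
  have [->|z0] := eqVneq z 0; first exact: pl0 hO.
  by apply/(pl_ord z0).
by have [->|z0] := eqVneq z 0; [left|right; apply/(pl_ord z0)].
Qed.

Lemma vgeM n n' (z w : F) : vge O n z -> vge O n' w -> vge O (n + n') (z * w).
Proof.
move=> hz hw; have [->|z0] := eqVneq z 0; first by rewrite mul0r; left.
have [->|w0] := eqVneq w 0; first by rewrite mulr0; left.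
case: hz => [/eqP|hz]; first by rewrite (negPf z0).
case: hw => [/eqP|hw]; first by rewrite (negPf w0).
by right; rewrite ordM //; lia.
Qed.

Lemma vge_const a : vge O 0 (iota a). Proof. by apply/vge_vr; exact: vr_const hO _. Qed.

Lemma vgeD n (z w : F) : vge O n z -> vge O n w -> vge O n (z + w).
Proof.
have key u v : u != 0 -> v != 0 -> ord O u <= ord O v -> vge O (ord O u) (u + v).
  move=> u0 v0 h; have [->|uv0] := eqVneq (u + v) 0; first by left.
  right; have e : u + v = u * (1 + v / u) by fld.
  have n0 : 1 + v / u != 0 by apply: contraNneq uv0 => e0; rewrite e e0 mulr0.
  rewrite e ordM // lerDl; apply/(vr_ord n0)/(vrD hO); first exact: vr1 hO.
  have vu0 : v / u != 0 by rewrite mulf_neq0 ?invr_eq0.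
  by apply/(vr_ord vu0); rewrite ordM ?invr_eq0 // ordV //; lia.
move=> hz hw; have [->|z0] := eqVneq z 0; first by rewrite add0r.
have [->|w0] := eqVneq w 0; first by rewrite addr0.
case: (hz) => [/eqP|hz']; first by rewrite (negPf z0).
case: (hw) => [/eqP|hw']; first by rewrite (negPf w0).
case: (leP (ord O z) (ord O w)) => [le|/ltW le].
  exact: vge_le hz' (key _ _ z0 w0 le).
by rewrite addrC; apply: vge_le hw' (key _ _ w0 z0 le).
Qed.

Lemma vgeN n (z : F) : vge O n z -> vge O n (- z).
Proof. by case=> [->|h]; [left; rewrite oppr0|right; rewrite ordN]. Qed.

Lemma subsp_vge n : subsp (vge O n).
Proof.
split=> [|a u v hu hv]; first by left.
apply: vgeD => //; rewrite -[n]add0r lmodF_scaleE; apply: vgeM => //.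
exact: vge_const.
Qed.

Lemma vge_sum n (I : Type) (r : seq I) (P : pred I) (f : I -> F) :
  (forall i, P i -> vge O n (f i)) -> vge O n (\sum_(i <- r | P i) f i).
Proof. exact: (subsp_sum (U := vge O n)) (subsp_vge n). Qed.

Lemma ord_ltD (z w : F) : z != 0 -> vge O (ord O z + 1) w ->
  z + w != 0 /\ ord O (z + w) = ord O z.
Proof.
move=> z0 hw.
have n0 : z + w != 0.
  apply/eqP => /eqP; rewrite addr_eq0 => /eqP e.
  have := vgeN hw; rewrite -e => -[/eqP|]; [by rewrite (negPf z0)|lia].
split=> //.
have h1 : vge O (ord O z) (z + w).
  apply: vgeD; first by right.
  by apply: vge_le hw; lia.
have : ~ vge O (ord O z + 1) (z + w).
  move=> h; have := vgeD h (vgeN hw); rewrite addrK.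
  case=> [/eqP|]; [by rewrite (negPf z0)|lia].
case: h1 => [/eqP|h1]; first by rewrite (negPf n0).
by move=> h; apply/eqP; rewrite eq_le h1 andbT leNgt; apply/negP => h2; apply: h; right; lia.
Qed.

Lemma place_degreeP f : place_degree iota O f <-> exists s : 'I_f -> VF, basis_mod (O : VF -> Prop) m s.
Proof.
split=> [[s [h1 h2 h3]]|[s [h1 h2 h3]]]; exists s; split=> //.
- by move=> c hc; apply/rowP => i; rewrite mxE; apply: (h2 (c 0)).
- by move=> z /h3[c hc]; exists (\row_i c i); under eq_bigr => i _ do rewrite mxE.
- move=> c hc i; have /rowP/(_ i) : (\row_i c i) = 0.
    by apply: h2; under eq_bigr => j _ do rewrite mxE.
  by rewrite !mxE.
- by move=> z /h3[c hc]; exists (c 0).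
Qed.

Lemma pdegP : place_degree iota O (pdeg O).
Proof.
rewrite /pdeg; case: pselect => [h|no]; first by case: (cid h).
case: no; have [t [mt t0 ht]] := exists_uniformizer hFF hO.
have [n hn] := dimle_ideal hFF hO t0 (pl_vr mt).
have hm : dimle (O : VF -> Prop) m n.
  apply: dimle_sub hn => // z [u hu ->].
  by rewrite mulrC; apply: (plM hO).
have [r [s [_ _ hs]]] := dim_basis (subsp_pl hO) hm.
by exists r; apply/place_degreeP; exists s.
Qed.

Lemma place_degree_uniq f : place_degree iota O f -> f = pdeg O.
Proof.
move=> /place_degreeP[s hs]; have /place_degreeP[s' hs'] := pdegP.
have h1 := basis_dimle (subsp_pl hO) hs; have h2 := basis_dimle (subsp_pl hO) hs'.
have d1 : dimge (O : VF -> Prop) m f by case: hs => a b _; exists s.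
have d2 : dimge (O : VF -> Prop) m (pdeg O) by case: hs' => a b _; exists s'.
by apply/eqP; rewrite eqn_leq (dimge_dimle d1 h2) (dimge_dimle d2 h1).
Qed.

Lemma pdeg_dimle : dimle (O : VF -> Prop) m (pdeg O).
Proof. by have /place_degreeP[s hs] := pdegP; apply: basis_dimle hs; apply: subsp_pl hO. Qed.
Lemma pdeg_dimge : dimge (O : VF -> Prop) m (pdeg O).
Proof. by have /place_degreeP[s [a b _]] := pdegP; exists s. Qed.

Lemma pdeg_gt0 : (0 < pdeg O)%N.
Proof.
have h : dimge (O : VF -> Prop) (m : VF -> Prop) 1.
  apply: dimge_gt0; [exact: subsp_pl hO|exact: (vr1 hO)|exact: pl_not1 hO].
exact: dimge_dimle h pdeg_dimle.
Qed.

Lemma pdeg_le z n : z != 0 -> m z -> dimle (O : VF -> Prop) (ideal_gen (iota := iota) O z) n ->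
  (pdeg O <= n)%N.
Proof.
move=> z0 mz hn; apply: dimge_dimle pdeg_dimge _; apply: dimle_sub hn => // w [u hu ->].
by rewrite mulrC; apply: (plM hO).
Qed.

Lemma unif_ord t : uniformizer O t -> ord O t = 1.
Proof.
move=> ht; have [_ t0 _] := ht; apply: val_ord => //; exists t, 1.
by split=> //; [exact: vunit1|rewrite expr1z mulr1].
Qed.

Lemma exists_ord (n : int) : exists2 z, z != 0 & ord O z = n.
Proof.
have [t ht] := exists_uniformizer hFF hO; have [_ t0 _] := ht.
exists (t ^ n); first exact: expfz_neq0.
case: n => n; first by rewrite -exprnP ordX // unif_ord //; lia.
by rewrite NegzE -exprnN ordV ?expf_neq0 // ordX // unif_ord //; lia.
Qed.

Lemma mul_lin (y : F) (a : K) (u v : VF) : y * (a *: u + v) = a *: (y * u : VF) + y * v :> VF.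
Proof. by rewrite !lmodF_scaleE; ring. Qed.

Lemma vge_mul_sub (y : F) n z : y != 0 -> vge O n (y * z) -> vge O (n - ord O y) z.
Proof.
move=> y0 h; have -> : z = y^-1 * (y * z) by fld.
by rewrite addrC; apply: vgeM h; right; rewrite ordV.
Qed.

(** Multiplication by an element of order [- n] identifies this quotient with the residue field. *)
Lemma vge_step_dimle n : dimle (vge O n) (vge O (n + 1)) (pdeg O).
Proof.
have [y y0 oy] := exists_ord (- n).
apply: (dimle_preim (mul_lin y)) pdeg_dimle; last exact: subsp_vge.
- move=> z hz; apply/vge_vr; rewrite -(addNr n); apply: vgeM => //.
  by right; rewrite oy.
- move=> z hz /vge_pl h; have := vge_mul_sub y0 h.
  by rewrite oy opprK addrC.
Qed.

Lemma vge_step_dimge n : dimge (vge O n) (vge O (n + 1)) (pdeg O).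
Proof.
have [y y0 oy] := exists_ord n.
apply: (dimge_img (mul_lin y)) pdeg_dimge; last exact: subsp_vr hO.
- move=> z hz; rewrite -[n]addr0; apply: vgeM; first by right; rewrite oy.
  exact/vge_vr.
- move=> z hz /(vge_mul_sub y0) h; apply/vge_pl; apply: vge_le h.
  by rewrite oy; lia.
Qed.

End Order.

(** * Divisors *)

Definition place (K : finFieldType) (F : fieldType) (iota : {rmorphism K -> F}) :=
  {O : F -> Prop | valuation_ring iota O}.

Section PlaceType.
Variables (K : finFieldType) (F : fieldType) (iota : {rmorphism K -> F}).
HB.instance Definition _ := gen_eqMixin (place iota).
HB.instance Definition _ := gen_choiceMixin (place iota).
Lemma place_eq (P Q : place iota) : sval P = sval Q -> P = Q.
Proof. by case: P Q => O hO [O' hO'] /= e; subst O'; congr exist; apply: Prop_irrelevance. Qed.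
End PlaceType.

Section Divisors.
Variables (K : finFieldType) (F : fieldType) (iota : {rmorphism K -> F}).
Local Notation VF := (lmodF iota).
Local Notation place := (place iota).
Implicit Types (P Q : place) (A D E : place -> int).

Definition dg P : nat := pdeg iota (sval P).
Definition fs D := exists s : seq place, forall P, D P != 0 -> P \in s.
Definition pt P : place -> int := fun Q => (Q == P)%:Z.
Definition dv (z : F) : place -> int := fun P => ord (sval P) z.
(** Some list without repetition that contains the support, empty if there is none; by [degE] the
    degree does not depend on the choice. *)
Definition supp D : seq place :=
  if pselect (exists s, uniq s /\ forall P, D P != 0 -> P \in s) is left h
  then sval (cid h) else [::].
Definition deg D : int := \sum_(P <- supp D) (dg P)%:Z * D P.
Definition leD A D := forall P, A P <= D P.
Definition Ls A : VF -> Prop := fun z => forall P, vge (iota := iota) (sval P) (- A P) z.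
Definition zerosp (V : zmodType) : V -> Prop := fun z => z = 0.
(** The default 0 would stand for an infinite dimension; [ellP] excludes that case for divisors. *)
Definition ell A : nat :=
  if pselect (exists n, dimge (Ls A) (@zerosp VF) n /\ dimle (Ls A) (@zerosp VF) n) is left h
  then sval (cid h) else 0%N.

Lemma addfE A D P : (A + D) P = A P + D P. Proof. by []. Qed.
Lemma oppfE A P : (- A) P = - A P. Proof. by []. Qed.

Lemma fsD A D : fs A -> fs D -> fs (A + D).
Proof.
move=> [s hs] [t ht]; exists (s ++ t) => P hP; rewrite mem_cat.
apply/orP; have [e|] := eqVneq (A P) 0; last by move/hs; left.
by right; apply: ht; apply: contra hP => /eqP e2; apply/eqP; rewrite fctE e e2 addr0.
Qed.
Lemma fsN A : fs A -> fs (- A).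
Proof. by move=> [s hs]; exists s => P; rewrite oppr_eq0; apply: hs. Qed.
Lemma fsB A D : fs A -> fs D -> fs (A - D).
Proof. by move=> hA hD; apply: fsD => //; apply: fsN. Qed.
Lemma fs0 : fs 0. Proof. by exists [::] => P; rewrite eqxx. Qed.
Lemma fs_pt P : fs (pt P).
Proof. by exists [:: P] => Q; rewrite inE /pt; case: (Q == P). Qed.
Lemma fs_sum (ps : seq place) : fs (\sum_(P <- ps) pt P).
Proof. by apply: (big_ind fs) => [|x y|P _]; [exact: fs0|exact: fsD|exact: fs_pt]. Qed.
Lemma fsMn A n : fs A -> fs (A *+ n).
Proof. by move=> hA; elim: n => [|n IH]; [exact: fs0|rewrite mulrS; apply: fsD]. Qed.
Lemma fs_max A D : fs A -> fs D -> fs (fun P => Num.max (A P) (D P)).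
Proof.
move=> [s hs] [t ht]; exists (s ++ t) => P hP; rewrite mem_cat.
apply/orP; have [e|] := eqVneq (A P) 0; last by move/hs; left.
right; apply: ht; apply: contra hP => /eqP e2; apply/eqP; by rewrite e e2 maxxx.
Qed.

Lemma suppP D : fs D -> uniq (supp D) /\ forall P, D P != 0 -> P \in supp D.
Proof.
move=> [s hs]; rewrite /supp; case: pselect => [h|no]; first by case: (cid h).
case: no; exists (undup s); split; first exact: undup_uniq.
by move=> P /hs; rewrite mem_undup.
Qed.

Lemma degE D s : uniq s -> (forall P, D P != 0 -> P \in s) ->
  deg D = \sum_(P <- s) (dg P)%:Z * D P.
Proof.
move=> us hs; have [ut ht] := suppP (ex_intro _ s hs).
have key (t : seq place) : \sum_(P <- t) (dg P)%:Z * D P =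
    \sum_(P <- [seq P <- t | D P != 0]) (dg P)%:Z * D P.
  rewrite big_filter [RHS]big_mkcond /=; apply: eq_bigr => P _.
  by case: eqP => //= ->; rewrite mulr0.
rewrite /deg (key s) key; apply: perm_big; apply: uniq_perm; rewrite ?filter_uniq //.
move=> P; rewrite !mem_filter; case: eqVneq => //= h.
by rewrite (hs _ h) (ht _ h).
Qed.

Lemma degD A D : fs A -> fs D -> deg (A + D) = deg A + deg D.
Proof.
move=> [s hs] [t ht]; pose u := undup (s ++ t).
have uu : uniq u by apply: undup_uniq.
have hA P : A P != 0 -> P \in u by move/hs => h; rewrite mem_undup mem_cat h.
have hD P : D P != 0 -> P \in u by move/ht => h; rewrite mem_undup mem_cat h orbT.
have hAD P : (A + D) P != 0 -> P \in u.
  have [e|/hA //] := eqVneq (A P) 0; move=> h; apply: hD; apply: contra h => /eqP e2.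
  by apply/eqP; rewrite fctE e e2 addr0.
rewrite (degE uu hA) (degE uu hD) (degE uu hAD) -big_split /=.
by apply: eq_bigr => P _; rewrite -mulrDr.
Qed.
Lemma deg0 : deg 0 = 0.
Proof. by rewrite (@degE 0 [::]) ?big_nil // => P; rewrite eqxx. Qed.
Lemma degN A : fs A -> deg (- A) = - deg A.
Proof.
by move=> hA; apply/eqP; rewrite -addr_eq0 -degD ?addNr ?deg0 //; apply: fsN.
Qed.
Lemma degB A D : fs A -> fs D -> deg (A - D) = deg A - deg D.
Proof. by move=> hA hD; rewrite degD ?degN //; apply: fsN. Qed.
Lemma degMn A n : fs A -> deg (A *+ n) = deg A *+ n.
Proof.
move=> hA; elim: n => [|n IH]; first exact: deg0.
by rewrite !mulrS degD ?IH //; apply: fsMn.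
Qed.
Lemma deg_pt P : deg (pt P) = (dg P)%:Z.
Proof.
rewrite (@degE _ [:: P]) // ?big_seq1 /pt ?eqxx ?mulr1 // => Q.
by rewrite inE; case: (Q == P).
Qed.
Lemma deg_sum_pt (ps : seq place) : deg (\sum_(P <- ps) pt P) = (\sum_(P <- ps) dg P)%:Z.
Proof.
elim: ps => [|P ps IH]; first by rewrite !big_nil deg0.
by rewrite !big_cons degD ?deg_pt ?IH ?PoszD //; [exact: fs_pt|exact: fs_sum].
Qed.
Lemma deg_ge0 D : fs D -> leD 0 D -> 0 <= deg D.
Proof. by move=> hD h; rewrite /deg sumr_ge0 // => P _; rewrite mulr_ge0 //; apply: h. Qed.

(** Inequalities of divisors are used in this form, since the dimension estimates add one place at a
    time. *)
Lemma leD_seq A D : fs A -> fs D -> leD A D -> exists ps : seq place, D = A + \sum_(P <- ps) pt P.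
Proof.
move=> hA hD hle; have [us hs] := suppP (fsB hD hA).
pose N (E : place -> int) := (\sum_(P <- supp (D - A)%R) `|(D P - E P)%R|)%N.
suff: forall n E, leD E D -> (forall P, D P - E P != 0 -> P \in supp (D - A)) -> (N E < n)%N ->
   exists ps : seq place, D = E + \sum_(P <- ps) pt P.
  by move/(_ _ A hle hs (ltnSn _)).
elim=> [//|n IH] E hE hsE hN.
case: (pselect (D = E)) => [->|ne]; first by exists [::]; rewrite big_nil addr0.
have [P hP] : exists P, D P - E P != 0.
  apply: contrapT => no; apply: ne; apply/funext => P; apply/eqP; rewrite -subr_eq0.
  by apply/negPn/negP => h; apply: no; exists P.
have le1 : E P + 1 <= D P by have := hE P; move: hP; lia.
have [|||ps e] := IH (E + pt P).
- move=> Q; rewrite fctE /pt; case: eqP => [->//|_]; have := hE Q; lia.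
- move=> Q; rewrite addfE /pt; case: (eqVneq Q P) => [->|_ /=]; first by move=> _; apply: hsE.
  by rewrite addr0; apply: hsE.
- apply: leq_trans (_ : (N E <= n)%N) => //.
  rewrite /N !(big_rem P (hsE _ hP)) /= -addSn leq_add //.
    by rewrite fctE /pt eqxx; move: le1 hP; lia.
  rewrite leq_sum // => Q _; rewrite addfE /pt; case: (eqVneq Q P) => [->|_] /=; first by move: le1; lia.
  by rewrite addr0.
- by exists (P :: ps); rewrite big_cons addrA.
Qed.

Lemma leD_deg A D : fs A -> fs D -> leD A D -> deg A <= deg D.
Proof.
move=> hA hD hle; rewrite -subr_ge0 -degB //; apply: deg_ge0; first exact: fsB.
by move=> P; rewrite fctE subr_ge0; apply: hle.
Qed.

Hypothesis hFF : function_field iota.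

Lemma dg_gt0 P : (0 < dg P)%N. Proof. by rewrite /dg; apply: pdeg_gt0 (svalP P). Qed.

Lemma subsp_Ls A : subsp (Ls A).
Proof.
split=> [P|a u v hu hv P]; first by left.
by apply: (subsp_vge hFF (svalP P) _).2.
Qed.
Lemma subsp_zero (V : lmodType K) : subsp (@zerosp V).
Proof. by split=> // a u v -> ->; rewrite /zerosp scaler0 addr0. Qed.

Lemma Ls_mono A D : leD A D -> forall z, Ls A z -> Ls D z.
Proof. by move=> h z hz P; apply: vge_le (hz P); rewrite lerN2; apply: h. Qed.

Lemma Ls_step A P : dimle (Ls (A + pt P)) (Ls A) (dg P).
Proof.
have idlin (a : K) (u v : VF) : id (a *: u + v) = a *: id u + id v by [].
have := vge_step_dimle hFF (svalP P) (n := - A P - 1); rewrite subrK.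
apply: (dimle_preim idlin); last exact: subsp_Ls.
- by move=> z /(_ P); rewrite fctE /pt eqxx opprD.
- move=> z hz hP Q; have := hz Q; rewrite fctE /pt.
  by case: eqP => [->|_]; rewrite ?addr0.
Qed.

Lemma Ls_dimle A (ps : seq place) :
  dimle (Ls (A + \sum_(P <- ps) pt P)) (Ls A) (\sum_(P <- ps) dg P).
Proof.
elim: ps A => [|P ps IH] A; first by rewrite !big_nil addr0; apply: dimle_inj.
rewrite !big_cons addrA addnC.
apply: (dimle_trans (subsp_Ls (A + pt P)) _ (IH (A + pt P)) (@Ls_step A P)).
apply: Ls_mono => Q; rewrite [X in _ <= X]addfE lerDl.
apply: (big_ind (fun E : place -> int => 0 <= E Q)) => // x y hx hy.
by rewrite fctE addr_ge0.
Qed.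

Lemma ell_spec A n : dimle (Ls A) (@zerosp VF) n ->
  dimge (Ls A) (@zerosp VF) (ell A) /\ dimle (Ls A) (@zerosp VF) (ell A).
Proof.
move=> /dim_exact[r [_ h1 h2]]; rewrite /ell; case: pselect => [h|no]; first by case: (cid h).
by case: no; exists r.
Qed.

Lemma dv_mul z w : z != 0 -> w != 0 -> dv (z * w) = dv z + dv w.
Proof. by move=> z0 w0; apply/funext => P; rewrite fctE /dv (ordM hFF (svalP P)). Qed.
Lemma dvV z : z != 0 -> dv z^-1 = - dv z.
Proof. by move=> z0; apply/funext => P; rewrite fctE /dv (ordV hFF (svalP P)). Qed.
Lemma dv_const a : a != 0 -> dv (iota a) = 0.
Proof. by move=> a0; apply/funext => P; rewrite /dv (ord_const hFF (svalP P)). Qed.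
Lemma LsE A z : z != 0 -> Ls A z <-> leD 0 (A + dv z).
Proof.
move=> z0; split=> h P; have := h P; rewrite ?fctE /dv => h2.
  case: h2 => [/eqP|]; first by rewrite (negPf z0).
  by rewrite addrC; lia.
by right; move: h2; rewrite addrC; lia.
Qed.

Variable B : nat -> nat.
Hypothesis hB : forall r : nat, (1 <= r)%N -> has_card (places_of_degree iota r) (B r).

Lemma places_of r : (1 <= r)%N ->
  exists s : seq place, [/\ uniq s, size s = B r & forall P, (P \in s) = (dg P == r)].
Proof.
move=> r1; have [f [finj fP fsur]] := hB r1.
pose p i : place := exist _ (f i) (fP i).1.
exists [seq p i | i <- enum 'I_(B r)]; split.
- by rewrite map_inj_uniq ?enum_uniq // => i j /(congr1 sval) /= /finj.
- by rewrite size_map size_enum_ord.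
- move=> P; apply/mapP/eqP => [[i _ ->]|e].
    by rewrite /dg; apply/esym/(place_degree_uniq hFF (fP i).1); exact: (fP i).2.
  have [i hi] : exists i, f i = sval P.
    apply: fsur; split; first exact: svalP.
    by rewrite -e; apply: pdegP (svalP P).
  by exists i; [rewrite mem_enum|apply: place_eq].
Qed.

Lemma places_upto N : exists s : seq place, uniq s /\ forall P, (P \in s) = (dg P <= N)%N.
Proof.
elim: N => [|N [s [us hs]]].
  by exists [::]; split=> // P; rewrite leqn0 -(negbK (_ == _)) -lt0n dg_gt0.
have [t [ut _ ht]] := places_of (ltn0Sn N).
exists (s ++ t); split=> [|P]; last by rewrite mem_cat hs ht orbC -leq_eqVlt.
rewrite cat_uniq us ut andbT; apply/hasPn => P /=; rewrite ht hs => /eqP ->.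
by rewrite ltnn.
Qed.

(** The degree of a zero of [w] is at most the dimension of [O / w O], which is bounded uniformly in
    the place, and by [hB] there are finitely many places of bounded degree. The poles are the zeros
    of the inverse. *)
Lemma fs_dv z : z != 0 -> fs (dv z).
Proof.
have zeros w : w != 0 -> exists s : seq place, forall P, 0 < dv w P -> P \in s.
  move=> w0; have [n hn] := dimle_ideal_unif hFF w0.
  have [s [_ hs]] := places_upto n; exists s => P hP; rewrite hs.
  have mP : in_place (sval P) w by apply/(pl_ord hFF (svalP P) w0).
  by rewrite /dg; apply: (pdeg_le hFF (svalP P) w0 mP); apply: hn (svalP P) (pl_vr mP).
move=> z0; have [s hs] := zeros z z0; have z0' : z^-1 != 0 by rewrite invr_eq0.
have [t ht] := zeros _ z0'; exists (s ++ t) => P hP; rewrite mem_cat.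
case: (ltP 0 (dv z P)) => [/hs -> //|le]; rewrite ht ?orbT // dvV // fctE.
by move: hP le; lia.
Qed.

End Divisors.

(** * Riemann's theorem *)

Section Conversion.
Variables (K : finFieldType) (F : fieldType) (iota : {rmorphism K -> F}).
Hypothesis hFF : function_field iota.
Local Notation VF := (lmodF iota).
Local Notation place := (place iota).

(** [restr] and [ext] translate between divisors as functions on all predicates, used in the
    statement of the theorem, and functions on the type of places, used in the proof. *)
Definition restr (A : (F -> Prop) -> int) : place -> int := fun P => A (sval P).
Definition ext (D : place -> int) : (F -> Prop) -> int := fun O =>
  if pselect (valuation_ring iota O) is left h then D (exist _ O h) else 0.

Lemma ext_sval D P : ext D (sval P) = D P.
Proof.
rewrite /ext; case: pselect => [h|]; last by case; exact: (svalP P).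
by congr D; apply: place_eq.
Qed.

Lemma restr_ext D : restr (ext D) = D.
Proof. by apply/funext => P; apply: ext_sval. Qed.

Lemma RR_spaceE A z : RR_space iota A z <-> Ls (restr A) z.
Proof.
have [->|z0] := eqVneq z 0; first by split=> _; [move=> P; left|left].
split=> [[e|h] P|h]; first by rewrite e eqxx in z0.
  have [n [hn le]] := h _ (svalP P); right.
  by rewrite (val_ord hFF (svalP P) z0 hn).
right=> O hO; exists (ord O z); split; first exact: (ordP hFF hO z0).
by case: (h (exist _ O hO)) => [/eqP|//]; rewrite (negPf z0).
Qed.

Lemma K_dimP (S : F -> Prop) l : K_dim iota S l <->
  exists s : 'I_l -> VF, basis_mod (S : VF -> Prop) (@zerosp VF) s.
Proof.
split=> [[s [h1 h2 h3]]|[s [h1 h2 h3]]]; exists s; split=> //.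
- by move=> c hc; apply/rowP => i; rewrite mxE; apply: (h2 (c 0)).
- move=> z /h3[c hc]; exists (\row_i c i); rewrite /zerosp hc; apply/eqP.
  by rewrite subr_eq0; apply/eqP; apply: eq_bigr => i _; rewrite mxE.
- move=> c hc i; have /rowP/(_ i) : (\row_i c i) = 0.
    by apply: h2; rewrite /zerosp -[RHS]hc; apply: eq_bigr => j _; rewrite mxE.
  by rewrite !mxE.
- move=> z /h3[c hc]; exists (c 0); apply/eqP; rewrite -subr_eq0; exact/eqP.
Qed.

Definition toplace (O : F -> Prop) : option place :=
  if pselect (valuation_ring iota O) is left h then Some (exist _ O h) else None.

Lemma toplace_sval P : toplace (sval P) = Some P.
Proof.
rewrite /toplace; case: pselect => [h|]; last by case; exact: (svalP P).
by congr Some; apply: place_eq.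
Qed.
Lemma toplaceP O P : toplace O = Some P -> O = sval P.
Proof. by rewrite /toplace; case: pselect => // h [<-]. Qed.

Lemma mem_pmap_toplace (s : seq (F -> Prop)) P :
  P \in pmap toplace s <-> List.In (sval P) s.
Proof.
elim: s => [|O s IH] //=; case E: (toplace O) => [Q|] /=.
  rewrite inE; split=> [/orP[/eqP ->|/IH h]|[e|/IH ->]].
  - by left; apply: toplaceP.
  - by right.
  - by move: E; rewrite e toplace_sval => -[->]; rewrite eqxx.
  - by rewrite orbT.
split=> [/IH|[e|/IH //]]; first by right.
by move: E; rewrite e toplace_sval.
Qed.

Lemma uniq_pmap_toplace (s : seq (F -> Prop)) : List.NoDup s -> uniq (pmap toplace s).
Proof.
elim: s => [|O s IH] //= hs; have [nin nd] : ~ List.In O s /\ List.NoDup s by inversion hs.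
case E: (toplace O) => [P|] /=; last exact: IH.
rewrite IH // andbT; apply/negP => /mem_pmap_toplace.
by rewrite -(toplaceP E).
Qed.

Lemma fs_restr A : divisor iota A -> fs (restr A).
Proof.
move=> [_ [s hs]]; exists (pmap toplace s) => P hP.
by apply/mem_pmap_toplace/hs.
Qed.

Lemma div_degreeE A d : divisor iota A -> div_degree iota A d -> d = deg (restr A).
Proof.
move=> [hA _] [s [n [nd sz hs hn ->]]].
rewrite (degE (uniq_pmap_toplace nd)); last by move=> P hP; apply/mem_pmap_toplace/hs.
elim: s n sz hn {nd hs} => [|O s IH] [|k n] //=; first by rewrite big_ord0 big_nil.
move=> [sz] hn; rewrite big_ord_recl /= (IH n) //; last by move=> i hi; apply: (hn i.+1).
case E: (toplace O) => [P|] /=.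
  rewrite big_cons; congr (_ + _); rewrite /restr -(toplaceP E).
  have := hn 0%N isT; rewrite /= (toplaceP E) => h.
  by rewrite /dg -(place_degree_uniq hFF (svalP P) h).
rewrite hA ?mulr0 ?add0r // => hO; move: E.
by rewrite -[O]/(sval (exist _ O hO : place)) toplace_sval.
Qed.

Lemma ext_divisor D : fs D -> divisor iota (ext D).
Proof.
move=> [s hs]; split=> [O hO|]; first by rewrite /ext; case: pselect.
exists (map sval s) => O; rewrite /ext; case: pselect => // h hD.
have := hs _ hD; elim: s {hs} => //= P s IH; rewrite inE => /orP[/eqP <-|/IH]; [by left|by right].
Qed.

Lemma map_sval_In (s : seq place) O : List.In O (map sval s) -> exists2 P, P \in s & O = sval P.
Proof.
elim: s => //= P s IH [<-|/IH[Q hQ ->]]; first by exists P; rewrite ?mem_head.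
by exists Q; rewrite ?inE ?hQ ?orbT.
Qed.

Lemma ext_degree D : fs D -> div_degree iota (ext D) (deg D).
Proof.
move=> hD; have [us hs] := suppP hD.
exists (map sval (supp D)), (map (@dg _ _ iota) (supp D)); split.
- elim: (supp D) us => [|P s IH] /=; first by constructor.
  case/andP=> nP /IH h; constructor => //.
  by move=> /map_sval_In[Q hQ /place_eq e]; rewrite e hQ in nP.
- by rewrite !size_map.
- move=> O; rewrite /ext; case: pselect => // h hO.
  have := hs _ hO; elim: (supp D) => //= P s IH.
  by rewrite inE => /orP[/eqP <-|/IH]; [left|right].
- move=> i; rewrite size_map => hi.
  have [P0 _] : exists P : place, True by move: hi; case: (supp D) => // P; exists P.
  rewrite (nth_map P0) // (nth_map P0) //; exact: (pdegP hFF (svalP _)).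
- rewrite size_map /deg; case E: (supp D) => [|P0 s]; first by rewrite big_nil big_ord0.
  rewrite -E (big_nth P0) big_mkord; apply: eq_bigr => i _.
  by rewrite (nth_map P0) // (nth_map P0) // ext_sval.
Qed.

End Conversion.

Section Riemann.
Variables (K : finFieldType) (F : fieldType) (iota : {rmorphism K -> F}).
Hypothesis hFF : function_field iota.
Hypothesis hfull : full_constant_field iota.
Variable B : nat -> nat.
Hypothesis hB : forall r : nat, (1 <= r)%N -> has_card (places_of_degree iota r) (B r).
Variable g : nat.
Hypothesis hg : genus iota g.
Local Notation VF := (lmodF iota).
Local Notation place := (place iota).
Local Notation Z0 := (@zerosp VF).
Local Notation dv := (@dv K F iota).
Implicit Types (P Q : place) (A D W : place -> int).

Let sZ0 : subsp Z0 := subsp_zero VF.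
Let fsdv z (z0 : z != 0) := fs_dv hFF hB z0.

Lemma genus_le A l : fs A -> dimge (Ls A) Z0 l -> dimle (Ls A) Z0 l -> deg A - l%:Z + 1 <= g%:Z.
Proof.
move=> hA [s hs ind] hle; have [h1 _] := hg.
apply: h1 (ext_divisor hA) (ext_degree hFF hA) _; apply/K_dimP; exists s.
have b := indep_basis sZ0 hle hs ind; case: b => b1 b2 b3; split=> //.
  by move=> i; apply/(RR_spaceE hFF); rewrite restr_ext; apply: hs.
by move=> z /(RR_spaceE hFF); rewrite restr_ext => /b3.
Qed.

Lemma genus_eq : exists A l, [/\ fs A, dimge (Ls A) Z0 l, dimle (Ls A) Z0 l & deg A - l%:Z + 1 = g%:Z].
Proof.
have [_ [A [d [l [hA hd hl e]]]]] := hg; exists (restr A), l.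
have hdim := (K_dimP _ _ _).1 hl; case: hdim => s [h1 h2 h3].
have hb : basis_mod (Ls (restr A)) Z0 s.
  by split=> // [i|z hz]; [apply/(RR_spaceE hFF)|apply/h3/(RR_spaceE hFF)].
split; [exact: fs_restr|by exists s; case: hb|exact: basis_dimle hb|].
by rewrite -(div_degreeE hFF hA hd).
Qed.

(** The divisor [A0] that realizes the genus has a finite-dimensional space by definition, and the
    maximum of [A] and [A0] exceeds [A0] by finitely many places. *)
Lemma Ls_fin A : fs A -> exists n, dimle (Ls A) Z0 n.
Proof.
move=> hA; have [A0 [l [hA0 _ hle _]]] := genus_eq.
have hM := fs_max hA hA0; set M := (fun P => _) in hM.
have le0 : leD A0 M by move=> P; rewrite /M le_max lexx orbT.
have le1 : leD A M by move=> P; rewrite /M le_max lexx.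
have [ps e] := leD_seq hA0 hM le0.
have h := @Ls_dimle _ _ _ hFF A0 ps; rewrite -e in h.
exists (\sum_(P <- ps) dg P + l)%N.
apply: dimle_sub (Ls_mono le1) (fun z h => h) _.
exact: dimle_trans (subsp_Ls hFF A0) (Ls_mono le0) h hle.
Qed.

Lemma ellP A : fs A -> dimge (Ls A) Z0 (ell A) /\ dimle (Ls A) Z0 (ell A).
Proof. by move=> /Ls_fin[n]; apply: ell_spec. Qed.

Lemma ell_uniq A l : fs A -> dimge (Ls A) Z0 l -> dimle (Ls A) Z0 l -> l = ell A.
Proof.
move=> /ellP[h1 h2] h3 h4; apply/eqP.
by rewrite eqn_leq (dimge_dimle h3 h2) (dimge_dimle h1 h4).
Qed.

Lemma riemann A : fs A -> deg A + 1 - g%:Z <= (ell A)%:Z.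
Proof. by move=> hA; have [h1 h2] := ellP hA; have := genus_le hA h1 h2; lia. Qed.

Lemma ell_mono A D : fs A -> fs D -> leD A D -> (ell A <= ell D)%N.
Proof.
move=> hA hD le; have [h1 _] := ellP hA; have [_ h2] := ellP hD.
by apply: dimge_dimle h2; apply: dimge_sub h1 => //; apply: Ls_mono.
Qed.

Lemma ell_add A D : fs A -> fs D -> leD A D -> (ell D)%:Z <= (ell A)%:Z + (deg D - deg A).
Proof.
move=> hA hD le; have [ps e] := leD_seq hA hD le.
have -> : deg D - deg A = (\sum_(P <- ps) dg P)%N%:Z.
  by rewrite e degD ?deg_sum_pt //; [lia|exact: fs_sum].
have [h1 _] := ellP hD; have [_ h2] := ellP hA.
have h := @Ls_dimle _ _ _ hFF A ps; rewrite -e in h.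
have := dimge_dimle h1 (dimle_trans (subsp_Ls hFF A) (Ls_mono le) h h2).
lia.
Qed.

Lemma ell_dv A z : z != 0 -> fs A -> ell (A + dv z) = ell A.
Proof.
move=> z0 hA; have [h1 h2] := ellP hA.
have key (D : place -> int) (w : F) : w != 0 -> forall y, Ls (D + dv w) y -> Ls D (w * y).
  move=> w0 y hy P; have := hy P; rewrite addfE opprD => h.
  rewrite -[- D P](addrNK (dv w P)) addrC [in X in vge _ X _]addrC.
  by rewrite addrC; apply: (vgeM hFF (svalP P)) => //; right.
have z0' : z^-1 != 0 by rewrite invr_eq0.
have e : A = A + dv z + dv z^-1 by rewrite (dvV hFF) // addrK.
have hAz : fs (A + dv z) by apply: fsD => //; apply: fsdv.
apply/esym; apply: ell_uniq => //.
- apply: (dimge_img (mul_lin z^-1)) h1; last exact: subsp_Ls.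
    by rewrite {1}e; apply: key.
  by move=> y _ /eqP; rewrite mulf_eq0 (negPf z0') => /eqP.
- apply: (dimle_preim (mul_lin z)) h2; last exact: subsp_Ls.
    exact: key.
  by move=> y _ /eqP; rewrite mulf_eq0 (negPf z0) => /eqP.
Qed.

(* Since [l(n(z)) = l(0)] for all [n], Riemann's inequality bounds [n deg(z)] from above for all n in Z. *)
Lemma deg_dv z : z != 0 -> deg (dv z) = 0.
Proof.
have half w : w != 0 -> deg (dv w) <= 0.
  move=> w0; have h0 := fsdv w0.
  have hl n : ell (dv w *+ n) = ell (0 : place -> int).
    elim: n => [|n IH]; first by rewrite mulr0n.
    by rewrite mulrSr ell_dv //; apply: fsMn.
  rewrite leNgt; apply/negP => lt.
  have := riemann (fsMn (g + ell (0 : place -> int)) h0); rewrite hl degMn // -mulr_natr natz.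
  nia.
move=> z0; have z0' : z^-1 != 0 by rewrite invr_eq0.
have := half _ z0'; rewrite (dvV hFF) // degN; last exact: fsdv.
by have := half _ z0; lia.
Qed.

(** All powers of [z] stay in the finite-dimensional space [L(0)], so [z] is algebraic over [K]. *)
Lemma Ls0 z : Ls (0 : place -> int) z -> exists a, z = iota a.
Proof.
move=> hz; apply: hfull; have [_ h] := ellP (@fs0 _ _ iota).
have hX i : Ls (0 : place -> int) (z ^+ i : F).
  elim: i => [|i IH] P.
    by rewrite expr0 oppr0 -(rmorph1 iota); exact: (vge_const hFF (svalP P)).
  by rewrite exprS -(addr0 (- _)); apply: (vgeM hFF (svalP P)); [exact: hz|have := IH P; rewrite oppr0].
have [c c0 hc] := h (fun i => z ^+ i : F) (fun i => hX i).
exists (\poly_(i < (ell (0 : place -> int)).+1) (if insub i is Some j then c 0 j else 0)); split.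
  case/rV0Pn: c0 => i ci; apply/eqP => /polyP/(_ i); rewrite coef_poly ltn_ord coef0.
  case: insubP => [u _ /val_inj ->|/negP[]//] /eqP.
  by rewrite (negPf ci).
rewrite pevE pev_poly -[RHS]hc; apply: eq_bigr => i _.
by case: insubP => [u _ /val_inj -> //|/negP[]//].
Qed.

Lemma Ls_neg A z : fs A -> deg A < 0 -> Ls A z -> z = 0.
Proof.
move=> hA lt hz; apply/eqP; apply: contraTT lt => z0; rewrite -leNgt.
have := (LsE A z0).1 hz => h; have := deg_ge0 (fsD hA (fsdv z0)) h.
by rewrite degD ?deg_dv ?addr0 //; apply: fsdv.
Qed.

Lemma ell_neg A : fs A -> deg A < 0 -> ell A = 0%N.
Proof.
move=> hA lt; have [h _] := ellP hA; apply/eqP; rewrite -leqn0.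
by apply: dimge_dimle h _; apply: dimle_inj => z; apply: Ls_neg.
Qed.

Lemma ell_gt0 A : fs A -> (0 < ell A)%N -> exists2 z, z != 0 & Ls A z.
Proof.
move=> hA h; have [_ hle] := ellP hA; have [hge _] := ellP hA.
apply: contrapT => no; move: h; rewrite ltnNge; case/negP.
apply: dimge_dimle hge _; apply: dimle_inj => z hz; apply/eqP/negPn/negP => z0.
by apply: no; exists z.
Qed.

Lemma ell0 : ell (0 : place -> int) = 1%N.
Proof.
apply/esym; apply: ell_uniq; first exact: fs0.
  apply: (dimge_gt0 (z := ((1 : F) : VF))) => //; last by move/eqP; rewrite oner_eq0.
  by move=> P; rewrite oppr0 -(rmorph1 iota); exact: (vge_const hFF (svalP P)).
have b : basis_mod (Ls (0 : place -> int)) Z0 (fun _ : 'I_1 => ((1 : F) : VF)).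
  split=> [i P|c|z /Ls0[a ->]].
  - by rewrite oppr0 -(rmorph1 iota); exact: (vge_const hFF (svalP P)).
  - rewrite big_ord1 lmodF_scaleE mulr1 /zerosp => /eqP; rewrite fmorph_eq0 => /eqP e.
    by apply/rowP => i; rewrite ord1 e mxE.
  - by exists (const_mx a); rewrite big_ord1 mxE lmodF_scaleE mulr1 /zerosp subrr.
exact: basis_dimle b.
Qed.

(** The index of speciality, that is, the defect in Riemann's inequality. *)
Definition ispec A : int := (ell A)%:Z - deg A - 1 + g%:Z.

Lemma ispec_ge0 A : fs A -> 0 <= ispec A.
Proof. by move=> /riemann; rewrite /ispec; lia. Qed.

Lemma ispec_anti A D : fs A -> fs D -> leD A D -> ispec D <= ispec A.
Proof. by move=> hA hD /(ell_add hA hD); rewrite /ispec; lia. Qed.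

(** Without places the only divisor is 0, and it would give genus [0 - 1 + 1 = 0]. *)
Lemma exists_place : (2 <= g)%N -> exists P : place, True.
Proof.
move=> g2; apply: contrapT => no.
have [A0 [l [hA0 h1 h2 e]]] := genus_eq.
have e0 : A0 = 0 by apply/funext => P; case: no; exists P.
have := ell_uniq hA0 h1 h2; rewrite e0 ell0 => el.
by move: e; rewrite e0 deg0 el; lia.
Qed.

End Riemann.

(** * Adeles *)

Section Adeles.
Variables (K : finFieldType) (F : fieldType) (iota : {rmorphism K -> F}).
Hypothesis hFF : function_field iota.
Hypothesis hfull : full_constant_field iota.
Variable B : nat -> nat.
Hypothesis hB : forall r : nat, (1 <= r)%N -> has_card (places_of_degree iota r) (B r).
Variable g : nat.
Hypothesis hg : genus iota g.
Local Notation VF := (lmodF iota).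
Local Notation place := (place iota).
Local Notation V := (place -> VF).
Local Notation Z0 := (@zerosp VF).
Local Notation dv := (@dv K F iota).
Local Notation ispec := (ispec g).
Implicit Types (P Q : place) (A D W M : place -> int) (al be : V).

Definition adele al := exists s : seq place, forall P, P \notin s -> vge (sval P) 0 (al P).
Definition XA A al := forall P, vge (sval P) (- A P) (al P).
Definition diag (z : VF) : V := fun=> z.
(** The sum of the adeles bounded by [A] and of the diagonal. [XAF_dimle] bounds its codimension in
    all adeles by [ispec A]. *)
Definition XAF A al := exists z, XA A (al - diag z).
Definition mulA (f : F) al : V := fun P => f * (al P : F) : F.

Lemma subsp_XA A : subsp (XA A).
Proof.
split=> [P|a u v hu hv P]; first by left.
by apply: (subsp_vge hFF (svalP P) _).2; [apply: hu|apply: hv].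
Qed.
Lemma diag_lin (a : K) (u v : VF) : diag (a *: u + v) = a *: diag u + diag v.
Proof. by []. Qed.
Lemma subsp_XAF A : subsp (XAF A).
Proof.
split=> [|a u v [y hy] [z hz]]; first by exists 0; rewrite subr0; apply: (subsp_XA A).1.
exists (a *: y + z); rewrite diag_lin opprD addrACA -scalerBr.
exact: (subsp_XA A).2.
Qed.
Lemma XA_XAF A al : XA A al -> XAF A al.
Proof. by move=> h; exists 0; rewrite (_ : al - diag 0 = al) //; apply: subr0. Qed.
Lemma diag_XAF A z : XAF A (diag z).
Proof. by exists z; rewrite subrr; apply: (subsp_XA A).1. Qed.
Lemma XA_diag A z : XA A (diag z) <-> Ls A z. Proof. by []. Qed.
Lemma XA_mono A D : leD A D -> forall al, XA A al -> XA D al.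
Proof. by move=> h al hz P; apply: vge_le (hz P); rewrite lerN2; apply: h. Qed.

Lemma adele_XA A al : fs A -> XA A al -> adele al.
Proof.
move=> [s hs] h; exists s => P hP; have := h P.
suff -> : A P = 0 by rewrite oppr0.
by apply/eqP; apply: contraNT hP; apply: hs.
Qed.
Lemma subsp_adele : subsp adele.
Proof.
split=> [|a u v [s hs] [t ht]]; first by exists [::] => P _; left.
exists (s ++ t) => P; rewrite mem_cat negb_or => /andP[h1 h2].
by apply: (subsp_vge hFF (svalP P) _).2; [apply: hs|apply: ht].
Qed.
Lemma fs_adele (f : F) : adele (diag f).
Proof.
have [->|f0] := eqVneq f 0; first by exists [::] => P _; left.
have [s hs] := fs_dv hFF hB f0; exists s => P hP; right.
suff -> : ord (sval P) f = 0 by [].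
by apply/eqP; apply: contraNT hP; apply: hs.
Qed.
Lemma adele_mulA f al : adele al -> adele (mulA f al).
Proof.
move=> [s hs]; have [t ht] := fs_adele f; exists (s ++ t) => P.
rewrite mem_cat negb_or => /andP[h1 h2]; rewrite -[0]addr0.
by apply: (vgeM hFF (svalP P)); [apply: ht|apply: hs].
Qed.

Lemma XA_step_le A P : dimle (XA (A + pt P)) (XA A) (dg P).
Proof.
have lin (a : K) (u v : V) : (a *: u + v) P = a *: u P + v P by [].
have := vge_step_dimle hFF (svalP P) (n := - A P - 1); rewrite subrK.
apply: (dimle_preim (f := fun al : V => al P) lin); last exact: subsp_XA.
- by move=> z /(_ P); rewrite addfE /pt eqxx opprD.
- move=> z hz hP Q; have := hz Q; rewrite addfE /pt.
  by case: eqP => [->|_]; rewrite ?addr0.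
Qed.

Lemma XA_step_ge A P : dimge (XA (A + pt P)) (XA A) (dg P).
Proof.
pose f (z : VF) : V := fun Q => if Q == P then z else 0.
have lin (a : K) (u v : VF) : f (a *: u + v) = a *: f u + f v.
  apply/funext => Q; rewrite /f; change ((if Q == P then a *: u + v else 0) =
    a *: (if Q == P then u else 0) + (if Q == P then v else 0)).
  by case: eqP => // _; rewrite scaler0 addr0.
have := vge_step_dimge hFF (svalP P) (- A P - 1); rewrite subrK.
apply: (dimge_img lin); last exact: (subsp_vge hFF (svalP P)).
- move=> z hz Q; rewrite /f addfE /pt; case: eqP => [->|_]; last by left.
  by rewrite opprD.
- by move=> z hz /(_ P); rewrite /f eqxx.
Qed.

Lemma leD_addpt A (ps : seq place) : leD A (A + \sum_(P <- ps) pt P).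
Proof.
move=> Q; rewrite addfE lerDl.
apply: (big_ind (fun E : place -> int => 0 <= E Q)) => // x y hx hy.
by rewrite addfE addr_ge0.
Qed.

Lemma XA_dimle A (ps : seq place) : dimle (XA (A + \sum_(P <- ps) pt P)) (XA A) (\sum_(P <- ps) dg P).
Proof.
elim: ps A => [|P ps IH] A; first by rewrite !big_nil addr0; apply: dimle_inj.
rewrite !big_cons addrA addnC.
apply: (dimle_trans (subsp_XA (A + pt P)) _ (IH (A + pt P)) (@XA_step_le A P)).
exact/XA_mono/leD_addpt.
Qed.
Lemma XA_dimge A (ps : seq place) : dimge (XA (A + \sum_(P <- ps) pt P)) (XA A) (\sum_(P <- ps) dg P).
Proof.
elim: ps A => [|P ps IH] A; first by rewrite !big_nil addr0; apply: dimge0.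
rewrite !big_cons addrA addnC.
apply: (dimge_trans (subsp_XA (A + pt P)) _ _ (IH (A + pt P)) (@XA_step_ge A P)).
  exact/XA_mono/leD_addpt.
by apply: XA_mono; have := @leD_addpt A [:: P]; rewrite big_seq1.
Qed.

Let rie := riemann hFF hg.
Let ellP' := @ellP _ _ _ hFF _ hg.

Lemma XA_dims A D : fs A -> fs D -> leD A D -> exists n : nat,
  [/\ n%:Z = deg D - deg A, dimle (XA D) (XA A) n & dimge (XA D) (XA A) n].
Proof.
move=> hA hD le; have [ps e] := leD_seq hA hD le; exists (\sum_(P <- ps) dg P)%N.
split; [|by rewrite e; apply: XA_dimle|by rewrite e; apply: XA_dimge].
by rewrite e degD ?deg_sum_pt //; [lia|exact: fs_sum].
Qed.

Lemma Ls_dims A D : fs A -> fs D -> leD A D ->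
  dimge (Ls D) (Ls A) (ell D - ell A) /\ dimle (Ls D) (Ls A) (ell D - ell A).
Proof.
move=> hA hD le; have [a1 a2] := ellP' hA; have [d1 d2] := ellP' hD; split.
  exact: dimge_quot (subsp_Ls hFF A) (Ls_mono le) d1 a2.
apply: dimle_quot (subsp_Ls hFF A) (Ls_mono le) _ d2 a1.
by move=> z ->; apply: (subsp_Ls hFF A).1.
Qed.

Lemma exists_nonspecial A : fs A -> exists M, [/\ fs M, leD A M & ispec M = 0].
Proof.
move=> hA; have [A0 [l [hA0 h1 h2 e]]] := genus_eq hFF hg.
have i0 : ispec A0 = 0 by rewrite /ispec -(ell_uniq hFF hg hA0 h1 h2); lia.
exists (fun P => Num.max (A P) (A0 P)); have hM := fs_max hA hA0; split=> //.
  by move=> P; rewrite le_max lexx.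
have le0 : leD A0 (fun P => Num.max (A P) (A0 P)) by move=> P; rewrite le_max lexx orbT.
have := ispec_anti hFF hg hA0 hM le0; have := ispec_ge0 hFF hg hM; rewrite i0; lia.
Qed.

Lemma adele_bound M al : fs M -> adele al -> exists M', [/\ fs M', leD M M' & XA M' al].
Proof.
move=> hM [s hs]; pose E P : int := if P \in s then Num.max 0 (- ord (sval P) (al P)) else 0.
have hE : fs E by exists s => P; rewrite /E; case: ifP => //; rewrite eqxx.
exists (fun P => Num.max (M P) (E P)); split; first exact: fs_max.
  by move=> P; rewrite le_max lexx.
move=> P; rewrite /E; case: ifP => [_|/negbT hP]; last first.
  by apply: vge_le (hs _ hP); lia.
have [->|z0] := eqVneq (al P) 0; first by left.
right; lia.
Qed.

(** Let [M' >= M] bound [al]. Both divisors are nonspecial, so [l(M') - l(M) = deg M' - deg M],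
    which is the dimension of the adeles bounded by [M'] modulo those bounded by [M]. The diagonal
    elements from [L(M')] therefore already span this quotient. *)
Lemma nonspecial_XAF M al : fs M -> ispec M = 0 -> adele al -> XAF M al.
Proof.
move=> hM iM hal; have [M' [hM' le hX]] := adele_bound hM hal.
have iM' : ispec M' = 0.
  by have := ispec_anti hFF hg hM hM' le; have := ispec_ge0 hFF hg hM'; rewrite iM; lia.
have [n [en nle _]] := XA_dims hM hM' le.
have [[s hs ind] _] := Ls_dims hM hM' le.
have en' : (ell M' - ell M)%N = n by move: iM iM'; rewrite /ispec; lia.
rewrite en' in s hs ind.
have [_ _ hspan] : basis_mod (XA M') (XA M) (fun i => diag (s i)).
  apply: indep_basis => //; first exact: subsp_XA.
  move=> c hc; apply: ind; apply/XA_diag.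
  by move: hc; rewrite -(lin_comb diag_lin).
have [c hc] := hspan _ hX; exists (\sum_i c 0 i *: s i).
by rewrite (lin_comb diag_lin).
Qed.

(** For a nonspecial [M >= A] every adele can be moved into those bounded by [M] along the diagonal.
    These have dimension [deg M - deg A] modulo those bounded by [A], of which [L(M)] accounts for
    [l(M) - l(A)]; the difference is [ispec A]. *)
Lemma XAF_dimle A : fs A -> exists2 r : nat, r%:Z = ispec A & dimle adele (XAF A) r.
Proof.
move=> hA; have [M [hM le iM]] := exists_nonspecial hA.
have [n [en nle _]] := XA_dims hA hM le.
have [[w hw indw] _] := Ls_dims hA hM le.
have hr : exists r : nat, r%:Z = ispec A.
  by exists `|ispec A|%N; have := ispec_ge0 hFF hg hA; lia.
have [r er] := hr; exists r => //; apply: not_dimge => -[al hal ind].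
have /choice[z hz] : forall i, exists z, XA M (al i - diag z).
  by move=> i; apply: nonspecial_XAF.
pose U' be := XAF A be /\ XA M be.
have d1 : dimge (XA M) U' r.+1.
  exists (fun i => al i - diag (z i)) => // c [hc _]; apply: ind.
  have -> : \sum_i c 0 i *: al i = \sum_i c 0 i *: (al i - diag (z i)) + diag (\sum_i c 0 i *: z i).
    rewrite (lin_comb diag_lin) -big_split /=; apply: eq_bigr => i _.
    by rewrite -scalerDr subrK.
  by apply: subspD => //; [exact: subsp_XAF|exact: diag_XAF].
have d2 : dimge U' (XA A) (ell M - ell A).
  exists (fun i => diag (w i)) => [i|c hc].
    by split; [exact: diag_XAF|exact: hw].
  by apply: indw; move: hc; rewrite -(lin_comb diag_lin).
have sU' : subsp U'.
  have [a1 a2] := subsp_XAF A; have [b1 b2] := subsp_XA M.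
  by split=> // a u v [u1 u2] [v1 v2]; split; [apply: a2|apply: b2].
have hUX : forall be, XA A be -> U' be.
  by move=> be hb; split; [exact: XA_XAF|exact: XA_mono le _ hb].
have := dimge_dimle (dimge_trans sU' (fun be h => proj2 h) hUX d1 d2) nle.
have := ell_mono hFF hg hA hM le; move: er iM en; rewrite /ispec; lia.
Qed.

(** Otherwise [L(M)] would span the adeles bounded by a nonspecial [M >= W] modulo those bounded by
    [W], whence [deg M - deg W <= l(M) - l(W)] and [ispec W <= ispec M = 0]. *)
Lemma special_XAF W : fs W -> 0 < ispec W -> exists2 al, adele al & ~ XAF W al.
Proof.
move=> hW iW; apply: contrapT => no.
have all al : adele al -> XAF W al.
  by move=> h; apply: contrapT => h2; apply: no; exists al.
have [M [hM le iM]] := exists_nonspecial hW.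
have [n [en _ nge]] := XA_dims hW hM le.
have [_ hle] := Ls_dims hW hM le.
have hle2 : dimle (XA M) (XA W) (ell M - ell W).
  move=> al hal.
  have /choice[z hz] : forall i, exists z, XA W (al i - diag z).
    by move=> i; apply: all; apply: adele_XA (hal i).
  have [i|c c0 hc] := hle z.
    have : XA M (diag (z i)); last by [].
    rewrite -[diag _](subKr (al i)); apply: (subspB (subsp_XA M)); first exact: hal.
    exact: XA_mono le _ (hz i).
  exists c => //.
  have -> : \sum_i c 0 i *: al i = \sum_i c 0 i *: (al i - diag (z i)) + diag (\sum_i c 0 i *: z i).
    rewrite (lin_comb diag_lin) -big_split /=; apply: eq_bigr => i _.
    by rewrite -scalerDr subrK.
  apply: (subspD (subsp_XA W)) => //; apply: (subsp_comb _ (subsp_XA W)) => i; exact: hz.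
by have := dimge_dimle nge hle2; have := ell_mono hFF hg hW hM le; move: iM iW en; rewrite /ispec; lia.
Qed.

Lemma mulA_lin f (a : K) al be : mulA f (a *: al + be) = a *: mulA f al + mulA f be.
Proof. by apply/funext => P; exact: mul_lin. Qed.

Lemma XAF_mulA W A f al : Ls (W - A) f -> XAF A al -> XAF W (mulA f al).
Proof.
move=> hf [z hz]; exists (f * (z : F)) => P.
have -> : (mulA f al - diag (f * (z : F))) P = f * ((al - diag z) P : F) :> F.
  by rewrite -[RHS]/(f * (al P - z)) mulrBr.
have -> : - W P = - (W - A) P + - A P by rewrite addfE oppfE; lia.
exact: (vgeM hFF (svalP P)).
Qed.

(* A linear form on the adeles that vanishes on [XAF W] but not identically can be multiplied by the
   elements of [L(W - A)]. *)
Lemma pairing W A : fs W -> 0 < ispec W -> fs A -> (ell (W - A))%:Z <= ispec A.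
Proof.
move=> hW iW hA; have [al0 hal0 nal0] := special_XAF hW iW.
have [rW _ dW] := XAF_dimle hW.
have [r [s [_ _ [hs ind hspan]]]] := dim_basis (subsp_XAF W) dW.
have [i0 _] : exists i : 'I_r, True.
  case: r s hs ind hspan => [|r] s hs ind hspan; last by exists ord0.
  by have [c] := hspan _ hal0; rewrite big_ord0 subr0.
(* One coordinate modulo [XAF W] is a nonzero linear form [lam] on the adeles that kills [XAF W], in
   other words a Weil differential. *)
pose coo al : 'rV[K]_r :=
  if pselect (exists c : 'rV[K]_r, XAF W (al - \sum_i c 0 i *: s i)) is left h
  then sval (cid h) else 0.
have cooP al : adele al -> XAF W (al - \sum_i coo al 0 i *: s i).
  move=> h; rewrite /coo; case: pselect => [h2|[]]; first by case: (cid h2).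
  exact: hspan.
have coo_uniq al (c : 'rV[K]_r) : adele al -> XAF W (al - \sum_i c 0 i *: s i) -> c = coo al.
  move=> h hc; apply/eqP; rewrite -subr_eq0; apply/eqP/ind.
  have := subspB (subsp_XAF W) (cooP _ h) hc; rewrite opprB addrC addrA subrK -sumrB.
  by congr XAF; apply: eq_bigr => i _; rewrite !mxE scalerBl.
pose lam al := coo al 0 i0.
have lamL (a : K) al be : adele al -> adele be -> lam (a *: al + be) = a * lam al + lam be.
  move=> h1 h2; rewrite /lam -(@coo_uniq _ (a *: coo al + coo be)) ?mxE //.
    exact: subsp_adele.2.
  have := (subsp_XAF W).2 a _ _ (cooP _ h1) (cooP _ h2); congr XAF.
  rewrite scalerBr addrACA -opprD scaler_sumr -big_split /=; congr (_ - _).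
  by apply: eq_bigr => i _; rewrite !mxE scalerDl scalerA.
have lam0 al : adele al -> XAF W al -> lam al = 0.
  move=> h1 h2; rewrite /lam -(@coo_uniq _ 0) ?mxE //.
  by rewrite big1 ?subr0 // => i _; rewrite mxE scale0r.
have lam1 : lam (s i0) = 1.
  rewrite /lam -(@coo_uniq _ (delta_mx 0 i0)) ?mxE ?eqxx //.
  rewrite (bigD1 i0) //= big1 => [|i ne]; last by rewrite mxE (negPf ne) andbF scale0r.
  by rewrite mxE !eqxx scale1r addr0 subrr; apply: (subsp_XAF W).1.
have lamS n (c : 'rV[K]_n) (t : 'I_n -> V) : (forall i, adele (t i)) ->
    lam (\sum_i c 0 i *: t i) = \sum_i c 0 i * lam (t i).
  move=> ht; suff [] : adele (\sum_i c 0 i *: t i) /\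
     lam (\sum_i c 0 i *: t i) = \sum_i c 0 i * lam (t i) by [].
  apply: (big_rec2 (fun x y => adele x /\ lam x = y)).
    split; first exact: subsp_adele.1.
    by apply: lam0; [exact: subsp_adele.1|exact: (subsp_XAF W).1].
  by move=> i x y _ [h1 <-]; split; [exact: subsp_adele.2|rewrite lamL].
have hWA := fsB hW hA.
have [[f hf indf] _] := ellP' hWA.
have [rA erA dA] := XAF_dimle hA.
have [r' [t [lr _ [ht _ tspan]]]] := dim_basis (subsp_XAF A) dA.
(* If [l(W - A)] exceeded [ispec A], some nonzero [f0] in [L(W - A)] would make [lam (f0 al)] vanish
   on the representatives [t k]. It vanishes on [XAF A] because [f0] sends it into [XAF W], hence it
   vanishes everywhere, and dividing by [f0] contradicts [lam1]. *)
rewrite -erA lez_nat; apply: leq_trans lr; rewrite leqNgt; apply/negP => lt.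
have [c c0 hc] := exists_left_kernel (\matrix_(j, k) lam (mulA (f j) (t k))) lt.
pose f0 : F := \sum_j c 0 j *: f j.
have hf0 : Ls (W - A) f0 by apply: subsp_comb => //; exact: subsp_Ls.
have nz : f0 != 0 by apply: contra c0 => /eqP e; apply/eqP/indf.
have hk k : lam (mulA f0 (t k)) = 0.
  have -> : mulA f0 (t k) = \sum_j c 0 j *: mulA (f j) (t k).
    apply/funext => P; rewrite fct_sumE /mulA /f0 mulr_suml.
    by apply: eq_bigr => j _; rewrite -[RHS]/(iota (c 0 j) * (f j * t k P)) mulrA.
  rewrite lamS; last by move=> j; apply: adele_mulA.
  have /rowP/(_ k) := hc; rewrite !mxE => e; rewrite -[RHS]e.
  by apply: eq_bigr => j _; rewrite mxE.
have hal al : adele al -> lam (mulA f0 al) = 0.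
  move=> h; have [d hd] := tspan _ h.
  have e : mulA f0 al = \sum_k d 0 k *: mulA f0 (t k) + mulA f0 (al - \sum_k d 0 k *: t k).
    rewrite -(lin_comb (mulA_lin f0)); have := mulA_lin f0 1 (\sum_k d 0 k *: t k) (al - \sum_k d 0 k *: t k).
    by rewrite !scale1r addrCA subrr addr0.
  have a1 : adele (\sum_k d 0 k *: mulA f0 (t k)).
    by apply: subsp_comb => [|k]; [exact: subsp_adele|exact: adele_mulA].
  have a2 : adele (mulA f0 (al - \sum_k d 0 k *: t k)).
    apply: adele_mulA; apply: subspB => //; first exact: subsp_adele.
    by apply: subsp_comb => //; exact: subsp_adele.
  rewrite e -[X in lam (X + _)]scale1r lamL // lamS; last by move=> k; apply: adele_mulA.
  rewrite big1 => [|k _]; last by rewrite hk mulr0.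
  by rewrite mulr0 add0r; apply: lam0 => //; apply: XAF_mulA hd.
have := hal (mulA f0^-1 (s i0)) (adele_mulA _ (hs i0)).
have -> : mulA f0 (mulA f0^-1 (s i0)) = s i0.
  by apply/funext => P; rewrite /mulA mulrA mulfV // mul1r.
by rewrite lam1 => /eqP; rewrite oner_eq0.
Qed.

(** Apply [pairing] with [A = - P]: since [l(- P) = 0], it gives [l(W + P) <= deg P - 1 + g], while
    Riemann's inequality gives [l(W + P) >= deg W + deg P + 1 - g]. *)
Lemma special_deg W : fs W -> 0 < ispec W -> (2 <= g)%N -> deg W <= 2 * g%:Z - 2.
Proof.
move=> hW iW g2; have [P _] := exists_place hFF hfull hg g2.
have hP := @fs_pt _ _ iota P; have hA := fsN hP.
have dP := dg_gt0 hFF P.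
have := pairing hW iW hA; have := rie (fsB hW hA); rewrite /ispec.
rewrite (ell_neg hFF hB hg hA) ?degB // ?degN // ?deg_pt; lia.
Qed.

Lemma ell_large A : (2 <= g)%N -> fs A -> 2 * g%:Z - 1 <= deg A -> (ell A)%:Z = deg A + 1 - g%:Z.
Proof.
move=> g2 hA le; have := ispec_ge0 hFF hg hA; rewrite le_eqVlt => /orP[/eqP|h].
  by rewrite /ispec; lia.
have := special_deg hA h g2; lia.
Qed.

End Adeles.

(** * The zeta function *)

Section Newton.
Variable R : comNzRingType.
Implicit Types a b : nat -> R.

(* [b] is the sequence of power sums attached to the series [sum_k a_k T^k]: [T a'(T) = b(T) a(T)] *)
Definition newton_rel a b :=
  forall k, k%:R * a k = \sum_(i < k) b i.+1 * a (k - i.+1)%N.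

(** The coefficients of [(1 - z T) a(T)]. *)
Definition mul1X (z : R) a k := a k - z * (if k is k'.+1 then a k' else 0).

Lemma newton_uniq a b b' : a 0%N = 1 -> newton_rel a b -> newton_rel a b' ->
  forall k, b k.+1 = b' k.+1.
Proof.
move=> a0 h h'; elim/ltn_ind => k IH.
have := h k.+1; rewrite h' !big_ord_recr /= subnn a0 !mulr1.
rewrite (eq_bigr (fun i : 'I_k => b i.+1 * a (k.+1 - i.+1)%N)) => [/addrI //|i _].
by rewrite IH.
Qed.

Lemma mul1X_telescope z a n : \sum_(i < n.+1) z ^+ i.+1 * mul1X z a (n - i) = z * a n.
Proof.
elim: n => [|n IH]; first by rewrite big_ord1 /mul1X /= mulr0 subr0 expr1.
rewrite big_ord_recl /= subn0.
under eq_bigr => i _ do rewrite /bump /= add1n subSS exprS -mulrA.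
by rewrite -mulr_sumr IH /mul1X; ring.
Qed.

(** The logarithmic derivative of [1 - z T] subtracts [z ^ i] from the power sums. *)
Lemma newton_mul z a b : newton_rel a b -> newton_rel (mul1X z a) (fun i => b i - z ^+ i).
Proof.
move=> h [|n]; first by rewrite mul0r big_ord0.
under eq_bigr => i _ do rewrite subSS mulrBl.
rewrite sumrB mul1X_telescope.
have -> : \sum_(i < n.+1) b i.+1 * mul1X z a (n - i) =
   \sum_(i < n.+1) b i.+1 * a (n.+1 - i.+1)%N - z * \sum_(i < n) b i.+1 * a (n - i.+1)%N.
  rewrite !big_ord_recr /= /mul1X subnn mulr0 subr0 mulr_sumr -addrAC -sumrB; congr (_ + _).
  apply: eq_bigr => i _; rewrite subSS -[(n - i)%N]prednK ?subn_gt0 //.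
    by rewrite -subnS; ring.
  by rewrite subnn.
by rewrite -!h /mul1X; ring.
Qed.

Lemma coef_mul1X z (p : {poly R}) k : ((1 - z *: 'X) * p)`_k = mul1X z (fun i => p`_i) k.
Proof.
rewrite mulrBl mul1r coefB -scalerAl coefZ coefXM /mul1X.
by case: k.
Qed.

Lemma newton_prod (rs : seq R) (p := \prod_(z <- rs) (1 - z *: 'X)) :
  newton_rel (fun i => p`_i) (fun i => - \sum_(z <- rs) z ^+ i).
Proof.
rewrite {}/p; elim: rs => [|z rs IH] k.
  rewrite big_nil coef1; case: k => [|k]; first by rewrite mul0r big_ord0.
  by rewrite mulr0 big1 // => i _; rewrite big_nil oppr0 mul0r.
rewrite big_cons coef_mul1X.
have := newton_mul z IH k; move=> ->; apply: eq_bigr => i _.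
by rewrite -coef_mul1X big_cons; congr (_ * _); rewrite opprD addrC.
Qed.

End Newton.

Lemma exp_unbounded (x M : algC) : 1 < x -> 0 <= M ->
  exists m0, forall m, (m0 <= m)%N -> M < x ^+ m.
Proof.
move=> x1 M0; have e0 : 0 < x - 1 by rewrite subr_gt0.
have bern m : 1 + m%:R * (x - 1) <= x ^+ m.
  elim: m => [|m IH]; first by rewrite mul0r addr0 expr0.
  have x0 : 0 <= x by rewrite ltW // (lt_trans ltr01).
  rewrite exprS; apply: le_trans (ler_wpM2l x0 IH).
  rewrite -subr_ge0 -natr1 (_ : _ - _ = m%:R * (x - 1) ^+ 2); last by ring.
  by rewrite mulr_ge0 ?exprn_ge0 // ltW.
exists (Num.bound (M / (x - 1))) => m hm.
have /archi_boundP h : 0 <= M / (x - 1) by rewrite divr_ge0 // ltW.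
apply: lt_le_trans (bern m); rewrite ltr_pwDl // -ler_pdivrMr //.
by rewrite (le_trans (ltW h)) // ler_nat.
Qed.

(** An exponential sum bounded by [rho ^ m] has no term with base larger than [rho] in absolute
    value: a fixed linear combination of shifts isolates the term of [mu], whose growth would exceed
    the bound. *)
Lemma exp_sum_bound (s : seq algC) (c0 lam rho C : algC) m0 :
  0 < rho -> (forall m, (m0 <= m)%N -> `|c0 * lam ^+ m - \sum_(z <- s) z ^+ m| <= C * rho ^+ m) ->
  forall mu, rho < `|mu| -> c0 * (mu == lam)%:R = (count_mem mu s)%:R.
Proof.
move=> rho0 hb mu hmu.
have C0 : 0 <= C.
  have := le_trans (normr_ge0 _) (hb m0 (leqnn _)).
  by rewrite pmulr_lge0 // exprn_gt0.
(* The shift operator attached to [b] kills the powers of every base but [mu]. *)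
pose T := [seq z <- undup (lam :: s) | z != mu].
pose b := \prod_(z <- T) ('X - z%:P).
have b0 z : z \in lam :: s -> z != mu -> b.[z] = 0.
  move=> hz ne; apply/rootP; rewrite root_prod_XsubC mem_filter ne mem_undup; exact: hz.
have bmu : b.[mu] != 0.
  by rewrite -[_ == 0]/(root b mu) root_prod_XsubC mem_filter eqxx.
pose f m := c0 * lam ^+ m - \sum_(z <- s) z ^+ m.
pose k := c0 * (mu == lam)%:R - (count_mem mu s)%:R.
have keyz z m : \sum_(i < size b) b`_i * z ^+ (m + i) = z ^+ m * b.[z].
  rewrite horner_coef mulr_sumr; apply: eq_bigr => i _; rewrite exprD; ring.
have key m : \sum_(i < size b) b`_i * f (m + i)%N = k * mu ^+ m * b.[mu].
  transitivity (c0 * (lam ^+ m * b.[lam]) - \sum_(z <- s) z ^+ m * b.[z]).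
    have -> : \sum_(z <- s) z ^+ m * b.[z] = \sum_(z <- s) \sum_(i < size b) b`_i * z ^+ (m + i).
      by apply: eq_bigr => z _; rewrite keyz.
    rewrite -keyz mulr_sumr exchange_big -sumrB; apply: eq_bigr => i _.
    by rewrite /f mulrBr -mulr_sumr; ring.
  rewrite /k mulrBl mulrBl; congr (_ - _).
    case: (eqVneq mu lam) => [->|ne]; first by rewrite mulr1 mulrA.
    by rewrite (_ : false%:R = 0 :> algC) // b0 ?mem_head 1?eq_sym //; ring.
  have -> : \sum_(z <- s) z ^+ m * b.[z] = \sum_(z <- s | z == mu) mu ^+ m * b.[mu].
    rewrite [RHS]big_mkcond big_seq [RHS]big_seq; apply: eq_bigr => z hz.
    by case: eqVneq => [->//|ne]; rewrite b0 ?mulr0 // inE hz orbT.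
  rewrite big_const_seq iter_addr_0 -mulrA mulr_natl; congr (_ *+ _).
apply/eqP; rewrite -subr_eq0 -/k; apply/negPn/negP => k0.
pose M := \sum_(i < size b) `|b`_i| * C * rho ^+ i.
have M0 : 0 <= M.
  by apply: sumr_ge0 => i _; rewrite !mulr_ge0 // exprn_ge0 // ltW.
have bd m : (m0 <= m)%N -> `|k * b.[mu]| * (`|mu| / rho) ^+ m <= M.
  move=> hm; rewrite expr_div_n mulrA ler_pdivrMr ?exprn_gt0 //.
  rewrite -normrX -normrM (_ : k * b.[mu] * mu ^+ m = k * mu ^+ m * b.[mu]); last by ring.
  rewrite -key; apply: le_trans (ler_norm_sum _ _ _) _.
  rewrite /M mulr_suml; apply: ler_sum => i _; rewrite normrM -!mulrA.
  rewrite ler_wpM2l // (le_trans (hb _ _)) ?(leq_trans hm) ?leq_addr //.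
  by rewrite addnC exprD.
have kb : 0 < `|k * b.[mu]| by rewrite normr_gt0 mulf_neq0.
have x1 : 1 < `|mu| / rho by rewrite ltr_pdivlMr // mul1r.
have Mk : 0 <= M / `|k * b.[mu]| by rewrite divr_ge0 // ltW.
have [m1 h1] := exp_unbounded x1 Mk.
have := bd _ (leq_maxl m0 m1); have := h1 _ (leq_maxr m0 m1).
rewrite ltr_pdivrMr // mulrC => h2 h3.
by have := lt_le_trans h2 h3; rewrite ltxx.
Qed.

Lemma poly_inv_roots (p : {poly algC}) : p`_0 = 1 ->
  exists rs : seq algC, p = \prod_(z <- rs) (1 - z *: 'X) /\ size p = (size rs).+1.
Proof.
move=> p0; have [r e] := closed_field_poly_normal p.
have pn0 : p != 0 by apply/eqP => e0; move: p0; rewrite e0 coef0 => /eqP; rewrite eq_sym oner_eq0.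
have e1 : lead_coef p * \prod_(z <- r) (- z) = 1.
  rewrite -[RHS]p0 -horner_coef0 [in RHS]e hornerZ horner_prod; congr (_ * _).
  by apply: eq_bigr => z _; rewrite hornerXsubC sub0r.
have rz z : z \in r -> z != 0.
  move=> hz; apply/eqP => z0; move: e1; rewrite (big_rem z hz) /= z0 oppr0 mul0r mulr0.
  by move/eqP; rewrite eq_sym oner_eq0.
exists [seq z^-1 | z <- r]; split.
  suff hp : \prod_(z <- r) ('X - z%:P) = \prod_(z <- r) (- z) *: \prod_(z <- r) (1 - z^-1 *: 'X).
    by rewrite big_map {1}e hp scalerA e1 scale1r.
  have fz (z : algC) : z != 0 -> 'X - z%:P = - z *: (1 - z^-1 *: 'X).
    move=> z0; rewrite scalerBr scalerA mulNr mulfV //.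
    by rewrite scaleN1r opprK scaleNr alg_polyC addrC.
  elim: r rz {e e1} => [|z r IH] rz; first by rewrite !big_nil scale1r.
  rewrite !big_cons fz ?rz ?mem_head // IH => [|w hw]; last by apply: rz; rewrite inE hw orbT.
  by rewrite -scalerAl -scalerAr scalerA.
by rewrite e size_scale ?lead_coef_eq0 // size_prod_XsubC size_map.
Qed.

Lemma dist_nat (m n c : nat) : (m <= n + c)%N -> (n <= m + c)%N -> `|m%:R - n%:R : algC| <= c%:R.
Proof.
move=> h1 h2; case: (leqP m n) => [le|/ltnW le].
  by rewrite distrC -natrB // normr_nat ler_nat; lia.
by rewrite -natrB // normr_nat ler_nat; lia.
Qed.

Lemma prod_squeeze (T : eqType) (s : seq T) (x y : T -> algC) :
  (forall z, z \in s -> 0 < x z /\ x z <= y z) ->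
  \prod_(z <- s) y z <= \prod_(z <- s) x z -> forall z, z \in s -> x z = y z.
Proof.
elim: s => [|z s IH] h hle w; first by [].
have hs u : u \in s -> 0 < x u /\ x u <= y u by move=> hu; apply: h; rewrite inE hu orbT.
have [xz xyz] := h z (mem_head _ _).
have px : 0 < \prod_(u <- s) x u.
  by rewrite big_seq; apply: prodr_gt0 => u /hs[].
have pxy : \prod_(u <- s) x u <= \prod_(u <- s) y u.
  rewrite big_seq [X in _ <= X]big_seq; apply: ler_prod => u hu.
  by have [h1 ->] := hs u hu; rewrite ltW.
move: hle; rewrite !big_cons => hle.
have e1 : x z = y z.
  apply/eqP; rewrite eq_le xyz /= -(ler_pM2r px) (le_trans _ hle) // ler_wpM2l //.
  by rewrite (le_trans _ xyz) // ltW.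
rewrite inE => /orP[/eqP -> //|hw]; apply: IH => //.
by move: hle; rewrite -e1 ler_pM2l.
Qed.

Lemma deriv_prod_1X (rs : seq algC) : (forall z, z \in rs -> 1 - z != 0) ->
  (\prod_(z <- rs) (1 - z *: 'X))^`().[1] = \prod_(z <- rs) (1 - z) * \sum_(z <- rs) - z / (1 - z).
Proof.
elim: rs => [|z rs IH] h; first by rewrite !big_nil derivC horner0 mulr0.
have hz : 1 - z != 0 by apply: h; rewrite mem_head.
rewrite !big_cons derivM hornerD !hornerM IH => [|w hw]; last by apply: h; rewrite inE hw orbT.
rewrite derivB derivC derivZ derivX sub0r horner_prod.
have -> : \prod_(w <- rs) (1 - w *: 'X).[1] = \prod_(w <- rs) (1 - w).
  by apply: eq_bigr => w _; rewrite !hornerE.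
rewrite !hornerE /=; set u := \prod_(w <- rs) _; set v := \sum_(w <- rs) _.
by move: hz; clear; move: u v => u v hz; field.
Qed.

Lemma half_sum_frac (z w : algC) : 1 - z != 0 -> 1 - w != 0 ->
  - ((1 + z) / (1 - z)) / 2%:R + - ((1 + w) / (1 - w)) / 2%:R = (z * w - 1) / ((1 - z) * (1 - w)).
Proof.
move=> n1 n2; have c2 : 2%:R != 0 :> algC by rewrite pnatr_eq0.
by fld.
Qed.

Section Zeta.
Variables (q g h dl e C r0 : nat) (A N : nat -> nat).
Hypotheses (q2 : (2 <= q)%N) (g2 : (2 <= g)%N) (h0 : (0 < h)%N) (dl0 : (0 < dl)%N).
Hypothesis A0 : A 0%N = 1%N.
Hypothesis HN : forall n, (n * A n = \sum_(i < n) N i.+1 * A (n - i.+1))%N.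
Hypothesis Hdl : forall n, ~~ (dl %| n)%N -> A n = 0%N.
Hypothesis Hlarge : forall n, (dl %| n)%N -> (2 * g - 1 <= n)%N ->
  ((q - 1) * A n + h = h * q ^ (n + 1 - g))%N.
Hypotheses (e0 : (0 < e)%N) (dle : (dl %| e)%N).
Hypothesis Hstep : forall r, (r0 <= r)%N ->
  (N (2 * e * r) <= q ^ (2 * e * r) + C * q ^ (e * r))%N /\
  (q ^ (2 * e * r) <= N (2 * e * r) + C * q ^ (e * r))%N.

Let qC : algC := q%:R.
Let hC : algC := h%:R.
(** In the variable [T ^ dl] the zeta series has coefficients [a] and power sums [b]; [p] is its
    numerator, with the poles at 1 and at [1 / Lam] removed. *)
Let Lam : algC := qC ^+ dl.
Let a k : algC := (A (dl * k))%:R.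
Let b i : algC := (N (dl * i))%:R / dl%:R.
Let p := mul1X Lam (mul1X 1 a).

Let dlC : dl%:R != 0 :> algC. Proof. by rewrite pnatr_eq0 -lt0n. Qed.
Let qC0 : 0 < qC. Proof. by rewrite ltr0n; lia. Qed.
Let qCn : qC != 0. Proof. by rewrite gt_eqF. Qed.
Let q1 : 1 < qC. Proof. by rewrite ltr1n. Qed.
Let q1n : qC - 1 != 0. Proof. by rewrite subr_eq0 gt_eqF. Qed.

Lemma block_sum (G : nat -> algC) k : (forall i, ~~ (dl %| i)%N -> G i = 0) ->
  \sum_(i < dl * k) G i.+1 = \sum_(j < k) G (dl * j.+1)%N.
Proof.
move=> hG; elim: k => [|k IH]; first by rewrite muln0 !big_ord0.
rewrite mulnSr big_split_ord /= IH [RHS]big_ord_recr /=; congr (_ + _).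
case: (dl) dl0 hG => // d _ hG; rewrite big_ord_recr /= big1 ?add0r => [|i _].
  by congr G; rewrite mulnSr addnS.
apply: hG; rewrite -addnS dvdn_addr ?dvdn_mulr // gtnNdvd // ltnS; exact: ltn_ord.
Qed.

Lemma newton_a : newton_rel a b.
Proof.
move=> k; apply: (mulfI dlC); rewrite mulr_sumr mulrA -natrM -natrM HN natr_sum.
pose G i : algC := if (i <= dl * k)%N then (N i * A (dl * k - i))%:R else 0.
rewrite (eq_bigr (fun i : 'I_(dl * k) => G i.+1)) => [|i _]; last by rewrite /G ltn_ord.
rewrite block_sum => [|i hi]; last first.
  rewrite /G; case: leqP => // hik.
  rewrite Hdl ?muln0 //; apply: contra hi => hd.
  by rewrite -(subKn hik) dvdn_sub // dvdn_mulr.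
apply: eq_bigr => j _; rewrite /G leq_pmul2l // ltn_ord -mulnBr natrM /b /a.
by rewrite mulrA [_%:R * (_ / _)]mulrC divfK.
Qed.

Lemma a_large k : (2 * g - 1 <= k)%N -> (qC - 1) * a k = hC * (qC ^+ (dl * k + 1 - g) - 1).
Proof.
move=> hk; have le : (2 * g - 1 <= dl * k)%N by rewrite (leq_trans hk) // leq_pmull.
have := congr1 (fun n : nat => n%:R : algC) (Hlarge (dvdn_mulr k (dvdnn dl)) le).
rewrite natrD !natrM natrX natrB; last by lia.
by rewrite -/qC -/hC -/(a k) => H; apply: (addIr hC); rewrite H; ring.
Qed.

(** From index [2 g - 1] on, [a] is a combination of the powers of [Lam] and of a constant, which
    the two factors of the numerator annihilate. *)
Lemma p_large k : (2 * g + 1 <= k)%N -> p k = 0.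
Proof.
case: k => [|[|k]] hk; [lia|lia|].
have h1 := @a_large k; have h2 := @a_large k.+1; have h3 := @a_large k.+2.
apply: (mulfI q1n); rewrite mulr0 /p /mul1X.
rewrite (_ : (qC - 1) * _ = (qC - 1) * a k.+2 - (qC - 1) * a k.+1 - Lam * ((qC - 1) * a k.+1 - (qC - 1) * a k)); last by ring.
rewrite h1 ?h2 ?h3; try lia.
have -> : (dl * k.+1 + 1 - g = dl + (dl * k + 1 - g))%N.
  have : (k <= dl * k)%N by rewrite leq_pmull.
  rewrite mulnS; lia.
have -> : (dl * k.+2 + 1 - g = dl + dl + (dl * k + 1 - g))%N.
  have : (k <= dl * k)%N by rewrite leq_pmull.
  rewrite !mulnS; lia.
by rewrite !exprD -/Lam; ring.
Qed.

Let P : {poly algC} := \poly_(k < 2 * g + 1) p k.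

Lemma coefPp k : P`_k = p k.
Proof. by rewrite coef_poly; case: ltnP => // /p_large. Qed.

Lemma p0 : p 0%N = 1.
Proof. by rewrite /p /mul1X /a muln0 A0 !mulr0 !subr0. Qed.

Lemma roots_rel : exists rs : seq algC, [/\ P = \prod_(z <- rs) (1 - z *: 'X),
  (size rs <= 2 * g)%N & forall i, b i.+1 = 1 + Lam ^+ i.+1 - \sum_(z <- rs) z ^+ i.+1].
Proof.
have [|rs [e1 e2]] := @poly_inv_roots P; first by rewrite coefPp p0.
exists rs; split=> //.
  by have := size_poly (2 * g + 1) p; rewrite -/P e2 addn1 ltnS.
move=> i; have h1 := newton_mul Lam (newton_mul 1 newton_a).
have h2 := newton_prod rs; rewrite -e1 in h2.
have h2' : newton_rel p (fun i => - \sum_(z <- rs) z ^+ i).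
  move=> k; rewrite -coefPp h2; apply: eq_bigr => j _; by rewrite coefPp.
have := newton_uniq p0 h1 h2' i; rewrite expr1n => H.
rewrite (_ : b i.+1 = (b i.+1 - 1 - Lam ^+ i.+1) + 1 + Lam ^+ i.+1); last by ring.
by rewrite H; ring.
Qed.

(** Since [b] is [N / dl] and [N] is close to the power of [q], the power sums of the roots are
    [(1 - 1 / dl) Lam ^ i] up to a square-root error. By [exp_sum_bound], applied to the powers of
    the roots along the given exponents, [1 - 1 / dl] is a multiplicity, hence an integer, and
    [dl = 1]. No root can then exceed the square root of [q]. *)
Lemma rh : dl = 1%N /\ exists rs : seq algC, [/\ P = \prod_(z <- rs) (1 - z *: 'X),
  (size rs <= 2 * g)%N, forall z, z \in rs -> `|z| ^+ 2 <= qC & \sum_(z <- rs) z = 1 + qC - (N 1)%:R].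
Proof.
have [rs [e1 sz e2]] := roots_rel.
have [e' ee] := dvdnP dle.
have e'0 : (0 < e')%N by move: e0; rewrite ee; case: (e').
pose rho : algC := qC ^+ e; pose lam : algC := qC ^+ (2 * e).
pose c0 : algC := 1 - dl%:R^-1.
have hb m : (maxn r0 1 <= m)%N ->
   `|c0 * lam ^+ m - \sum_(z <- [seq z ^+ (2 * e') | z <- rs]) z ^+ m| <= (C%:R + 1) * rho ^+ m.
  rewrite geq_max => /andP[hr m1]; have [s1 s2] := Hstep hr.
  have i0 : (0 < 2 * e' * m)%N by rewrite !muln_gt0 e'0.
  have := e2 (2 * e' * m).-1; rewrite prednK // => H.
  have de : (dl * (2 * e' * m) = 2 * e * m)%N by rewrite ee; lia.
  have -> : \sum_(z <- [seq z ^+ (2 * e') | z <- rs]) z ^+ m = 1 + Lam ^+ (2 * e' * m) - b (2 * e' * m).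
    rewrite H big_map opprB addrC subrK; apply: eq_bigr => z _; by rewrite -exprM.
  have -> : lam ^+ m = Lam ^+ (2 * e' * m) by rewrite /lam /Lam -!exprM de.
  have -> : Lam ^+ (2 * e' * m) = (q ^ (2 * e * m))%:R by rewrite /Lam -exprM de natrX.
  rewrite /b de; set X := (q ^ _)%:R; set Y := (N _)%:R.
  have -> : c0 * X - (1 + X - Y / dl%:R) = (Y - X) / dl%:R - 1 by rewrite /c0; ring.
  apply: le_trans (ler_normB _ _) _; rewrite normr1 [X in _ <= X]mulrDl mul1r lerD //; last first.
    by rewrite exprn_ege1 // exprn_ege1 // ltW.
  rewrite normrM normfV normr_nat ler_pdivrMr ?ltr0n //.
  have h1 := dist_nat s1 s2; apply: le_trans h1 _.
  rewrite natrM natrX exprM -/rho; apply: ler_peMr; last by rewrite ler1n.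
  by rewrite mulr_ge0 // ?ler0n // exprn_ge0 // exprn_ge0 // ltW.
have rho0 : 0 < rho by rewrite exprn_gt0.
have hcount := exp_sum_bound rho0 hb.
have lamn : rho < `|lam|.
  rewrite ger0_norm ?exprn_ge0 ?ltW // /lam mul2n -addnn exprD -/rho ltr_pMr //.
  by rewrite exprn_egt1 // -lt0n.
have dl1 : dl = 1%N.
  have := hcount _ lamn; rewrite eqxx mulr1 /c0 => H.
  have : dl%:R - 1 = (dl * count_mem lam [seq z ^+ (2 * e') | z <- rs])%:R :> algC.
    by rewrite natrM -H mulrBr mulr1 mulfV.
  move/eqP; rewrite subr_eq natr1 eqr_nat; case: (count_mem _ _) => [|n]; first by rewrite muln0; lia.
  rewrite mulnS; lia.
split=> //; exists rs; split=> // [z hz|]; last first.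
  have := e2 0%N; rewrite /b /Lam dl1 muln1 !expr1 divr1 => ->.
  by rewrite opprB addrC subrK.
have e'e : e' = e by rewrite ee dl1 muln1.
rewrite real_leNgt ?rpredX ?normr_real ?realn //; apply/negP => hlt.
have hz2 : rho < `|z ^+ (2 * e)|.
  by rewrite normrX exprM /rho ltr_pXn2r // nnegrE ?exprn_ge0 // ltW.
have := hcount _ hz2; rewrite /c0 dl1 invr1 subrr mul0r => /eqP.
rewrite eq_sym pnatr_eq0 -leqn0 leqNgt -has_count; case/negP; apply/hasP.
by exists (z ^+ (2 * e)); [apply/mapP; exists z; rewrite ?e'e|exact: eqxx].
Qed.

End Zeta.

(** * Functional equation and the inequality for the class number *)

Section Zeta1.
Variables (q g h : nat) (A : nat -> nat) (B1 : nat) (rs : seq algC).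
Hypotheses (q2 : (2 <= q)%N) (g2 : (2 <= g)%N) (h0 : (0 < h)%N).
Hypothesis A0 : A 0%N = 1%N.
Hypothesis Hlarge : forall n, (2 * g - 1 <= n)%N -> ((q - 1) * A n + h = h * q ^ (n + 1 - g))%N.
Let qC : algC := q%:R.
Let hC : algC := h%:R.
Let a k : algC := (A k)%:R.
Let p := mul1X qC (mul1X 1 a).
Let P : {poly algC} := \poly_(k < 2 * g + 1) p k.
Hypothesis rsP : P = \prod_(z <- rs) (1 - z *: 'X).
Hypothesis rs_size : (size rs <= 2 * g)%N.
Hypothesis rs_le : forall z, z \in rs -> `|z| ^+ 2 <= qC.
Hypothesis rs_sum : \sum_(z <- rs) z = 1 + qC - B1%:R.

Let qC0 : 0 < qC. Proof. by rewrite ltr0n; lia. Qed.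
Let qCn : qC != 0. Proof. by rewrite gt_eqF. Qed.
Let q1 : 1 < qC. Proof. by rewrite ltr1n. Qed.
Let q1n : qC - 1 != 0. Proof. by rewrite subr_eq0 gt_eqF. Qed.
Let hCn : hC != 0. Proof. by rewrite pnatr_eq0 -lt0n. Qed.

Let a_large1 k : (2 * g - 1 <= k)%N -> (qC - 1) * a k = hC * (qC ^+ (k + 1 - g) - 1).
Proof.
move=> hk; have := congr1 (fun n : nat => n%:R : algC) (Hlarge hk).
rewrite natrD !natrM natrX natrB; last by lia.
by rewrite -/qC -/hC -/(a k) => H; apply: (addIr hC); rewrite H; ring.
Qed.

(** The partial sums of [(1 - z T) c(T)] at [T = 1 / z] telescope. With [z = 1] and [z = q] this
    evaluates the numerator from two values of [a] in the range where they are known. *)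
Lemma sum_mul1X (c : nat -> algC) z k : z != 0 ->
  \sum_(i < k.+1) mul1X z c i * z ^- i = c k * z ^- k.
Proof.
move=> z0; elim: k => [|k IH]; first by rewrite big_ord1 /mul1X mulr0 subr0.
have zk : z ^+ k != 0 by rewrite expf_neq0.
rewrite big_ord_recr /= IH /mul1X exprS; fld.
Qed.

Lemma mul1XC y z (c : nat -> algC) k : mul1X y (mul1X z c) k = mul1X z (mul1X y c) k.
Proof. by case: k => [|[|k]]; rewrite /mul1X; ring. Qed.

Lemma P_at1 : P.[1] = hC.
Proof.
rewrite horner_poly addn1.
transitivity (\sum_(i < (2 * g).+1) mul1X 1 (mul1X qC a) i * 1 ^- i).
  by apply: eq_bigr => i _; rewrite /p mul1XC expr1n invr1.
rewrite sum_mul1X ?oner_neq0 // expr1n invr1 mulr1.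
apply: (mulfI q1n); rewrite -[(2 * g)%N]prednK; last by lia.
rewrite /mul1X mulrBr mulrCA !a_large1; try lia.
have -> : ((2 * g).-1.+1 + 1 - g = g.+1)%N by lia.
have -> : ((2 * g).-1 + 1 - g = g)%N by lia.
by rewrite exprS; ring.
Qed.

Lemma P_atV : P.[qC^-1] = hC * qC ^- g.
Proof.
rewrite horner_poly addn1.
transitivity (\sum_(i < (2 * g).+1) p i * qC ^- i).
  by apply: eq_bigr => i _; rewrite exprVn.
rewrite sum_mul1X // -{1}[(2 * g)%N]prednK; last by lia.
apply: (mulfI q1n); rewrite /mul1X mulrA mul1r mulrBr !a_large1; try lia.
have -> : ((2 * g).-1.+1 + 1 - g = g.+1)%N by lia.
have -> : ((2 * g).-1 + 1 - g = g)%N by lia.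
have qg : qC ^+ g != 0 by rewrite expf_neq0.
by rewrite exprS mul2n -addnn exprD; fld.
Qed.

Lemma P_root1 t : P.[t] = \prod_(z <- rs) (1 - z * t).
Proof. by rewrite rsP horner_prod; apply: eq_bigr => z _; rewrite !hornerE. Qed.

(** By [yx] and [rs_le] each [x z] is at most [y z]. The products over the roots are [h ^ 2] and
    [q ^ (size rs - 2 g) * h ^ 2], and [size rs <= 2 g]; so all these inequalities are
    equalities. *)
Lemma rs_eq : size rs = (2 * g)%N /\ forall z, z \in rs -> z * z^* = qC.
Proof.
pose x (z : algC) : algC := `|1 - z| ^+ 2.
pose y (z : algC) : algC := qC * `|1 - z / qC| ^+ 2.
have px : \prod_(z <- rs) x z = hC ^+ 2.
  rewrite prodrXl -normr_prod -P_at1 P_root1.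
  have -> : \prod_(z <- rs) (1 - z * 1) = \prod_(z <- rs) (1 - z) by apply: eq_bigr => z _; rewrite mulr1.
  by rewrite real_normK //; have := P_at1; rewrite P_root1; under eq_bigr do rewrite mulr1; move=> ->; rewrite realn.
have py : \prod_(z <- rs) y z = qC ^+ size rs * (hC * qC ^- g) ^+ 2.
  rewrite /y big_split /= big_const_seq count_predT iter_mulr_1 prodrXl -normr_prod.
  rewrite -P_root1 P_atV ger0_norm // mulr_ge0 ?ler0n // invr_ge0 exprn_ge0 // ltW.
have yx z : y z - x z = (qC - 1) * (qC - z * z^*) / qC.
  rewrite /x /y !normCK !rmorphB !rmorph1 rmorphM fmorphV /= (CrealP (_ : qC \is Num.real)) ?realn //.
  by fld.
have hxy z : z \in rs -> 0 < x z /\ x z <= y z.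
  move=> hz; split.
    rewrite exprn_gt0 // normr_gt0; apply/eqP => e0; move/eqP: px.
    rewrite (big_rem z hz) /= /x e0 normr0 expr0n mul0r eq_sym expf_eq0 /=.
    by rewrite (negPf hCn).
  rewrite -subr_ge0 yx; apply: divr_ge0; last exact: ltW.
  by apply: mulr_ge0; [rewrite subr_ge0 ltW|rewrite subr_ge0 -normCK rs_le].
have le : \prod_(z <- rs) y z <= \prod_(z <- rs) x z.
  rewrite px py exprMn -exprVn mulrCA -[X in _ <= X]mulr1 ler_wpM2l ?exprn_ge0 ?ler0n //.
  rewrite -exprM exprVn ler_pdivrMr ?exprn_gt0 // mul1r ler_eXn2l //.
  by rewrite mulnC.
have exy := prod_squeeze hxy le; split; last first.
  move=> z hz; have := yx z; rewrite (exy z hz) subrr => /esym/eqP.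
  rewrite mulf_eq0 invr_eq0 (negPf qCn) orbF mulf_eq0 (negPf q1n) /= subr_eq0.
  by move/eqP.
have : \prod_(z <- rs) x z = \prod_(z <- rs) y z.
  by rewrite big_seq [RHS]big_seq; apply: eq_bigr.
rewrite px py exprMn mulrCA -[LHS]mulr1 => /mulfI; rewrite expf_eq0 (negPf hCn) => /(_ isT).
rewrite -exprVn -exprM exprVn => /(congr1 (fun t => t * qC ^+ (g * 2))).
rewrite mul1r divfK ?expf_neq0 // => /esym/(@ieexprIn _ _ qC0).
by rewrite mulnC => -> //; rewrite gt_eqF.
Qed.

(* [E_n] is the excess of [A_n] over its generic value. *)
Let Hn n : algC := if (g <= n)%N then hC * (qC ^+ (n + 1 - g) - 1) / (qC - 1) else 0.
Let E n : algC := a n - Hn n.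

Lemma E_small n : (n < g)%N -> E n = a n.
Proof. by rewrite /E /Hn ltnNge => /negPf ->; rewrite subr0. Qed.

Lemma E_large n : (2 * g - 1 <= n)%N -> E n = 0.
Proof.
move=> hn; rewrite /E /Hn (_ : (g <= n)%N); last by lia.
by apply: (mulfI q1n); rewrite mulrBr a_large1 // mulr0 mulrCA mulfV // mulr1 subrr.
Qed.

Lemma Hn_rec k : mul1X qC Hn k = if (g <= k)%N then hC else 0.
Proof.
case: k => [|k]; rewrite /mul1X /Hn.
  by rewrite leqNgt (leq_trans _ g2) //= mulr0 subr0.
case: (leqP g k.+1) => hk; last by rewrite leqNgt (ltnW hk) /= mulr0 subr0.
case: (leqP g k) => hk2.
  have -> : (k.+1 + 1 - g = (k + 1 - g).+1)%N by lia.
  by rewrite exprS; fld.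
have -> : (k.+1 + 1 - g = 1)%N by lia.
by rewrite expr1 mulr0 subr0 mulfK.
Qed.

(** The generic values of [A] contribute exactly [h T ^ g] to the numerator. *)
Lemma pE k : p k = mul1X qC (mul1X 1 E) k + (if k == g then hC else 0).
Proof.
have Hk : mul1X qC (mul1X 1 Hn) k = if k == g then hC else 0.
  rewrite mul1XC; case: k => [|k]; rewrite {1}/mul1X !Hn_rec.
    by rewrite leqn0 mulr0 subr0 eq_sym.
  case: (ltngtP g k.+1) => hk.
  - by rewrite -ltnS hk mul1r subrr.
  - by rewrite leqNgt (ltnW hk) /= mulr0 subr0.
  - by rewrite hk ltnn mulr0 subr0.
rewrite -Hk /p /E; case: k {Hk} => [|[|k]]; rewrite /mul1X; ring.
Qed.

Lemma p_zero k : (2 * g + 1 <= k)%N -> p k = 0.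
Proof.
case: k => [|[|k]] hk; [lia|lia|].
rewrite pE (_ : (k.+2 == g) = false); last by lia.
have e1 : E k.+2 = 0 by apply: E_large; lia.
have e2 : E k.+1 = 0 by apply: E_large; lia.
have e3 : E k = 0 by apply: E_large; lia.
by rewrite /mul1X e1 e2 e3; ring.
Qed.

Lemma coefP k : P`_k = p k.
Proof. by rewrite coef_poly; case: ltnP => // /p_zero. Qed.

Lemma P_poly : P = (1 - qC *: 'X) * ((1 - 1 *: 'X) * \poly_(n < 2 * g - 1) E n) + hC *: 'X^g.
Proof.
apply/polyP => k; rewrite coefP pE coefD coefZ coefXn; congr (_ + _); last first.
  by case: eqP => _; rewrite ?mulr1 ?mulr0.
rewrite coef_mul1X; have eE n : (\poly_(n < 2 * g - 1) E n)`_n = E n.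
  by rewrite coef_poly; case: ltnP => // /E_large.
by case: k => [|[|k]]; rewrite /mul1X !coef_mul1X /mul1X ?eE.
Qed.

Lemma P_conj t : P.[t^*] = (P.[t])^*.
Proof.
rewrite !horner_poly rmorph_sum; apply: eq_bigr => i _; rewrite rmorphM rmorphXn /=.
congr (_ * _); apply/esym/CrealP.
by case: (i : nat) => [|[|k]]; rewrite /p /mul1X /a;
  rewrite ?(rpredB, rpredM, rpred0, rpred1, realn).
Qed.

(** The coefficients of [P] are real and conjugation sends a root [z] to [q / z], which is the
    functional equation up to the product of the roots. The values of [P] at 1 and at [1 / q]
    determine that product. *)
Lemma prod_rs : \prod_(z <- rs) z = qC ^+ g /\
  forall t, t != 0 -> P.[t] = qC ^+ g * t ^+ (2 * g) * P.[(qC * t)^-1].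
Proof.
have [sz zz] := rs_eq.
have zn z : z \in rs -> z != 0.
  by move=> hz; apply: contraNneq qCn => e0; rewrite -(zz z hz) e0 mul0r.
pose c := \prod_(z <- rs) z.
have c0 : c != 0 by rewrite prodf_seq_neq0; apply/allP => z /zn.
have key t : t != 0 -> P.[t] = (qC * t) ^+ (2 * g) * P.[(qC * t)^-1] / c.
  move=> t0; have -> : P.[t] = (P.[t^*])^* by rewrite P_conj conjCK.
  have cst : (qC * t) ^+ (2 * g) = \prod_(z <- rs) (qC * t).
    by rewrite big_const_seq count_predT iter_mulr_1 sz.
  rewrite !P_root1 rmorph_prod /= cst.
  rewrite -big_split /= -prodfV -big_split /= big_seq [RHS]big_seq.
  (* Each factor [1 - q t / z] equals [- (q t / z) (1 - z / (q t))]; there are [2 g] of these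
     signs. *)
  have sgn : \prod_(z <- rs | z \in rs) (-1 : algC) = 1.
    by rewrite -big_seq big_const_seq count_predT iter_mulr_1 sz exprM sqrrN expr1n expr1n.
  transitivity ((\prod_(z <- rs | z \in rs) (-1)) *
    \prod_(i <- rs | i \in rs) (qC * t * (1 - i / (qC * t)) / i)); last by rewrite sgn mul1r.
  rewrite -big_split /=; apply: eq_bigr => z hz.
  have z0 := zn z hz; rewrite rmorphB rmorph1 rmorphM /= ?conjCK.
  have -> : z^* = qC / z by rewrite -(zz z hz); fld.
  by fld.
have cE : c = qC ^+ g.
  have := key 1 (oner_neq0 _); rewrite P_at1 mulr1 P_atV => H.
  apply: (mulfI hCn); apply: (mulIf c0).
  have qg : qC ^+ g != 0 by rewrite expf_neq0.
  rewrite {1}H mul2n -addnn exprD; fld.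
split=> // t t0; rewrite key // cE exprMn mul2n -addnn !exprD.
have qg : qC ^+ g != 0 by rewrite expf_neq0.
by fld.
Qed.

Lemma p_sym k : (k <= 2 * g)%N -> p k * qC ^+ g = p (2 * g - k)%N * qC ^+ k.
Proof.
have [_ fe] := prod_rs.
pose R : {poly algC} := \poly_(j < 2 * g + 1) (p (2 * g - j)%N * qC ^+ j).
suff e : qC ^+ g *: P - R = 0.
  move=> hk; move/eqP: e; rewrite subr_eq0 => /eqP/polyP/(_ k).
  by rewrite coefZ coefP coef_poly addn1 ltnS hk mulrC.
(* The difference has size at most [2 g + 1] and vanishes at the nonzero points
   [1, ..., 2 g + 1]. *)
apply: (@roots_geq_poly_eq0 _ _ [seq (i.+1)%:R | i <- iota 0 (2 * g + 1)]); last first.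
- rewrite size_map size_iota; apply: leq_trans (size_polyD _ _) _.
  rewrite geq_max size_polyN size_poly andbT; apply: leq_trans (size_scale_leq _ _) _.
  exact: size_poly.
- by rewrite map_inj_uniq ?iota_uniq // => i j /eqP; rewrite eqr_nat eqSS => /eqP.
apply/allP => _ /mapP[i _ ->]; rewrite /root hornerD hornerN hornerZ subr_eq0; apply/eqP.
set t : algC := _%:R; have t0 : t != 0 by rewrite pnatr_eq0.
rewrite fe // !horner_poly addn1 mulr_sumr mulr_sumr.
rewrite (reindex_inj rev_ord_inj) /=; apply: eq_bigr => j _.
have hj : (j <= 2 * g)%N by rewrite -ltnS.
rewrite subSS invfM exprMn !exprVn.
have qj : qC ^+ (2 * g - j) != 0 by rewrite expf_neq0.
have tj : t ^+ (2 * g - j) != 0 by rewrite expf_neq0.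
have -> : t ^+ (2 * g) = t ^+ (2 * g - j) * t ^+ j by rewrite -exprD subnK.
have qq : qC ^+ g * qC ^+ g = qC ^+ (2 * g - j) * qC ^+ j by rewrite -!exprD subnK // addnn mul2n.
rewrite [LHS](_ : _ = (qC ^+ g * qC ^+ g) / qC ^+ (2 * g - j) * t ^+ j * p (2 * g - j)%N).
  by rewrite qq; fld.
by fld.
Qed.

(** The numerical form of duality, read off from the functional equation: by [pE] and [p_sym] the
    case [n] follows from the cases [n - 1] and [n - 2]. The cases 0 and 1 are apart because some of
    these indices are missing. *)
Lemma E_sym n : (n < g)%N -> E (2 * g - 2 - n) = qC ^+ (g - 1 - n) * E n.
Proof.
elim/ltn_ind: n => n IH hn.
have := @p_sym n; rewrite (_ : (n <= 2 * g)%N); last by lia.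
move=> /(_ isT); have -> : (2 * g - n = (2 * g - 2 - n).+2)%N by lia.
have e1 : (n == g) = false by lia.
have e2 : ((2 * g - 2 - n).+2 == g) = false by lia.
rewrite !pE e1 e2.
rewrite !addr0 => H; apply: (mulfI qCn); apply: (mulIf (expf_neq0 n qCn)).
have qg : qC ^+ g = qC * qC ^+ (g - 1 - n) * qC ^+ n.
  by rewrite -exprS -exprD; congr (_ ^+ _); lia.
rewrite [RHS](_ : _ = qC ^+ g * E n); last by rewrite qg; ring.
set m := (2 * g - 2 - n)%N in H *.
have em : qC * E m * qC ^+ n = mul1X qC (mul1X 1 E) m.+2 * qC ^+ n
    + ((1 + qC) * E m.+1 - E m.+2) * qC ^+ n by rewrite /mul1X; ring.
rewrite em -H.
case: n IH hn {H em e1 e2} @m qg => [|[|n]] IH hn m qg.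
- have -> : E m.+1 = 0 by apply: E_large; rewrite /m; lia.
  have -> : E m.+2 = 0 by apply: E_large; rewrite /m; lia.
  by rewrite /mul1X; ring.
- have -> : E m.+2 = 0 by apply: E_large; rewrite /m; lia.
  have -> : E m.+1 = qC ^+ (g - 1 - 0) * E 0%N.
    by rewrite -IH //; [congr E; rewrite /m; lia|lia].
  have -> : (g - 1 - 0 = (g - 1 - 1).+1)%N by lia.
  by rewrite /mul1X qg !exprS expr0; ring.
- have -> : E m.+2 = qC ^+ (g - 1 - n) * E n.
    by rewrite -IH //; [congr E; rewrite /m; lia|lia].
  have -> : E m.+1 = qC ^+ (g - 1 - n.+1) * E n.+1.
    by rewrite -IH //; [congr E; rewrite /m; lia|lia].
  have -> : (g - 1 - n = (g - 1 - n.+2).+2)%N by lia.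
  have -> : (g - 1 - n.+1 = (g - 1 - n.+2).+1)%N by lia.
  by rewrite /mul1X qg !exprS; ring.
Qed.

Let S : algC := \sum_(n < g) a n + \sum_(n < g - 1) qC ^+ (g - 1 - n) * a n.

Lemma S_sum : S = \sum_(n < 2 * g - 1) E n.
Proof.
have -> : (2 * g - 1 = g + (g - 1))%N by lia.
rewrite big_split_ord /=; congr (_ + _).
  by apply: eq_bigr => i _; rewrite E_small.
rewrite (reindex_inj rev_ord_inj) /=; apply: eq_bigr => i _.
have hi := ltn_ord i; rewrite -E_small; last by lia.
by rewrite -E_sym; [congr E; lia|lia].
Qed.

(** In [P_poly] the factor [1 - T] vanishes at 1, so only its derivative survives there; [h T ^ g]
    contributes [g h]. *)
Lemma P_deriv : (qC - 1) * S = P^`().[1] - g%:R * hC.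
Proof.
rewrite S_sum P_poly; set Q := \poly_(n < _) _.
have <- : Q.[1] = \sum_(n < 2 * g - 1) E n.
  by rewrite horner_poly; apply: eq_bigr => i _; rewrite expr1n mulr1.
have d1 (z : algC) : (1 - z *: 'X)^`() = (- z)%:P by rewrite derivB derivC derivZ derivX sub0r polyCN alg_polyC.
have e1 (z : algC) : (1 - z *: 'X).[1] = 1 - z by rewrite !hornerE.
have := d1 1; have := e1 1; rewrite !scale1r => e1' d1'.
rewrite derivD derivM derivM derivZ derivXn !d1 ?d1' !(e1, e1', hornerD, hornerN, hornerX, hornerM, hornerZ, hornerC, hornerMn, hornerXn, expr1n).
by move: Q^`().[1] Q.[1] => u v; rewrite -mulr_natr; ring.
Qed.

Lemma zeta_ineq : (qC - 1) ^+ 2 * S <= hC * ((g%:R + 1) * (qC + 1) - B1%:R).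
Proof.
have [sz zz] := rs_eq.
have nz z : z \in rs -> 1 - z != 0.
  move=> hz; apply/eqP => e; have := P_at1; rewrite P_root1 (big_rem z hz) /= mulr1 e mul0r.
  by move/eqP; rewrite eq_sym (negPf hCn).
have nzc z : z \in rs -> 1 - z^* != 0.
  by move=> /nz; rewrite -conjC_eq0 rmorphB rmorph1.
have Sr : S^* = S.
  apply/CrealP; rewrite rpredD //; apply: rpred_sum => i _; first exact: realn.
  by rewrite rpredM ?rpredX // realn.
have hr : hC^* = hC by apply/CrealP/realn.
have qr : qC^* = qC by apply/CrealP/realn.
have c2 : 2%:R != 0 :> algC by rewrite pnatr_eq0.
(* The logarithmic derivative of [P] at 1 is the sum of [- z / (1 - z)], and [g] is the sum of
   [1 / 2] over the [2 g] roots. *)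
have k1 : (qC - 1) * S = hC * \sum_(z <- rs) - ((1 + z) / (1 - z)) / 2%:R.
  rewrite P_deriv rsP deriv_prod_1X //.
  have -> : \prod_(z <- rs) (1 - z) = hC.
    by rewrite -P_at1 P_root1; apply: eq_bigr => z _; rewrite mulr1.
  rewrite [g%:R * _]mulrC -mulrBr; congr (_ * _).
  have -> : g%:R = \sum_(z <- rs) 2%:R^-1 :> algC.
    by rewrite big_const_seq count_predT iter_addr_0 sz -[RHS]mulr_natr natrM mulrA mulVf // mul1r.
  rewrite -sumrB big_seq [RHS]big_seq; apply: eq_bigr => z hz; have := nz z hz => ?.
  by fld.
have k2 : (qC - 1) * S = hC * \sum_(z <- rs) - ((1 + z^*) / (1 - z^*)) / 2%:R.
  have := congr1 (fun t => t^*) k1; rewrite !rmorphM rmorphB rmorph1 /= Sr hr qr rmorph_sum /= => ->.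
  congr (_ * _); apply: eq_bigr => z _.
  by rewrite !(rmorphM, rmorphN, fmorphV, rmorphD, rmorphB, rmorph1) /= ?rmorph_nat ?conjC_nat.
(* Adding [k1] to its conjugate; in [half_sum_frac] the product of [z] and its conjugate is [q], so
   the numerator is [q - 1]. *)
have k3 : 2%:R * S = hC * \sum_(z <- rs) ((1 - z) * (1 - z^*))^-1.
  apply: (mulfI q1n); rewrite mulrCA mulr_natl mulr2n {1}k1 k2 -mulrDr -big_split /= mulrCA.
  congr (_ * _); rewrite mulr_sumr big_seq [RHS]big_seq; apply: eq_bigr => z hz.
  have n1 := nz z hz; have n2 := nzc z hz.
  by rewrite -(zz z hz); apply: half_sum_frac.
(* The bound expresses [|1 - z| |1 + z| = |1 - z^2| >= |z|^2 - 1 = q - 1]. *)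
have k4 z : z \in rs -> ((1 - z) * (1 - z^*))^-1 <= (1 + z) * (1 + z^*) / (qC - 1) ^+ 2.
  move=> hz; have n1 := nz z hz; have n2 := nzc z hz.
  have p1 : 0 < (1 - z) * (1 - z^*).
    by rewrite (_ : (1 - z) * (1 - z^*) = `|1 - z| ^+ 2) ?exprn_gt0 ?normr_gt0 // normCK rmorphB rmorph1.
  rewrite ler_pdivlMr; last by rewrite exprn_gt0 // subr_gt0.
  rewrite mulrC ler_pdivrMr //.
  rewrite (_ : (1 + z) * _ * _ = `|1 - z ^+ 2| ^+ 2); last first.
    by rewrite normCK rmorphB rmorph1 rmorphXn /=; ring.
  have <- : `|z ^+ 2| = qC by rewrite normrX normCK zz.
  rewrite ler_sqr ?nnegrE ?normr_ge0 //; last first.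
    by rewrite subr_ge0 normrX normCK zz // ltW.
  rewrite distrC; have := lerB_dist (z ^+ 2) 1; rewrite normr1 //.
have k5 : \sum_(z <- rs) (1 + z) * (1 + z^*) = 2%:R * ((g%:R + 1) * (qC + 1) - B1%:R).
  have e1 : \sum_(z <- rs) (1 + z) * (1 + z^*) = \sum_(z <- rs) ((1 + qC) + z + z^*).
    rewrite big_seq [RHS]big_seq; apply: eq_bigr => z hz; rewrite -(zz z hz); ring.
  rewrite e1 !big_split /= !big_const_seq !count_predT !iter_addr_0 -rmorph_sum /= rs_sum sz.
  have -> : (1 + qC - B1%:R)^* = 1 + qC - B1%:R.
    by apply/CrealP; rewrite rpredB ?rpredD ?rpred1 //; exact: realn.
  by rewrite -[qC *+ _]mulr_natr natrM; ring.
have q12 : 0 < (qC - 1) ^+ 2 by rewrite exprn_gt0 // subr_gt0.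
rewrite -(ler_pM2l (_ : 0 < 2%:R)) ?ltr0n // mulrCA k3 [X in _ <= X]mulrCA -k5 mulrCA.
rewrite ler_wpM2l ?ler0n // mulr_sumr big_seq [X in _ <= X]big_seq; apply: ler_sum => z hz.
by rewrite mulrC -ler_pdivlMr // k4.
Qed.

End Zeta1.

Theorem zeta_bound (q g h dl e C r0 : nat) (A N : nat -> nat) :
  (2 <= q)%N -> (2 <= g)%N -> (0 < h)%N -> (0 < dl)%N -> A 0%N = 1%N ->
  (forall n, (n * A n = \sum_(i < n) N i.+1 * A (n - i.+1))%N) ->
  (forall n, ~~ (dl %| n)%N -> A n = 0%N) ->
  (forall n, (dl %| n)%N -> (2 * g - 1 <= n)%N -> ((q - 1) * A n + h = h * q ^ (n + 1 - g))%N) ->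
  (0 < e)%N -> (dl %| e)%N ->
  (forall r, (r0 <= r)%N -> (N (2 * e * r) <= q ^ (2 * e * r) + C * q ^ (e * r))%N /\
    (q ^ (2 * e * r) <= N (2 * e * r) + C * q ^ (e * r))%N) ->
  ((q - 1) ^ 2 * (\sum_(n < g) A n + \sum_(n < g - 1) q ^ (g - 1 - n) * A n) + h * N 1
    <= h * ((g + 1) * (q + 1)))%N.
Proof.
move=> q2 g2 h0 dl0 A0 HN Hdl Hlarge e0 dle Hstep.
have [dl1 [rs [e1 sz rle rsum]]] := rh q2 g2 h0 dl0 A0 HN Hdl Hlarge e0 dle Hstep.
have Hl1 n : (2 * g - 1 <= n)%N -> ((q - 1) * A n + h = h * q ^ (n + 1 - g))%N.
  by apply: Hlarge; rewrite dl1 dvd1n.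
have eP : \poly_(k < 2 * g + 1) mul1X q%:R (mul1X 1 (fun k => (A k)%:R)) k =
    \prod_(z <- rs) (1 - z *: 'X) :> {poly algC}.
  rewrite -e1; apply: eq_poly => k _; rewrite dl1 expr1.
  by case: k => [|[|k]]; rewrite /mul1X ?mul1n.
have := zeta_ineq q2 g2 h0 A0 Hl1 eP sz rle rsum.
move=> H.
rewrite -(ler_nat algC) natrD natrM natrX natrB; last by lia.
rewrite [(h * N 1)%:R]natrM natrM natrM !natrD !natr_sum.
rewrite -lerBrDr -mulrBr.
have -> : \sum_(i < g - 1) (q ^ (g - 1 - i) * A i)%:R = \sum_(i < g - 1) q%:R ^+ (g - 1 - i) * (A i)%:R :> algC.
  by apply: eq_bigr => i _; rewrite natrM natrX.
exact: H.
Qed.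

(** * Stepanov's method on a plane model *)

Lemma mod_uniq (R : nat) (b a z' z : int) : 0 <= a < R%:Z -> 0 <= b < R%:Z ->
  b + z' *+ R = a + z *+ R -> b = a.
Proof.
rewrite -(mulr_natr z) -(mulr_natr z') natz.
case: (ltgtP z z') => [lt|lt|-> _ _]; last by move/addIr.
  have : (z + 1) * R%:Z <= z' * R by rewrite ler_wpM2r //; lia.
  by rewrite mulrDl mul1r; move: (z * _) (z' * _) => u v; lia.
have : (z' + 1) * R%:Z <= z * R by rewrite ler_wpM2r //; lia.
by rewrite mulrDl mul1r; move: (z * _) (z' * _) => u v; lia.
Qed.

(** [Tu] is about [R / n] and [Tw] slightly more. The first condition keeps the pole orders of the
    monomials below [R], the second leaves more unknowns than linear conditions, and the third keeps
    the pole order of the auxiliary function within [O(R)] of [R ^ 2]. *)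
Lemma stepanov_params n W R : (0 < n)%N -> ((W + n + 2) * (W + n + 2) <= R)%N -> exists Tu Tw : nat,
  [/\ (n * Tu + W < R)%N,
    (R * (n * Tu + W) + (n * Tw + W) + n < n * Tu * (n * Tw))%N &
    ((n * Tu + W) + R * (n * Tw + W) <= R * R + (1 + n * (W + n + 3) + W) * R)%N].
Proof.
move=> n0 hR; exists ((R - W - 1) %/ n)%N, (R %/ n + (W + n + 3))%N.
have hR1 : (W + n + 2 <= R)%N by apply: leq_trans hR; rewrite leq_pmulr // addnS.
have e1 := divn_eq (R - W - 1) n; have l1 := ltn_pmod (R - W - 1) n0.
have e2 := divn_eq R n; have l2 := ltn_pmod R n0.
have l3 : (W + n + 3 <= n * (W + n + 3))%N by rewrite leq_pmull.
have l4 : (n * (W + n + 3) = n * (W + n + 2) + n)%N by rewrite addnS mulnS addnC.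
have l5 : (W + n + 2 <= n * (W + n + 2))%N by rewrite leq_pmull.
rewrite [(n * (R %/ n + _))%N]mulnDr ![(n * (_ %/ n))%N]mulnC.
move: ((R - W - 1) %/ n * n)%N ((R - W - 1) %% n)%N (R %/ n * n)%N (R %% n)%N e1 l1 e2 l2 => X v Y0 w e1 l1 e2 l2.
set Y := (Y0 + _)%N; set c := (W + n)%N in hR hR1 l3 l4 l5 *.
have X1 : (X + W + 1 <= R)%N by rewrite /c in hR1; lia.
have X2 : (R <= X + c)%N by rewrite /c in hR1 *; lia.
have Y1 : (Y <= R + n * (c + 3))%N by rewrite /Y; lia.
have Y2 : (R + c + 2 <= Y)%N by rewrite /Y l4; lia.
have Wc : (W + n = c)%N by [].
have [d Xd] : exists d, X = d.+1 by exists X.-1; rewrite prednK //; lia.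
have [r Rr] : exists r, R = (r + (c + 2))%N by exists (R - (c + 2))%N; lia.
clearbody Y c; split; first by lia.
- have f1 : (R * (X + W) + R <= R * R)%N by rewrite -mulnSr leq_mul2l; apply/orP; right; lia.
  have f2 : ((R + c + 2) * d <= Y * d)%N by rewrite leq_mul2r Y2 orbT.
  have f3 : ((R + c + 2) * (r + 1) <= (R + c + 2) * d)%N by rewrite leq_mul2l; apply/orP; right; lia.
  have f4 : (R * R + R = (R + c + 2) * (r + 1) + (c + 2) * (c + 1))%N by rewrite Rr; ring.
  have f5 : (X * Y = Y * d + Y)%N by rewrite Xd; ring.
  have f6 : ((c + 2) * (c + 1) + (c + 2) = (c + 2) * (c + 2))%N by ring.
  rewrite f5; move: (R * (X + W))%N (R * R)%N (Y * d)%N (_ * d)%N (_ * (r + 1))%N ((c + 2) * (c + 1))%N ((c + 2) * (c + 2))%N f1 f2 f3 f4 f6 hR => *.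
  lia.
have : (R * (Y + W) <= R * (R + n * (c + 3) + W))%N by rewrite leq_mul2l leq_add2r Y1 orbT.
have -> : (R * (R + n * (c + 3) + W) = R * R + (n * (c + 3) + W) * R)%N by ring.
have -> : ((1 + n * (c + 3) + W) * R = (n * (c + 3) + W) * R + R)%N by ring.
move: (R * (Y + W))%N (R * R)%N ((_ + W) * R)%N => *; lia.
Qed.

(** The lower bound by complement: [S] is almost [(nu + 1) Q], and at most [nu * U] of it, about
    [nu * Q], lies in [SP']. *)
Lemma stepanov_arith nu b C0 R Q S SP SP' U : (0 < R)%N -> (nu.+1 * Q <= S + nu.+1 * b)%N ->
  S = (SP + SP')%N -> (SP' <= U * nu)%N -> (U <= Q + C0 * R)%N ->
  (Q <= SP + nu.+1 * (b + C0) * R)%N.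
Proof.
move=> R0 h1 e h2 h3; rewrite e in h1.
have h4 : (U * nu <= (Q + C0 * R) * nu)%N by rewrite leq_mul2r h3 orbT.
have h5 : (nu.+1 * b <= nu.+1 * b * R)%N by rewrite leq_pmulr.
have -> : (nu.+1 * (b + C0) * R = nu.+1 * b * R + nu * (C0 * R) + C0 * R)%N.
  by rewrite mulnDr mulnDl -addnA; congr (_ + _)%N; rewrite mulSn mulnDl addnC mulnA.
move: h1 h2 h4 h5; rewrite [(nu.+1 * Q)%N]mulSn mulnDl [(Q * nu)%N]mulnC [(C0 * R * nu)%N]mulnC.
move: (nu.+1 * b * R)%N (nu * (C0 * R))%N (U * nu)%N (nu.+1 * b)%N (nu * Q)%N => u v x z t; lia.
Qed.

Section PlaneModel.
Variables (k : fieldType) (nu : nat).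
Local Notation n := nu.+1.
(* [y] is a root of [phi = Y^n - sum_j c_j Y^j] with [c_j] in [k[x]]; bivariate polynomials are
   polynomials in [Y] over [k[x]]. *)
Variable c : 'rV[{poly k}]_n.

Definition compmx : 'M[{poly k}]_n :=
  \matrix_(i, j) if (i == n.-1 :> nat) then c 0 j else (i.+1 == j :> nat)%:R.

(** Multiplication by [w] modulo [phi] in the basis of powers of [Y]: row [i] expands [w * Y ^ i].
    The first row reduces [w] modulo [phi], and the determinant is the norm of [w] to the
    polynomials in [x]. *)
Definition Mx (w : {poly {poly k}}) : 'M[{poly k}]_n := horner_mx compmx w.

Section Point.
Variables (S : comNzRingType) (f : {rmorphism {poly k} -> S}) (y : S).

Definition bev (w : {poly {poly k}}) : S := (map_poly f w).[y].
Definition vvec : 'cV[S]_n := \col_i y ^+ i.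
Definition on_curve := y ^+ n = \sum_j f (c 0 j) * y ^+ j.

Lemma bevE w : bev w = (horner_eval y \o map_poly f) w. Proof. by []. Qed.

Lemma compmx_v : on_curve -> map_mx f compmx *m vvec = y *: vvec.
Proof.
move=> hy; apply/colP => i; rewrite !mxE.
case: (eqVneq (i : nat) n.-1) => [e|ne].
  rewrite e -exprS -[_.+1]/n hy; apply: eq_bigr => j _; by rewrite !mxE e eqxx.
have lt : (i.+1 < n)%N by have := ltn_ord i; move: ne; rewrite /=; lia.
rewrite (bigD1 (Ordinal lt)) //= big1 ?addr0 => [|j nj].
  by rewrite !mxE (negPf ne) /= eqxx rmorph1 mul1r exprS.
rewrite !mxE (negPf ne) (_ : (i.+1 == j :> nat) = false) ?rmorph0 ?mul0r //.
by apply: contraNF nj => /eqP e; apply/eqP/val_inj.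
Qed.

Lemma Mx_v w : on_curve -> map_mx f (Mx w) *m vvec = bev w *: vvec.
Proof.
move=> hy; elim/poly_ind: w => [|w a IH].
  by rewrite /Mx rmorph0 map_mx0 mul0mx /bev map_poly0 horner0 scale0r.
rewrite /Mx rmorphD rmorphM /= horner_mx_X horner_mx_C -/(Mx w) map_mxD map_mxM mulmxDl -mulmxA.
rewrite compmx_v // -scalemxAr IH map_scalar_mx mul_scalar_mx scalerA.
by rewrite /bev !rmorphD !rmorphM /= map_polyX map_polyC /= hornerMXaddC scalerDl mulrC.
Qed.

Lemma bev_row w : on_curve -> bev w = \sum_j f (Mx w 0 j) * y ^+ j.
Proof.
move=> /(Mx_v w)/colP/(_ 0); rewrite !mxE expr0 mulr1 => <-.
by apply: eq_bigr => j _; rewrite !mxE.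
Qed.

Lemma Mx_row_i w (i : 'I_n) : on_curve -> bev w * y ^+ i = \sum_(j < n) f (Mx w i j) * y ^+ j.
Proof.
move=> /(Mx_v w)/colP/(_ i); rewrite !mxE => <-.
by apply: eq_bigr => j _; rewrite !mxE.
Qed.

Lemma bev_is_additive : zmod_morphism bev.
Proof. by move=> u w; rewrite !bevE rmorphB. Qed.
Lemma bev_is_multiplicative : monoid_morphism bev.
Proof. by split=> [|u w]; rewrite !bevE ?rmorphM ?rmorph1. Qed.
HB.instance Definition _ := GRing.isZmodMorphism.Build _ _ bev bev_is_additive.
HB.instance Definition _ := GRing.isMonoidMorphism.Build _ _ bev bev_is_multiplicative.

Lemma bevC u : bev u%:P = f u.
Proof. by rewrite /bev map_polyC hornerC. Qed.
Lemma bevX : bev 'X = y.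
Proof. by rewrite /bev map_polyX hornerX. Qed.
Lemma bevXn i : bev 'X^i = y ^+ i.
Proof. by rewrite rmorphXn /= bevX. Qed.

End Point.

Section Valued.
Variables (E : fieldType) (fE : {rmorphism {poly k} -> E}) (y : E) (o : E -> int) (om : nat).
(** [o] is the order of the pole at the distinguished place, which is why [x] and [y] have orders
    [n] and [om]; [ole] is the filtration by pole order. *)
Definition ole (z : E) (m : int) := z = 0 \/ o z <= m.
Hypothesis oM : forall z w : E, z != 0 -> w != 0 -> o (z * w) = o z + o w.
Hypothesis oleD : forall z w m, ole z m -> ole w m -> ole (z + w) m.
Hypothesis oC : forall a, a != 0 -> o (fE a%:P) = 0.
Hypotheses (x0 : fE 'X != 0) (ox : o (fE 'X) = n) (y0 : y != 0) (oy : o y = om).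
Hypotheses (cop : coprime n om) (hy : on_curve fE y).
Local Notation bev := (bev fE y).

Lemma o1 : o 1 = 0.
Proof. by have := oM (oner_neq0 E) (oner_neq0 E); rewrite mulr1 => e; apply: (addrI (o 1)); rewrite addr0 -e. Qed.

Lemma oN z : o (- z) = o z.
Proof.
have [->|z0] := eqVneq z 0; first by rewrite oppr0.
have n1 : -1 != 0 :> E by rewrite oppr_eq0 oner_neq0.
have := oM n1 n1; rewrite mulrNN mulr1 o1 -[- z]mulN1r oM // => e; move: (o _) (o z) e => a b; lia.
Qed.

Lemma oX z i : z != 0 -> o (z ^+ i) = o z *+ i.
Proof.
move=> z0; elim: i => [|i IH]; first by rewrite expr0 o1.
by rewrite exprS oM ?expf_neq0 // IH mulrS.
Qed.

Lemma ole0 m : ole 0 m. Proof. by left. Qed.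
Lemma oleo z : ole z (o z). Proof. by right. Qed.
Lemma ole_le z m m' : m <= m' -> ole z m -> ole z m'.
Proof. by move=> h [->|h']; [left|right; apply: le_trans h]. Qed.
Lemma oleN z m : ole z m -> ole (- z) m.
Proof. by case=> [->|h]; [left; rewrite oppr0|right; rewrite oN]. Qed.
Lemma oleB z w m : ole z m -> ole w m -> ole (z - w) m.
Proof. by move=> hz /oleN; apply: oleD. Qed.
Lemma oleM z w m m' : ole z m -> ole w m' -> ole (z * w) (m + m').
Proof.
have [->|z0] := eqVneq z 0; first by rewrite mul0r; left.
have [->|w0] := eqVneq w 0; first by rewrite mulr0; left.
case=> [/eqP|hz]; first by rewrite (negPf z0).
case=> [/eqP|hw]; first by rewrite (negPf w0).
by right; rewrite oM // lerD.
Qed.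
Lemma ole_sum (I : Type) (r : seq I) (P : pred I) (z : I -> E) m :
  (forall i, P i -> ole (z i) m) -> ole (\sum_(i <- r | P i) z i) m.
Proof. by move=> h; elim/big_rec: _ => [|i w hi hw]; [left|apply: oleD => //; apply: h]. Qed.
Lemma ole_prod (I : Type) (r : seq I) (z : I -> E) (m : I -> int) :
  (forall i, ole (z i) (m i)) -> ole (\prod_(i <- r) z i) (\sum_(i <- r) m i).
Proof.
move=> h; elim: r => [|i r IH]; first by rewrite !big_nil; right; rewrite o1.
by rewrite !big_cons; apply: oleM.
Qed.
Lemma oleM_inv z w m : z != 0 -> ole (z * w) (o z + m) -> ole w m.
Proof.
move=> z0; have [->|w0] := eqVneq w 0; first by left.
case=> [/eqP|]; first by rewrite mulf_eq0 (negPf z0) (negPf w0).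
by rewrite oM // lerD2l => h; right.
Qed.
Lemma not_ole z : z != 0 -> ~ ole z (o z - 1).
Proof. by move=> z0 [/eqP|]; [rewrite (negPf z0)|lia]. Qed.

(** The weights [e] cancel in every term of the Leibniz formula, as each index occurs once as a row
    and once as a column. *)
Lemma ole_det m (A : 'M[E]_m) (b : int) (e : 'I_m -> int) :
  (forall i j, ole (A i j) (b + e i - e j)) -> ole (\det A) (b *+ m).
Proof.
move=> h; apply: ole_sum => s _; rewrite -[b *+ m]add0r; apply: oleM.
  by right; case: odd_perm; rewrite ?expr0 ?expr1 ?oN o1.
have -> : b *+ m = \sum_(i < m) (b + e i - e (fun_of_perm s i)).
  rewrite sumrB big_split /= [X in _ - X](_ : _ = \sum_i e i) ?addrK; last first.
    by rewrite [RHS](reindex_inj (@perm_inj _ s)).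
  by rewrite sumr_const card_ord.
by apply: ole_prod => i; exact: h.
Qed.

Lemma o_dom z w : w != 0 -> ole z (o w - 1) -> z + w != 0 /\ o (z + w) = o w.
Proof.
move=> w0 hz; have nz : z + w != 0.
  apply/eqP => e; apply: (not_ole w0); have ew : w = - z by apply/eqP; rewrite -addr_eq0 addrC e.
  by rewrite [X in ole X _]ew; apply: oleN.
split=> //; apply/eqP; rewrite eq_le; apply/andP; split.
  have /(_ _ _)[] // := @oleD z w (o w); first by apply: ole_le hz; lia.
  - exact: oleo.
  - by move/eqP; rewrite (negPf nz).
rewrite leNgt; apply/negP => lt; apply: (not_ole w0).
rewrite [X in ole X _](_ : w = (z + w) - z); last by rewrite addrC addKr.
by apply: oleB => //; right; move: lt; lia.
Qed.

Lemma o_px u : u != 0 -> fE u != 0 /\ o (fE u) = (n * (size u).-1)%N.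
Proof.
elim/poly_ind: u => [|u a IH]; first by rewrite eqxx.
have [->|u0] := eqVneq u 0.
  rewrite mul0r add0r => a0; have := a0; rewrite polyC_eq0 => a0'.
  have fa : fE a%:P != 0.
    apply/eqP => e; have : fE (a%:P * a^-1%:P) = 0 by rewrite rmorphM e /= mul0r.
    by rewrite -polyCM mulfV // rmorph1 => /eqP; rewrite oner_eq0.
  by rewrite oC // size_polyC a0' muln0.
have [fu ou] := IH u0 => _.
have su : (0 < size u)%N by rewrite lt0n size_poly_eq0.
have oux : o (fE u * fE 'X) = (n * size u)%N.
  by rewrite oM // ou ox -PoszD; congr Posz; rewrite -{2}[size u]prednK // mulnS addnC.
rewrite size_MXaddC (negPf u0) /= rmorphD rmorphM addrC.
have [] := @o_dom (fE a%:P) (fE u * fE 'X).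
- by rewrite mulf_neq0.
- have [->|a0] := eqVneq a 0; first by rewrite rmorph0; left.
  by right; rewrite oC // oux; lia.
by move=> h1 h2; split=> //; rewrite h2 oux.
Qed.

Lemma o_mon u i : u != 0 -> fE u * y ^+ i != 0 /\ o (fE u * y ^+ i) = (n * (size u).-1 + om * i)%N.
Proof.
move=> /o_px[h1 h2]; have yi : y ^+ i != 0 by rewrite expf_neq0.
by rewrite mulf_neq0 // oM // h2 oX // oy; split=> //; lia.
Qed.

Lemma order_inj (a b : nat) (i j : 'I_n) : (n * a + om * i = n * b + om * j)%N -> a = b /\ i = j.
Proof.
have main (a' b' : nat) (i' j' : 'I_n) : (i' <= j')%N -> (n * a' + om * i' = n * b' + om * j')%N -> i' = j'.
  move=> le e; apply/val_inj/eqP; rewrite eqn_leq le /= -subn_eq0.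
  have d : (n %| j' - i')%N.
    rewrite -(Gauss_dvdr _ cop); apply/dvdnP; exists (a' - b')%N.
    have : (om * i' <= om * j')%N by rewrite leq_mul2l le orbT.
    rewrite mulnBr mulnBl [(a' * _)%N]mulnC [(b' * _)%N]mulnC; lia.
  have lt : (j' - i' < n)%N by have := ltn_ord j'; lia.
  by case: (posnP (j' - i')) => [/eqP //|p]; have := dvdn_leq p d; rewrite leqNgt lt.
move=> e; have ij : i = j.
  by case: (leqP i j) => [le|/ltnW le]; [exact: main le e|symmetry; exact: main le (esym e)].
split=> //; move: e; rewrite ij => /addIn/eqP; by rewrite eqn_mul2l /= => /eqP.
Qed.

(** By [order_inj], which rests on the coprimality of [n] and [om], the nonzero summands have
    distinct pole orders, so their leading terms cannot cancel. *)
Lemma ole_comb (u : 'I_n -> {poly k}) (m : int) :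
  ole (\sum_i fE (u i) * y ^+ i) m -> forall i, u i != 0 -> (n * (size (u i)).-1 + om * i)%N%:Z <= m.
Proof.
move=> hm i ui; pose w (j : 'I_n) := (n * (size (u j)).-1 + om * j)%N.
have [j uj jmax] := @arg_maxnP _ i (fun j => u j != 0) w ui.
apply: (@le_trans _ _ (w j)%:Z); first by rewrite lez_nat; exact: jmax.
rewrite leNgt; apply/negP => lt.
have [h1 h2] := o_mon j uj; apply: (not_ole h1); rewrite h2 -/(w j).
move: hm; rewrite (bigD1 j) //=; set rest := \sum_(_ | _) _ => hm.
have -> : fE (u j) * y ^+ j = (fE (u j) * y ^+ j + rest) - rest by rewrite addrK.
apply: oleB; first by apply: ole_le hm; lia.
apply: ole_sum => l lj; have [->|ul] := eqVneq (u l) 0; first by rewrite rmorph0 mul0r; left.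
have [h3 h4] := o_mon l ul; right; rewrite h4 -/(w l).
have le := jmax l ul; have ne : w l <> w j by case/order_inj => _ e; rewrite e eqxx in lj.
lia.
Qed.

Lemma comb_eq0 (u : 'I_n -> {poly k}) : \sum_i fE (u i) * y ^+ i = 0 -> forall i, u i = 0.
Proof.
move=> h i; apply/eqP/negPn/negP => ui.
have := @ole_comb u (-1); rewrite h => /(_ (ole0 _) i ui); move: (_ + _)%N => m; lia.
Qed.

Lemma bev_ge0 w : bev w != 0 -> 0 <= o (bev w).
Proof.
move=> w0; have e := bev_row w hy.
case: (pickP (fun j => Mx w 0 j != 0)) => [j hj|hz].
  have := @ole_comb (Mx w 0) (o (bev w)); rewrite -e => /(_ (oleo _) j hj); exact: le_trans.
move/eqP: w0; rewrite e big1 // => j _; have /negbFE/eqP -> := hz j; by rewrite rmorph0 mul0r.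
Qed.

Lemma Mx_eq0 w : bev w = 0 -> Mx w = 0.
Proof.
move=> e; apply/matrixP => i j; rewrite !mxE.
by apply: comb_eq0 j; rewrite -Mx_row_i // e mul0r.
Qed.

Lemma ole_Mx w m i j : ole (bev w) m -> ole (fE (Mx w i j)) (m + (om * i)%:Z - (om * j)%:Z).
Proof.
move=> hm; have [->|nz] := eqVneq (Mx w i j) 0; first by rewrite rmorph0; left.
have h : ole (\sum_l fE (Mx w i l) * y ^+ l) (m + (om * i)%:Z).
  rewrite -Mx_row_i //; apply: oleM => //; right; rewrite oX // oy; lia.
right; have [_ ->] := o_px nz; have := ole_comb h nz; lia.
Qed.

(** The entry at [(i, j)] has pole order at most [o (bev w) + om * i - om * j]. By [ole_det] the
    norm has pole order at most [n * o (bev w)], and [n] times its degree is that order. *)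
Lemma det_Mx w : bev w != 0 -> \det (Mx w) != 0 /\ (size (\det (Mx w))).-1%:Z <= o (bev w).
Proof.
move=> w0; have d0 : \det (Mx w) != 0.
  apply/det0P => -[v v0 vM]; case/rV0Pn: v0 => i /eqP; apply.
  apply: (@comb_eq0 (v 0)); apply: (mulfI w0); rewrite mulr0 mulr_sumr.
  under eq_bigr => l _ do rewrite mulrCA (Mx_row_i w l hy) mulr_sumr.
  rewrite exchange_big big1 //= => j _.
  under eq_bigr => l _ do rewrite mulrA -rmorphM.
  rewrite -mulr_suml -rmorph_sum /=; have := congr1 (fun A : 'rV_n => A 0 j) vM.
  by rewrite !mxE => ->; rewrite rmorph0 mul0r.
split=> //; have [_ e] := o_px d0.
have := @ole_det _ (map_mx fE (Mx w)) (o (bev w)) (fun i => (om * i)%:Z).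
rewrite det_map_mx; case=> [i j|/eqP|].
- rewrite mxE; apply: ole_Mx; exact: oleo.
- by rewrite (negPf (o_px d0).1).
by rewrite e PoszM -mulr_natl natz ler_pM2l.
Qed.

Lemma Mx_comp w p : Mx (p \Po w) = horner_mx (Mx w) p.
Proof.
elim/poly_ind: p => [|p a IH]; first by rewrite comp_poly0 /Mx !rmorph0.
by rewrite comp_poly_MXaddC /Mx !(rmorphD, rmorphM) /= -/(Mx _) IH !horner_mx_C horner_mx_X.
Qed.

Lemma MxM w w' : Mx (w * w') = Mx w *m Mx w'.
Proof. by rewrite /Mx rmorphM. Qed.

(** By Cayley-Hamilton [w] divides its norm up to sign; the cofactor [w'] is a polynomial in [w]. *)
Lemma Mx_norm w : bev w != 0 -> exists w' a,
  [/\ a != 0, Mx w *m Mx w' = a%:M, bev w' != 0 & o (bev w) + o (bev w') = o (fE a)].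
Proof.
move=> w0; have [d0 _] := det_Mx w0; set chi := char_poly (Mx w).
pose p := drop_poly 1 chi; have echi : chi = p * 'X + (chi`_0)%:P.
  rewrite -[LHS](poly_take_drop 1) addrC expr1; congr (_ + _).
  apply/polyP => -[|i]; rewrite coef_take_poly coefC //.
pose a := - chi`_0.
have a0 : a != 0 by rewrite oppr_eq0 char_poly_det mulf_neq0 // signr_eq0.
have eM : Mx (w * (p \Po w)) = a%:M.
  have := Cayley_Hamilton (Mx w); rewrite -/chi echi rmorphD rmorphM /= horner_mx_X horner_mx_C.
  move=> /eqP; rewrite addr_eq0 -Mx_comp /Mx -rmorphM mulrC => /eqP ->.
  by rewrite /a raddfN.
have eb : bev w * bev (p \Po w) = fE a.
  transitivity (bev (w * (p \Po w))); first by rewrite rmorphM.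
  rewrite bev_row // eM (bigD1 0) //= mxE eqxx mulr1n expr0 mulr1 big1 ?addr0 // => j j0.
  by rewrite mxE eq_sym (negPf j0) mulr0n rmorph0 mul0r.
have fa := (o_px a0).1.
have w'0 : bev (p \Po w) != 0 by apply: contraNneq fa => e; rewrite -eb e mulr0.
by exists (p \Po w), a; split; rewrite -?MxM // -eb oM.
Qed.

(** The weights [om * i] are those for which multiplication by [Mx w] shifts the filtration by
    exactly [o (bev w)]: see [vole_Mx] and [vole_Mx_inv]. *)
Definition vole (v : 'rV[E]_n) (m : int) := forall i, ole (v 0 i) (m - (om * i)%:Z).
Local Notation ME w := (map_mx fE (Mx w)).

Lemma vole_Mx w v m : vole v m -> vole (v *m ME w) (m + o (bev w)).
Proof.
move=> h j; rewrite mxE; apply: ole_sum => i _; rewrite mxE.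
have -> : m + o (bev w) - (om * j)%:Z =
  (m - (om * i)%:Z) + (o (bev w) + (om * i)%:Z - (om * j)%:Z) by ring.
by apply: oleM => //; apply: ole_Mx; exact: oleo.
Qed.

Lemma vole_Mx_inv w v m : bev w != 0 -> vole (v *m ME w) (m + o (bev w)) -> vole v m.
Proof.
move=> w0 h; have [w' [a [a0 eM w'0 oo]]] := Mx_norm w0.
have := vole_Mx w' h; rewrite -mulmxA -map_mxM eM map_scalar_mx -addrA oo => h' i.
have := h' i; rewrite mul_mx_scalar mxE.
rewrite (_ : m + _ - _ = o (fE a) + (m - (om * i)%:Z)); last by ring.
by apply: oleM_inv; exact: (o_px a0).1.
Qed.

Lemma vole_norm v : v != 0 -> exists2 m, vole v m & ~ vole v (m - 1).
Proof.
case/rV0Pn => i vi; pose t (j : 'I_n) : int := o (v 0 j) + (om * j)%:Z.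
have [j vj jmax] := @Order.TotalTheory.arg_maxP _ _ _ i (fun j => v 0 j != 0) t vi.
exists (t j).
  move=> l; have [->|vl] := eqVneq (v 0 l) 0; first exact: ole0.
  by right; rewrite lerBrDr; exact: jmax.
move/(_ j); rewrite (_ : t j - 1 - _ = o (v 0 j) - 1); last by rewrite /t; ring.
exact: not_ole.
Qed.

Section FrobeniusTwist.
Variables (I : finType) (R : nat) (u : I -> E) (w : I -> {poly {poly k}}).
Hypotheses (u0 : forall e, u e != 0) (ou : forall e, 0 <= o (u e) < R%:Z)
  (ou_inj : forall e e', o (u e) = o (u e') -> e = e').
Hypothesis w0 : exists e, bev (w e) != 0.

(* The summands have distinct leading orders modulo [R], hence do not cancel. *)
Lemma twist_inj (v : 'rV[E]_n) :
  v *m (\sum_e u e *: ME (w e ^+ R)) = 0 -> v = 0.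
Proof.
move=> h; apply/eqP/negPn/negP => v0; have [m hm nm] := vole_norm v0.
have [e1 we1] := w0; pose t e : int := o (u e) + o (bev (w e ^+ R)).
have bX e : bev (w e ^+ R) = bev (w e) ^+ R by rewrite rmorphXn.
have [e we emax] := @Order.TotalTheory.arg_maxP _ _ _ e1 (fun e => bev (w e) != 0) t we1.
apply: nm; apply: (@vole_Mx_inv (w e ^+ R)); first by rewrite bX expf_neq0.
move: h; rewrite mulmx_sumr (bigD1 e) //= => /eqP; rewrite addr_eq0 => /eqP h i.
apply: (@oleM_inv (u e)) => //.
have -> : u e * (v *m ME (w e ^+ R)) 0 i = (v *m (u e *: ME (w e ^+ R))) 0 i.
  by rewrite -scalemxAr [RHS]mxE.
rewrite h mxE; apply: oleN; rewrite summxE; apply: ole_sum => e' ne.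
rewrite -scalemxAr mxE; have [e0|we'] := eqVneq (bev (w e')) 0.
  rewrite (_ : Mx (w e' ^+ R) = 0) ?map_mx0 ?mulmx0 ?mxE ?mulr0; first exact: ole0.
  apply: Mx_eq0; rewrite bX e0 expr0n; case: (R) (ou e') => //; lia.
have := oleM (oleo (u e')) (vole_Mx (w e' ^+ R) hm i); apply: ole_le.
have le : t e' <= t e := emax e' we'.
have lt : t e' < t e.
  rewrite lt_neqAle le andbT; apply/eqP => et; case/eqP: ne; apply: ou_inj.
  move: et; rewrite /t !bX !oX // => et; have := ou e'; have := ou e.
  by move=> h1 h2; exact: mod_uniq h1 h2 et.
move: lt; rewrite /t; lia.
Qed.

End FrobeniusTwist.

Section Points.
Variables (L : closedFieldType) (jL : {rmorphism k -> L}).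
Definition ev (a : L) : {rmorphism {poly k} -> L} := horner_eval a \o map_poly jL.
Definition phi : {poly {poly k}} := 'X^n - \sum_j (c 0 j)%:P * 'X^j.

Lemma bev_phi (S : comNzRingType) (f : {rmorphism {poly k} -> S}) (z : S) :
  PlaneModel.bev f z phi = z ^+ n - \sum_j f (c 0 j) * z ^+ j.
Proof.
rewrite /phi rmorphB rmorphXn /= bevX rmorph_sum; congr (_ - _).
by apply: eq_bigr => j _; rewrite rmorphM rmorphXn /= bevX bevC.
Qed.

Lemma on_curveE (S : comNzRingType) (f : {rmorphism {poly k} -> S}) (z : S) :
  on_curve f z <-> PlaneModel.bev f z phi = 0.
Proof.
by rewrite bev_phi /on_curve; split=> [->|/eqP]; rewrite ?subrr // subr_eq0 => /eqP.
Qed.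

Lemma size_phi (S : comNzRingType) (f : {rmorphism {poly k} -> S}) :
  map_poly f phi \is monic /\ size (map_poly f phi) = n.+1.
Proof.
pose cj j : {poly k} := if insub j is Some j' then c 0 (j' : 'I_n) else 0.
have e : map_poly f phi = 'X^n - \poly_(j < n) f (cj j).
  rewrite /phi rmorphB rmorphXn /= map_polyX; congr (_ - _).
  rewrite rmorph_sum poly_def /=; apply: eq_bigr => j _.
  by rewrite rmorphM rmorphXn /= map_polyX map_polyC /= mul_polyC /cj valK.
have lt : (size (- \poly_(j < n) f (cj j)) < size ('X^n : {poly S}))%N.
  by rewrite size_polyN size_polyXn ltnS size_poly.
by rewrite e monicE lead_coefDl // lead_coefXn eqxx size_polyDl // size_polyXn.
Qed.

Lemma extend_uniq (s : seq L) m : uniq s -> (size s <= m)%N -> exists s', uniq (s ++ s') /\ size (s ++ s') = m.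
Proof.
move=> us; elim: m => [|m IH]; first by rewrite leqn0 => /nilP ->; exists [::].
rewrite leq_eqVlt => /orP[/eqP <-|]; first by exists [::]; rewrite cats0.
rewrite ltnS => /IH[s' [us' ss']].
have [a ha] : exists a, a \notin s ++ s'.
  have [->|ne] := eqVneq (s ++ s') [::]; first by exists 0.
  pose p := \prod_(b <- s ++ s') ('X - b%:P) + 1.
  have sp : size p = (size (s ++ s')).+1.
    rewrite size_polyDl size_prod_XsubC // size_poly1; case: (s ++ s') ne => //.
  have : size p != 1%N by rewrite sp; case: (s ++ s') ne.
  case/closed_rootP => a; rewrite /root hornerD hornerC => /eqP h; exists a; apply/negP => ha.
  move: h; have /rootP -> : root (\prod_(b <- s ++ s') ('X - b%:P)) a by rewrite root_prod_XsubC.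
  by rewrite add0r => /eqP; rewrite oner_eq0.
by exists (rcons s' a); rewrite -rcons_cat rcons_uniq ha us' size_rcons ss'.
Qed.

(** Multiplying by an invertible constant Vandermonde matrix makes [size s] of the columns divisible
    by ['X - a%:P]. *)
Lemma dvd_det (A : 'M[{poly L}]_n) (a : L) (s : seq L) : uniq s -> (size s <= n)%N ->
  (forall b, b \in s -> map_mx (horner_eval a) A *m vvec b = 0) ->
  ('X - a%:P) ^+ size s %| \det A.
Proof.
move=> us ss hs; have [s' [ut st]] := extend_uniq us ss; set t := s ++ s' in ut st.
pose V : 'M[L]_n := Vandermonde n (\row_j t`_j).
have V0 : \det V != 0.
  rewrite det_Vandermonde; apply/prodf_neq0 => i _; apply/prodf_neq0 => j ij.
  by rewrite !mxE subr_eq0 nth_uniq ?st // gtn_eqF.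
pose B := A *m map_mx polyC V.
have dB : \det B = \det A * (\det V)%:P by rewrite det_mulmx det_map_mx.
suff : ('X - a%:P) ^+ size s %| \det B.
  by rewrite dB mulrC mul_polyC dvdpZr.
have hB i (j : 'I_n) : (j < size s)%N -> 'X - a%:P %| B i j.
  move=> js; rewrite -root_factor_theorem -/(horner_eval _ _); apply/rootP.
  have := congr1 (fun v : 'cV_n => v i 0) (hs s`_j (mem_nth _ js)); rewrite !mxE => <-.
  rewrite horner_sum; apply: eq_bigr => l _; rewrite !mxE hornerM hornerC; congr (_ * _ ^+ _).
  by rewrite nth_cat js.
pose B' := \matrix_(i, j) if (j < size s)%N then B i j %/ ('X - a%:P) else B i j.
pose d : 'rV[{poly L}]_n := \row_j if (j < size s)%N then 'X - a%:P else 1.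
have -> : B = B' *m diag_mx d.
  apply/matrixP => i j; rewrite mul_mx_diag [RHS]mxE [B' i j]mxE [d 0 j]mxE; case: ltnP => js; last by rewrite mulr1.
  by rewrite divpK // hB.
rewrite det_mulmx det_diag dvdp_mull //.
under eq_bigr => j _ do rewrite mxE.
by rewrite -big_mkcond /= -(big_ord_widen n (fun=> 'X - a%:P)) // prodr_const card_ord dvdpp.
Qed.

Lemma dvd_prod_XsubC (s : seq L) (D : {poly L}) :
  (forall a, ('X - a%:P) ^+ count_mem a s %| D) -> \prod_(a <- s) ('X - a%:P) %| D.
Proof.
elim: s D => [|a s IH] D h; first by rewrite big_nil dvd1p.
have /dvdpP[D1 e] : 'X - a%:P %| D.
  by apply: dvdp_trans (h a); rewrite /= eqxx exprS dvdp_mulr.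
rewrite big_cons e mulrC dvdp_mul2r ?polyXsubC_eq0 //; apply: IH => b.
have := h b; rewrite e /=; case: (eqVneq a b) => [<-|ab].
  by rewrite exprSr dvdp_mul2r // polyXsubC_eq0.
rewrite add0n Gauss_dvdpl //; apply: coprimep_expl.
by rewrite coprimep_XsubC2 // subr_eq0.
Qed.

(** Zeros of [w] on the curve over the abscissa [a] give vectors [vvec b] killed by the matrix of
    [w] at [a], so the norm of [w] vanishes at [a] to at least their number. By [det_Mx] the degree
    of the norm is at most the pole order of [w]. *)
Lemma zero_bound w (pts : seq (L * L)) : bev w != 0 -> uniq pts ->
  (forall p, p \in pts -> on_curve (ev p.1) p.2 /\ PlaneModel.bev (ev p.1) p.2 w = 0) ->
  (size pts)%:Z <= o (bev w).
Proof.
move=> w0 up hp; have [d0 sd] := det_Mx w0; apply: le_trans sd.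
set D := \det _ in d0 *; have sD : size D = size (map_poly jL D) by rewrite size_map_poly.
have D0 : map_poly jL D != 0 by rewrite map_poly_eq0.
have : \prod_(a <- map fst pts) ('X - a%:P) %| map_poly jL D.
  apply: dvd_prod_XsubC => a; rewrite count_map.
  pose ys := [seq p.2 | p <- pts & p.1 == a].
  have ysP b : b \in ys -> (a, b) \in pts.
    by case/mapP => -[a' b']; rewrite mem_filter /= => /andP[/eqP -> ?] ->.
  have uys : uniq ys.
    rewrite map_inj_in_uniq ?filter_uniq // => -[a1 b1] [a2 b2].
    by rewrite !mem_filter /= => /andP[/eqP -> _] /andP[/eqP -> _] ->.
  have -> : count (preim fst (pred1 a)) pts = size ys by rewrite size_map size_filter.
  have -> : map_poly jL D = \det (map_mx (map_poly jL) (Mx w)) by rewrite det_map_mx.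
  apply: dvd_det => // [|b /ysP/hp[/= h1 h2]].
    have [mo sz] := size_phi (ev a); rewrite -ltnS -sz; apply: max_poly_roots => //.
      by rewrite -size_poly_eq0 sz.
    by apply/allP => b /ysP/hp[/= /on_curveE h _]; apply/rootP.
  rewrite -map_mx_comp; have := Mx_v w h1; rewrite h2 scale0r => <-; congr (_ *m _).
move/dvdp_leq => /(_ D0); rewrite size_prod_XsubC size_map -sD; lia.
Qed.

Section Twist.
Variable R : nat.
Hypotheses (R0 : (0 < R)%N) (Rch : [pchar L].-nat R) (RK : forall a, jL a ^+ R = jL a).

Lemma frob_sum (I : Type) (s : seq I) (P : pred I) (F : I -> L) :
  (\sum_(i <- s | P i) F i) ^+ R = \sum_(i <- s | P i) F i ^+ R.
Proof.
elim/big_rec2: _ => [|i a b _ <-]; first by rewrite expr0n (gtn_eqF R0).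
by rewrite exprDn_pchar.
Qed.

Lemma ev_frob a u : ev a u ^+ R = ev (a ^+ R) u.
Proof.
elim/poly_ind: u => [|u b IH]; first by rewrite !rmorph0 expr0n (gtn_eqF R0).
have evD z : ev z (u * 'X + b%:P) = ev z u * z + jL b.
  by rewrite rmorphD rmorphM /= !/horner_eval !map_polyX !map_polyC hornerX hornerC.
by rewrite !evD exprDn_pchar // exprMn IH RK.
Qed.

Lemma bev_frob a b w :
  PlaneModel.bev (ev a) b w ^+ R = PlaneModel.bev (ev (a ^+ R)) (b ^+ R) w.
Proof.
elim/poly_ind: w => [|w u IH]; first by rewrite !rmorph0 expr0n (gtn_eqF R0).
rewrite !rmorphD !rmorphM /= !bevX !bevC exprDn_pchar // exprMn IH.
by congr (_ + _); exact: ev_frob.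
Qed.

Definition mon T (e : 'I_T * 'I_n) : {poly {poly k}} := ('X^(e.1))%:P * 'X^(e.2).

Lemma bev_mon (S : comNzRingType) (f : {rmorphism {poly k} -> S}) (z : S) T (e : 'I_T * 'I_n) :
  PlaneModel.bev f z (mon e) = f 'X^(e.1) * z ^+ e.2.
Proof. by rewrite /mon rmorphM /= bevC bevXn. Qed.

Lemma o_bev_mon T (e : 'I_T * 'I_n) :
  bev (mon e) != 0 /\ o (bev (mon e)) = (n * e.1 + om * e.2)%N.
Proof.
have X0 : 'X^(e.1) != 0 :> {poly k} by rewrite monic_neq0 // monicXn.
by have [h1 h2] := o_mon e.2 X0; rewrite bev_mon h1 h2 size_polyXn.
Qed.

Lemma ole_mon T (e : 'I_T * 'I_n) : ole (bev (mon e)) (n * T + om * n)%N.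
Proof.
right; rewrite (o_bev_mon e).2 lez_nat; apply: leq_add; apply: leq_mul => //; exact: ltnW.
Qed.

Definition comb T (a : 'I_T * 'I_n -> k) : {poly {poly k}} := \sum_e (a e)%:P%:P * mon e.

Lemma ole_sum_const (I : finType) (a : I -> k) (W : I -> {poly {poly k}}) m :
  (forall e, ole (bev (W e)) m) -> ole (bev (\sum_e (a e)%:P%:P * W e)) m.
Proof.
move=> h; rewrite rmorph_sum; apply: ole_sum => e _; rewrite rmorphM /= bevC.
have [->|ae] := eqVneq (a e) 0; first by rewrite rmorph0 mul0r; exact: ole0.
by rewrite -[m]add0r; apply: oleM => //; right; rewrite oC.
Qed.

Lemma comb_neq0 T (a : 'I_T * 'I_n -> k) e : a e != 0 -> bev (comb a) != 0.
Proof.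
case: e => t l ae; apply/eqP => h.
pose u (j : 'I_n) : {poly k} := \sum_(s < T) a (s, j) *: 'X^s.
have e : bev (comb a) = \sum_j fE (u j) * y ^+ j.
  rewrite /comb rmorph_sum /= (eq_bigr (fun p : 'I_T * 'I_n => fE (a (p.1, p.2))%:P * fE 'X^(p.1) * y ^+ p.2)).
    rewrite -(pair_big predT predT (fun (s : 'I_T) (j : 'I_n) => fE (a (s, j))%:P * fE 'X^s * y ^+ j)) /=.
    rewrite exchange_big; apply: eq_bigr => j _; rewrite rmorph_sum mulr_suml; apply: eq_bigr => s _.
    by rewrite -mul_polyC rmorphM.
  by case=> s j _; rewrite rmorphM /= bevC bev_mon mulrA.
rewrite e in h; have := comb_eq0 h l => /(congr1 (fun p : {poly k} => p`_t)).
rewrite coef0 coef_sum (bigD1 t) //= coefZ coefXn eqxx mulr1 big1 ?addr0 => [/eqP|s st].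
  by rewrite (negPf ae).
by rewrite coefZ coefXn eq_sym (_ : (_ == _ :> nat) = false) ?mulr0 //; apply: contraNF st => /eqP/val_inj ->.
Qed.

Variables (Tu Tw : nat).
Let mu := (n * Tu + om * n)%N.
Let mw := (n * Tw + om * n)%N.
Hypothesis muR : (mu < R)%N.
Hypothesis Tuw : (R * mu + mw + n < n * Tu * (n * Tw))%N.

Lemma stepanov_aux : exists w : 'I_Tu * 'I_n -> {poly {poly k}},
  [/\ exists e, bev (w e) != 0, forall e, ole (bev (w e)) mw &
    Mx (\sum_e mon e ^+ R * w e) = 0].
Proof.
pose m0 := (R * mu + mw)%N; pose D := (m0 %/ n).+1.
pose W (e : ('I_Tu * 'I_n) * ('I_Tw * 'I_n)) := mon e.1 ^+ R * mon e.2.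
pose co e (j : 'I_n * 'I_D) : k := (Mx (W e) 0 j.1)`_j.2.
have [|a [[i0 e0] ai0] ha] := @exists_dep k _ _ co.
  rewrite !card_prod !card_ord /D; have := leq_trunc_div m0 n; move: Tuw; rewrite -/m0; nia.
have oW e : ole (bev (W e)) m0.
  rewrite rmorphM rmorphXn /= /m0 PoszD; apply: oleM; last exact: ole_mon.
  right; rewrite oX ?(o_bev_mon _).1 //; have := ole_mon e.1.
  case=> [/eqP|h]; first by rewrite (negPf (o_bev_mon _).1).
  by rewrite -mulr_natl natz PoszM ler_wpM2l.
exists (fun i => comb (fun e => a (i, e))); split.
- by exists i0; exact: comb_neq0 ai0.
- by move=> e; apply: ole_sum_const => e'; exact: ole_mon.
pose Z := \sum_p (a p)%:P%:P * W p.
have -> : \sum_e mon e ^+ R * comb (fun e' => a (e, e')) = Z.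
  rewrite /Z (eq_bigr (fun p => (a (p.1, p.2))%:P%:P * (mon p.1 ^+ R * mon p.2))); last by case.
  rewrite -(pair_big predT predT (fun i e => (a (i, e))%:P%:P * (mon i ^+ R * mon e))) /=.
  apply: eq_bigr => i _; rewrite mulr_sumr; apply: eq_bigr => e _; exact: mulrCA.
apply: Mx_eq0; rewrite bev_row // big1 // => j _; suff -> : Mx Z 0 j = 0 by rewrite rmorph0 mul0r.
have eZ : Mx Z 0 j = \sum_p a p *: Mx (W p) 0 j.
  rewrite /Mx rmorph_sum summxE; apply: eq_bigr => p _.
  by rewrite rmorphM /= horner_mx_C -mulmxE mul_scalar_mx mxE mul_polyC.
apply/polyP => d; rewrite coef0 eZ coef_sum; case: (ltnP d D) => dD.
  rewrite -[RHS](ha (j, Ordinal dD)); apply: eq_bigr => p _; by rewrite coefZ.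
rewrite big1 // => p _; rewrite coefZ [_`_d]nth_default ?mulr0 //; apply: leq_trans dD.
have [->|nz] := eqVneq (Mx (W p) 0 j) 0; first by rewrite size_poly0.
have := @ole_comb (Mx (W p) 0) m0; rewrite -bev_row // => /(_ (oW p) j nz).
rewrite lez_nat => h; rewrite /D -[size _]prednK ?ltnS ?lt0n ?size_poly_eq0 // leq_divRL //.
by rewrite mulnC; apply: leq_trans h; exact: leq_addr.
Qed.

Section Aux.
Variable w : 'I_Tu * 'I_n -> {poly {poly k}}.
Hypotheses (w0 : exists e, bev (w e) != 0) (wle : forall e, ole (bev (w e)) mw)
  (Mw : Mx (\sum_e mon e ^+ R * w e) = 0).

(* Stepanov's auxiliary function: as [sum_e mon e ^+ R * w e] vanishes on the curve, [Gf] vanishes at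
   the points of the curve fixed by the [R ^ 2]-Frobenius, whereas [Hf] vanishes at those with only
   the abscissa fixed. *)
Definition Gf : {poly {poly k}} := \sum_e mon e * w e ^+ R.
(** Multiplication by the sum of the [mon e * w e ^ R], where [mon e] is kept as a function of one
    ordinate [z] while [w e] acts on the powers of a second ordinate [z'] over the same abscissa;
    see [GG_row]. *)
Definition GG : 'M[{poly {poly k}}]_n := \matrix_(i, j) \sum_e mon e * (Mx (w e ^+ R) i j)%:P.
(** The matrix through which [GG] acts on the differences [z' ^ i - z ^ i] with [i >= 1]. When the
    sum of the [mon e (z) * w e (z') ^ R] is zero for some [z' != z], these differences form a
    kernel vector. *)
Definition HH : 'M[{poly {poly k}}]_nu :=
  \matrix_(i, j) (GG (lift 0 i) (lift 0 j) - 'X^(lift 0 i) * GG 0 (lift 0 j)).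
Definition Hf := \det HH.

Lemma GG_row (S : comNzRingType) (f : {rmorphism {poly k} -> S}) (z z' : S) i : on_curve f z' ->
  \sum_j PlaneModel.bev f z (GG i j) * z' ^+ j =
  (\sum_e PlaneModel.bev f z (mon e) * PlaneModel.bev f z' (w e) ^+ R) * z' ^+ i.
Proof.
move=> hz; rewrite mulr_suml.
under eq_bigr => j _ do rewrite mxE rmorph_sum mulr_suml.
rewrite exchange_big; apply: eq_bigr => e _; rewrite -mulrA -rmorphXn Mx_row_i // mulr_sumr.
by apply: eq_bigr => j _; rewrite rmorphM /= bevC mulrA.
Qed.

Lemma bev_Gf (S : comNzRingType) (f : {rmorphism {poly k} -> S}) (z : S) :
  PlaneModel.bev f z Gf = \sum_e PlaneModel.bev f z (mon e) * PlaneModel.bev f z (w e) ^+ R.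
Proof. by rewrite rmorph_sum; apply: eq_bigr => e _; rewrite rmorphM rmorphXn. Qed.

Let b := (mu + R * mw)%N.

Lemma ole_wR e : ole (bev (w e ^+ R)) (R * mw)%N.
Proof.
rewrite rmorphXn /=; have [->|we] := eqVneq (bev (w e)) 0; first by rewrite expr0n (gtn_eqF R0); left.
right; rewrite oX // -mulr_natl natz PoszM ler_wpM2l //.
by case: (wle e) => // /eqP; rewrite (negPf we).
Qed.

Lemma ole_Gf : ole (bev Gf) b.
Proof.
rewrite rmorph_sum; apply: ole_sum => e _; rewrite rmorphM /b PoszD.
by apply: oleM; [exact: ole_mon|exact: ole_wR].
Qed.

Lemma ole_GG i j : ole (bev (GG i j)) (b%:Z + (om * i)%:Z - (om * j)%:Z).
Proof.
rewrite mxE rmorph_sum; apply: ole_sum => e _; rewrite rmorphM /= bevC /b PoszD -!addrA.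
by apply: oleM; [exact: ole_mon|rewrite addrA; apply: ole_Mx; exact: ole_wR].
Qed.

Lemma ole_Hf : ole (bev Hf) (b * nu)%N.
Proof.
rewrite -det_map_mx /=.
have -> : (b * nu)%N%:Z = b%:Z *+ nu by rewrite PoszM -mulr_natr natz.
apply: (@ole_det _ _ b%:Z (fun i : 'I_nu => (om * (lift ord0 i : 'I_n))%N%:Z)) => i j.
rewrite mxE [HH i j]mxE rmorphB rmorphM /= bevXn; apply: oleB; first exact: ole_GG.
rewrite [X in ole _ X](_ : _ = (om * bump 0 i)%N%:Z +
  (b%:Z + (om * (ord0 : 'I_n))%N%:Z - (om * (lift ord0 j : 'I_n))%N%:Z)); last by rewrite /= muln0; ring.
apply: oleM; last exact: ole_GG.
by right; rewrite oX // oy -mulr_natr natz PoszM.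
Qed.

Lemma GG_inj (v : 'rV[E]_n) : v *m map_mx bev GG = 0 -> v = 0.
Proof.
have -> : map_mx bev GG = \sum_e bev (mon e) *: map_mx fE (Mx (w e ^+ R)).
  apply/matrixP => i j; rewrite !mxE rmorph_sum summxE; apply: eq_bigr => e _.
  by rewrite rmorphM /= bevC !mxE.
apply: (twist_inj (u := fun e => bev (mon e))) => // [e|e|e e']; rewrite ?(o_bev_mon _).1 ?(o_bev_mon _).2 //.
  rewrite le0z_nat ltz_nat; apply: leq_ltn_trans muR.
  by apply: leq_add; apply: leq_mul => //; exact: ltnW.
case: e e' => s i [s' i'] /= [] /order_inj[/val_inj -> ->] //.
Qed.

(** If [Gf] vanished, [GG] would kill the nonzero vector [vvec y], against [GG_inj]. *)
Lemma Gf_neq0 : bev Gf != 0.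
Proof.
apply/eqP => e; have : \det (map_mx bev GG) == 0.
  rewrite -det_tr; apply/det0P; exists (vvec y)^T.
    by apply/eqP => /rowP/(_ 0); rewrite !mxE expr0 => /eqP; rewrite oner_eq0.
  rewrite -trmx_mul; apply/rowP => i; rewrite !mxE; have := GG_row y i hy.
  by rewrite -bev_Gf e mul0r => e2; rewrite -[RHS]e2; apply: eq_bigr => j _; rewrite !mxE.
by case/det0P => v /eqP v0 /GG_inj.
Qed.

(** A left kernel vector of [HH], completed at index 0 so as to be orthogonal to [vvec y], is a left
    kernel vector of [GG]. *)
Lemma Hf_neq0 : bev Hf != 0.
Proof.
rewrite -det_map_mx /=; apply/det0P => -[d d0 dH].
pose s := \sum_i d 0 i * y ^+ (lift ord0 i).
pose v : 'rV[E]_n := \row_i if unlift ord0 i is Some i' then d 0 i' else - s.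
have vl i : v 0 (lift ord0 i) = d 0 i by rewrite mxE liftK.
have v0 : v 0 ord0 = - s by rewrite mxE unlift_none.
have cl j : (v *m map_mx bev GG) 0 (lift ord0 j) = 0.
  have := congr1 (fun A : 'rV_nu => A 0 j) dH; rewrite !mxE big_ord_recl => e2; rewrite -[RHS]e2.
  rewrite v0 mulNr addrC mulr_suml -sumrB; apply: eq_bigr => i _.
  by rewrite vl ![map_mx _ _ _ _]mxE [HH i j]mxE rmorphB rmorphM rmorphXn /= bevX mulrBr mulrA.
have c0 : (v *m map_mx bev GG) 0 ord0 = 0.
  have : ((v *m map_mx bev GG) *m vvec y) 0 0 = 0.
    rewrite -mulmxA (_ : map_mx bev GG *m vvec y = bev Gf *: vvec y); last first.
      apply/colP => i; rewrite !mxE -[X in X * _]/(bev Gf) bev_Gf -GG_row //.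
      by apply: eq_bigr => j _; rewrite !mxE.
    rewrite -scalemxAr mxE [X in _ * X]mxE big_ord_recl v0 mxE expr0 mulr1.
    by rewrite (eq_bigr (fun i => d 0 i * y ^+ (lift ord0 i))) ?addNr ?mulr0 // => i _; rewrite vl mxE.
  rewrite mxE big_ord_recl [vvec y _ _]mxE expr0 mulr1 big1 ?addr0 // => i _.
  by rewrite cl mul0r.
have /GG_inj v00 : v *m map_mx bev GG = 0.
  by apply/rowP => j; rewrite [RHS]mxE; case: (unliftP ord0 j) => [j'|] ->.
by case/rV0Pn: d0 => i /eqP; apply; rewrite -vl v00 mxE.
Qed.

(** The [R]-th power of the sum is the relation [Mw] at [(a, b0)]: the value of [w e] at [(a, b1)],
    raised to the power [R * R], is its value at [(a, b0)]. *)
Lemma twist_zero a b1 b0 : a ^+ (R * R) = a -> b1 ^+ (R * R) = b0 ->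
  on_curve (ev a) b0 ->
  \sum_e PlaneModel.bev (ev a) b0 (mon e) * PlaneModel.bev (ev a) b1 (w e) ^+ R = 0.
Proof.
move=> ha hb h0; set X := \sum_e _.
suff hX : X ^+ R = 0 by move/eqP: hX; rewrite expf_eq0 R0 => /eqP.
have h : PlaneModel.bev (ev a) b0 (\sum_e mon e ^+ R * w e) = 0.
  by rewrite bev_row // Mw big1 // => j _; rewrite mxE rmorph0 mul0r.
rewrite /X frob_sum // -[RHS]h rmorph_sum; apply: eq_bigr => e _.
rewrite [RHS]rmorphM [X in _ = X * _]rmorphXn /= exprMn; congr (_ * _).
by rewrite -exprM exprM !bev_frob // -!exprM ha hb.
Qed.

Lemma Gf_vanish a b0 : a ^+ (R * R) = a -> b0 ^+ (R * R) = b0 -> on_curve (ev a) b0 ->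
  PlaneModel.bev (ev a) b0 Gf = 0.
Proof. by move=> ha hb h; rewrite bev_Gf; apply: twist_zero. Qed.

Lemma Hf_vanish a b0 b1 : a ^+ (R * R) = a -> b1 ^+ (R * R) = b0 -> b1 != b0 ->
  on_curve (ev a) b0 -> on_curve (ev a) b1 -> PlaneModel.bev (ev a) b0 Hf = 0.
Proof.
move=> ha hb ne h0 h1; rewrite -det_map_mx -det_tr; apply/eqP/det0P.
exists (\row_i (b1 ^+ (lift ord0 i) - b0 ^+ (lift ord0 i))).
  (* For [nu = 0] there is a single ordinate over each abscissa, so [b1 != b0] is impossible. *)
  case: (posnP nu) => [nu0|nu1].
    have bE z : on_curve (ev a) z -> z = \sum_j ev a (c 0 j).
      move=> hb'; rewrite -[LHS]expr1; transitivity (z ^+ n); first by congr (_ ^+ _); rewrite nu0.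
      rewrite hb'; apply: eq_bigr => j _; rewrite (_ : (j : nat) = 0%N) ?expr0 ?mulr1 //.
      by have := ltn_ord j; lia.
    by case/eqP: ne; rewrite (bE _ h0) (bE _ h1).
  apply/rV0Pn; exists (Ordinal nu1); rewrite mxE /= /bump /= !expr1 subr_eq0 //.
apply/rowP => i; rewrite !mxE; set M := fun i j => PlaneModel.bev (ev a) b0 (GG i j).
have z1 l : \sum_j M l j * b1 ^+ j = 0 by rewrite GG_row // twist_zero // mul0r.
have z0 l : \sum_j M l j * b0 ^+ j = PlaneModel.bev (ev a) b0 Gf * b0 ^+ l by rewrite GG_row // bev_Gf.
pose F j := (M (lift ord0 i) j - b0 ^+ (lift ord0 i) * M ord0 j) * (b1 ^+ j - b0 ^+ j).
have -> : \sum_j0 (\row_i0 (b1 ^+ (lift ord0 i0) - b0 ^+ (lift ord0 i0))) 0 j0 *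
    (map_mx (PlaneModel.bev (ev a) b0) HH)^T j0 i = \sum_j F j.
  rewrite [RHS]big_ord_recl {1}/F !expr0 subrr mulr0 add0r; apply: eq_bigr => j _.
  by rewrite !mxE rmorphB rmorphM rmorphXn /= bevX mulrC /F /M -!/(GG _ _) !mxE.
have -> : \sum_j F j = \sum_j M (lift ord0 i) j * b1 ^+ j - \sum_j M (lift ord0 i) j * b0 ^+ j
    - b0 ^+ (lift ord0 i) * (\sum_j M ord0 j * b1 ^+ j - \sum_j M ord0 j * b0 ^+ j).
  rewrite -!sumrB mulr_sumr -sumrB; apply: eq_bigr => j _; rewrite /F; ring.
by rewrite !z1 !z0 expr0; ring.
Qed.

End Aux.
End Twist.

Lemma fixed_seq Q : (1 < Q)%N -> [pchar L].-nat Q ->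
  exists r : seq L, [/\ uniq r, size r = Q & forall a, (a \in r) = (a ^+ Q == a)].
Proof.
move=> Q1 Qch; pose p : {poly L} := 'X^Q - 'X.
have lt : (size (- 'X : {poly L}) < size ('X^Q : {poly L}))%N.
  by rewrite size_polyN size_polyX size_polyXn.
have pm : lead_coef p = 1 by rewrite lead_coefDl // lead_coefXn.
have [r e] := closed_field_poly_normal p; rewrite pm scale1r in e.
have Q0 : Q%:R = 0 :> L.
  have pp : pdiv Q \in [pchar L] by rewrite (pnatPpi Qch) ?pi_pdiv.
  by apply/eqP; rewrite -(dvdn_pcharf pp) pdiv_dvd.
exists r; split.
- rewrite -separable_prod_XsubC -e unlock /separable_poly.
  rewrite (_ : p^`() = (-1) *: 1); first by rewrite coprimepZr ?oppr_eq0 ?oner_eq0 // coprimep1.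
  by rewrite derivB derivXn derivX -scaler_nat Q0 scale0r sub0r scaleN1r.
- by apply: succn_inj; rewrite -(size_prod_XsubC r id) -e size_polyDl // size_polyXn.
move=> a; rewrite -root_prod_XsubC -e /root hornerD hornerN hornerXn hornerX subr_eq0 //.
Qed.

Variable kap : nat.
Hypotheses (kap1 : (1 < kap)%N) (kch : [pchar L].-nat kap) (kK : forall a, jL a ^+ kap = jL a).
Hypothesis n0 : n%:R != 0 :> k.

Lemma frob_pow r : [/\ (0 < kap ^ r)%N, [pchar L].-nat (kap ^ r)%N & forall a, jL a ^+ (kap ^ r) = jL a].
Proof.
split; first by rewrite expn_gt0 (ltnW kap1).
  by rewrite pnatX kch.
by move=> a; elim: r => [|r IH]; rewrite ?expn0 ?expr1 // expnS exprM kK.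
Qed.

(** The derivative has degree below [n] in [Y] and leading coefficient [n], nonzero in [k], so
    [comb_eq0] applies. Its zeros on the curve control the abscissas with fewer than [n]
    ordinates. *)
Lemma deriv_phi_neq0 : bev phi^`() != 0.
Proof.
have [mo sz] := size_phi (idfun : {rmorphism {poly k} -> {poly k}}).
rewrite map_poly_id // in mo sz.
have sd : (size phi^`() <= n)%N.
  by rewrite -ltnS -sz lt_size_deriv // -size_poly_eq0 sz.
apply/eqP; rewrite /PlaneModel.bev (@horner_coef_wide _ n); last first.
  by apply: leq_trans (size_poly _ _) sd.
under eq_bigr => i _ do rewrite coef_map.
move=> h; have := comb_eq0 (u := fun i : 'I_n => phi^`()`_i) h ord_max.
rewrite coef_deriv /= (_ : phi`_n = 1); last first.
  by move: mo; rewrite monicE lead_coefE sz => /eqP.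
move/eqP; rewrite -polyC_natr polyC_eq0; exact/negP.
Qed.

Theorem stepanov_bound : exists C r0, forall r, (r0 <= r)%N -> exists pts : seq (L * L),
  [/\ uniq pts,
    forall p, p \in pts <-> [/\ on_curve (ev p.1) p.2, p.1 ^+ (kap ^ (2 * r)) = p.1 & p.2 ^+ (kap ^ (2 * r)) = p.2],
    (size pts <= kap ^ (2 * r) + C * kap ^ r)%N & (kap ^ (2 * r) <= size pts + C * kap ^ r)%N].
Proof.
pose C0 := (1 + n * (om * n + n + 3) + om * n)%N.
have [b eb] : exists b : nat, o (bev phi^`()) = b.
  by have := bev_ge0 deriv_phi_neq0; case: (o _) => // b _; exists b.
exists (n * (b + C0))%N, ((om * n + n + 2) * (om * n + n + 2))%N => r hr.
have [R0 Rch RK] := frob_pow r; have [Q0 Qch QK] := frob_pow (2 * r).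
have eQ : (kap ^ (2 * r) = kap ^ r * kap ^ r)%N by rewrite mul2n -addnn expnD.
have rR : (r < kap ^ r)%N by apply: ltn_expl.
set Q := (kap ^ (2 * r))%N in Q0 Qch QK eQ *; set R := (kap ^ r)%N in R0 Rch RK eQ rR *.
have Q1 : (1 < Q)%N by rewrite eQ; apply: (@leq_trans (R * 1)); [lia|rewrite leq_mul2l R0 orbT].
have [] := @stepanov_params n (om * n) R _ (leq_trans hr (ltnW rR)) => // Tu [Tw [muR Tuw Tb]].
have [w [w0 wle Mw]] := stepanov_aux R0 Rch muR Tuw.
have [s [us ss ms]] := fixed_seq Q1 Qch.
have /choice[rt rtE] a : exists rt : seq L, map_poly (ev a) phi = \prod_(z <- rt) ('X - z%:P).
  have [rt e] := closed_field_poly_normal (map_poly (ev a) phi); exists rt.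
  by move: e; have [/monicP -> _] := size_phi (ev a); rewrite scale1r.
have rtP a z : z \in rt a <-> on_curve (ev a) z.
  rewrite -root_prod_XsubC -rtE on_curveE; split=> [/rootP //|h]; exact/rootP.
have srt a : size (rt a) = n.
  by apply: succn_inj; rewrite -(size_prod_XsubC (rt a) id) -rtE (size_phi (ev a)).2.
(* All points with abscissa fixed by the [Q]-Frobenius; [pts] and [pts'] separate them by whether
   the ordinate is fixed too. *)
pose all := [seq (a, z) | a <- s, z <- undup (rt a)].
have uall : uniq all.
  by apply: allpairs_uniq_dep => // [a _|[a z] [a' z'] _ _ /= [-> ->]] //; exact: undup_uniq.
have mall a z : ((a, z) \in all) <-> a ^+ Q = a /\ on_curve (ev a) z.
  split=> [/allpairsPdep[a' [z' [ha hz [-> ->]]]]|[ha hz]].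
    by move: ha hz; rewrite ms mem_undup => /eqP ? /rtP.
  by apply/allpairsPdep; exists a, z; rewrite ms ha eqxx mem_undup; split=> //; apply/rtP.
pose pts := [seq p <- all | p.2 ^+ Q == p.2].
pose pts' := [seq p <- all | p.2 ^+ Q != p.2].
have split_all : (size all = size pts + size pts')%N by rewrite !size_filter count_predC.
have eRR : Q = (R * R)%N := eQ.
have b1 : (size pts <= (n * Tu + om * n) + R * (n * Tw + om * n))%N.
  rewrite -lez_nat; apply: le_trans (zero_bound (Gf_neq0 muR w0) (filter_uniq _ uall) _) _.
    case=> a z; rewrite mem_filter /= => /andP[/eqP hz /mall[ha hc]]; split=> //.
    by apply: Gf_vanish => //; rewrite -eRR.
  by case: (ole_Gf R0 wle) => // /eqP; rewrite (negPf (Gf_neq0 muR w0)).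
have b2 : (size pts' <= ((n * Tu + om * n) + R * (n * Tw + om * n)) * nu)%N.
  rewrite -lez_nat; apply: le_trans (zero_bound (Hf_neq0 muR w0) (filter_uniq _ uall) _) _.
    case=> a z; rewrite mem_filter /= => /andP[hz /mall[ha hc]]; split=> //.
    (* The preimage [z1] of [z] under the [Q]-Frobenius is the second ordinate over [a]; it differs
       from [z] because [z] is not fixed. *)
    have : size ('X^Q - z%:P : {poly L}) != 1%N by rewrite size_XnsubC // eqSS -lt0n.
    case/closed_rootP => z1; rewrite /root hornerD hornerN hornerXn hornerC subr_eq0 => /eqP z1E.
    apply: (Hf_vanish R0 Rch RK muR Tuw Mw (b1 := z1)) => //; rewrite -?eRR //.
      by apply: contraNneq hz => e; rewrite -{1}e z1E.
    apply/on_curveE/eqP; have /on_curveE : on_curve (ev (a ^+ Q)) (z1 ^+ Q) by rewrite ha z1E.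
    by rewrite -bev_frob // => /eqP; rewrite expf_eq0 Q0.
  by case: (ole_Hf R0 wle) => // /eqP; rewrite (negPf (Hf_neq0 muR w0)).
(* The abscissas with a multiple ordinate. [zz] selects such an ordinate, which is a zero of the
   derivative of [phi]. *)
pose bad := [seq a <- s | ~~ uniq (rt a)].
pose zz a := nth 0 (rt a) (find (fun z => (map_poly (ev a) phi)^`().[z] == 0) (rt a)).
have b3 : (size bad <= b)%N.
  rewrite -lez_nat -eb -(size_map (fun a => (a, zz a))).
  apply: zero_bound deriv_phi_neq0 _ _.
    by rewrite map_inj_uniq ?filter_uniq // => a1 a2 [].
  move=> _ /mapP[a + ->] /=; rewrite mem_filter => /andP[nu_a _].
  have hh : has (fun z => (map_poly (ev a) phi)^`().[z] == 0) (rt a).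
    apply: contraNT nu_a => nh; rewrite -separable_prod_XsubC -rtE unlock /separable_poly.
    apply: Pdiv.ClosedField.root_coprimep => z; rewrite {1}rtE root_prod_XsubC => hz.
    by apply: contraNneq nh => e; apply/hasP; exists z => //; apply/eqP.
  split; first by apply/rtP; rewrite mem_nth -?has_find.
  have /eqP <- := nth_find 0 hh; by rewrite /PlaneModel.bev -deriv_map.
have b4 : (n * Q <= size all + n * b)%N.
  rewrite size_allpairs_dep sumnE big_map.
  have -> : (n * Q = \sum_(a <- s | uniq (rt a)) n + n * size bad)%N.
    by rewrite big_const_seq iter_addn_0 /bad size_filter -mulnDr -ss -(count_predC (fun a => uniq (rt a))).
  rewrite leq_add ?leq_mul // big_mkcond; apply: leq_sum => a _; case: ifP => // ua.
  by rewrite undup_id // srt.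
exists pts; split.
- exact: filter_uniq.
- case=> a z; rewrite mem_filter /=; split=> [/andP[/eqP hz /mall[]]//|[hc ha hz]].
  by rewrite hz eqxx /=; apply/mall.
- rewrite eQ; apply: leq_trans b1 _; apply: leq_trans Tb _; rewrite leq_add2l leq_mul2r.
  by rewrite -/C0 (leq_trans (leq_addl b C0)) ?orbT // leq_pmull.
by apply: stepanov_arith b4 split_all b2 _ => //; rewrite eQ.
Qed.

End Points.
End Valued.
End PlaneModel.

(** * Functions regular outside one place *)

Section RingA.
Variables (K : finFieldType) (F : fieldType) (iota : {rmorphism K -> F}).
Variable P : place iota.

Definition inA (z : F) := forall P' : place iota, P' != P -> sval P' z.

Lemma inA_const a : inA (iota a).
Proof. by move=> P' _; exact: vr_const (svalP P') _. Qed.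
Lemma inA0 : inA 0. Proof. by rewrite -(rmorph0 iota); exact: inA_const. Qed.
Lemma inA1 : inA 1. Proof. by rewrite -(rmorph1 iota); exact: inA_const. Qed.
Lemma inAD z w : inA z -> inA w -> inA (z + w).
Proof. by move=> h h' P' ne; apply: (vrD (svalP P')); [exact: h|exact: h']. Qed.
Lemma inAM z w : inA z -> inA w -> inA (z * w).
Proof. by move=> h h' P' ne; apply: (vrM (svalP P')); [exact: h|exact: h']. Qed.
Lemma inAN z : inA z -> inA (- z).
Proof. by move=> h; rewrite -mulN1r -(rmorphN1 iota); apply: inAM => //; exact: inA_const. Qed.
Lemma inA_sum (I : Type) (r : seq I) (Q : pred I) (G : I -> F) :
  (forall i, Q i -> inA (G i)) -> inA (\sum_(i <- r | Q i) G i).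
Proof. by move=> h; elim/big_rec: _ => [|i x qi hx]; [exact: inA0|apply: inAD => //; exact: h]. Qed.

Definition Apred : {pred F} := fun z => `[< inA z >].
Lemma ApredP z : z \in Apred <-> inA z. Proof. by split=> [/asboolP|h] //; apply/asboolP. Qed.

Fact Apred_subring : subring_closed Apred.
Proof.
split=> [|z w|z w]; first by apply/ApredP; exact: inA1.
  by move=> /ApredP hz /ApredP hw; apply/ApredP; apply: inAD => //; exact: inAN.
by move=> /ApredP hz /ApredP hw; apply/ApredP; exact: inAM.
Qed.
HB.instance Definition _ := GRing.isSubringClosed.Build F Apred Apred_subring.

Record Aring := MkA {aval : F; _ : aval \in Apred}.
HB.instance Definition _ := [isSub for aval].
HB.instance Definition _ := [Choice of Aring by <:].
HB.instance Definition _ := [SubChoice_isSubComNzRing of Aring by <:].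

Lemma avalP (a : Aring) : inA (aval a). Proof. by case: a => z h; apply/ApredP. Qed.
Lemma aval_surj z : inA z -> exists a : Aring, aval a = z.
Proof. by move=> /ApredP h; exists (MkA h). Qed.
Lemma aval_inj : injective aval. Proof. exact: val_inj. Qed.
Lemma aval0 : aval 0 = 0. Proof. exact: (rmorph0 (val : {rmorphism Aring -> F})). Qed.
Lemma aval1 : aval 1 = 1. Proof. exact: (rmorph1 (val : {rmorphism Aring -> F})). Qed.
Lemma avalM a b : aval (a * b) = aval a * aval b.
Proof. exact: (rmorphM (val : {rmorphism Aring -> F})). Qed.
Lemma avalB a b : aval (a - b) = aval a - aval b.
Proof. exact: (rmorphB (val : {rmorphism Aring -> F})). Qed.
End RingA.

Section Approximation.
Variables (K : finFieldType) (F : fieldType) (iota : {rmorphism K -> F}).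
Hypothesis hFF : function_field iota.
Hypothesis hfull : full_constant_field iota.
Variable B : nat -> nat.
Hypothesis hB : forall r : nat, (1 <= r)%N -> has_card (places_of_degree iota r) (B r).
Variable g : nat.
Hypotheses (hg : genus iota g) (g2 : (2 <= g)%N).
Local Notation VF := (lmodF iota).
Variable P : place iota.
Local Notation inA := (@inA K F iota P).
Implicit Types D : place iota -> int.

Lemma ptE (Q Q' : place iota) : pt Q Q' = (Q' == Q)%:Z :> int. Proof. by []. Qed.
Lemma fmulrnE D n P' : (D *+ n) P' = D P' *+ n.
Proof. by elim: n => [|n IH]; rewrite ?mulr0n // !mulrS addfE IH. Qed.

Lemma ptMnE (Q : place iota) n P' : (pt Q *+ n) P' = if P' == Q then n%:Z else 0.
Proof. by rewrite fmulrnE ptE; case: (P' == Q); rewrite ?mul0rn // -[X in X *+ n]/(1 : int) natz. Qed.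

Lemma Ls_inA D z : (forall P', P' != P -> D P' <= 0) -> Ls D z -> inA z.
Proof.
move=> hD hz P' ne; apply/(vge_vr hFF (svalP P')); apply: vge_le (hz P').
by have := hD P' ne; lia.
Qed.

Lemma inA_Ls z : inA z -> exists n, Ls (pt P *+ n) z.
Proof.
move=> hz; exists `|ord (sval P) z|%N => P'; rewrite ptMnE; have [->|ne] := eqVneq P' P.
  by right; lia.
by rewrite oppr0; apply/(vge_vr hFF (svalP P')); exact: hz.
Qed.

Lemma dgP0 (Q : place iota) : (0 < dg Q)%N. Proof. exact: (pdeg_gt0 hFF (svalP Q)). Qed.

(** In this range [ell_large] gives both dimensions exactly; the functions with prescribed poles,
    zeros or residues below come from this gap. *)
Lemma Ls_drop D Q : fs D -> 2 * g%:Z - 1 <= deg D -> dimge (Ls (D + pt Q)) (Ls D) (dg Q).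
Proof.
move=> fD hD; have fQ := fs_pt Q; have fDQ := fsD fD fQ.
have le : leD D (D + pt Q) by move=> P'; rewrite addfE ptE; lia.
have [h _] := Ls_dims hFF hg fD fDQ le.
have e1 := ell_large hFF hfull hB hg g2 fD hD.
have e2 : (ell (D + pt Q))%:Z = deg (D + pt Q) + 1 - g%:Z.
  by apply: (ell_large hFF hfull hB hg g2 fDQ); rewrite degD // deg_pt; lia.
by move: h; have -> : (ell (D + pt Q)%R - ell D = dg Q)%N by move: e2; rewrite degD // deg_pt; lia.
Qed.

Lemma dimge_elt (V : lmodType K) (U W : V -> Prop) n : subsp W -> (0 < n)%N -> dimge U W n -> exists2 z, U z & ~ W z.
Proof.
case: n => // n sW _ [s hs ind]; exists (s ord0) => // h0.
have := ind (\row_i (i == ord0)%:R); rewrite (bigD1 ord0) //= mxE eqxx scale1r big1 ?addr0; last first.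
  by move=> i i0; rewrite mxE (negPf i0) scale0r.
by move=> /(_ h0)/rowP/(_ ord0); rewrite !mxE eqxx => /eqP; rewrite oner_eq0.
Qed.

Lemma deg_ptMn (Q : place iota) n : deg (pt Q *+ n) = (dg Q * n)%N%:Z.
Proof. by rewrite degMn; [rewrite deg_pt -mulr_natr natz PoszM|exact: fs_pt]. Qed.

Lemma deg_ptMn_ge (Q : place iota) n : n%:Z <= deg (pt Q *+ n).
Proof. by rewrite deg_ptMn lez_nat leq_pmull // dgP0. Qed.

Lemma exists_pole m : (2 * g <= m)%N -> exists u, [/\ inA u, u != 0 & ord (sval P) u = - m.+1%:Z].
Proof.
move=> hm; have h : 2 * g%:Z - 1 <= deg (pt P *+ m) by apply: le_trans (deg_ptMn_ge P m); lia.
have fm : fs (pt P *+ m) := fsMn m (fs_pt P).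
have [u hu nu] := dimge_elt (subsp_Ls hFF _) (dgP0 P) (Ls_drop P fm h).
have uA : inA u by apply: Ls_inA hu => P' ne; rewrite addfE ptMnE ptE (negPf ne).
have u0 : u != 0 by apply/eqP => e; apply: nu; rewrite e; exact: (subsp_Ls hFF _).1.
exists u; split=> //; have := hu P; rewrite addfE ptMnE ptE eqxx.
case=> [/eqP|h1]; first by rewrite (negPf u0).
have : ~ (- m%:Z <= ord (sval P) u).
  move=> h2; apply: nu => P'; rewrite ptMnE; have [->|ne] := eqVneq P' P.
    by right.
  by rewrite oppr0; apply/(vge_vr hFF (svalP P')); exact: uA.
by move: h1; lia.
Qed.

(** For [n > M0] multiplication by [u], whose pole has order [e], carries a basis of one step of the
    filtration of [A] onto a basis of the step at [n], as both have dimension [dg P]. So [u] and a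
    basis of [L(M0 P)] generate. Generation is stated as an induction principle. *)
Lemma A_generated : exists bs : seq F, (forall b, b \in bs -> inA b) /\
  forall T : F -> Prop, (forall a, T (iota a)) -> (forall z w, T z -> T w -> T (z + w)) ->
    (forall z w, T z -> T w -> T (z * w)) -> (forall b, b \in bs -> T b) -> forall z, inA z -> T z.
Proof.
have [u [uA u0 ou]] := exists_pole (leqnn (2 * g)).
pose e := (2 * g).+1; pose M0 := (2 * e)%N.
have fM n : fs (pt P *+ n) := fsMn n (fs_pt P).
have [nM hnM] := Ls_fin hFF hg (fM M0).
have [r [s [_ _ [sL _ sgen]]]] := dim_basis (subsp_zero VF) hnM.
have LA n z : Ls (pt P *+ n) z -> inA z.
  by apply: Ls_inA => P' ne; rewrite ptMnE (negPf ne).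
exists (u :: [seq s i | i <- enum 'I_r]); split.
  by move=> b; rewrite inE => /orP[/eqP -> //|/mapP[i _ ->]]; exact: LA (sL i).
move=> T TC TD TM Tb.
have Tsum m (c : 'rV[K]_m) (t : 'I_m -> VF) : (forall i, T (t i)) -> T (\sum_i c 0 i *: t i).
  move=> ht; elim/big_rec: _ => [|i x _ hx]; first by rewrite -(rmorph0 iota).
  by apply: TD => //; rewrite lmodF_scaleE; apply: TM.
have key n : forall z, Ls (pt P *+ n) z -> T z.
  elim/ltn_ind: n => n IH z hz; case: (leqP n M0) => nM0.
    have hz' : Ls (pt P *+ M0) z.
      by apply: Ls_mono hz => P'; rewrite !ptMnE; case: (P' == P).
    have [c hc] := sgen z hz'; have -> : z = \sum_i c 0 i *: s i by apply/eqP; rewrite -subr_eq0; apply/eqP.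
    by apply: Tsum => i; apply: Tb; rewrite inE map_f ?orbT // mem_enum.
  have nE : n = (n - e - 1 + 1 + e)%N by rewrite /M0 /e in nM0 *; lia.
  pose n1 := (n - e - 1)%N.
  have h1 : 2 * g%:Z - 1 <= deg (pt P *+ n1) by apply: le_trans (deg_ptMn_ge P n1); rewrite /n1 /M0 /e in nM0 *; lia.
  have [t tL tind] := Ls_drop P (fM n1) h1.
  have e1 : pt P *+ n1 + pt P = pt P *+ n1.+1 by rewrite mulrSr.
  have ut i : Ls (pt P *+ n) (u * t i).
    move=> P'; have := tL i P'; rewrite e1 !ptMnE; have [->|ne] := eqVneq P' P => h.
      have -> : - n%:Z = - e%:Z + - n1.+1%:Z by rewrite [in LHS]nE /n1; lia.
      by apply: (vgeM hFF (svalP P)) => //; right; rewrite ou.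
    rewrite oppr0 in h *; rewrite -[0]addr0; apply: (vgeM hFF (svalP P')) => //.
    by apply/(vge_vr hFF (svalP P')); exact: uA.
  have e2 : pt P *+ n = pt P *+ n.-1 + pt P by rewrite -mulrSr prednK //; lia.
  have uind : indep_mod (Ls (pt P *+ n.-1)) (fun i => u * t i : VF).
    move=> c hc; apply: tind.
    have sL' : Ls (pt P *+ n1 + pt P) (\sum_i c 0 i *: t i) := subsp_comb _ (subsp_Ls hFF _) tL.
    have eu : \sum_i c 0 i *: (u * t i : VF) = u * (\sum_i c 0 i *: t i) :> F.
      by rewrite mulr_sumr; apply: eq_bigr => i _; rewrite !lmodF_scaleE mulrCA.
    move=> P'; rewrite ptMnE; have [->|ne] := eqVneq P' P; last first.
      by have := sL' P'; rewrite addfE ptMnE ptE (negPf ne).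
    have := hc P; rewrite eu ptMnE eqxx => /(vge_mul_sub hFF (svalP P) u0).
    by apply: vge_le; rewrite ou [in X in _ <= X]nE /n1; lia.
  have hd : dimle (Ls (pt P *+ n)) (Ls (pt P *+ n.-1)) (dg P) by rewrite e2; exact: Ls_step.
  have [_ _ gen] := indep_basis (subsp_Ls hFF _) hd ut uind.
  have [c hc] := gen z hz; rewrite -(subrK (\sum_i c 0 i *: (u * t i : VF)) z); apply: TD.
    by apply: IH hc; lia.
  apply: Tsum => i; apply: TM; first by apply: Tb; rewrite mem_head.
  by apply: (IH n1.+1); [rewrite /n1; lia|rewrite -e1; exact: tL].
by move=> z /inA_Ls[n hn]; exact: key hn.
Qed.

(** By [Ls_drop] there are [dg P'] functions in [L(n P)] independent modulo [L(n P - P')]. Their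
    residues at [P'] are independent, hence span the residue field. *)
Lemma A_residue (P' : place iota) z : P' != P -> sval P' z ->
  exists2 a, inA a & in_place (sval P') (z - a).
Proof.
move=> ne hz; pose n := (2 * g + dg P')%N; pose D := pt P *+ n - pt P'.
have fD : fs D := fsB (fsMn n (fs_pt P)) (fs_pt P').
have hD : 2 * g%:Z - 1 <= deg D.
  rewrite degB ?deg_pt; [|exact: fsMn (fs_pt P)|exact: fs_pt].
  by have := deg_ptMn_ge P n; rewrite /n; lia.
have [s sL sind] := Ls_drop P' fD hD; rewrite subrK in sL.
have hP' := svalP P'.
have sO i : sval P' (s i).
  by apply/(vge_vr hFF hP'); have := sL i P'; rewrite ptMnE (negPf ne) oppr0.
have sA i : inA (s i) by apply: Ls_inA (sL i) => Q nQ; rewrite ptMnE (negPf nQ).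
have sind' : indep_mod (in_place (sval P') : VF -> Prop) s.
  move=> c hc; apply: sind => Q; rewrite /D addfE oppfE ptMnE ptE.
  have [->|nQ] := eqVneq Q P'; last first.
    by have := subsp_comb c (subsp_Ls hFF _) sL Q; rewrite ptMnE subr0.
  by rewrite (negPf ne) add0r opprK; apply/(vge_pl hFF hP').
have [_ _ gen] := indep_basis (subsp_pl hP') (pdeg_dimle hFF hP') sO sind'.
have [c hc] := gen z hz; exists (\sum_i c 0 i *: s i) => //.
by apply: inA_sum => i _; rewrite lmodF_scaleE; apply: inAM => //; exact: inA_const.
Qed.

Lemma A_separates (P1 P2 : place iota) : P1 != P -> P2 != P -> P1 != P2 ->
  exists2 a, inA a & in_place (sval P1) a /\ ~ in_place (sval P2) a.
Proof.
move=> n1 n2 n12; pose n := (2 * g + dg P1 + dg P2)%N; pose D := pt P *+ n - pt P1 - pt P2.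
have fD1 : fs (pt P *+ n - pt P1) := fsB (fsMn n (fs_pt P)) (fs_pt P1).
have fD : fs D := fsB fD1 (fs_pt P2).
have hD : 2 * g%:Z - 1 <= deg D.
  rewrite degB ?deg_pt // ?degB ?deg_pt; [|exact: fsMn (fs_pt P)|exact: fs_pt|exact: fs_pt].
  by have := deg_ptMn_ge P n; rewrite /n; lia.
have [a] := dimge_elt (subsp_Ls hFF _) (dgP0 P2) (Ls_drop P2 fD hD); rewrite subrK => ha na.
exists a; first by apply: Ls_inA ha => Q nQ; rewrite addfE oppfE ptMnE ptE (negPf nQ); lia.
split.
  apply/(vge_pl hFF (svalP P1)); have := ha P1; rewrite addfE oppfE ptMnE ptE eqxx (negPf n1).
  by rewrite add0r opprK.
move=> h2; apply: na => Q; have := ha Q; rewrite /D !(addfE, oppfE) ptMnE !ptE.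
have [->|nQ] := eqVneq Q P2; last by rewrite subr0.
move=> _; rewrite (negPf n2) eq_sym (negPf n12) subr0 add0r opprK.
exact/(vge_pl hFF (svalP P2)).
Qed.

(** [M] is the divisor of poles of [z], and [n] is large enough for Riemann's inequality to give a
    nonzero function in [L(n P - M)]. *)
Lemma A_denominator z : exists a, [/\ inA a, a != 0 & inA (a * z)].
Proof.
have [->|z0] := eqVneq z 0; first by exists 1; rewrite mulr0 oner_neq0; split=> //; [exact: inA1|exact: inA0].
pose M : place iota -> int := fun Q => Num.max 0 (- dv z Q).
have fM : fs M.
  have [s hs] := fs_dv hFF hB z0; exists s => Q hQ; apply: hs; apply: contraNneq hQ => e.
  by rewrite /M e oppr0 maxxx.
pose n := (`|deg M| + g)%N; pose D := pt P *+ n - M.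
have fn : fs (pt P *+ n) := fsMn n (fs_pt P).
have fD : fs D := fsB fn fM.
have [|a a0 ha] := ell_gt0 hFF hg fD.
  have := riemann hFF hg fD; rewrite degB // -ltz_nat; have := deg_ptMn_ge P n; rewrite /n; lia.
have h Q : Q != P -> vge (iota := iota) (sval Q) (M Q) a.
  by move=> nQ; have := ha Q; rewrite /D addfE oppfE ptMnE (negPf nQ) add0r opprK.
have M1 Q : 0 <= M Q by rewrite /M le_max lexx.
have M2 Q : - ord (sval Q) z <= M Q by rewrite /M le_max lexx orbT.
exists a; split=> // Q nQ; apply/(vge_vr hFF (svalP Q)).
  exact: vge_le (h Q nQ).
apply: (@vge_le _ _ _ _ (M Q + ord (sval Q) z)); first by have := M2 Q; lia.
by apply: (vgeM hFF (svalP Q)); [exact: h|right].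
Qed.

End Approximation.

(** * Finite fields *)

Lemma mk_rmorph (R S : nzRingType) (f : R -> S) : zmod_morphism f -> monoid_morphism f ->
  exists h : {rmorphism R -> S}, h =1 f.
Proof.
move=> fB fM.
pose h := HB.pack_for {rmorphism R -> S} f (GRing.isZmodMorphism.Build R S f fB)
  (GRing.isMonoidMorphism.Build R S f fM).
by exists h.
Qed.

Lemma rel_rmorph (R S : nzRingType) (r : R -> S -> Prop) :
  (forall a, exists b, r a b) -> (forall a b b', r a b -> r a b' -> b = b') ->
  (forall a b a' b', r a b -> r a' b' -> r (a - a') (b - b')) ->
  (forall a b a' b', r a b -> r a' b' -> r (a * a') (b * b')) -> r 1 1 ->
  exists h : {rmorphism R -> S}, forall a, r a (h a).
Proof.
move=> /choice[f hf] ru rB rM r1; have [||h e] := @mk_rmorph R S f.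
- by move=> a b; apply: ru (hf _) _; apply: rB.
- by split=> [|a b]; [apply: ru r1 | apply: ru (hf _) _; apply: rM].
by exists h => a; rewrite e.
Qed.

Lemma mod_exp_dvd q f n : (1 < q)%N -> (0 < f)%N -> ((q ^ f - 1) %| (q ^ n - 1))%N -> (f %| n)%N.
Proof.
move=> q1 f0; elim/ltn_ind: n => n IH h.
have qp m : (0 < q ^ m)%N by rewrite expn_gt0 (ltnW q1).
case: (ltnP n f) => [lt|le].
  case: (posnP n) => [-> //|n0]; have : (q ^ n < q ^ f)%N by rewrite ltn_exp2l.
  have : (q ^ f - 1 <= q ^ n - 1)%N.
    apply: dvdn_leq => //; have : (q ^ 0 < q ^ n)%N by rewrite ltn_exp2l.
    by rewrite expn0; lia.
  by have := qp n; lia.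
have e : (q ^ n - 1 = q ^ (n - f) * (q ^ f - 1) + (q ^ (n - f) - 1))%N.
  have -> : (q ^ n = q ^ (n - f) * q ^ f)%N by rewrite -expnD subnK.
  have h1 : (q ^ (n - f) <= q ^ (n - f) * q ^ f)%N by rewrite leq_pmulr.
  by have := qp (n - f)%N; rewrite mulnBr muln1; move: (_ * _)%N h1 => u h1; lia.
rewrite -(subnKC le) dvdn_addr //; apply: IH; first by lia.
by move: h; rewrite e dvdn_addr // dvdn_mull.
Qed.

Section Frobenius.
Variables (K : finFieldType) (L : fieldType) (j : {rmorphism K -> L}).
Local Notation q := #|K|.

Lemma card_gt1 : (1 < q)%N. Proof. exact: finNzRing_gt1. Qed.

Lemma pchar_card : [pchar L].-nat q.
Proof.
have h : (pdiv q).-nat q.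
  by have := finField_is_abelem K; rewrite /is_abelem cardsT => /abelem_pgroup; rewrite /pgroup cardsT.
have /p_natP[n e] := h.
have pc : pdiv q \in [pchar K] by apply: card_finPcharP e _; exact/pdiv_prime/card_gt1.
have pc' : pdiv q \in [pchar L] by rewrite (fmorph_pchar j).
by rewrite (eq_pnat _ (pcharf_eq pc')).
Qed.

Lemma pchar_cardX n : [pchar L].-nat (q ^ n)%N.
Proof. by rewrite pnatX pchar_card. Qed.

Lemma frob_exists n : exists fr : {rmorphism L -> L}, forall a, fr a = a ^+ (q ^ n).
Proof.
have [||fr e] := @mk_rmorph L L (fun a => a ^+ (q ^ n)); last by exists fr.
  by move=> a b; rewrite exprDn_pchar ?pchar_cardX // exprNn_pchar ?pchar_cardX.
by split=> [|a b]; rewrite ?expr1n ?exprMn.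
Qed.

Lemma fix_const n a : j a ^+ (q ^ n) = j a.
Proof.
elim: n => [|n IH]; first by rewrite expn0 expr1.
by rewrite expnSr exprM IH -rmorphXn expf_card.
Qed.

Lemma fix_expn n m (a : L) : a ^+ (q ^ n) = a -> a ^+ (q ^ (n * m)) = a.
Proof. by move=> h; elim: m => [|m IH]; rewrite ?muln0 ?expn0 ?expr1 // mulnS expnD exprM h. Qed.

Lemma fix_const_inv a : a ^+ q = a -> exists b, a = j b.
Proof.
move=> ha; pose s := [seq j b | b <- enum K].
have us : uniq s by rewrite map_inj_uniq ?enum_uniq //; exact: fmorph_inj.
have [/mapP[b _ ->]|ns] := boolP (a \in s); first by exists b.
pose p : {poly L} := 'X^q - 'X.
have sp : size p = q.+1.
  by rewrite size_polyDl ?size_polyXn // size_polyN size_polyX ltnS card_gt1.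
have p0 : p != 0 by rewrite -size_poly_eq0 sp.
have : (size (a :: s) < size p)%N.
  apply: max_poly_roots => //; last by rewrite /= ns.
  apply/allP => b; rewrite /root hornerD hornerN hornerXn hornerX subr_eq0 inE.
  by case/orP => [/eqP ->|/mapP[c _ ->]]; [rewrite ha|have := fix_const 1 c; rewrite expn1 => ->].
by rewrite sp /= size_map -cardE ltnn.
Qed.

Lemma poly_fix (p : {poly L}) : (forall i, p`_i ^+ q = p`_i) -> exists r, p = map_poly j r.
Proof.
move=> h; have /choice[c hc] i : exists b, p`_i = j b by apply: fix_const_inv.
exists (\poly_(i < size p) c i); apply/polyP => i; rewrite coef_map coef_poly.
by case: ltnP => [_|le]; [exact: hc|rewrite raddf0 nth_default].
Qed.

Lemma horner_fix (r : {poly K}) n (a : L) : (map_poly j r).[a] ^+ (q ^ n) = (map_poly j r).[a ^+ (q ^ n)].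
Proof.
have [fr e] := frob_exists n; rewrite -!e -horner_map -map_poly_comp; congr horner.
by apply/polyP => i; rewrite !coef_map /= e fix_const.
Qed.

End Frobenius.

Section PrimitiveElement.
Variables (K : finFieldType) (L : closedFieldType) (j : {rmorphism K -> L}) (f : nat).
Hypothesis f0 : (0 < f)%N.
Local Notation q := #|K|.
Let qf1 : (1 < q ^ f)%N. Proof. by rewrite -[1%N](expn0 q) ltn_exp2l // card_gt1. Qed.

Lemma exists_prim : exists z : L, (q ^ f - 1).-primitive_root z.
Proof.
have [r [ur sr hr]] := fixed_seq qf1 (pchar_cardX j f).
pose r' := rem 0 r; have r0 : 0 \in r by rewrite hr expr0n (gtn_eqF (ltnW qf1)).
have /hasP[z _ hz] : has (q ^ f - 1).-primitive_root r'; last by exists z.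
apply: has_prim_root; first by lia.
- apply/allP => z hz; rewrite unity_rootE.
  have : z \in r /\ z != 0 by move: hz; rewrite /r' (rem_filter _ ur) mem_filter => /andP[/= ? ?].
  rewrite hr => -[/eqP e z0]; apply/eqP; apply: (mulIf z0).
  by rewrite -exprSr subn1 prednK ?mul1r // ltnW.
- exact: rem_uniq.
by rewrite size_rem // sr subn1.
Qed.

Variable z : L.
Hypothesis hz : (q ^ f - 1).-primitive_root z.

Lemma prim_fix : z ^+ (q ^ f) = z.
Proof.
have e : (q ^ f = (q ^ f - 1).+1)%N by lia.
by rewrite e exprS prim_expr_order // mulr1.
Qed.

Lemma prim_conj_inj i i' : (i < f)%N -> (i' < f)%N -> z ^+ (q ^ i) = z ^+ (q ^ i') -> i = i'.
Proof.
have q1 := card_gt1 K.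
have main a b : (a <= b)%N -> (b < f)%N -> z ^+ (q ^ a) = z ^+ (q ^ b) -> a = b.
  move=> ab bf /eqP; rewrite (eq_prim_root_expr hz) => /eqP e.
  apply/eqP; rewrite eqn_leq ab /= leqNgt; apply/negP => lt.
  have l1 : (q ^ a < q ^ b)%N by rewrite ltn_exp2l.
  have l2 : (q ^ b * 2 <= q ^ f)%N.
    by apply: (@leq_trans (q ^ b * q)%N); [rewrite leq_mul2l q1 orbT|rewrite -expnSr leq_exp2l].
  have l3 : (0 < q ^ a)%N by rewrite expn_gt0 (ltnW q1).
  by move: e; rewrite !modn_small; lia.
move=> hi hi' e; case: (leqP i i') => [le|/ltnW le]; first exact: main.
by symmetry; apply: main.
Qed.

Lemma prim_pow (a : L) : a ^+ (q ^ f) = a -> a != 0 -> exists i, a = z ^+ i.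
Proof.
move=> ha a0; have /(prim_rootP hz)[i ->] : a ^+ (q ^ f - 1) = 1; last by exists i.
by apply: (mulIf a0); rewrite -exprSr subn1 prednK ?mul1r // ltnW.
Qed.

Definition conjs := [seq z ^+ (q ^ i) | i <- iota 0 f].

Lemma uniq_conjs : uniq conjs.
Proof.
rewrite map_inj_in_uniq ?iota_uniq // => i i'; rewrite !mem_iota /= !add0n.
exact: prim_conj_inj.
Qed.

(** The product over the conjugates of [z] is invariant under Frobenius, hence has coefficients in
    [K]; a polynomial over [K] that vanishes at one conjugate vanishes at all of them. *)
Lemma minpoly_exists : exists m : {poly K}, [/\ map_poly j m = \prod_(a <- conjs) ('X - a%:P),
  m \is monic, size m = f.+1, irreducible_poly m & forall p, (map_poly j p).[z] = 0 -> m %| p].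
Proof.
have [fr e] := frob_exists j 1; rewrite expn1 in e.
pose M := \prod_(a <- conjs) ('X - a%:P).
have frM : map_poly fr M = M.
  rewrite /M rmorph_prod big_map [RHS]big_map.
  rewrite (eq_bigr (fun i => 'X - (z ^+ (q ^ i.+1))%:P)); last first.
    by move=> i _; rewrite rmorphB /= map_polyX map_polyC /= e -exprM -expnSr.
  have -> : iota 0 f = index_iota 0 f by rewrite /index_iota subn0.
  case: (f) f0 prim_fix => // f' _ pf.
  by rewrite big_nat_recr //= [RHS]big_nat_recl //= expn0 expr1 pf mulrC.
have [m em] : exists m, M = map_poly j m.
  apply: poly_fix => i; rewrite -e -coef_map; by rewrite frM.
have mon : m \is monic by rewrite -(map_monic j) -em monic_prod_XsubC.
have sz : size m = f.+1 by rewrite -(size_map_poly j) -em size_prod_XsubC size_map size_iota.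
have rt i p : (map_poly j p).[z ^+ (q ^ i)] = 0 -> (i < f)%N -> (map_poly j p).[z] = 0.
  move=> h lt; have e1 : (z ^+ (q ^ i)) ^+ (q ^ (f - i)) = z.
    by rewrite -exprM -expnD subnKC ?prim_fix // ltnW.
  have := horner_fix j p (f - i) (z ^+ (q ^ i)); rewrite h e1 => <-.
  by rewrite expr0n gtn_eqF // expn_gt0 (ltnW (card_gt1 K)).
have dv p : (map_poly j p).[z] = 0 -> m %| p.
  move=> h; rewrite -(dvdp_map j) -em; apply: uniq_roots_dvdp; last by rewrite uniq_rootsE uniq_conjs.
  apply/allP => _ /mapP[i _ ->]; apply/rootP.
  by rewrite -horner_fix h expr0n gtn_eqF // expn_gt0 ltnW // card_gt1.
exists m; split=> //; split=> [|p sp pm]; first by rewrite sz ltnS.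
apply/andP; split=> //; apply: dv.
have : size (map_poly j p) != 1%N by rewrite size_map_poly.
case/closed_rootP => a ra; have : root M a by rewrite em; apply: root_dvdp ra; rewrite dvdp_map.
rewrite root_prod_XsubC => /mapP[i]; rewrite mem_iota /= add0n => lt ea.
by apply: (rt i) => //; rewrite -ea; exact/rootP.
Qed.

End PrimitiveElement.

(** On a nonzero common stable subspace of least rank, each eigenspace of each matrix is stable
    again, so it is the whole subspace and all matrices act as scalars. *)
Lemma commuting_eigenvector (L : closedFieldType) n (T : Type) (M : T -> 'M[L]_n) : (0 < n)%N ->
  (forall s t, comm_mx (M s) (M t)) ->
  exists2 v : 'rV[L]_n, v != 0 & forall t, exists a, v *m M t = a *: v.
Proof.
move=> n0 cM.
pose Pr r := `[< exists V : 'M[L]_n, [/\ \rank V = r, (0 < r)%N & forall t, stablemx V (M t)] >].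
have ex : exists r, Pr r.
  exists n; apply/asboolP; exists 1%:M; split=> [|//|t]; first exact: mxrank1.
  by apply: stablemx_full; rewrite row_full_unit unitmx1.
case: (ex_minnP ex) => r /asboolP[V [rV r0 sV]] rmin.
have key t : exists a, V *m M t = a *: V.
  have W0 := row_base_free V; set W := row_base V in W0.
  have /submxP[N eN] : stablemx W (M t) by rewrite stablemx_row_base.
  have : size (char_poly N) != 1%N by rewrite size_char_poly eqSS rV -lt0n.
  case/closed_rootP => a; rewrite -eigenvalue_root_char => /eigenvalueP[u uN u0].
  pose V' := (V :&: eigenspace (M t) a)%MS.
  have uV : (u *m W <= V')%MS.
    rewrite sub_capmx (submx_trans (submxMl _ _)) ?eq_row_base //=.
    by apply/eigenspaceP; rewrite -mulmxA eN mulmxA uN scalemxAl.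
  have V'0 : (0 < \rank V')%N.
    rewrite lt0n mxrank_eq0; apply: contra_neq u0 => e0; move: uV; rewrite e0 submx0 => /eqP.
    by move=> e1; apply: (row_free_inj W0); rewrite mul0mx.
  have : (r <= \rank V')%N.
    apply: rmin; apply/asboolP; exists V'; split=> // s.
    rewrite sub_capmx (submx_trans _ (sV s)) ?submxMr ?capmxSl //=.
    by apply: submx_trans (comm_mx_stable_eigenspace a (cM t s)); rewrite submxMr // capmxSr.
  rewrite -rV => le; have : (V <= eigenspace (M t) a)%MS.
    apply: submx_trans (capmxSr V _); rewrite -(geq_leqif (mxrank_leqif_sup (capmxSl V _))) //.
  by move/eigenspaceP => e; exists a.
have /rowV0Pn[v vV v0] : V != 0 by rewrite -mxrank_eq0 rV -lt0n.
exists v => // t; have [a ea] := key t; exists a.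
by case/submxP: vV => D ->; rewrite -mulmxA ea scalemxAr.
Qed.

(** * Residue homomorphisms *)

Section ResidueHom.
Variables (K : finFieldType) (F : fieldType) (iota : {rmorphism K -> F}).
Variables (L : closedFieldType) (j : {rmorphism K -> L}).
Hypothesis hFF : function_field iota.
Variable O : F -> Prop.
Hypothesis hO : valuation_ring iota O.
Local Notation q := #|K|.
Local Notation f := (pdeg iota O).
Local Notation m := (in_place O).

(** A residue map followed by an embedding of the residue field into [L]. It is a function on all of
    [F], with no multiplicative or additive law imposed on elements outside [O]; its image on [O] is
    the subfield of [q ^ f] elements. *)
Record reshom (rho : F -> L) : Prop := Reshom {
  rh_const : forall a, rho (iota a) = j a;
  rh_add : forall z w, O z -> O w -> rho (z + w) = rho z + rho w;
  rh_mul : forall z w, O z -> O w -> rho (z * w) = rho z * rho w;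
  rh_ker : forall z, O z -> rho z = 0 <-> m z;
  rh_img : forall a, a ^+ (q ^ f) = a <-> exists2 z, O z & rho z = a }.

(** Multiplication by a nonzero [a] permutes the nonzero elements of [s]; compare their products. *)
Lemma group_fix (s : seq L) : uniq s -> 0 \in s ->
  (forall a b, a \in s -> b \in s -> a * b \in s) -> forall a, a \in s -> a ^+ size s = a.
Proof.
move=> us s0 sM a ha; have s1 : (0 < size s)%N by case: (s) s0.
have [->|a0] := eqVneq a 0; first by rewrite expr0n (gtn_eqF s1).
pose t := [seq b <- s | b != 0].
have ut : uniq t := filter_uniq _ us.
have st : size s = (size t).+1.
  have := perm_size (perm_to_rem s0); rewrite /= => ->; congr S.
  by rewrite (rem_filter _ us); congr size; apply: eq_filter => b.
have pt : perm_eq [seq a * b | b <- t] t.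
  have ut' : uniq [seq a * b | b <- t] by rewrite map_inj_uniq //; exact: mulfI.
  apply: uniq_perm => //; apply: (uniq_min_size ut' _ _).2 => [b|]; last by rewrite size_map.
  case/mapP => c; rewrite mem_filter => /andP[c0 hc] ->.
  by rewrite mem_filter mulf_neq0 // sM.
have p0 : \prod_(b <- t) b != 0.
  by rewrite prodf_seq_neq0; apply/allP => b; rewrite mem_filter /= => /andP[].
have : \prod_(b <- t) (a * b) = \prod_(b <- t) b by rewrite -[RHS](perm_big _ pt) big_map.
rewrite big_split /= big_const_seq count_predT iter_mulr_1 => e.
by rewrite st exprS (mulIf p0 (etrans e (esym (mul1r _)))) mulr1.
Qed.

(** The residue field is not built as a type: [M z] is the matrix of multiplication by [z] on it,
    these matrices commute, and [rho z] is the eigenvalue of [M z] on a common eigenvector over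
    [L]. *)
Lemma exists_reshom : exists rho, reshom rho.
Proof.
have f0 := pdeg_gt0 hFF hO; have [s [sO sind sgen]] := pdegP hFF hO.
pose isM z (M : 'M[K]_f) := forall i, m (z * s i - \sum_l iota (M i l) * s l).
have /choice[M hM] z : exists M, O z -> isM z M.
  case: (pselect (O z)) => [hz|nz]; last by exists 0.
  have /choice[c hc] i : exists c : 'I_f -> K, m (z * s i - \sum_l iota (c l) * s l).
    by apply: sgen; apply: (vrM hO).
  exists (\matrix_(i, l) c i l) => _ i; have := hc i; congr in_place; congr (_ - _).
  by apply: eq_bigr => l _; rewrite mxE.
have Mu z N N' : isM z N -> isM z N' -> N = N'.
  move=> h h'; apply/matrixP => i l; apply/eqP; rewrite -subr_eq0; apply/eqP.
  apply: (sind (fun l => N i l - N' i l)).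
  rewrite (_ : \sum_i0 _ = (z * s i - \sum_l iota (N' i l) * s l) - (z * s i - \sum_l iota (N i l) * s l)).
    by apply: (plD hO) => //; apply: (plN hO).
  rewrite opprB addrC subrKA -sumrB; apply: eq_bigr => r _; by rewrite rmorphB mulrBl.
have MD z w : O z -> O w -> M (z + w) = M z + M w.
  move=> hz hw; apply: (Mu (z + w)); first by apply: hM; apply: (vrD hO).
  move=> i; have := plD hO (hM _ hz i) (hM _ hw i); congr in_place.
  rewrite mulrDl addrACA -opprD; congr (_ - _); rewrite -big_split /=.
  by apply: eq_bigr => l _; rewrite mxE rmorphD mulrDl.
have MM z w : O z -> O w -> M (z * w) = M w *m M z.
  move=> hz hw; apply: (Mu (z * w)); first by apply: hM; apply: (vrM hO).
  move=> i; have h1 := plM hO hz (hM _ hw i).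
  have h2 : m (\sum_l iota (M w i l) * (z * s l - \sum_r iota (M z l r) * s r)).
    elim/big_rec: _ => [|l x _ hx]; first exact: pl0 hO.
    by apply: (plD hO) => //; apply: (plM hO); [exact: vr_const hO _|exact: hM].
  have := plD hO h1 h2; congr in_place; rewrite mulrBr mulr_sumr -mulrA.
  rewrite -addrA; congr (_ + _); rewrite -sumrN -big_split /=.
  transitivity (\sum_l - (iota (M w i l) * \sum_r iota (M z l r) * s r)).
    by apply: eq_bigr => l _; ring.
  rewrite sumrN; congr (- _); under [LHS]eq_bigr => l _ do rewrite mulr_sumr.
  rewrite exchange_big; apply: eq_bigr => r _; rewrite mxE rmorph_sum mulr_suml.
  by apply: eq_bigr => l _; rewrite rmorphM mulrA.
have MC a : M (iota a) = a%:M.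
  apply: (Mu (iota a)); first by apply: hM; exact: vr_const hO _.
  move=> i; rewrite (bigD1 i) //= mxE eqxx mulr1n big1 ?addr0 ?subrr; first exact: pl0 hO.
  by move=> l li; rewrite mxE eq_sym (negPf li) rmorph0 mul0r.
have Mm z : m z -> M z = 0.
  move=> hz; apply: (Mu z); first by apply: hM; case: hz.
  move=> i; rewrite big1 ?subr0 => [|l _]; last by rewrite mxE rmorph0 mul0r.
  by rewrite mulrC; apply: (plM hO).
have [|v v0 hv] := @commuting_eigenvector L f {z | O z} (fun t => map_mx j (M (sval t))) f0.
  move=> [z hz] [w hw]; rewrite /comm_mx /= -!map_mxM -!MM //; by rewrite mulrC.
have /choice[rho hr] z : exists a, O z -> v *m map_mx j (M z) = a *: v.
  case: (pselect (O z)) => [hz|nz]; last by exists 0.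
  by have [a ha] := hv (exist _ z hz); exists a.
have vI (a b : L) : a *: v = b *: v -> a = b.
  move/eqP; rewrite -subr_eq0 -scalerBl scalemx_eq0 (negPf v0) orbF subr_eq0 => /eqP //.
have rC a : rho (iota a) = j a.
  by apply: vI; rewrite -hr ?MC ?map_scalar_mx ?mul_mx_scalar //; exact: vr_const hO _.
have rA z w : O z -> O w -> rho (z + w) = rho z + rho w.
  move=> hz hw; apply: vI; rewrite -hr; last by apply: (vrD hO).
  by rewrite MD // map_mxD mulmxDr !hr // scalerDl.
have rM z w : O z -> O w -> rho (z * w) = rho z * rho w.
  move=> hz hw; apply: vI; rewrite -hr; last by apply: (vrM hO).
  by rewrite MM // map_mxM mulmxA hr // -scalemxAl hr // scalerA mulrC.
have rK z : O z -> rho z = 0 <-> m z.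
  move=> hz; split=> [e|h]; last by apply: vI; rewrite -hr // Mm // map_mx0 mulmx0 scale0r.
  apply: contrapT => nz; have [z0 hz'] := vr_unit hO hz nz.
  have := rM _ _ hz hz'; rewrite mulfV // e mul0r -(rmorph1 iota) rC rmorph1 => /eqP.
  by rewrite oner_eq0.
pose el (c : {ffun 'I_f -> K}) := \sum_l iota (c l) * s l.
have elO c : O (el c).
  by apply: (vr_sum hO) => l _; apply: (vrM hO) => //; exact: vr_const hO _.
have rN z : O z -> rho (- z) = - rho z.
  move=> hz; have hm : O (iota (-1)) by exact: vr_const hO _.
  by rewrite -mulN1r -[X in rho (X * _)](rmorphN1 iota) rM // rC rmorphN1 mulN1r.
have rel z : O z -> exists c, rho z = rho (el c).
  move=> hz; have [c hc] := sgen _ hz; exists [ffun l => c l].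
  have e : el [ffun l => c l] = \sum_l iota (c l) * s l by apply: eq_bigr => l _; rewrite ffunE.
  have hc' := hc.1; move/(rK _ hc'): hc; rewrite -e rA ?rN //; last first.
    by rewrite -mulN1r -(rmorphN1 iota); apply: (vrM hO) => //; exact: vr_const hO _.
  by move/eqP; rewrite subr_eq0 => /eqP.
pose lst := [seq rho (el c) | c <- enum {ffun 'I_f -> K}].
have sl : size lst = (q ^ f)%N by rewrite size_map -cardE card_ffun card_ord.
have ul : uniq lst.
  rewrite map_inj_uniq ?enum_uniq // => c c' e; apply/ffunP => l; apply/eqP; rewrite -subr_eq0; apply/eqP.
  apply: (sind (fun l => c l - c' l)).
  have -> : \sum_i iota (c i - c' i) * s i = el c - el c'.
    by rewrite -sumrB; apply: eq_bigr => r _; rewrite rmorphB mulrBl.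
  have hn : O (- el c') by rewrite -mulN1r -(rmorphN1 iota); apply: (vrM hO) => //; exact: vr_const hO _.
  by apply/rK; [exact: (vrD hO)|rewrite rA // rN // e subrr].
have lP a : a \in lst <-> exists2 z, O z & rho z = a.
  split=> [/mapP[c _ ->]|[z hz <-]]; first by exists (el c).
  by have [c ->] := rel z hz; apply: map_f; rewrite mem_enum.
have l0 : 0 \in lst.
  by apply/lP; exists 0; [exact: vr0 hO|apply/rK; [exact: vr0 hO|exact: pl0 hO]].
have lM a b : a \in lst -> b \in lst -> a * b \in lst.
  move=> /lP[z hz <-] /lP[w hw <-]; apply/lP; exists (z * w); [exact: (vrM hO)|exact: rM].
have fixl := group_fix ul l0 lM.
have qf1 : (1 < q ^ f)%N by rewrite -[1%N](expn0 q) ltn_exp2l // card_gt1.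
have [r [ur sr hrr]] := fixed_seq qf1 (pchar_cardX j f).
exists rho; split=> // a; rewrite -lP.
(* By [group_fix] the [q ^ f] residues are fixed by the [q ^ f]-Frobenius, hence are all its fixed
   points. *)
have sub : {subset lst <= r} by move=> b /fixl; rewrite sl hrr => ->.
have [] := uniq_min_size ul sub; first by rewrite sr sl.
by move=> _ ->; rewrite hrr; split=> /eqP.
Qed.

Section Use.
Variable rho : F -> L.
Hypothesis hr : reshom rho.

Lemma rh_0 : rho 0 = 0.
Proof. by rewrite -(rmorph0 iota) (rh_const hr) rmorph0. Qed.
Lemma rh_1 : rho 1 = 1.
Proof. by rewrite -(rmorph1 iota) (rh_const hr) rmorph1. Qed.
Lemma rh_opp z : O z -> rho (- z) = - rho z.
Proof.
move=> hz; apply/eqP; rewrite -addr_eq0 addrC -(rh_add hr) ?subrr ?rh_0 //; exact: (vrN hO).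
Qed.
Lemma rh_sub z w : O z -> O w -> rho (z - w) = rho z - rho w.
Proof. by move=> hz hw; rewrite (rh_add hr) ?rh_opp //; apply: (vrN hO). Qed.
Lemma rh_exp z n : O z -> rho (z ^+ n) = rho z ^+ n.
Proof.
move=> hz; elim: n => [|n IH]; first by rewrite !expr0 rh_1.
by rewrite !exprS (rh_mul hr) ?IH //; apply: (vrX hO).
Qed.
Lemma rh_pev z p : O z -> rho (pev iota z p) = (map_poly j p).[rho z].
Proof.
move=> hz; elim/poly_ind: p => [|p c IH]; first by rewrite !rmorph0 rh_0 horner0.
rewrite !rmorphD !rmorphM /= pevX pevC map_polyX map_polyC hornerMXaddC -IH.
have hp := vr_pev hO p hz; rewrite (rh_add hr) ?(rh_mul hr) ?(rh_const hr) //.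
  exact: (vrM hO).
exact: vr_const hO _.
Qed.

End Use.
End ResidueHom.

(** * Constant extensions and limits of valuations *)

Section Gauss.
Variables (K : finFieldType) (F : fieldType) (iota : {rmorphism K -> F}).
Hypothesis hFF : function_field iota.
Variable O : F -> Prop.
Hypothesis hO : valuation_ring iota O.
Local Notation vge := (vge (iota := iota) O).

Lemma first_min (p : {poly F}) : p != 0 -> exists i, [/\ p`_i != 0,
  forall i', vge (ord O p`_i) p`_i' & forall i', (i' < i)%N -> vge (ord O p`_i + 1) p`_i'].
Proof.
move=> p0; pose T i := `[< p`_i != 0 /\ forall i', vge (ord O p`_i) p`_i' >].
have ex : exists i, T i.
  have lt : ((size p).-1 < size p)%N by rewrite ltn_predL lt0n size_poly_eq0.
  have h0 : p`_(Ordinal lt) != 0 by rewrite /= -lead_coefE lead_coef_eq0.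
  have [i pi imin] := @Order.TotalTheory.arg_minP _ _ _ (Ordinal lt)
    (fun i : 'I_(size p) => p`_i != 0) (fun i => ord O p`_i) h0.
  exists i; apply/asboolP; split=> // i'; have [->|ni] := eqVneq p`_i' 0; first by left.
  case: (ltnP i' (size p)) => lt'; last by move: ni; rewrite nth_default ?eqxx.
  by right; exact: (imin (Ordinal lt') ni).
case: (ex_minnP ex) => i /asboolP[pi hi] imin; exists i; split=> // i' lt.
have [->|ni] := eqVneq p`_i' 0; first by left.
right; case: (hi i') => [/eqP|le]; first by rewrite (negPf ni).
rewrite -ltzD1 ltrD2r lt_neqAle le andbT.
apply/eqP => e; have : T i' by apply/asboolP; split=> // l; rewrite -e.
by move/imin; rewrite leqNgt lt.
Qed.

(** Gauss's lemma: if [a] and [b] are the first indices of coefficients of least order, the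
    coefficient of [g * h] at [a + b] has the sum of these orders. Both orders are at most 0 by
    monicity, so both are 0. *)
Lemma gauss_monic (g h : {poly F}) : g \is monic -> h \is monic ->
  (forall i, O (g * h)`_i) -> forall i, O g`_i.
Proof.
move=> gm hm gh; have g0 := monic_neq0 gm; have h0 := monic_neq0 hm.
have [a [ga a1 a2]] := first_min g0; have [b [hb b1 b2]] := first_min h0.
have le p c : p \is monic -> (forall i', vge c p`_i') -> c <= 0.
  move=> pm /(_ (size p).-1); rewrite -lead_coefE (monicP pm); case=> [/eqP|]; first by rewrite oner_eq0.
  by rewrite (ord_one hFF hO).
have [ne oe] : (g * h)`_(a + b) != 0 /\ ord O (g * h)`_(a + b) = ord O g`_a + ord O h`_b.
  have gb : g`_a * h`_b != 0 by rewrite mulf_neq0.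
  rewrite -(ordM hFF hO) // coefM.
  have lt : (a < (a + b).+1)%N by rewrite ltnS leq_addr.
  rewrite (bigD1 (Ordinal lt)) //= addKn; apply: (ord_ltD hFF hO) => //.
  apply: (vge_sum hFF hO) => i ni; rewrite (ordM hFF hO) //.
  case: (ltngtP i a) => [lti|gti|e]; last by case/eqP: ni; apply: val_inj.
    by rewrite addrAC; apply: (vgeM hFF hO); [exact: a2|exact: b1].
  rewrite -addrA; apply: (vgeM hFF hO); [exact: a1|apply: b2].
  by have := ltn_ord i; lia.
have := gh (a + b)%N; rewrite (vr_ord hFF hO) // oe => ge0.
have := le _ _ gm a1; have := le _ _ hm b1 => l1 l2 i.
apply/(vge_vr hFF hO); apply: vge_le (a1 i); lia.
Qed.

End Gauss.

(** By Gauss's lemma at every place, a monic factor over [F] has coefficients without poles, that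
    is, constants. *)
Lemma irreducible_ext (K : finFieldType) (F : fieldType) (iota : {rmorphism K -> F})
    (hFF : function_field iota) (hc : forall z, Ls (0 : place iota -> int) z -> exists a, z = iota a)
    (mu : {poly K}) :
  mu \is monic -> irreducible_poly mu -> irreducible_poly (map_poly iota mu).
Proof.
move=> mum [smu irr]; split=> [|p sp pd]; first by rewrite size_map_poly.
have mu0 : map_poly iota mu != 0 by rewrite map_poly_eq0 monic_neq0.
have p0 : p != 0 by apply: contraNneq mu0 => e; move: pd; rewrite e dvd0p.
pose g := (lead_coef p)^-1 *: p; have lp : lead_coef p != 0 by rewrite lead_coef_eq0.
have gm : g \is monic by rewrite monicE lead_coefZ mulVf.
have gp : g %= p by rewrite eqp_scale // invr_eq0.
have /dvdpP[h e] : g %| map_poly iota mu by rewrite (eqp_dvdl _ gp).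
have hm : h \is monic.
  have : map_poly iota mu \is monic by rewrite map_monic.
  by rewrite e !monicE lead_coefM (monicP gm) mulr1.
have /choice[c hgc] i : exists a, g`_i = iota a.
  apply: hc => P; rewrite oppr0; apply/(vge_vr hFF (svalP P)).
  apply: (gauss_monic hFF (svalP P) gm hm) => l; rewrite mulrC -e coef_map.
  exact: vr_const (svalP P) _.
have eg : g = map_poly iota (\poly_(i < size g) c i).
  apply/polyP => i; rewrite coef_map coef_poly; case: ltnP => [_|le]; first exact: hgc.
  by rewrite raddf0 nth_default.
set gK := \poly_(i < _) _ in eg.
have dv : gK %| mu by rewrite -(dvdp_map iota) -eg e dvdp_mull.
have sg : size gK != 1%N by rewrite -(size_map_poly iota) -eg (eqp_size gp).
by have := irr _ sg dv; rewrite -(eqp_map iota) -eg -(eqp_ltrans gp).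
Qed.

Lemma adjoin_root (F : fieldType) (mu : {poly F}) : irreducible_poly mu ->
  exists (E : fieldType) (iE : {rmorphism F -> E}) (th : E),
  [/\ (map_poly iE mu).[th] = 0, forall z, exists p, z = (map_poly iE p).[th] &
    forall p, (map_poly iE p).[th] = 0 -> mu %| p].
Proof.
move=> irr; have [E dE [th rt gen]] := irredp_FAdjoin irr.
exists E, (in_alg E), th; split; first exact/rootP.
  move=> z; have : z \in <<1; th>>%VS by rewrite gen memvf.
  by case/Fadjoin1_polyP => p ->; exists p.
move=> p hp; have [e|ne] := eqVneq (size (gcdp p mu)) 1%N; last first.
  have := irr.2 _ ne (dvdp_gcdr _ _) => /eqp_dvdl <-; exact: dvdp_gcdl.
have /Bezout_eq1_coprimepP[[u v] /= uv] : coprimep p mu by rewrite /coprimep e.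
have := congr1 (fun p => (map_poly (in_alg E) p).[th]) uv.
rewrite rmorphD !rmorphM /= hornerD !hornerM hp (rootP rt) !mulr0 addr0 rmorph1 hornerC => /eqP.
by rewrite eq_sym oner_eq0.
Qed.

Lemma adjoin_map (K k M : fieldType) (mu : {poly K}) (ik : {rmorphism K -> k}) (th : k)
    (jM : {rmorphism K -> M}) (w : M) :
  (forall z, exists p, z = (map_poly ik p).[th]) -> (forall p, (map_poly ik p).[th] = 0 -> mu %| p) ->
  (map_poly jM mu).[w] = 0 ->
  exists h : {rmorphism k -> M}, forall p, h (map_poly ik p).[th] = (map_poly jM p).[w].
Proof.
move=> gen ker rt.
have ker' p p' : (map_poly ik p).[th] = (map_poly ik p').[th] -> (map_poly jM p).[w] = (map_poly jM p').[w].
  move=> e; have /dvdpP[r er] : mu %| p - p' by apply: ker; rewrite rmorphB hornerD hornerN e subrr.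
  apply/eqP; rewrite -subr_eq0 -hornerN -hornerD -rmorphB er rmorphM hornerM rt mulr0 //.
have [||||| h hh] := @rel_rmorph k M (fun a b => exists2 p, a = (map_poly ik p).[th] & b = (map_poly jM p).[w]).
- by move=> a; have [p e] := gen a; exists (map_poly jM p).[w], p.
- by move=> a b b' [p -> ->] [p' e ->]; apply: ker'.
- move=> a b a' b' [p -> ->] [p' -> ->]; exists (p - p'); by rewrite rmorphB hornerD hornerN.
- move=> a b a' b' [p -> ->] [p' -> ->]; exists (p * p'); by rewrite rmorphM hornerM.
- by exists 1; rewrite rmorph1 hornerC.
by exists h => p; have [p' e ->] := hh (map_poly ik p).[th]; symmetry; apply: ker'.
Qed.

Section LimitValuation.
Variables (K : finFieldType) (F : fieldType) (iota : {rmorphism K -> F}).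
Hypothesis hFF : function_field iota.
Variable O : F -> Prop.
Hypothesis hO : valuation_ring iota O.
Local Notation vge := (vge (iota := iota) O).

Lemma horner_bounded (p : {poly F}) : exists N, forall u, O u -> vge N p.[u].
Proof.
elim/poly_ind: p => [|p c [N IH]]; first by exists 0 => u _; rewrite horner0; left.
exists (Num.min N (ord O c)) => u hu; rewrite hornerMXaddC; apply: (vgeD hFF hO); last first.
  by right; rewrite ge_min lexx orbT.
apply: (@vge_le _ _ _ _ (N + 0)); first by rewrite addr0 ge_min lexx.
by apply: (vgeM hFF hO); [exact: IH|apply/(vge_vr hFF hO)].
Qed.

Lemma horner_lipschitz (p : {poly F}) : exists N, forall u w, O u -> O w ->
  exists2 c, vge N c & p.[u] - p.[w] = (u - w) * c.
Proof.
elim/poly_ind: p => [|p a [N IH]].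
  by exists 0 => u w _ _; exists 0; [left|rewrite !horner0 mulr0 subrr].
have [N' h'] := horner_bounded p.
exists (Num.min N N') => u w hu hw; have [c hc e] := IH u w hu hw; exists (c * u + p.[w]).
  apply: (vgeD hFF hO); last by apply: vge_le (h' w hw); rewrite ge_min lexx orbT.
  apply: (@vge_le _ _ _ _ (N + 0)); first by rewrite addr0 ge_min lexx.
  by apply: (vgeM hFF hO) => //; apply/(vge_vr hFF hO).
by rewrite !hornerMXaddC mulrDr mulrA -e; ring.
Qed.

Definition tends0 (s : nat -> F) := forall N : int, exists i0, forall i, (i0 <= i)%N -> vge N (s i).

Lemma tends0M s c N : tends0 s -> (forall i, vge N (c i)) -> tends0 (fun i => s i * c i).
Proof.
move=> hs hc N'; have [i0 h] := hs (N' - N); exists i0 => i /h h1.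
by rewrite -[N'](subrK N); apply: (vgeM hFF hO).
Qed.

Variables (mu : {poly F}) (t : nat -> F).
Hypotheses (irr : irreducible_poly mu) (tO : forall i, O (t i)).
Hypotheses (tmu : tends0 (fun i => mu.[t i])) (tcauchy : tends0 (fun i => t i.+1 - t i)).

Definition evord (p : {poly F}) n := exists i0, forall i, (i0 <= i)%N -> p.[t i] != 0 /\ ord O p.[t i] = n.

Lemma tends_dvd p : mu %| p -> tends0 (fun i => p.[t i]).
Proof.
case/dvdpP => r ->; have [N hN] := horner_bounded r => M.
have [i0 h] := tends0M tmu (fun i => hN _ (tO i)) M.
by exists i0 => i /h; rewrite hornerM mulrC.
Qed.

Lemma horner_cauchy p : tends0 (fun i => p.[t i.+1] - p.[t i]).
Proof.
have [N h] := horner_lipschitz p => M; have [i0 h0] := tcauchy (M - N).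
exists i0 => i /h0 h1; have [c hc ->] := h _ _ (tO i.+1) (tO i).
by rewrite -[M](subrK N); apply: (vgeM hFF hO).
Qed.

(** A Bezout relation between [p] and [mu] bounds the order of [p.[t i]] from above, because
    [mu.[t i]] tends to 0. As [p.[t i]] is Cauchy, its order is eventually constant. *)
Lemma evord_coprime p : ~~ (mu %| p) -> exists n, evord p n.
Proof.
move=> nd; have /Bezout_eq1_coprimepP[[u v] /= uv] : coprimep p mu.
  rewrite /coprimep; apply: contraNT nd => ne.
  have := irr.2 _ ne (dvdp_gcdr _ _) => /eqp_dvdl <-; exact: dvdp_gcdl.
have [N hN] := horner_bounded u; have [N' hN'] := horner_bounded v.
have [i1 h1] := tends0M tmu (fun i => hN' _ (tO i)) 1.
have [i2 h2] := horner_cauchy p (1 - N).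
pose i0 := maxn i1 i2.
have ub i : (i0 <= i)%N -> p.[t i] != 0 /\ ord O p.[t i] <= - N.
  rewrite geq_max => /andP[/h1 hi _].
  have e : u.[t i] * p.[t i] = 1 - mu.[t i] * v.[t i].
    have := congr1 (fun p => p.[t i]) uv; rewrite hornerD !hornerM hornerC => <-; ring.
  have [ne oe] : 1 - mu.[t i] * v.[t i] != 0 /\ ord O (1 - mu.[t i] * v.[t i]) = 0.
    rewrite -(ord_one hFF hO); apply: (ord_ltD hFF hO); first exact: oner_neq0.
    by rewrite (ord_one hFF hO) add0r; apply: (vgeN hFF hO).
  move: ne oe; rewrite -e mulf_eq0 negb_or => /andP[u0 p0]; rewrite (ordM hFF hO) // => oe.
  split=> //; have := hN _ (tO i); case=> [/eqP|]; first by rewrite (negPf u0).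
  by move: oe; lia.
exists (ord O p.[t i0]), i0 => i le; split; first by case: (ub i le).
rewrite -(subnKC le); elim: (i - i0)%N => [|l IH]; first by rewrite addn0.
rewrite addnS -{}IH; set a := (i0 + l)%N.
have la : (i0 <= a)%N by rewrite leq_addr.
have [pa oa] := ub a la.
have -> : p.[t a.+1] = p.[t a] + (p.[t a.+1] - p.[t a]) by ring.
have [] // := @ord_ltD _ _ _ hFF _ hO p.[t a] (p.[t a.+1] - p.[t a]) pa.
apply: vge_le (h2 a _); first by lia.
by apply: leq_trans la; rewrite leq_maxr.
Qed.

Lemma evordM p p' n n' : evord p n -> evord p' n' -> evord (p * p') (n + n').
Proof.
move=> [i h] [i' h']; exists (maxn i i') => l; rewrite geq_max => /andP[/h[a b] /h'[a' b']].
by rewrite hornerM mulf_neq0 // (ordM hFF hO) // b b'.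
Qed.

Definition evge N (p : {poly F}) := exists i0, forall i, (i0 <= i)%N -> vge N p.[t i].

Lemma evge_mod N p p' : mu %| p' - p -> evge N p -> evge N p'.
Proof.
move=> /tends_dvd/(_ N)[i1 h1] [i2 h2]; exists (maxn i1 i2) => i.
rewrite geq_max => /andP[/h1 v /h2 w].
rewrite (_ : p'.[t i] = p.[t i] + (p' - p).[t i]); last by rewrite hornerD hornerN; ring.
exact: (vgeD hFF hO).
Qed.

Lemma evgeD N p p' : evge N p -> evge N p' -> evge N (p + p').
Proof.
move=> [i h] [i' h']; exists (maxn i i') => l; rewrite geq_max => /andP[/h a /h' b].
by rewrite hornerD; apply: (vgeD hFF hO).
Qed.

Lemma evge_evord N p n : evord p n -> evge N p <-> N <= n.
Proof.
move=> [i h]; split=> [[i' h']|le]; last by exists i => l /h[_ e]; right; rewrite e.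
have [p0 <-] := h (maxn i i') (leq_maxl _ _).
by case: (h' (maxn i i') (leq_maxr _ _)) => // /eqP; rewrite (negPf p0).
Qed.

End LimitValuation.

(** * Homomorphisms and places *)

Section PlacesOfHoms.
Variables (K : finFieldType) (F : fieldType) (iota : {rmorphism K -> F}).
Hypothesis hFF : function_field iota.
Hypothesis hfull : full_constant_field iota.
Variable B : nat -> nat.
Hypothesis hB : forall r : nat, (1 <= r)%N -> has_card (places_of_degree iota r) (B r).
Variable g : nat.
Hypothesis hg : genus iota g.
Hypothesis g2 : (2 <= g)%N.
Variable P : place iota.
Variables (L : closedFieldType) (j : {rmorphism K -> L}).
Variable rr : place iota -> F -> L.
Hypothesis hrr : forall P', reshom iota j (sval P') (rr P').
Local Notation q := #|K|.
Local Notation AR := (Aring P).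
Local Notation inA := (@inA K F iota P).

Definition khom (r : {rmorphism AR -> L}) := forall a b, aval b = iota a -> r b = j a.

Lemma exists_constA : exists cA : {rmorphism K -> AR}, forall a, aval (cA a) = iota a.
Proof.
have [|||||cA h] := @rel_rmorph K AR (fun a b => aval b = iota a); last by exists cA.
- by move=> a; apply: aval_surj; exact: inA_const.
- by move=> a b b' e e'; apply: aval_inj; rewrite e e'.
- by move=> a b a' b' e e'; rewrite avalB e e' rmorphB.
- by move=> a b a' b' e e'; rewrite avalM e e' rmorphM.
by rewrite aval1 rmorph1.
Qed.

Lemma avalX (a : AR) n : aval (a ^+ n) = aval a ^+ n.
Proof. by elim: n => [|n IH]; rewrite ?expr0 ?aval1 // !exprS avalM IH. Qed.

Section OnePlace.
Variable P' : place iota.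
Hypothesis ne : P' != P.
Local Notation f := (dg P').
Let hO := svalP P'.
Let hr := hrr P'.
Let f0 : (0 < f)%N := dg_gt0 hFF P'.

Lemma aO (a : AR) : sval P' (aval a). Proof. exact: avalP. Qed.

Lemma res_hom i : exists2 r : {rmorphism AR -> L}, khom r & forall a, r a = rr P' (aval a) ^+ (q ^ i).
Proof.
have [fr e] := frob_exists j i.
have [||r er] := @mk_rmorph AR L (fun a => fr (rr P' (aval a))).
- by move=> a b; rewrite avalB (rh_sub hO hr) ?rmorphB //; exact: aO.
- split=> [|a b]; first by rewrite aval1 (rh_1 hr) rmorph1.
  by rewrite avalM (rh_mul hr) ?rmorphM //; exact: aO.
exists r => [a b eb|a]; rewrite er ?e //.
by rewrite eb (rh_const hr) fix_const.
Qed.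

Lemma res_fix (a : AR) M : (f %| M)%N -> rr P' (aval a) ^+ (q ^ M) = rr P' (aval a).
Proof. by case/dvdnP=> l ->; rewrite mulnC; apply: fix_expn; apply/(rh_img hr); exists (aval a) => //; exact: aO. Qed.

Lemma res_lift z : z ^+ (q ^ f) = z -> exists a : AR, rr P' (aval a) = z.
Proof.
case/(rh_img hr) => w wO <-; have [a aA h] := A_residue hFF hfull hB hg g2 ne wO.
have [b eb] := aval_surj aA; exists b; have bO := aO b.
apply/eqP; rewrite eq_sym -subr_eq0 -(rh_sub hO hr) ?eb //; first by apply/eqP/(rh_ker hr); [case: h|].
by rewrite -eb.
Qed.

Lemma res_gen : exists (a : AR), (q ^ f - 1).-primitive_root (rr P' (aval a)).
Proof.
have [z hz] := exists_prim j f0; have [a e] := res_lift (prim_fix f0 hz).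
by exists a; rewrite e.
Qed.

(** [r] factors through the residue field at [P'], so it is determined by the image of a lift [a1]
    of a primitive element [z]. This image is a root of the minimal polynomial of [z], hence a
    conjugate [z ^+ (q ^ i)]. *)
Lemma hom_factor (r : {rmorphism AR -> L}) M : khom r -> (forall a, r a ^+ (q ^ M) = r a) ->
  (forall a, in_place (sval P') (aval a) -> r a = 0) ->
  exists i, [/\ (i < f)%N, (f %| M)%N & forall a, r a = rr P' (aval a) ^+ (q ^ i)].
Proof.
move=> hk hM hP; have [a1 hz] := res_gen; set z := rr P' _ in hz.
have [m [em _ _ _ _]] := minpoly_exists j f0 hz; have [cA hcA] := exists_constA.
have eq_r a b : rr P' (aval a) = rr P' (aval b) -> r a = r b.
  move=> e; apply/eqP; rewrite -subr_eq0 -rmorphB; apply/eqP/hP; rewrite avalB.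
  have h : sval P' (aval a - aval b) by rewrite -avalB; exact: aO.
  by apply/(rh_ker hr) => //; rewrite (rh_sub hO hr) ?e ?subrr //; exact: aO.
have [i lt ei] : exists2 i, (i < f)%N & r a1 = z ^+ (q ^ i).
  pose b := (map_poly cA m).[a1].
  have eb : aval b = pev iota (aval a1) m.
    rewrite /b -[pev _ _ m]/(map_poly iota m).[aval a1]; elim/poly_ind: m {em b} => [|p e IH].
      by rewrite !rmorph0 !horner0 aval0.
    have E : aval ((map_poly cA p).[a1] * a1 + cA e) = aval (map_poly cA p).[a1] * aval a1 + iota e.
      by rewrite -[cA e]opprK -[- cA e]sub0r avalB avalM avalB aval0 hcA sub0r opprK.
    by rewrite !rmorphD !rmorphM /= !map_polyX !map_polyC /= !hornerMXaddC E IH.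
  have : r b = r 0.
    by apply: eq_r; rewrite eb aval0 (rh_0 hr) (rh_pev hO hr) ?em; [|exact: aO]; apply/eqP; rewrite -rootE root_prod_XsubC;
       apply/mapP; exists 0%N; rewrite ?mem_iota ?expn0 ?expr1.
  rewrite rmorph0 /b -horner_map -map_poly_comp (_ : map_poly (r \o cA) m = map_poly j m); last first.
    by apply/polyP => l; rewrite !coef_map /= (hk (m`_l)).
  by rewrite em => /eqP; rewrite -rootE root_prod_XsubC => /mapP[i]; rewrite mem_iota /= add0n => lt ->; exists i.
exists i; split=> //.
  apply: (mod_exp_dvd (card_gt1 K) f0); rewrite (prim_order_dvd hz).
  have [fr e] := frob_exists j i; have [fr' e'] := frob_exists j M.
  have zM : z ^+ (q ^ M) = z.
    by apply: (fmorph_inj fr); rewrite rmorphXn /= !e -ei hM.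
  have z0 : z != 0.
    apply/eqP => e0; have /eqP := prim_expr_order hz.
    by rewrite e0 expr0n (gtn_eqF (prim_order_gt0 hz)) eq_sym oner_eq0.
  have qM : (0 < q ^ M)%N by rewrite expn_gt0 (ltnW (card_gt1 K)).
  by apply/eqP; apply: (mulIf z0); rewrite -exprSr mul1r subn1 prednK.
move=> a; have [e0|n0] := eqVneq (rr P' (aval a)) 0.
  rewrite e0 expr0n gtn_eqF ?expn_gt0 ?(ltnW (card_gt1 K)) // mulr0n -(rmorph0 r); apply: eq_r.
  by rewrite e0 aval0 (rh_0 hr).
have [l el] := prim_pow f0 hz (res_fix a (dvdnn f)) n0.
rewrite el exprAC -ei -rmorphXn; apply: eq_r; rewrite el avalX (rh_exp hO hr) //; exact: aO.
Qed.

End OnePlace.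

Lemma res_hom_inj P1 P2 i1 i2 : P1 != P -> P2 != P -> (i1 < dg P1)%N -> (i2 < dg P2)%N ->
  (forall a : AR, rr P1 (aval a) ^+ (q ^ i1) = rr P2 (aval a) ^+ (q ^ i2)) -> P1 = P2 /\ i1 = i2.
Proof.
move=> n1 n2 l1 l2 h; have [e|ne] := eqVneq P1 P2.
  subst P2; split=> //; have [a hz] := res_gen n1.
  exact: (prim_conj_inj (dg_gt0 hFF P1) hz l1 l2 (h a)).
have [a aA [h1 h2]] := A_separates hFF hfull hB hg g2 n1 n2 ne.
have [b eb] := aval_surj aA; have := h b; rewrite eb.
have O1 : sval P1 a by rewrite -eb; apply: aO.
have O2 : sval P2 a by rewrite -eb; apply: aO.
have -> : rr P1 a = 0 by apply/(rh_ker (hrr P1)).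
rewrite expr0n gtn_eqF ?expn_gt0 ?(ltnW (card_gt1 K)) // => /esym/eqP; rewrite expf_eq0 => /andP[_ /eqP e].
by case: h2; apply/(rh_ker (hrr P2)).
Qed.

(* Otherwise a product of functions outside the kernel, one for each zero of [z], would be a multiple
   of [z]. *)
Lemma prime_ideal (r : {rmorphism AR -> L}) (z : AR) : z != 0 -> r z = 0 ->
  exists2 P', P' != P & forall a, in_place (sval P') (aval a) -> r a = 0.
Proof.
move=> z0 rz; apply: contrapT => no.
have /choice[cc hcc] (P' : place iota) : exists c : AR, P' != P -> in_place (sval P') (aval c) /\ r c != 0.
  have [->|ne] := eqVneq P' P; first by exists 0.
  apply: contrapT => no'; apply: no; exists P' => // a ha; apply/eqP/negPn/negP => ra.
  by apply: no'; exists a.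
have az0 : aval z != 0 by apply: contra_neq z0 => e; apply: aval_inj; rewrite e aval0.
have [us hs] := suppP (fs_dv hFF hB az0).
pose w := \prod_(P' <- supp (dv (aval z)) | P' != P) cc P' ^+ `|dv (aval z) P'|%N.
have rw : r w != 0.
  rewrite rmorph_prod; elim/big_ind: _ => [|x y|P' ne]; [exact: oner_neq0|exact: mulf_neq0|].
  by rewrite rmorphXn expf_neq0 //; exact: (hcc P' ne).2.
have zO P' : P' != P -> 0 <= dv (aval z) P'.
  by move=> ne; apply/(vr_ord hFF (svalP P') az0); exact: aO.
have [b eb] : exists b : AR, aval b = aval w / aval z.
  apply: aval_surj => P' ne; have := zO P' ne; rewrite le_eqVlt eq_sym => /orP[/eqP e0|gt].
    apply: (vrM (svalP P')); first exact: aO.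
    by apply/(vr_ord hFF (svalP P')); rewrite ?invr_eq0 // (ordV hFF (svalP P')) // -[ord _ _]/(dv _ P') e0.
  have hP : P' \in supp (dv (aval z)) by apply: hs; rewrite gt_eqF.
  have [w' ->] : exists w', w = cc P' ^+ `|dv (aval z) P'|%N * w'.
    by rewrite /w -big_filter (big_rem P') ?mem_filter ?ne //=; eexists.
  rewrite avalM avalX mulrAC; apply: (vrM (svalP P')); last exact: aO.
  apply/(vge_vr hFF (svalP P')).
  have e0 : `|dv (aval z) P'|%N%:Z - dv (aval z) P' = 0 by rewrite gtz0_abs ?subrr.
  rewrite -[X in vge _ X _]e0; apply: (vgeM hFF (svalP P')); last by right; rewrite (ordV hFF (svalP P')).
  have h1 : vge (iota := iota) (sval P') 1 (aval (cc P')) by apply/(vge_pl hFF (svalP P')); exact: (hcc P' ne).1.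
  elim: `|_|%N => [|n IH]; first by rewrite expr0; apply/(vge_vr hFF (svalP P')); exact: (vr1 (svalP P')).
  by rewrite exprS -add1n PoszD; apply: (vgeM hFF (svalP P')).
move/negP: rw; apply; have -> : w = b * z by apply: aval_inj; rewrite avalM eb mulfVK.
by rewrite rmorphM rz mulr0.
Qed.

(* The kernel contains [u ^+ (q ^ M) - u] for any non-constant [u]. *)
Lemma hom_place (r : {rmorphism AR -> L}) M : khom r -> (0 < M)%N -> (forall a, r a ^+ (q ^ M) = r a) ->
  exists P' i, [/\ P' != P, (i < dg P')%N, (dg P' %| M)%N & forall a, r a = rr P' (aval a) ^+ (q ^ i)].
Proof.
move=> hk M0 hM; have [u [uA u0 ou]] := exists_pole hFF hfull hB hg g2 P (leqnn (2 * g)).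
have [b eb] := aval_surj uA; pose z := b ^+ (q ^ M) - b.
have z0 : z != 0.
  apply/negP => /eqP/(congr1 (@aval _ _ _ P)); rewrite aval0 avalB avalX eb => /eqP; rewrite subr_eq0 => /eqP e.
  have := congr1 (ord (sval P)) e; rewrite (ordX hFF (svalP P)) // ou.
  have : (1 < q ^ M)%N by rewrite -[1%N](expn0 q) ltn_exp2l // card_gt1.
  by rewrite -mulr_natr natz; move: (q ^ M)%N => Q; nia.
have [|P' ne hP] := @prime_ideal r z z0; first by rewrite rmorphB rmorphXn hM subrr.
by have [i [li df h]] := hom_factor ne hk hM hP; exists P', i.
Qed.

End PlacesOfHoms.

(** * The plane model of a constant extension *)

Section ConstantExtension.
Variables (K : finFieldType) (F : fieldType) (iota : {rmorphism K -> F}).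
Hypothesis hFF : function_field iota.
Hypothesis hfull : full_constant_field iota.
Variable g : nat.
Hypothesis hg : genus iota g.
Variable P : place iota.
Local Notation q := #|K|.
Local Notation d := (pdeg iota (sval P)).
Local Notation O := (sval P).
Let hO : valuation_ring iota O := svalP P.
Let d0 : (0 < d)%N := pdeg_gt0 hFF hO.

Variables (L : closedFieldType) (j : {rmorphism K -> L}).
Variables (rho : F -> L) (zt : L) (th0 : F) (mu : {poly K}).
Hypotheses (hr : reshom iota j O rho) (hz : (q ^ d - 1).-primitive_root zt).
Hypotheses (thO : O th0) (rth : rho th0 = zt).
Hypotheses (mum : mu \is monic) (smu : size mu = d.+1) (muz : (map_poly j mu).[zt] = 0).
Variables (E : fieldType) (iE : {rmorphism F -> E}) (th : E).
Local Notation muF := (map_poly iota mu).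
Hypothesis irrF : irreducible_poly muF.
Hypotheses (rtE : (map_poly iE muF).[th] = 0)
  (genE : forall z, exists p, z = (map_poly iE p).[th])
  (kerE : forall p, (map_poly iE p).[th] = 0 -> muF %| p).
Variables (k : fieldType) (ik : {rmorphism K -> k}) (thk : k).
Hypothesis genk : forall z, exists p, z = (map_poly ik p).[thk].
Variables (kE : {rmorphism k -> E}) (kL : {rmorphism k -> L}).
Hypothesis hkE : forall p, kE (map_poly ik p).[thk] = (map_poly (iE \o iota) p).[th].
Hypothesis hkL : forall p, kL (map_poly ik p).[thk] = (map_poly j p).[zt].

(** [E] is [F] with a root [th] of [mu] adjoined, and [k] is [K] with a root [thk]; elements of [E]
    are handled through representatives in [{poly F}] modulo [muF]. *)
Definition piE : {rmorphism {poly F} -> E} := horner_eval th \o map_poly iE.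

Lemma piEE p : piE p = (map_poly iE p).[th]. Proof. by []. Qed.
Lemma piE_muF : piE muF = 0. Proof. exact: rtE. Qed.
Lemma piE_C a : piE a%:P = iE a.
Proof. by rewrite piEE map_polyC hornerC. Qed.
Lemma piE_X : piE 'X = th.
Proof. by rewrite piEE map_polyX hornerX. Qed.
Lemma piE_eq p p' : piE p = piE p' -> muF %| p' - p.
Proof. by move=> e; apply: kerE; rewrite rmorphB hornerD hornerN -!piEE e subrr. Qed.
Lemma kE_pi c : exists r, kE c = piE (map_poly iota r) /\ kL c = (map_poly j r).[zt].
Proof.
have [r ->] := genk c; exists r; rewrite hkE hkL piEE; split=> //.
by rewrite -map_poly_comp.
Qed.
Lemma pi_kE r : piE (map_poly iota r) = kE (map_poly ik r).[thk].
Proof. by rewrite hkE piEE -map_poly_comp. Qed.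

(* The sequence [tt jj] converges at [P] to a root of [muF]: the [d] places of [E] above [P] are
   obtained as limits of the valuation of [P] along these sequences. *)
Definition tt jj i : F := th0 ^+ (q ^ (d * i + jj)).

Lemma ttO jj i : O (tt jj i). Proof. exact: (vrX hO). Qed.

Lemma vge_exp x n : vge (iota := iota) O 1 x -> vge (iota := iota) O n%:Z (x ^+ n).
Proof.
move=> hx; elim: n => [|n IH]; first by rewrite expr0; apply/(vge_vr hFF hO); exact: (vr1 hO).
by rewrite exprS -[n.+1]add1n PoszD; apply: (vgeM hFF hO).
Qed.

Lemma tends_pow jj x : vge (iota := iota) O 1 x -> tends0 iota O (fun i => x ^+ (q ^ (d * i + jj))).
Proof.
move=> hx N; exists `|N|%N => i hi; apply: vge_le (vge_exp _ hx).
have : (i < q ^ (d * i + jj))%N.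
  apply: leq_ltn_trans (ltn_expl _ (card_gt1 K)).
  by rewrite -[i in (i <= _)%N]mul1n (leq_trans (leq_mul d0 (leqnn i))) // leq_addr.
lia.
Qed.

(** The coefficients of [muF] are constants, so its value at a Frobenius power of [th0] is the same
    power of its value at [th0], which lies in the maximal ideal. *)
Lemma tt_mu jj : tends0 iota O (fun i => muF.[tt jj i]).
Proof.
have h1 : vge (iota := iota) O 1 muF.[th0].
  apply/(vge_pl hFF hO); rewrite -[muF.[th0]]/(pev iota th0 mu).
  apply/(rh_ker hr); first exact: vr_pev.
  by rewrite (rh_pev hO hr) // rth.
move=> N; have [i0 h] := tends_pow jj h1 N; exists i0 => i /h.
by rewrite /tt -horner_fix.
Qed.

Lemma tt_cauchy jj : tends0 iota O (fun i => tt jj i.+1 - tt jj i).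
Proof.
have h1 : vge (iota := iota) O 1 (th0 ^+ (q ^ d) - th0).
  apply/(vge_pl hFF hO)/(rh_ker hr); first by apply: (vrD hO); [exact: (vrX hO)|exact: (vrN hO)].
  by rewrite (rh_sub hO hr) ?(rh_exp hO hr) ?rth ?(prim_fix d0 hz) ?subrr //; exact: (vrX hO).
move=> N; have [i0 h] := tends_pow jj h1 N; exists i0 => i /h.
have [fr e] := frob_exists iota (d * i + jj).
by rewrite -e rmorphB /= !e -exprM -expnD /tt mulnS addnA.
Qed.

Lemma zt_d i : zt ^+ (q ^ (d * i)) = zt.
Proof. by apply: fix_expn; exact: (prim_fix d0 hz). Qed.

Lemma rho_tt jj i : rho (tt jj i) = zt ^+ (q ^ jj).
Proof. by rewrite /tt (rh_exp hO hr) // rth expnD exprM zt_d. Qed.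

(* [wv jj] is the valuation of the [jj]-th place above [P], and [wge jj N] its filtration. *)
Definition wge jj N z := exists2 p, piE p = z & evge iota O (tt jj) N p.

Lemma wgeE jj N p : wge jj N (piE p) <-> evge iota O (tt jj) N p.
Proof.
split=> [[p' e h]|h]; last by exists p.
by apply: (evge_mod hFF hO (ttO jj) (tt_mu jj)) h; exact: piE_eq.
Qed.

Lemma wge0 jj N : wge jj N 0.
Proof. by exists 0; [rewrite rmorph0|exists 0%N => i _; rewrite horner0; left]. Qed.
Lemma wge_le jj N N' z : N' <= N -> wge jj N z -> wge jj N' z.
Proof. by move=> le [p e [i h]]; exists p => //; exists i => l /h; apply: vge_le. Qed.
Lemma wgeD jj N z w : wge jj N z -> wge jj N w -> wge jj N (z + w).
Proof.
move=> [p <- h] [p' <- h']; exists (p + p'); first by rewrite rmorphD.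
exact: (evgeD hFF hO).
Qed.
Lemma wgeM jj N N' z w : wge jj N z -> wge jj N' w -> wge jj (N + N') (z * w).
Proof.
move=> [p <- [i h]] [p' <- [i' h']]; exists (p * p'); first by rewrite rmorphM.
exists (maxn i i') => l; rewrite geq_max => /andP[/h a /h' b]; rewrite hornerM.
exact: (vgeM hFF hO).
Qed.
Lemma wge_kE jj c : wge jj 0 (kE c).
Proof.
have [r [-> _]] := kE_pi c; apply/wgeE; exists 0%N => i _; apply/(vge_vr hFF hO).
exact: (vr_pev hO r (ttO jj i)).
Qed.

Definition wv jj z : int :=
  if pselect (exists n, forall N, wge jj N z <-> N <= n) is left h then sval (cid h) else 0.

Lemma wv_evord jj p n : evord O (tt jj) p n -> wv jj (piE p) = n.
Proof.
move=> h; have hn N : wge jj N (piE p) <-> N <= n.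
  by rewrite wgeE; apply: (evge_evord iota N h).
rewrite /wv; case: pselect => [ex|nex]; last by case: nex; exists n.
case: cid => /= n' hn'; apply/eqP; rewrite eq_le; apply/andP; split; first by apply/hn/hn'.
by apply/hn'/hn.
Qed.

Lemma exists_evord jj p : piE p != 0 -> exists n, evord O (tt jj) p n.
Proof.
move=> p0; apply: (evord_coprime hFF hO irrF (ttO jj) (tt_mu jj) (tt_cauchy jj)).
by apply/negP => /dvdpP[r e]; move/eqP: p0; rewrite e rmorphM piE_muF mulr0.
Qed.

Lemma piE_surj z : exists p, z = piE p. Proof. exact: genE. Qed.

Lemma wvP jj N z : z != 0 -> wge jj N z <-> N <= wv jj z.
Proof.
have [p ->] := piE_surj z => /(exists_evord jj)[n h]; rewrite (wv_evord h) wgeE.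
exact: (evge_evord iota N h).
Qed.

Lemma wvM jj z w : z != 0 -> w != 0 -> wv jj (z * w) = wv jj z + wv jj w.
Proof.
have [p ->] := piE_surj z; have [p' ->] := piE_surj w.
move=> /(exists_evord jj)[n h] /(exists_evord jj)[n' h'].
by rewrite -rmorphM (wv_evord h) (wv_evord h') (wv_evord (evordM hFF hO h h')).
Qed.

Lemma wv1 jj : wv jj 1 = 0.
Proof.
have := wvM jj (oner_neq0 E) (oner_neq0 E); rewrite mulr1 => e.
by apply: (addrI (wv jj 1)); rewrite addr0 -e.
Qed.

Lemma wv_kE jj c : c != 0 -> wv jj (kE c) = 0.
Proof.
move=> c0; have kc : kE c != 0 by rewrite fmorph_eq0.
have kc' : kE c^-1 != 0 by rewrite fmorph_eq0 invr_eq0.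
have := wvM jj kc kc'; rewrite -rmorphM mulfV //.
have := wvM jj (oner_neq0 E) (oner_neq0 E); rewrite mulr1 rmorph1.
have /(wvP jj 0 kc) := wge_kE jj c; have /(wvP jj 0 kc') := wge_kE jj c^-1.
by move: (wv jj 1) (wv jj (kE c)) (wv jj (kE c^-1)) => a b b'; lia.
Qed.

(** The places above [P] are rational over [k]: the residues of [p.[tt jj i]] are eventually
    constant, lie in the field of [q ^ d] elements, and so are polynomials in [zt ^+ (q ^ jj)], the
    residue of [tt jj i]. *)
Lemma residue_step jj z : (jj < d)%N -> wge jj 0 z -> exists c, wge jj 1 (z - kE c).
Proof.
move=> ljj; have [p ->] := piE_surj z => /wgeE[i1 h1].
have [i2 h2] := horner_cauchy hFF hO (ttO jj) (tt_cauchy jj) p 1.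
pose i0 := maxn i1 i2.
have pO i : (i0 <= i)%N -> O p.[tt jj i].
  by rewrite geq_max => /andP[/h1 h _]; apply/(vge_vr hFF hO).
have cst i : (i0 <= i)%N -> rho p.[tt jj i] = rho p.[tt jj i0].
  move=> le; rewrite -(subnKC le); elim: (i - i0)%N => [|l IH]; first by rewrite addn0.
  rewrite addnS -IH; apply/eqP; rewrite -subr_eq0 -(rh_sub hO hr); try by apply: pO; lia.
  apply/eqP/(rh_ker hr); first by apply: (vrD hO); [apply: pO; lia|apply: (vrN hO); apply: pO; lia].
  by apply/(vge_pl hFF hO); apply: h2; rewrite (leq_trans (leq_maxr i1 i2)) // leq_addr.
set a := rho p.[tt jj i0] in cst.
have aq : a ^+ (q ^ d) = a by apply/(rh_img hr); exists p.[tt jj i0] => //; apply: pO.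
have [r hrr] : exists r : {poly K}, (map_poly j r).[zt ^+ (q ^ jj)] = a.
  have [->|a0] := eqVneq a 0; first by exists 0; rewrite rmorph0 horner0.
  have bq : (a ^+ (q ^ (d - jj))) ^+ (q ^ d) = a ^+ (q ^ (d - jj)) by rewrite exprAC aq.
  have [l el] := prim_pow d0 hz bq (expf_neq0 _ a0).
  exists 'X^l; rewrite map_polyXn hornerXn exprAC -el -exprM -expnD subnK ?aq //; exact: ltnW.
exists (map_poly ik r).[thk]; rewrite -pi_kE -rmorphB; apply/wgeE; exists i0 => i le.
apply/(vge_pl hFF hO); rewrite hornerD hornerN.
have rO : O (map_poly iota r).[tt jj i] := vr_pev hO r (ttO jj i).
apply/(rh_ker hr); first by apply: (vrD hO); [exact: pO|exact: (vrN hO)].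
rewrite (rh_sub hO hr) ?cst //; last exact: pO.
by rewrite -[(map_poly iota r).[_]]/(pev iota _ r) (rh_pev hO hr) ?rho_tt ?hrr ?subrr //; exact: ttO.
Qed.

Lemma residue_step_at jj z w : (jj < d)%N -> w != 0 -> wge jj (wv jj w) z ->
  exists c, wge jj (wv jj w + 1) (z - kE c * w).
Proof.
move=> ljj w0 hzw; have [|c hc] := @residue_step jj (z / w) ljj.
  have wV : w^-1 != 0 by rewrite invr_eq0.
  have e := wvM jj w0 wV; rewrite mulfV // in e.
  have e1 : wv jj 1 = 0 by exact: wv1.
  have hV : wge jj (- wv jj w) w^-1 by apply/wvP => //; lia.
  by rewrite -[X in wge _ X _](subrr (wv jj w)); apply: wgeM.
exists c; have -> : z - kE c * w = w * (z / w - kE c) by rewrite mulrBr mulrCA mulfV // mulr1 mulrC.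
by apply: wgeM => //; apply/wvP.
Qed.

Lemma vr_det n (A : 'M[F]_n) : (forall i l, O (A i l)) -> O (\det A).
Proof.
move=> hA; apply: (vr_sum hO) => s _; apply: (vrM hO).
  by apply: (vrX hO); apply: (vrN hO); exact: (vr1 hO).
by elim/big_rec: _ => [|i x _ hx]; [exact: (vr1 hO)|exact: (vrM hO)].
Qed.

(** The values of [p] at [d] approximate roots determine its coefficients. The Vandermonde
    determinant is a unit at [P], since the residues of these roots are the distinct conjugates of
    [zt]. *)
Lemma vandermonde_vge (p : {poly F}) N : (size p <= d)%N ->
  (forall jj, (jj < d)%N -> wge jj N (piE p)) -> forall l, vge (iota := iota) O N p`_l.
Proof.
move=> sp hw.
have /choice[ii hii] jj : exists i0, (jj < d)%N -> forall i, (i0 <= i)%N -> vge (iota := iota) O N p.[tt jj i].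
  case: (ltnP jj d) => [lt|_]; last by exists 0%N.
  by have /wgeE[i0 h] := hw jj lt; exists i0.
pose i0 := (\max_(jj < d) ii jj)%N.
have hi (jj : 'I_d) : vge (iota := iota) O N p.[tt jj i0].
  by apply: hii => //; exact: leq_bigmax.
pose V : 'M[F]_d := Vandermonde d (\row_jj tt jj i0).
pose a : 'rV[F]_d := \row_l p`_l.
have aV (jj : 'I_d) : (a *m V) 0 jj = p.[tt jj i0].
  by rewrite (horner_coef_wide _ sp) mxE; apply: eq_bigr => l _; rewrite !mxE.
have VO i l : O (V i l) by rewrite !mxE; apply: (vrX hO); exact: ttO.
have dV0 : \det V != 0 /\ ord O (\det V) = 0.
  have dO : O (\det V) := vr_det VO.
  have nm : ~ in_place O (\det V).
    move/(rh_ker hr dO); rewrite det_Vandermonde => e.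
    pose good x := rho x != 0 /\ O x.
    have one : good 1 by rewrite /good (rh_1 hr) oner_neq0; split=> //; exact: (vr1 hO).
    have mul x y : good x -> good y -> good (x * y).
      by move=> [x0 xO] [y0 yO]; rewrite /good (rh_mul hr) // mulf_neq0 //; split=> //; exact: (vrM hO).
    suff [] : good (\prod_(i < d) \prod_(l < d | (i < l)%N)
        ((\row_jj tt jj i0) 0 l - (\row_jj tt jj i0) 0 i)) by rewrite e eqxx.
    apply: (big_ind good) => // i _; apply: (big_ind good) => // l il; rewrite !mxE.
    split; last by apply: (vrD hO); [exact: ttO|apply: (vrN hO); exact: ttO].
    rewrite (rh_sub hO hr) ?rho_tt; try exact: ttO.
    by rewrite subr_eq0; apply: contraTneq il => /(prim_conj_inj d0 hz (ltn_ord l) (ltn_ord i)) ->; rewrite ltnn.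
  have [n0 nV] := vr_unit hO dO nm; split=> //; exact: (ord_unit hFF hO).
move=> l; case: (ltnP l d) => ld; last by rewrite nth_default ?(leq_trans sp) //; left.
have e : p`_l * \det V = \sum_(jj < d) p.[tt jj i0] * (\adj V) jj (Ordinal ld).
  have := congr1 (fun M : 'rV_d => M 0 (Ordinal ld)) (mulmxA a V (\adj V)).
  rewrite mul_mx_adj mul_mx_scalar !mxE mulrC => ->.
  by apply: eq_bigr => jj _; rewrite aV.
have : vge (iota := iota) O N (\det V * p`_l).
  rewrite mulrC e; apply: (vge_sum hFF hO) => jj _; rewrite -[N]addr0; apply: (vgeM hFF hO) => //.
  apply/(vge_vr hFF hO); rewrite mxE; apply: (vrM hO).
    by apply: (vrX hO); apply: (vrN hO); exact: (vr1 hO).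
  by apply: vr_det => i l'; rewrite mxE [X in O X]mxE; exact: VO.
by move/(vge_mul_sub hFF hO dV0.1); rewrite dV0.2 subr0.
Qed.

Local Notation inA := (@inA K F iota P).
Definition AE (z : E) := exists2 p, piE p = z & forall i, inA p`_i.

Lemma AE_kE c : AE (kE c).
Proof.
by have [r [-> _]] := kE_pi c; exists (map_poly iota r) => // i; rewrite coef_map; exact: inA_const.
Qed.
Lemma AE_D z w : AE z -> AE w -> AE (z + w).
Proof.
move=> [p <- h] [p' <- h']; exists (p + p'); first by rewrite rmorphD.
by move=> i; rewrite coefD; apply: inAD.
Qed.
Lemma AE_M z w : AE z -> AE w -> AE (z * w).
Proof.
move=> [p <- h] [p' <- h']; exists (p * p'); first by rewrite rmorphM.
by move=> i; rewrite coefM; apply: inA_sum => l _; apply: inAM.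
Qed.
Lemma AE_0 : AE 0. Proof. by rewrite -(rmorph0 kE); exact: AE_kE. Qed.
Lemma AE_1 : AE 1. Proof. by rewrite -(rmorph1 kE); exact: AE_kE. Qed.
Lemma AE_iE a : inA a -> AE (iE a).
Proof.
move=> ha; exists a%:P; first by rewrite piE_C.
by move=> i; rewrite coefC; case: ifP => // _; exact: inA0.
Qed.
Lemma AE_X z n : AE z -> AE (z ^+ n).
Proof. by move=> h; elim: n => [|n IH]; rewrite ?expr0 ?exprS; [exact: AE_1|exact: AE_M]. Qed.

Lemma AE_reduce z : AE z -> exists p, [/\ piE p = z, (size p <= d)%N & forall i, inA p`_i].
Proof.
case=> p <- {z}; elim/poly_ind: p => [|p c IH] hp.
  by exists 0; rewrite size_poly0; split=> // i; rewrite coef0; exact: inA0.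
have [|p' [e sp hp']] := IH.
  by move=> i; have := hp i.+1; rewrite coefD coefMX coefC /= addr0.
have hc : inA c by have := hp 0%N; rewrite coefD coefMX coefC /= add0r.
pose r := p' * 'X + c%:P; pose a := r`_d.
have hr' i : inA r`_i.
  rewrite coefD coefMX coefC; apply: inAD; case: (i == 0)%N => //; exact: inA0.
exists (r - a *: muF); split.
- rewrite rmorphB -mul_polyC rmorphM piE_muF mulr0 subr0 /r.
  by rewrite !(rmorphD piE) !(rmorphM piE) e.
- apply/leq_sizeP => i; rewrite leq_eqVlt => /orP[/eqP <-|lt]; rewrite coefB coefZ coef_map /=.
    have -> : iota mu`_d = 1 by move: mum; rewrite monicE lead_coefE smu => /eqP ->; rewrite rmorph1.
    by rewrite mulr1 subrr.
  rewrite [mu`_i]nth_default ?smu // rmorph0 mulr0 subr0 nth_default //.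
  rewrite (leq_trans (size_polyD _ _)) // geq_max (leq_trans (size_polyC_leq1 c)); last by lia.
  by rewrite andbT (leq_trans (size_polyMleq _ _)) // size_polyX addn2 /= (leq_ltn_trans sp).
move=> i; rewrite coefB coefZ coef_map; apply: inAD => //; apply: inAN; apply: inAM; first exact: hr'.
exact: inA_const.
Qed.

Local Notation VE := (lmodF kE).
Local Notation ZE := (@zerosp VE).

(** The Riemann-Roch space over [k] of a divisor of the constant extension supported on the [d]
    places above [P]. *)
Definition SS (n : nat -> int) : VE -> Prop := fun z => AE z /\ forall jj, (jj < d)%N -> wge jj (- n jj) z.

Lemma subsp_SS n : subsp (SS n).
Proof.
split=> [|a u v [uA uw] [vA vw]]; first by split=> [|jj _]; [exact: AE_0|exact: wge0].
split=> [|jj lj]; first by apply: AE_D => //; apply: AE_M => //; exact: AE_kE.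
apply: wgeD; last exact: vw.
by rewrite -[X in wge _ X _]add0r; apply: wgeM; [exact: wge_kE|exact: uw].
Qed.

Lemma SS_le n n' : (forall jj, (jj < d)%N -> n jj <= n' jj) -> forall z, SS n z -> SS n' z.
Proof. by move=> h z [zA zw]; split=> // jj lj; apply: wge_le (zw jj lj); have := h jj lj; lia. Qed.

Lemma SS_step n n' jj : (jj < d)%N -> n jj = n' jj + 1 ->
  (forall l, (l < d)%N -> l != jj -> n l = n' l) -> dimle (SS n) (SS n') 1.
Proof.
move=> lj e1 e2 s hs.
have key z : SS n z -> wge jj (- n' jj) z -> SS n' z.
  move=> [zA zw] h; split=> // l ll; have [->//|ne] := eqVneq l jj.
  by rewrite -e2 //; exact: zw.
pose s0 : E := s ord0; pose s1 : E := s (lift ord0 ord0).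
have sumE (c : 'rV[k]_2) : (\sum_i c 0 i *: s i : E) = kE (c 0 ord0) * s0 + kE (c 0 (lift ord0 ord0)) * s1.
  by rewrite big_ord_recl big_ord1 !lmodF_scaleE.
have [h1|n1] := pselect (wge jj (- n' jj) s1).
  exists (\row_i (i != ord0)%:R); first by apply/rV0Pn; exists (lift ord0 ord0); rewrite mxE oner_neq0.
  by rewrite sumE !mxE /= rmorph0 mul0r add0r rmorph1 mul1r; apply: key => //; exact: hs.
have s10 : s1 != 0 by apply/eqP => e; apply: n1; rewrite e; exact: wge0.
have wv1E : wv jj s1 = - n jj.
  have := (hs (lift ord0 ord0)).2 jj lj; rewrite -/s1 => /(wvP jj _ s10).
  move: n1; rewrite wvP // => /negP; rewrite -ltNge; lia.
have [|c hc] := @residue_step_at jj s0 s1 lj s10.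
  by rewrite wv1E; exact: (hs ord0).2.
exists (\row_i if i == ord0 then 1 else - c).
  by apply/rV0Pn; exists ord0; rewrite mxE eqxx oner_neq0.
rewrite sumE !mxE /= rmorph1 mul1r rmorphN mulNr; apply: key.
  rewrite -mulNr -rmorphN -[kE (- c) * _]/((- c) *: (s1 : VE) : E); apply: (subspD (subsp_SS n)).
    exact: hs.
  by apply: (subspZ _ (subsp_SS n)); exact: hs.
by move: hc; rewrite wv1E; apply: wge_le; lia.
Qed.

Definition lower (n : nat -> int) jj (m : nat) : nat -> int := fun l => if l == jj then n l - m%:Z else n l.

Lemma SS_lower n jj m : (jj < d)%N -> dimle (SS n) (SS (lower n jj m)) m.
Proof.
move=> lj; elim: m => [|m IH].
  by apply: dimle_inj; apply: SS_le => l _; rewrite /lower; case: eqP => _; lia.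
rewrite -addn1; apply: dimle_trans IH _; first exact: subsp_SS.
  by apply: SS_le => l _; rewrite /lower; case: eqP => _; lia.
apply: (@SS_step _ _ jj lj); first by rewrite /lower eqxx; lia.
by move=> l _ ne; rewrite /lower (negPf ne).
Qed.

(* Bounds on the pole orders at the [d] places above [P]: [a] at the first one, none at the next
   ones below index [l], and [M] at the others. *)
Definition nv (a : nat) l (M : nat) : nat -> int := fun jj => if (jj == 0)%N then a%:Z else if (jj < l)%N then 0 else M%:Z.

Lemma SS_nv a M l : (l < d)%N -> dimle (SS (nv a 1 M)) (SS (nv a l.+1 M)) (l * M).
Proof.
elim: l => [|l IH] ld; first by apply: dimle_inj.
rewrite mulSn addnC; apply: dimle_trans (IH (ltnW ld)) _; first exact: subsp_SS.
  by apply: SS_le => jj _; rewrite /nv; case: eqP => // _; case: (ltnP jj l.+1); case: (ltnP jj 1); lia.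
refine (@dimle_sub _ _ _ _ _ _ _ _ _ (@SS_lower (nv a l.+1 M) _ M ld)) => // z; apply: SS_le => jj _.
rewrite /lower /nv; case: (eqVneq jj 0%N) => [->//|j0]; case: (eqVneq jj l.+1) => [->|ne].
  by rewrite ltnn ltnSn subrr.
by case: (ltnP jj l.+1); case: (ltnP jj l.+2); lia.
Qed.

(** By [vandermonde_vge] the coefficients of the reduced representative have no pole at [P] either,
    hence are constants of [F]. *)
Lemma SS0_const z : SS (nv 0 d 0) z -> exists c, z = kE c.
Proof.
case=> /AE_reduce[p [<- sp pA]] hw.
have hv l : vge (iota := iota) O 0 p`_l.
  apply: (vandermonde_vge sp) => jj lj; apply: wge_le (hw jj lj).
  by rewrite /nv; case: eqP; rewrite ?lj ?oppr0.
have /choice[c hc] l : exists a, p`_l = iota a.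
  apply: (Ls0 hFF hfull hg) => P'; rewrite oppr0; have [->//|ne] := eqVneq P' P.
  by apply/(vge_vr hFF (svalP P')); exact: pA.
have -> : p = map_poly iota (\poly_(l < size p) c l).
  apply/polyP => l; rewrite coef_map coef_poly; case: ltnP => [_|le]; first exact: hc.
  by rewrite raddf0 nth_default.
by rewrite pi_kE; eexists.
Qed.

Lemma SS_upper a M : dimle (SS (nv a 1 M)) ZE (d * M + a + 1).
Proof.
have h1 : dimle (SS (nv a 1 M)) (SS (nv a d M)) (d.-1 * M).
  by have := @SS_nv a M d.-1; rewrite prednK // => /(_ (leqnn _)).
have h2 : dimle (SS (nv a d M)) (SS (nv 0 d 0)) a.
  refine (@dimle_sub _ _ _ _ _ _ _ _ _ (@SS_lower (nv a d M) _ a d0)) => // z; apply: SS_le => jj lj.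
  by rewrite /lower /nv; case: eqP => [_|_]; rewrite ?subrr // lj.
have h3 : dimle (SS (nv 0 d 0)) ZE 1.
  move=> s hs; have [c0 e0] := SS0_const (hs ord0); have [c1 e1] := SS0_const (hs (lift ord0 ord0)).
  have sumE (c : 'rV[k]_2) : (\sum_i c 0 i *: s i : E) = kE (c 0 ord0) * kE c0 + kE (c 0 (lift ord0 ord0)) * kE c1.
    by rewrite big_ord_recl big_ord1 !lmodF_scaleE e0 e1.
  have [c10|c10] := eqVneq c1 0.
    exists (\row_i (i != ord0)%:R); first by apply/rV0Pn; exists (lift ord0 ord0); rewrite mxE oner_neq0.
    by rewrite /zerosp sumE !mxE c10 !rmorph0 mul0r mulr0 addr0.
  exists (\row_i if i == ord0 then c1 else - c0); first by apply/rV0Pn; exists ord0; rewrite mxE eqxx.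
  by rewrite /zerosp sumE !mxE /= rmorphN; ring.
have s1 : forall z, SS (nv a d M) z -> SS (nv a 1 M) z.
  by apply: SS_le => jj lj; rewrite /nv lj; case: eqP => // /eqP j0; case: ifP => // _; lia.
have s2 : forall z, SS (nv 0 d 0) z -> SS (nv a d M) z.
  by apply: SS_le => jj lj; rewrite /nv lj; case: eqP; lia.
have := dimle_trans (subsp_SS _) s1 h1 (dimle_trans (subsp_SS _) s2 h2 h3).
by move/dimle_leq; apply; rewrite -{2}(prednK d0) mulSn; lia.
Qed.

Lemma rtk : (map_poly ik mu).[thk] = 0.
Proof. by apply/eqP; rewrite -(fmorph_eq0 kE) hkE map_poly_comp; apply/eqP. Qed.

(** A basis of [L(N P)] over [K] stays independent over [k], because representatives of degree below
    [d] are unique; so Riemann's inequality for [F] passes to [E]. Forbidding poles at the [d - 1]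
    other places costs at most [N] for each. *)
Lemma SS_lower_bound N r : dimle (SS (nv N d 0)) ZE r -> ((d * N)%N%:Z + 1 - g%:Z <= (d.-1 * N + r)%N%:Z).
Proof.
move=> h; have h1 : dimle (SS (nv N 1 N)) (SS (nv N d N)) (d.-1 * N).
  by have := @SS_nv N N d.-1; rewrite prednK // => /(_ (leqnn _)).
have s1 : forall z, SS (nv N d N) z -> SS (nv N 1 N) z.
  by apply: SS_le => jj lj; rewrite /nv lj; case: eqP => // /eqP j0; case: ifP => // _; lia.
have h2 : dimle (SS (nv N d N)) ZE r.
  by apply: (dimle_sub _ _ h) => // z; apply: SS_le => jj lj; rewrite /nv lj; case: eqP.
have ub := dimle_trans (subsp_SS _) s1 h1 h2.
have fsN : fs (pt P *+ N) := fsMn N (fs_pt P).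
have [[s sL sind] _] := ellP hFF hg fsN.
have le : (ell (pt P *+ N) <= d.-1 * N + r)%N.
  apply: dimge_dimle ub; exists (fun i => iE (s i) : VE) => [i|c].
    have hs P' : vge (iota := iota) (sval P') (- (pt P P' *+ N)) (s i).
      by have := sL i P'; rewrite fmulrnE.
    split=> [|jj lj].
      apply: AE_iE => P' ne; apply/(vge_vr hFF (svalP P')).
      by have := hs P'; rewrite /pt (negPf ne) mul0rn oppr0.
    rewrite -piE_C; apply/wgeE; exists 0%N => l _; rewrite hornerC.
    have := hs P; rewrite /pt eqxx -mulr_natr mul1r natz /nv; case: eqP => // j0.
    by case: ifP => // j1; case: (jj) j0 j1.
  have /choice[r0 hr0] i : exists r : {poly K}, (size r <= d)%N /\ c 0 i = (map_poly ik r).[thk].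
    have [r' ->] := genk (c 0 i); exists (r' %% mu); split.
      by rewrite -ltnS -smu ltn_modp monic_neq0.
    by rewrite {1}(divp_eq r' mu) rmorphD rmorphM hornerD hornerM rtk mulr0 add0r.
  rewrite /zerosp => e; apply/rowP => i; rewrite mxE (hr0 i).2.
  suff -> : r0 i = 0 by rewrite rmorph0 horner0.
  pose G := \sum_i s i *: map_poly iota (r0 i).
  have G0 : G = 0.
    apply/eqP; apply: contraTT isT => Gn; have : muF %| G.
      apply: kerE; rewrite -piEE rmorph_sum -[RHS]e; apply: eq_bigr => l _.
      by rewrite lmodF_scaleE (hr0 l).2 -pi_kE -mul_polyC (rmorphM piE) piE_C mulrC.
    move/dvdp_leq => /(_ Gn); rewrite size_map_poly smu leqNgt ltnS => /negP[].
    apply: leq_trans (size_sum _ _ _) _; apply/bigmax_leqP => l _.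
    by apply: leq_trans (size_scale_leq _ _) _; rewrite size_map_poly (hr0 l).1.
  apply/polyP => m; rewrite coef0.
  have := sind (\row_l (r0 l)`_m); rewrite /zerosp => /(_ _)/rowP/(_ i); rewrite !mxE; apply.
  transitivity (G`_m); last by rewrite G0 coef0.
  rewrite coef_sum; apply: eq_bigr => l _; by rewrite lmodF_scaleE mxE coefZ coef_map mulrC.
have := riemann hFF hg fsN; rewrite degMn; last exact: fs_pt.
rewrite deg_pt -mulr_natr natz -[dg P]/d -PoszM => h3.
by move: le; rewrite -lez_nat; apply: le_trans.
Qed.

Definition nongap m := exists z, [/\ SS (nv m d 0) z, z != 0 & wv 0 z = - m%:Z].

Lemma gap_dimle m : ~ nongap m.+1 -> dimle (SS (nv m.+1 d 0)) (SS (nv m d 0)) 0.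
Proof.
move=> ng; apply: dimle_inj => z [zA zw]; split=> // jj lj.
have := zw jj lj; rewrite /nv; case: (eqVneq jj 0%N) => [-> h|//].
have [->|z0] := eqVneq (z : E) 0; first exact: wge0.
apply/wvP => //; move/(wvP _ _ z0): h => h.
case: (ltP (- m%:Z) (wv 0 z + 1)) => [|lt]; first by lia.
by case: ng; exists z; split=> //; move: h lt; lia.
Qed.

Lemma nv_step m : dimle (SS (nv m.+1 d 0)) (SS (nv m d 0)) 1.
Proof.
apply: (@SS_step _ _ 0 d0); first by rewrite /nv /=; lia.
by move=> l _ l0; rewrite /nv (negPf l0).
Qed.

Lemma nv_sub m m' : (m <= m')%N -> forall z, SS (nv m d 0) z -> SS (nv m' d 0) z.
Proof. by move=> le; apply: SS_le => jj _; rewrite /nv; case: eqP; lia. Qed.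

(** Otherwise each pair [2 i + 1], [2 i + 2] contains a gap, and poles of order up to [2 (g + 1)]
    give dimension at most [g + 2], whereas [SS_lower_bound] requires at least [g + 3]. *)
Lemma exists_nongaps : exists i, nongap (2 * i).+1 /\ nongap (2 * i).+2.
Proof.
apply: contrapT => nex.
have st i : dimle (SS (nv (2 * i).+2 d 0)) (SS (nv (2 * i) d 0)) 1.
  have [h1|n1] := pselect (nongap (2 * i).+1); last first.
    exact: (@dimle_trans _ _ _ _ _ 1 0 (subsp_SS _) (nv_sub (leqnSn _)) (@nv_step _) (@gap_dimle _ n1)).
  have [h2|n2] := pselect (nongap (2 * i).+2); first by case: nex; exists i.
  exact: (@dimle_trans _ _ _ _ _ 0 1 (subsp_SS _) (nv_sub (leqnSn _)) (@gap_dimle _ n2) (@nv_step _)).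
have ch l : dimle (SS (nv (2 * l) d 0)) (SS (nv 0 d 0)) l.
  elim: l => [|l IH]; first exact: dimle_inj.
  have -> : (2 * l.+1 = (2 * l).+2)%N by lia.
  rewrite -add1n; apply: (dimle_trans (subsp_SS _) _ (st l) IH); apply: nv_sub; lia.
have z1 : dimle (SS (nv 0 d 0)) ZE 1.
  have h := @SS_upper 0 0; rewrite muln0 in h.
  refine (@dimle_sub _ _ _ _ _ _ _ _ _ h) => // z; apply: SS_le => jj lj; rewrite /nv lj.
  by case: eqP => // _; case: ifP.
have := dimle_trans (subsp_SS _) (nv_sub (leq0n _)) (ch g.+1) z1.
move/SS_lower_bound; rewrite -{1}(prednK d0) mulSn; lia.
Qed.

(** Two consecutive integers are coprime and at most one of them vanishes in [k]; the other one is
    taken as the degree of the model. *)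
Lemma exists_xy : exists (nu om : nat) (x y : E), [/\ coprime nu.+1 om, nu.+1%:R != 0 :> k,
  [/\ SS (nv nu.+1 d 0) x, x != 0 & wv 0 x = - nu.+1%:Z] &
  [/\ SS (nv om d 0) y, y != 0 & wv 0 y = - om%:Z]].
Proof.
have [i [[x hx] [y hy]]] := exists_nongaps.
have [e|ne] := eqVneq ((2 * i).+1%:R : k) 0.
  exists (2 * i).+1, (2 * i).+1, y, x; split=> //; first by rewrite coprimeSn.
  by rewrite -natr1 e add0r oner_neq0.
by exists (2 * i)%N, (2 * i).+2, x, y; split=> //; rewrite coprimenS.
Qed.

Lemma dimle_fin (V : lmodType k) (U W : V -> Prop) n (I : finType) (s : I -> V) : dimle U W n -> (n < #|I|)%N ->
  (forall i, U (s i)) -> exists2 c : I -> k, exists i, c i != 0 & W (\sum_i c i *: s i).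
Proof.
move=> h lt hs; have e : #|I| = #|I|.-1.+1 by rewrite prednK //; lia.
have h' : dimle U W #|I|.-1 by apply: dimle_leq h _; rewrite -ltnS -e.
have [|c c0 hc] := h' (fun l => s (enum_val (cast_ord (esym e) l))); first by move=> l; exact: hs.
exists (fun i => c 0 (cast_ord e (enum_rank i))).
  by case/rV0Pn: c0 => l cl; exists (enum_val (cast_ord (esym e) l)); rewrite enum_valK cast_ordKV.
rewrite (reindex (fun l => enum_val (cast_ord (esym e) l))) /=.
  move: hc; congr W; apply: eq_bigr => l _; by rewrite enum_valK cast_ordKV.
exists (fun i => cast_ord e (enum_rank i)) => l _; first by rewrite enum_valK cast_ordKV.
by rewrite cast_ordK enum_rankK.
Qed.

Lemma wge_bound z : exists M : nat, forall jj, (jj < d)%N -> wge jj (- M%:Z) z.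
Proof.
have [->|z0] := eqVneq z 0; first by exists 0%N => jj _; exact: wge0.
exists (\max_(jj < d) `|wv jj z|)%N => jj lj; apply/wvP => //.
have := @leq_bigmax _ (fun jj : 'I_d => `|wv jj z|%N) (Ordinal lj) => /=.
by move: (\max_(_ < _) _)%N => m; lia.
Qed.

Definition oE (z : E) : int := - wv 0 z.

Lemma oE_M z w : z != 0 -> w != 0 -> oE (z * w) = oE z + oE w.
Proof. by move=> z0 w0; rewrite /oE wvM // opprD. Qed.
Lemma oleE z m : ole oE z m <-> wge 0 (- m) z.
Proof.
have [->|z0] := eqVneq z 0; first by split=> _; [exact: wge0|left].
rewrite wvP //; split=> [[/eqP|]|h]; first by rewrite (negPf z0).
  by rewrite /oE; lia.
by right; rewrite /oE; lia.
Qed.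
Lemma oE_D z w m : ole oE z m -> ole oE w m -> ole oE (z + w) m.
Proof. by rewrite !oleE; apply: wgeD. Qed.

Section Plane.
Variables (nu om : nat) (x y : E).
Local Notation n := nu.+1.
Hypotheses (cop : coprime n om).
Hypotheses (hx : SS (nv n d 0) x) (x0 : x != 0) (ox : wv 0 x = - n%:Z).
Hypotheses (hy : SS (nv om d 0) y) (y0 : y != 0) (oy : wv 0 y = - om%:Z).

Definition fE : {rmorphism {poly k} -> E} := horner_eval x \o map_poly kE.

Lemma fEC c : fE c%:P = kE c.
Proof. by rewrite /fE /= /horner_eval map_polyC hornerC. Qed.
Lemma fEX : fE 'X = x.
Proof. by rewrite /fE /= /horner_eval map_polyX hornerX. Qed.

Lemma oE_C c : c != 0 -> oE (fE c%:P) = 0.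
Proof. by move=> c0; rewrite fEC /oE wv_kE // oppr0. Qed.
Lemma oE_x : oE (fE 'X) = n. Proof. by rewrite fEX /oE ox opprK. Qed.
Lemma oE_y : oE y = om. Proof. by rewrite /oE oy opprK. Qed.
Lemma fEX0 : fE 'X != 0. Proof. by rewrite fEX. Qed.

Lemma wge_X jj z i N : wge jj N z -> wge jj (N *+ i) (z ^+ i).
Proof.
move=> h; elim: i => [|i IH]; first by rewrite mulr0n expr0 -(rmorph1 kE); exact: wge_kE.
by rewrite exprS mulrS; apply: wgeM.
Qed.

(** Poles of [x] and [y] occur at the first place only, so the elements [x ^ a y ^ i] and [x ^ a z]
    with [a < T] lie in a space whose dimension grows like [n T] by [SS_upper]. There are
    [(n + 1) T] of them. *)
Lemma pigeonhole z : AE z -> exists (n0 : {poly k}) (p : 'I_n -> {poly k}),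
  n0 != 0 /\ fE n0 * z = \sum_i fE (p i) * y ^+ i.
Proof.
move=> zA; have [M hM] := wge_bound z.
pose T := (d * M + (om * n + M) + 2)%N.
pose s (e : 'I_n.+1 * 'I_T) : VE := x ^+ e.2 * (if unlift ord_max e.1 is Some i then y ^+ i else z).
have [||c [[i0 a0] c0] hc] := @dimle_fin VE _ _ _ _ s (@SS_upper (n * T + (om * n + M)) M).
- rewrite card_prod !card_ord mulSn; have hT : T = (d * M + (om * n + M) + 2)%N by [].
  by move: (n * T)%N (d * M)%N (om * n)%N hT => u v w hT; lia.
- case=> i a; rewrite /s /=; have xA : AE (x ^+ a) by apply: AE_X; case: hx.
  have xw jj : (jj < d)%N -> wge jj (if jj == 0%N then - (n * a)%N%:Z else 0) (x ^+ a).
    move=> lj; have := wge_X a (hx.2 jj lj); rewrite /nv; case: eqP => _; last by rewrite lj oppr0 mul0rn.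
    by rewrite mulNrn -mulr_natr natz PoszM.
  have aT : (n * a <= n * T)%N by rewrite leq_mul2l ltnW ?orbT.
  case: unliftP => [i' _|_]; split=> [|jj lj].
  + by apply: AE_M => //; apply: AE_X; case: hy.
  + have yw : wge jj (if jj == 0%N then - (om * i')%N%:Z else 0) (y ^+ i').
      have := wge_X i' (hy.2 jj lj); rewrite /nv; case: eqP => _; last by rewrite lj oppr0 mul0rn.
      by rewrite mulNrn -mulr_natr natz PoszM.
    have := wgeM (xw jj lj) yw; apply: wge_le; rewrite /nv.
    have : (om * i' <= om * n)%N by rewrite leq_mul2l ltnW ?orbT.
    by case: eqP => _; [move: (n * a)%N (n * T)%N (om * i')%N (om * n)%N aT; lia|case: ifP; lia].
  + exact: AE_M.
  have := wgeM (xw jj lj) (hM jj lj); apply: wge_le; rewrite /nv; case: eqP => j0.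
    by move: (n * a)%N (n * T)%N (om * n)%N aT; lia.
  by case: ifP => j1; [case: (jj) j0 j1|lia].
pose pp (i : 'I_n.+1) : {poly k} := \sum_(a < T) c (i, a) *: 'X^a.
have ppE i : fE (pp i) = \sum_(a < T) kE (c (i, a)) * x ^+ a.
  by rewrite rmorph_sum; apply: eq_bigr => a _; rewrite -mul_polyC (rmorphM fE) (rmorphXn fE) fEC fEX.
have rel : fE (pp ord_max) * z + \sum_(i < n) fE (pp (lift ord_max i)) * y ^+ i = 0.
  rewrite -[RHS]hc (eq_bigr (fun e : 'I_n.+1 * 'I_T => kE (c (e.1, e.2)) * x ^+ e.2 *
     (if unlift ord_max e.1 is Some i then y ^+ i else z))); last first.
    by case=> i a _; rewrite lmodF_scaleE /s /= mulrA.
  rewrite -(pair_big predT predT (fun i a => kE (c (i, a)) * x ^+ a *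
     (if unlift ord_max i is Some i' then y ^+ i' else z))) /=.
  under [RHS]eq_bigr => i _ do rewrite -mulr_suml -ppE.
  rewrite [RHS](bigD1 ord_max) //= unlift_none; congr (_ + _).
  rewrite (reindex_onto (lift ord_max) (fun i => odflt ord0 (unlift ord_max i))) /=; last first.
    by move=> i; rewrite eq_sym => /unlift_some[i' -> ->].
  apply: eq_big => [i|i _]; first by rewrite liftK eqxx eq_sym neq_lift.
  by rewrite liftK.
(* If [z] did not occur, the relation would be among the [x ^ a y ^ i], which [comb_eq0]
   excludes. *)
have [e|ne] := eqVneq (pp ord_max) 0.
  move: rel; rewrite e rmorph0 mul0r add0r => rel.
  have h := comb_eq0 oE_M oE_D oE_C fEX0 oE_x y0 oE_y cop rel.
  have /polyP/(_ a0) : pp i0 = 0 by case: (unliftP ord_max i0) => [i' ->|->].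
  rewrite coef0 coef_sum (bigD1 a0) //= coefZ coefXn eqxx mulr1 big1 ?addr0 => [/eqP|a an].
    by rewrite (negPf c0).
  by rewrite coefZ coefXn (_ : (a0 == a :> nat) = false) ?mulr0 //; apply: contraNF an => /eqP/val_inj ->.
exists (pp ord_max), (fun i => - pp (lift ord_max i)); split=> //.
under eq_bigr => i _ do rewrite rmorphN mulNr.
by rewrite sumrN; apply/eqP; rewrite -addr_eq0 rel.
Qed.

Lemma pigeonhole_bev z : AE z -> exists (n0 : {poly k}) (w : {poly {poly k}}),
  n0 != 0 /\ fE n0 * z = bev fE y w.
Proof.
move=> /pigeonhole[n0 [p [h e]]]; exists n0, (\sum_i (p i)%:P * 'X^i); split=> //.
rewrite e rmorph_sum; apply: eq_bigr => i _; by rewrite rmorphM /= bevC bevXn.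
Qed.

End Plane.

(** From [n0 y ^ n = sum p_i y ^ i] it follows that [n0 y] is integral over the polynomials in [x].
    Its pole order differs from that of [y] by a multiple of [n], hence stays coprime to [n]. *)
Lemma exists_plane_model : exists (nu om : nat) (x y : E) (c : 'rV[{poly k}]_nu.+1),
  [/\ coprime nu.+1 om, nu.+1%:R != 0 :> k,
  [/\ SS (nv nu.+1 d 0) x, x != 0 & wv 0 x = - nu.+1%:Z],
  [/\ SS (nv om d 0) y, y != 0 & wv 0 y = - om%:Z] & on_curve c (fE x) y].
Proof.
have [nu [om [x [y [cop ch [hx x0 ox] [hy y0 oy]]]]]] := exists_xy.
have [n0 [p [n00 e]]] := pigeonhole cop hx x0 ox hy y0 oy (AE_X nu.+1 hy.1).
have [f0 of0] := o_px oE_M oE_D (oE_C x) (fEX0 x0) (oE_x ox) y0 (oE_y oy) cop n00.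
pose om' := (om + nu.+1 * (size n0).-1)%N.
exists nu, om', x, (fE x n0 * y), (\row_i (p i * n0 ^+ (nu - i))); split=> //.
- by rewrite /om' addnC [(nu.+1 * _)%N]mulnC /coprime gcdnMDl.
- have wvn : wv 0 (fE x n0) = - (nu.+1 * (size n0).-1)%N%:Z by move: of0; rewrite /oE; lia.
  have nA : AE (fE x n0).
    elim/poly_ind: n0 {n00 e f0 of0 om' wvn} => [|u a IH]; first by rewrite rmorph0; exact: AE_0.
    by rewrite (rmorphD (fE x)) (rmorphM (fE x)) fEC fEX; apply: AE_D; [apply: AE_M => //; case: hx|exact: AE_kE].
  have nw jj : (jj < d)%N -> jj != 0%N -> wge jj 0 (fE x n0).
    move=> lj j0; elim/poly_ind: n0 {n00 e f0 of0 om' wvn nA} => [|u a IH]; first by rewrite rmorph0; exact: wge0.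
    rewrite (rmorphD (fE x)) (rmorphM (fE x)) fEC fEX; apply: wgeD; last exact: wge_kE.
    rewrite -[X in wge _ X _]addr0; apply: wgeM => //; have := hx.2 jj lj.
    by rewrite /nv (negPf j0) lj oppr0.
  have wvy : wv 0 (fE x n0 * y) = - om'%:Z by rewrite wvM // wvn oy /om'; lia.
  split=> //; last by rewrite mulf_neq0.
  split=> [|jj lj]; first by apply: AE_M => //; case: hy.
  rewrite /nv; have [->|j0] := eqVneq jj 0%N; first by apply/wvP; rewrite ?mulf_neq0 // wvy.
  rewrite lj oppr0 -[X in wge _ X _]addr0; apply: wgeM; first exact: nw.
  by have := hy.2 jj lj; rewrite /nv (negPf j0) lj oppr0.
rewrite /on_curve exprMn exprSr -mulrA e mulr_sumr; apply: eq_bigr => i _.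
rewrite mxE (rmorphM (fE x)) (rmorphXn (fE x)) exprMn.
have -> : fE x n0 ^+ nu = fE x n0 ^+ (nu - i) * fE x n0 ^+ i by rewrite -exprD subnK // -ltnS.
ring.
Qed.

(** * Points of the plane model, homomorphisms and places *)

Section Link.
Variable B : nat -> nat.
Hypothesis hB : forall r : nat, (1 <= r)%N -> has_card (places_of_degree iota r) (B r).
Hypothesis g2 : (2 <= g)%N.
Local Notation AR := (Aring P).
Local Notation av := (val : {rmorphism AR -> F}).

Definition eE : {rmorphism {poly AR} -> E} := piE \o map_poly av.
Definition psi (r : {rmorphism AR -> L}) : {rmorphism {poly AR} -> L} := horner_eval zt \o map_poly r.
Local Notation khom := (@khom K F iota P L j).

Lemma eEE p : eE p = piE (map_poly av p). Proof. by []. Qed.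
Lemma eE_C a : eE a%:P = iE (aval a).
Proof. by rewrite eEE map_polyC piE_C. Qed.
Lemma eE_X : eE 'X = th.
Proof. by rewrite eEE map_polyX piE_X. Qed.
Lemma psi_C r a : psi r a%:P = r a.
Proof. by rewrite /psi /= /horner_eval map_polyC hornerC. Qed.
Lemma psi_X r : psi r 'X = zt.
Proof. by rewrite /psi /= /horner_eval map_polyX hornerX. Qed.

Lemma AE_eE z : AE z -> exists p, eE p = z.
Proof.
case=> p <- hp; have /choice[c hc] i : exists a : AR, aval a = p`_i by exact: aval_surj (hp i).
exists (\poly_(i < size p) c i); rewrite eEE; congr (piE _); apply/polyP => i.
rewrite coef_map coef_poly /=; case: ltnP => [_|le]; first exact: hc.
by rewrite aval0 nth_default.
Qed.

(** This makes [psi r] well defined on the functions of [E] regular outside the places above [P].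
    Division by the monic [muA] leaves a remainder of degree below [d], which is zero as soon as it
    vanishes in [E]. *)
Lemma eE_ker r p : khom r -> eE p = 0 -> psi r p = 0.
Proof.
move=> hk; have [cA hcA] := exists_constA P; pose muA := map_poly cA mu.
have muAm : muA \is monic by rewrite monicE lead_coef_map_inj ?rmorph0 ?(monicP mum) ?rmorph1 //; exact: fmorph_inj.
have mv : map_poly av muA = muF.
  by apply/polyP => i; rewrite !coef_map /= hcA.
have smA : size muA = d.+1 by rewrite size_map_inj_poly ?rmorph0 //; exact: fmorph_inj.
have eq := Pdiv.RingMonic.rdivp_eq muAm p.
have emu : eE muA = 0 by rewrite /eE /= mv; exact: rtE.
have pmu : psi r muA = 0.
  rewrite /psi /= /horner_eval (_ : map_poly r muA = map_poly j mu) //.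
  by apply/polyP => i; rewrite !coef_map /= (hk (mu`_i)) // hcA.
rewrite eq !rmorphD !rmorphM emu pmu !mulr0 !add0r => e0.
suff -> : Pdiv.CommonRing.rmodp p muA = 0 by rewrite rmorph0.
set R := Pdiv.CommonRing.rmodp p muA in e0 *.
have sR : (size R <= d)%N by rewrite -ltnS -smA Pdiv.CommonRing.ltn_rmodp monic_neq0.
have R0 : map_poly av R = 0.
  apply/eqP; apply: contraTT isT => ne; have : muF %| map_poly av R by apply: kerE.
  move/dvdp_leq => /(_ ne); rewrite size_map_poly smu leqNgt ltnS => /negP[].
  by apply: leq_trans (size_poly _ _) sR.
apply/polyP => i; rewrite coef0; apply: aval_inj; rewrite aval0.
by have := congr1 (fun p : {poly F} => p`_i) R0; rewrite coef_map coef0.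
Qed.

Variables (nu om : nat) (x y : E) (c : 'rV[{poly k}]_nu.+1).
Local Notation n := nu.+1.
Hypotheses (cop : coprime n om) (chn : n%:R != 0 :> k).
Hypotheses (hx : SS (nv n d 0) x) (x0 : x != 0) (ox : wv 0 x = - n%:Z).
Hypotheses (hy : SS (nv om d 0) y) (y0 : y != 0) (oy : wv 0 y = - om%:Z).
Hypothesis hcurve : on_curve c (fE x) y.
Variables (px py : {poly AR}).
Hypotheses (epx : eE px = x) (epy : eE py = y).
Local Notation bE := (bev (fE x) y).
Local Notation bP a b := (bev (ev kL a) b).

Lemma kE_ik a : kE (ik a) = iE (iota a).
Proof. by have := hkE a%:P; rewrite !map_polyC !hornerC. Qed.
Lemma kL_ik a : kL (ik a) = j a.
Proof. by have := hkL a%:P; rewrite !map_polyC !hornerC. Qed.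
Lemma kE_thk : kE thk = th.
Proof. by have := hkE 'X; rewrite !map_polyX !hornerX. Qed.
Lemma kL_thk : kL thk = zt.
Proof. by have := hkL 'X; rewrite !map_polyX !hornerX. Qed.

Lemma lift_kE r a : khom r -> exists p, eE p = kE a /\ psi r p = kL a.
Proof.
move=> hk; have [cA hcA] := exists_constA P; have [s [-> ->]] := kE_pi a.
exists (map_poly cA s); rewrite /eE /psi /= /horner_eval; split.
  by rewrite -[(map_poly iE (map_poly av _)).[_]]/(piE _); congr (piE _); apply/polyP => i; rewrite !coef_map /= hcA.
by congr (_.[_]); apply/polyP => i; rewrite !coef_map /= (hk (s`_i)) // hcA.
Qed.

Lemma evC a b : ev kL a b%:P = kL b.
Proof. by rewrite /= /horner_eval map_polyC hornerC. Qed.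
Lemma evX a : ev kL a 'X = a.
Proof. by rewrite /= /horner_eval map_polyX hornerX. Qed.

Lemma lift_fE r u : khom r -> exists p, eE p = fE x u /\ psi r p = ev kL (psi r px) u.
Proof.
move=> hk; elim/poly_ind: u => [|u a [p [e1 e2]]]; first by exists 0; rewrite !rmorph0.
have [p' [e1' e2']] := lift_kE a hk.
exists (p * px + p'); split.
  by rewrite (rmorphD eE) (rmorphM eE) (rmorphD (fE x)) (rmorphM (fE x)) e1 e1' epx fEC fEX.
by rewrite (rmorphD (psi r)) (rmorphM (psi r)) (rmorphD (ev kL _)) (rmorphM (ev kL _)) e2 e2' evC evX.
Qed.

Lemma bevD (S : comNzRingType) (f : {rmorphism {poly k} -> S}) z V W : bev f z (V + W) = bev f z V + bev f z W.
Proof. exact: rmorphD. Qed.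
Lemma bevB (S : comNzRingType) (f : {rmorphism {poly k} -> S}) z V W : bev f z (V - W) = bev f z V - bev f z W.
Proof. exact: bev_is_additive. Qed.
Lemma bevM (S : comNzRingType) (f : {rmorphism {poly k} -> S}) z V W : bev f z (V * W) = bev f z V * bev f z W.
Proof. exact: rmorphM. Qed.
Lemma bevCX (S : comNzRingType) (f : {rmorphism {poly k} -> S}) z u i : bev f z (u%:P ^+ i) = f u ^+ i.
Proof. by rewrite rmorphXn /= bevC. Qed.

Lemma lift_bev r W : khom r -> exists p, eE p = bE W /\ psi r p = bP (psi r px) (psi r py) W.
Proof.
move=> hk; elim/poly_ind: W => [|W u [p [e1 e2]]]; first by exists 0; rewrite !rmorph0.
have [p' [e1' e2']] := lift_fE u hk.
exists (p * py + p'); split.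
  by rewrite (rmorphD eE) (rmorphM eE) bevD bevM bevX bevC e1 e1' epy.
by rewrite (rmorphD (psi r)) (rmorphM (psi r)) bevD bevM bevX bevC e2 e2'.
Qed.

Lemma bev_link r W p : khom r -> bE W = eE p -> bP (psi r px) (psi r py) W = psi r p.
Proof.
move=> hk e; have [p' [e1 <-]] := lift_bev W hk; apply/eqP; rewrite -subr_eq0 -rmorphB.
by apply/eqP; apply: eE_ker => //; rewrite rmorphB e1 e subrr.
Qed.

Lemma on_curve_hom r : khom r -> on_curve c (ev kL (psi r px)) (psi r py).
Proof.
move=> hk; apply/on_curveE; rewrite (@bev_link r _ 0) ?rmorph0 //.
exact/on_curveE.
Qed.

Lemma bev_zero_pt W a b : on_curve c (ev kL a) b -> bE W = 0 -> bP a b W = 0.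
Proof.
move=> hc0 h; rewrite (bev_row W hc0).
have -> := Mx_eq0 oE_M oE_D (oE_C x) (fEX0 x0) (oE_x ox) y0 (oE_y oy) cop hcurve h.
by rewrite big1 // => l _; rewrite mxE rmorph0 mul0r.
Qed.

(** Each function becomes a polynomial in [x] and [y] after multiplication by a polynomial in [x]; a
    single [s] works up to powers because finitely many functions generate. *)
Lemma exists_denominator : exists s : {poly k}, s != 0 /\
  forall a : F, inA a -> exists m W, fE x s ^+ m * iE a = bE W.
Proof.
have [bs [bsA gen]] := A_generated hFF hfull hB hg g2 P.
have /choice[nb hnb] b : exists nb : {poly k}, nb != 0 /\ (inA b -> exists W, fE x nb * iE b = bE W).
  have [h|h] := pselect (inA b); last by exists 1; split=> //; exact: oner_neq0.
  have [n0 [W [h0 e]]] := pigeonhole_bev cop hx x0 ox hy y0 oy (AE_iE h).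
  by exists n0; split=> // _; exists W.
pose s := \prod_(b <- bs) nb b.
have s0 : s != 0 by rewrite prodf_seq_neq0; apply/allP => b _; exact: (hnb b).1.
exists s; split=> // a; apply: (gen (fun a => exists m W, fE x s ^+ m * iE a = bE W)).
- by move=> b; exists 0%N, (ik b)%:P%:P; rewrite expr0 mul1r bevC fEC kE_ik.
- move=> z w [m [W e]] [m' [W' e']]; exists (m + m')%N, (s%:P ^+ m' * W + s%:P ^+ m * W').
  rewrite bevD !bevM !bevCX -e -e' exprD; ring.
- move=> z w [m [W e]] [m' [W' e']]; exists (m + m')%N, (W * W').
  rewrite bevM -e -e' exprD; ring.
move=> b hb; have [W e] := (hnb b).2 (bsA b hb).
exists 1%N, ((\prod_(b' <- rem b bs) nb b')%:P * W).
have -> : s = nb b * \prod_(b' <- rem b bs) nb b' by rewrite /s (big_rem b hb).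
rewrite expr1 (rmorphM (fE x)) bevM bevC -e; ring.
Qed.

Section Denominator.
Variable s : {poly k}.
Hypotheses (s0 : s != 0) (hs : forall a : F, inA a -> exists m W, fE x s ^+ m * iE a = bE W).

Lemma fEs0 : fE x s != 0.
Proof. exact: (o_px oE_M oE_D (oE_C x) (fEX0 x0) (oE_x ox) y0 (oE_y oy) cop s0).1. Qed.

Lemma hom_determined r1 r2 : khom r1 -> khom r2 -> psi r1 px = psi r2 px -> psi r1 py = psi r2 py ->
  ev kL (psi r1 px) s != 0 -> forall a, r1 a = r2 a.
Proof.
move=> h1 h2 eX eY ne a; have [m [W e]] := hs (avalP a).
have val r : khom r -> bP (psi r px) (psi r py) W = ev kL (psi r px) s ^+ m * r a.
  move=> hk; have [ps [e1 e2]] := lift_fE s hk.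
  rewrite (@bev_link r W (ps ^+ m * a%:P)) // !rmorphM !rmorphXn ?e1 ?e2 ?psi_C //.
  by rewrite eE_C e.
have := val r1 h1; rewrite eX eY (val r2 h2) -eX.
by move/(mulfI (expf_neq0 m ne)).
Qed.

(** The homomorphism is evaluation at the point of fractions [W / s ^ m]. It is well defined by
    [bev_zero_pt], since [s] does not vanish at the point. *)
Lemma hom_of_point a b : on_curve c (ev kL a) b -> ev kL a s != 0 -> exists r : {rmorphism AR -> L},
  [/\ khom r, psi r px = a, psi r py = b &
    forall N, (0 < N)%N -> [pchar L].-nat N -> (forall e, kL e ^+ N = kL e) -> a ^+ N = a -> b ^+ N = b ->
      forall z, r z ^+ N = r z].
Proof.
move=> hc0 sn; set sg := ev kL a s in sn.
pose rel (z : E) (v : L) := exists m W, fE x s ^+ m * z = bE W /\ bP a b W = sg ^+ m * v.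
have sgX m : bP a b (s%:P ^+ m) = sg ^+ m by rewrite bevCX.
have sEX m : bE (s%:P ^+ m) = fE x s ^+ m by rewrite bevCX.
have relu z v v' : rel z v -> rel z v' -> v = v'.
  move=> [m [W [e1 e2]]] [m' [W' [e1' e2']]].
  have : bP a b (s%:P ^+ m' * W - s%:P ^+ m * W') = 0.
    apply: bev_zero_pt => //; rewrite bevB !bevM !sEX -e1 -e1'; ring.
  rewrite bevB !bevM !sgX e2 e2' => /eqP; rewrite subr_eq0 => /eqP e.
  by apply: (mulfI (expf_neq0 (m + m') sn)); rewrite exprD -!mulrA -e; ring.
have relD z v z' v' : rel z v -> rel z' v' -> rel (z + z') (v + v').
  move=> [m [W [e1 e2]]] [m' [W' [e1' e2']]]; exists (m + m')%N, (s%:P ^+ m' * W + s%:P ^+ m * W').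
  by rewrite !bevD !bevM !sEX !sgX -e1 -e1' e2 e2' !exprD; split; ring.
have relM z v z' v' : rel z v -> rel z' v' -> rel (z * z') (v * v').
  move=> [m [W [e1 e2]]] [m' [W' [e1' e2']]]; exists (m + m')%N, (W * W').
  by rewrite !bevM -e1 -e1' e2 e2' !exprD; split; ring.
have relk e : rel (kE e) (kL e).
  exists 0%N, e%:P%:P; rewrite !expr0 !mul1r !bevC fEC; split=> //.
  by rewrite evC.
have relN z v : rel z v -> rel (- z) (- v).
  by move=> h; rewrite -mulN1r -[- v]mulN1r; apply: relM => //; rewrite -(rmorphN1 kE) -(rmorphN1 kL).
have [||||| r hr'] := @rel_rmorph AR L (fun z v => rel (iE (aval z)) v).
- move=> z; have [m [W e]] := hs (avalP z); exists (bP a b W / sg ^+ m), m, W.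
  by rewrite mulrCA mulfV ?mulr1 // expf_neq0.
- by move=> z v v'; apply: relu.
- by move=> z v z' v' h h'; rewrite avalB rmorphB; apply: relD => //; apply: relN.
- by move=> z v z' v' h h'; rewrite avalM rmorphM; apply: relM.
- by rewrite aval1 rmorph1 -(rmorph1 kE) -(rmorph1 kL).
have hk : khom r by move=> e z ez; have := hr' z; rewrite ez -kE_ik => /relu/(_ (relk (ik e))) ->; rewrite kL_ik.
have relp p : rel (eE p) (psi r p).
  elim/poly_ind: p => [|p e IH]; first by rewrite !rmorph0 -(rmorph0 kE) -(rmorph0 kL).
  rewrite (rmorphD eE) (rmorphM eE) (rmorphD (psi r)) (rmorphM (psi r)) eE_X eE_C psi_X psi_C; apply: relD => //; apply: relM => //.
  by rewrite -kE_thk -kL_thk.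
exists r; split=> //.
- apply: relu (relp px) _; rewrite epx; exists 0%N, ('X)%:P; rewrite !expr0 !mul1r !bevC fEX; split=> //.
  by rewrite evX.
- apply: relu (relp py) _; rewrite epy; exists 0%N, 'X; by rewrite !expr0 !mul1r !bevX.
move=> N N0 Nch Nk Na Nb z; have [m [W [e1 e2]]] := hr' z.
have hW : bP a b W ^+ N = bP a b W by rewrite bev_frob // Na Nb.
have hsg : sg ^+ N = sg by rewrite /sg ev_frob // Na.
apply: (mulfI (expf_neq0 m sn)); rewrite -e2 -hW e2 exprMn; congr (_ * _).
by rewrite exprAC hsg.
Qed.

Variable rr : place iota -> F -> L.
Hypothesis hrr : forall P', reshom iota j (sval P') (rr P').

Lemma exists_points : exists ptv : place iota * nat -> L * L, forall P' i, P' != P ->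
  exists r, [/\ khom r, forall a, r a = rr P' (aval a) ^+ (q ^ i) & ptv (P', i) = (psi r px, psi r py)].
Proof.
have /choice[ptv h] (z : place iota * nat) : exists p : L * L, z.1 != P ->
    exists r, [/\ khom r, forall a, r a = rr z.1 (aval a) ^+ (q ^ z.2) & p = (psi r px, psi r py)].
  have [->|ne] := eqVneq z.1 P; first by exists (0, 0).
  by have [r hk er] := res_hom hrr ne z.2; exists (psi r px, psi r py) => _; exists r.
by exists ptv => P' i; exact: (h (P', i)).
Qed.

Lemma psi_fix (r : {rmorphism AR -> L}) M p : (d %| M)%N -> (forall a, r a ^+ (q ^ M) = r a) ->
  psi r p ^+ (q ^ M) = psi r p.
Proof.
move=> /dvdnP[l eM] hM; have [fr e] := frob_exists j M; rewrite -e.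
have ez : fr zt = zt by rewrite e eM mulnC zt_d.
elim/poly_ind: p => [|p a IH]; first by rewrite !rmorph0.
by rewrite (rmorphD (psi r)) (rmorphM (psi r)) psi_X psi_C rmorphD rmorphM /= IH ez e hM.
Qed.

Lemma common_denominator (p : {poly F}) : exists a, [/\ inA a, a != 0 & forall i, inA (a * p`_i)].
Proof.
elim/poly_ind: p => [|p b [a [aA a0 ha]]].
  by exists 1; split; [exact: inA1|exact: oner_neq0|move=> i; rewrite coef0 mulr0; exact: inA0].
have [a' [aA' a0' ha']] := A_denominator hFF hB hg g2 P b.
exists (a * a'); split; [exact: inAM|by rewrite mulf_neq0|move=> i].
rewrite coefD coefMX coefC; case: i => [|i] /=; first by rewrite add0r -mulrA; apply: inAM.
by rewrite addr0 mulrAC; apply: inAM.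
Qed.

(** Some nonzero [a] makes [a / s] regular outside the places above [P]. A homomorphism at which [s]
    vanishes then kills [a], so its place is among the finitely many zeros of [a]. *)
Lemma bad_places : exists T : seq (place iota), forall P' r i, P' != P -> khom r ->
  (forall a, r a = rr P' (aval a) ^+ (q ^ i)) -> ev kL (psi r px) s = 0 -> P' \in T.
Proof.
have [p ep] := piE_surj (fE x s)^-1; have [a [aA a0 ha]] := common_denominator p.
have [pt ept] : exists p, eE p = iE a * (fE x s)^-1.
  apply: AE_eE; exists (a%:P * p); first by rewrite (rmorphM piE) piE_C ep.
  by move=> i; rewrite coefCM.
have [us hs'] := suppP (fs_dv hFF hB a0); exists (supp (dv a)) => P' r i ne hk er es.
apply: hs'; have [b eb] := aval_surj aA; have [ps [e1 e2]] := lift_fE s hk.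
have : psi r (b%:P - ps * pt) = 0.
  apply: eE_ker => //; rewrite (rmorphB eE) (rmorphM eE) eE_C eb e1 ept mulrCA mulfV ?mulr1 ?subrr //.
  exact: fEs0.
rewrite (rmorphB (psi r)) (rmorphM (psi r)) psi_C e2 es mul0r subr0 er => /eqP.
rewrite expf_eq0 => /andP[_ /eqP]; rewrite eb => ra.
have aO : sval P' a by rewrite -eb; exact: avalP.
have /(pl_ord hFF (svalP P') a0) : in_place (sval P') a by apply/(rh_ker (hrr P')).
by rewrite /dv => /gt_eqF ->.
Qed.

(** A place [P'] with [dg P'] dividing [M] yields [dg P'] conjugate homomorphisms, and these match
    the fixed points of the model where [s] is nonzero. The constant collects the points where [s]
    vanishes ([C1]), the places of [bad_places] ([C2]) and [P] itself ([d]). *)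
Lemma count_places : exists C, forall M (pts : seq (L * L)) (sp : seq (place iota)),
  (0 < M)%N -> (d %| M)%N -> uniq pts ->
  (forall p, p \in pts <-> [/\ on_curve c (ev kL p.1) p.2, p.1 ^+ (q ^ M) = p.1 & p.2 ^+ (q ^ M) = p.2]) ->
  uniq sp -> (forall P', (P' \in sp) = (dg P' %| M)%N) ->
  (size pts <= \sum_(P' <- sp) dg P' + C)%N /\ (\sum_(P' <- sp) dg P' <= size pts + C)%N.
Proof.
have [T hT] := bad_places; have [ptv hptv] := exists_points.
pose C1 := `|oE (bE s%:P)|%N; pose C2 := (\sum_(P' <- undup T) dg P')%N.
exists (C1 + (C2 + d))%N => M pts sp M0 dM upts hpts usp hsp.
pose ix (t : seq (place iota)) := [seq (P', i) | P' <- t, i <- seq.iota 0 (dg P')].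
have six t : size (ix t) = (\sum_(P' <- t) dg P')%N.
  rewrite /ix size_allpairs_dep sumnE big_map; apply: eq_bigr => P' _; exact: size_iota.
have uix t : uniq t -> uniq (ix t).
  move=> ut; apply: allpairs_uniq_dep => // [P' _|]; first exact: iota_uniq.
  by move=> [a1 b1] [a2 b2] /= _ _ [-> ->].
have mix t P' i : ((P', i) \in ix t) = (P' \in t) && (i < dg P')%N.
  apply/allpairsPdep/idP => [[P1 [i1 [h1 h2 [-> ->]]]]|/andP[h1 h2]].
    by rewrite h1; move: h2; rewrite mem_iota add0n.
  by exists P', i; split=> //; rewrite mem_iota add0n.
pose sp' := [seq P' <- sp | P' != P].
have sps : (\sum_(P' <- sp) dg P' = \sum_(P' <- sp') dg P' + d)%N.
  have hP : P \in sp by rewrite hsp.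
  rewrite (bigD1_seq P) //= addnC; congr (_ + _)%N; by rewrite /sp' big_filter.
pose good (p : L * L) := ev kL p.1 s != 0.
have good1 : (size (filter good pts) <= size (ix sp'))%N.
  rewrite -(size_map ptv); apply: uniq_leq_size; first exact: filter_uniq.
  move=> [a b]; rewrite mem_filter => /andP[hgd /hpts[hc0 fa fb]].
  have [r [hk ea eb hf]] := hom_of_point hc0 hgd.
  have kf e : kL e ^+ (q ^ M) = kL e.
    have [t [_ ->]] := kE_pi e; rewrite horner_fix; case/dvdnP: dM => l ->.
    by rewrite mulnC zt_d.
  have [|P' [i [ne li df er]]] := hom_place hFF hfull hB hg g2 hrr hk M0.
    by apply: hf => //; [rewrite expn_gt0 (ltnW (card_gt1 K))|exact: (pchar_cardX j)].
  have [r' [hk' er' ep]] := hptv P' i ne.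
  have eq p : psi r' p = psi r p.
    by rewrite /psi /= /horner_eval; congr (_.[_]); apply: eq_map_poly => z; rewrite er' er.
  apply/mapP; exists (P', i); first by rewrite mix mem_filter ne hsp df.
  by rewrite ep !eq ea eb.
have good2 : (size [seq z <- ix sp' | good (ptv z)] <= size pts)%N.
  rewrite -(size_map ptv); apply: uniq_leq_size.
    rewrite map_inj_in_uniq; first by rewrite filter_uniq // uix // filter_uniq.
    move=> [P1 i1] [P2 i2]; rewrite !mem_filter !mix !mem_filter => /andP[g1 /andP[/andP[n1 _] l1]].
    move=> /andP[_ /andP[/andP[n2 _] l2]] e.
    have [r1 [k1 e1 ep1]] := hptv P1 i1 n1; have [r2 [k2 e2 ep2]] := hptv P2 i2 n2.
    move: g1 e; rewrite /good ep1 ep2 /= => g1 [eX eY].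
    have h := hom_determined k1 k2 eX eY g1.
    have [|-> -> //] := res_hom_inj hFF hfull hB hg g2 hrr n1 n2 l1 l2.
    by move=> a; rewrite -e1 -e2 h.
  move=> p /mapP[[P' i]]; rewrite mem_filter mix mem_filter hsp => /andP[_ /andP[/andP[ne df] li]] ->.
  have [r [hk er ->]] := hptv P' i ne; apply/hpts => /=.
  have fr a : r a ^+ (q ^ M) = r a by rewrite er exprAC (res_fix hrr ne).
  by split; [exact: on_curve_hom|exact: psi_fix|exact: psi_fix].
have bad1 : (size (filter (predC good) pts) <= C1)%N.
  have := @zero_bound k nu c E (fE x) y oE om oE_M oE_D (oE_C x) (fEX0 x0) (oE_x ox) y0 (oE_y oy) cop hcurve L kL s%:P.
  move=> /(_ (filter (predC good) pts)) h.
  rewrite -lez_nat /C1 abszE; apply: le_trans (ler_norm _); apply: h; first by rewrite bevC fEs0.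
    exact: filter_uniq.
  move=> p; rewrite mem_filter => /andP[/negPn/eqP e /hpts[hc0 _ _]]; split=> //.
  by rewrite bevC.
have bad2 : (size [seq z <- ix sp' | ~~ good (ptv z)] <= C2)%N.
  rewrite /C2 -six; apply: uniq_leq_size; first by rewrite filter_uniq // uix // filter_uniq.
  move=> [P' i]; rewrite mem_filter mix mem_filter => /andP[gd /andP[/andP[ne _] li]].
  rewrite mix li andbT mem_undup; have [r [hk er e]] := hptv P' i ne.
  by move: gd; rewrite e /good negbK => /eqP /(hT _ _ _ ne hk er).
have s1 : size pts = (size (filter good pts) + size (filter (predC good) pts))%N.
  by rewrite !size_filter count_predC.
have s2 : size (ix sp') = (size [seq z <- ix sp' | good (ptv z)] + size [seq z <- ix sp' | ~~ good (ptv z)])%N.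
  by rewrite !size_filter -(count_predC (fun z => good (ptv z))).
move: (six sp') good1 good2 bad1 bad2 s1 s2 sps; clear.
move: (size (ix sp')) (size (filter good pts)) (size (filter (predC good) pts)) (size pts) => a1 a2 a3 a4.
move: (size [seq z <- ix sp' | good (ptv z)]) (size [seq z <- ix sp' | ~~ good (ptv z)]) => a5 a6.
move: (\sum_(P' <- sp) dg P')%N (\sum_(P' <- sp') dg P')%N C1 C2 d => b1 b2 b3 b4 b5; lia.
Qed.

End Denominator.
End Link.

Lemma point_count (B : nat -> nat) (rr : place iota -> F -> L) :
  (forall r : nat, (1 <= r)%N -> has_card (places_of_degree iota r) (B r)) -> (2 <= g)%N ->
  (forall P', reshom iota j (sval P') (rr P')) ->
  exists C r0, forall r (sp : seq (place iota)), (r0 <= r)%N ->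
  uniq sp -> (forall P', (P' \in sp) = (dg P' %| 2 * d * r)%N) ->
  (\sum_(P' <- sp) dg P' <= q ^ (2 * d * r) + C * q ^ (d * r))%N /\
  (q ^ (2 * d * r) <= \sum_(P' <- sp) dg P' + C * q ^ (d * r))%N.
Proof.
move=> hB g2 hrr; have [nu [om [x [y [c [cop chn [hx x0 ox] [hy y0 oy] hcurve]]]]]] := exists_plane_model.
have [px epx] := AE_eE hx.1; have [py epy] := AE_eE hy.1.
have [s [s0 hs]] := exists_denominator hB g2 cop hx x0 ox hy y0 oy.
have [C1 hC1] := count_places hB g2 cop x0 ox y0 oy hcurve epx epy s0 hs hrr.
have q1 : (1 < q ^ d)%N by rewrite -[1%N](expn0 q) ltn_exp2l // card_gt1.
have kf e : kL e ^+ (q ^ d) = kL e.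
  by have [t [_ ->]] := kE_pi e; rewrite horner_fix (prim_fix d0 hz).
have [C [r0 h]] := stepanov_bound oE_M oE_D (oE_C x) (fEX0 x0) (oE_x ox) y0 (oE_y oy) cop hcurve q1 (pchar_cardX j d) kf chn.
(* The successor makes the exponent [2 * d * r] positive, as [count_places] requires. *)
exists (C + C1)%N, r0.+1 => r sp ler us hsp.
have [pts [up hp]] := h r (ltnW ler); rewrite -!expnM.
have -> : (d * (2 * r) = 2 * d * r)%N by lia.
move=> b1 b2; have [|||c1 c2] := hC1 (2 * d * r)%N pts sp _ _ up _ us hsp.
- by rewrite !muln_gt0 d0 (leq_trans _ ler).
- by rewrite mulnAC dvdn_mull.
- by move=> p; rewrite hp -expnM (_ : d * (2 * r) = 2 * d * r)%N //; lia.
have : (0 < q ^ (d * r))%N by rewrite expn_gt0 (ltnW (card_gt1 K)).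
move: b1 b2 c1 c2; rewrite mulnDl.
move: (q ^ (2 * d * r))%N (q ^ (d * r))%N (\sum_(P' <- sp) dg P')%N (size pts) => a1 a2 a3 a4.
move=> b1 b2 c1 c2 a20; have := leq_pmulr C1 a20; clear -b1 b2 c1 c2.
by move: (C1 * a2)%N (C * a2)%N b1 b2 => u v; lia.
Qed.

End ConstantExtension.

Section PointCount.
Variables (K : finFieldType) (F : fieldType) (iota : {rmorphism K -> F}).
Hypothesis hFF : function_field iota.
Hypothesis hfull : full_constant_field iota.
Variable B : nat -> nat.
Hypothesis hB : forall r : nat, (1 <= r)%N -> has_card (places_of_degree iota r) (B r).
Variable g : nat.
Hypothesis hg : genus iota g.
Hypothesis g2 : (2 <= g)%N.

Theorem hasse_weil_weak (P : place iota) : exists C r0, forall r (sp : seq (place iota)), (r0 <= r)%N ->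
  uniq sp -> (forall P', (P' \in sp) = (dg P' %| 2 * dg P * r)%N) ->
  (\sum_(P' <- sp) dg P' <= #|K| ^ (2 * dg P * r) + C * #|K| ^ (dg P * r))%N /\
  (#|K| ^ (2 * dg P * r) <= \sum_(P' <- sp) dg P' + C * #|K| ^ (dg P * r))%N.
Proof.
have [L [j _]] := countable_algebraic_closure K.
have /choice[rr hrr] (P' : place iota) := exists_reshom j hFF (svalP P').
have hr := hrr P; have hO := svalP P; have d0 := dg_gt0 hFF P.
have [zt hz] := exists_prim j d0; have zfix := prim_fix d0 hz.
have [th0 thO rth] := (rh_img hr zt).1 zfix.
have [mu [emu mum smu irr hmu]] := minpoly_exists j d0 hz.
have muz : (map_poly j mu).[zt] = 0.
  apply/eqP; rewrite emu -rootE root_prod_XsubC; apply/mapP; exists 0%N; rewrite ?mem_iota ?expn0 ?expr1 //.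
have irrF := irreducible_ext hFF (Ls0 hFF hfull hg) mum irr.
have [E [iE [th [rtE genE kerE]]]] := adjoin_root irrF.
have [k [ik [thk [rtk genk kerk]]]] := adjoin_root irr.
have rtE' : (map_poly (iE \o iota) mu).[th] = 0 by rewrite map_poly_comp.
have [kE hkE] := @adjoin_map _ _ _ mu ik thk (iE \o iota) th genk kerk rtE'.
have [kL hkL] := @adjoin_map _ _ _ mu ik thk j zt genk kerk muz.
exact: (point_count hFF hfull hg hr hz thO rth mum smu muz irrF rtE genE kerE genk hkE hkL hB g2 hrr).
Qed.
End PointCount.

(** * Counting effective divisors *)

Lemma size_fibers (T S : eqType) (f : T -> S) (s : seq T) (t : seq S) : uniq t ->
  (forall x, x \in s -> f x \in t) -> size s = (\sum_(y <- t) count (fun x => f x == y) s)%N.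
Proof.
move=> ut; elim: s => [|x s IH] h; first by rewrite big1.
rewrite /= big_split /= -IH => [|y ys]; last by apply: h; rewrite inE ys orbT.
rewrite (bigD1_seq (f x)) //=; last by apply: h; rewrite mem_head.
by rewrite eqxx big1 // => y; rewrite eq_sym => /negPf ->.
Qed.

Section Counting.
Variables (K : finFieldType) (F : fieldType) (iota : {rmorphism K -> F}).
Hypothesis hFF : function_field iota.
Hypothesis hfull : full_constant_field iota.
Variable B : nat -> nat.
Hypothesis hB : forall r : nat, (1 <= r)%N -> has_card (places_of_degree iota r) (B r).
Variable g : nat.
Hypothesis hg : genus iota g.
Hypothesis g2 : (2 <= g)%N.
Local Notation place := (place iota).
Local Notation q := #|K|.
Implicit Types (P : place) (D C : place -> int) (s : seq place).

Fixpoint exps s (n : nat) : seq (place -> int) :=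
  if s is P :: s' then
    [seq D + pt P *+ k | k <- [seq k <- seq.iota 0 n.+1 | (k * dg P <= n)%N], D <- exps s' (n - k * dg P)]
  else if n == 0%N then [:: 0] else [::].

Lemma exps_cons P s n : exps (P :: s) n =
  [seq D + pt P *+ k | k <- [seq k <- seq.iota 0 n.+1 | (k * dg P <= n)%N], D <- exps s (n - k * dg P)].
Proof. by []. Qed.

Lemma size_exps s n : size (exps s n) = cnt (map (@dg _ _ iota) s) n.
Proof.
elim: s n => [|P s IH] n; first by rewrite /=; case: eqP.
rewrite exps_cons size_allpairs_dep sumnE big_map big_filter.
rewrite [RHS]/= -(big_mkord (fun k => k * dg P <= n)%N (fun k => cnt (map (@dg _ _ iota) s) (n - k * dg P))).
by rewrite /index_iota subn0; apply: eq_bigr => k _; rewrite IH.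
Qed.

Lemma mem_exps s n D : D \in exps s n <->
  [/\ leD 0 D, forall P, D P != 0 -> P \in s & deg D = n%:Z].
Proof.
elim: s n D => [|P s IH] n D.
  rewrite /=; split=> [|[_ h2 h3]].
    case: eqP => // ->; rewrite inE => /eqP ->; split=> [P|P|]; rewrite ?deg0 // eqxx.
  have e : D = 0 by apply/funext => P; apply/eqP/negPn/negP => /h2.
  by move: h3; rewrite e deg0; case: eqP => [_ _|]; [rewrite mem_head|lia].
rewrite exps_cons; split=> [/allpairsPdep[k [D' [hk /IH[h1 h2 h3] ->]]]|[h1 h2 h3]].
  have fD' : fs D' by exists s.
  have fk := fsMn k (fs_pt P); split=> [P'|P'|].
  - by rewrite addfE ptMnE; have := h1 P'; case: ifP; lia.
  - by rewrite addfE ptMnE inE; case: (P' == P) => //=; rewrite addr0; exact: h2.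
  - by rewrite degD // deg_ptMn h3; move: hk; rewrite mem_filter => /andP[]; lia.
have fD : fs D by exists (P :: s).
pose k := `|D P|%N; pose D' := D - pt P *+ k.
have kP : k%:Z = D P by have := h1 P; rewrite /k; lia.
have D'E Q : D' Q = if Q == P then 0 else D Q.
  by rewrite /D' addfE oppfE ptMnE; case: eqP => [->|_]; rewrite ?kP ?subrr ?subr0.
have D'0 : leD 0 D' by move=> Q; rewrite D'E; case: ifP => // _; exact: h1.
have fD' : fs D' := fsB fD (fsMn k (fs_pt P)).
have dD' : deg D' = n%:Z - (dg P * k)%N%:Z by rewrite degB ?deg_ptMn ?h3 //; exact: fsMn (fs_pt P).
have := deg_ge0 fD' D'0; rewrite dD' => ge0.
have dP := dg_gt0 hFF P; have lek : (k * dg P <= n)%N by rewrite mulnC; lia.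
apply/allpairsPdep; exists k, D'; split; last by rewrite subrK.
  by rewrite mem_filter lek mem_iota /= add0n ltnS (leq_trans _ lek) // leq_pmulr.
apply/IH; split=> // [Q|]; last by rewrite dD' mulnC; lia.
by rewrite D'E; case: ifP => [|ne /h2]; rewrite ?eqxx // inE ne.
Qed.

Lemma uniq_exps s n : uniq s -> uniq (exps s n).
Proof.
elim: s n => [|P s IH] n; first by rewrite /=; case: eqP.
case/andP=> nP us; rewrite exps_cons; apply: allpairs_uniq_dep => [|k _|]; [exact/filter_uniq/iota_uniq|exact: IH|].
have z0 m D : D \in exps s m -> D P = 0.
  by case/mem_exps => _ h _; apply/eqP/negPn/negP => /h; rewrite (negPf nP).
move=> x y /allpairsPdep[k1 [D1 [_ /z0 h1 ->]]] /allpairsPdep[k2 [D2 [_ /z0 h2 ->]]] /= e.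
have ek : k1 = k2.
  have := congr1 (fun D => D P) e; rewrite /= !addfE !ptMnE !eqxx h1 h2 !add0r; lia.
by subst k2; move/addIr: e => ->.
Qed.

Lemma eff_dg D P : fs D -> leD 0 D -> D P != 0 -> (dg P)%:Z <= deg D.
Proof.
move=> fD D0 DP; rewrite -deg_pt; apply: leD_deg => //; first exact: fs_pt.
by move=> Q; rewrite /pt; have := D0 Q; case: eqP => [->|_]; move: DP; rewrite /GRing.zero /=; lia.
Qed.

(** By [eff_dg] a place of degree above [n] cannot occur in an effective divisor of degree [n], so
    [s] already supports all of them. *)
Lemma exps_all s s' n : uniq s -> uniq s' -> (forall P, (dg P <= n)%N -> P \in s) ->
  (size (exps s' n) <= size (exps s n))%N.
Proof.
move=> us us' hs; apply: uniq_leq_size; first exact: uniq_exps.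
move=> D /mem_exps[h1 h2 h3]; apply/mem_exps; split=> // P DP; apply: hs.
have fD : fs D by exists s'.
by have := eff_dg fD h1 DP; rewrite h3.
Qed.

Lemma Ls_list C : fs C -> exists s : seq F, [/\ uniq s, size s = (q ^ ell C)%N & forall z, z \in s <-> Ls C z].
Proof.
move=> fC; have [[b hb ind] le] := ellP hFF hg fC.
have [_ _ span] := indep_basis (subsp_zero _) le hb ind.
pose f (c : 'rV[K]_(ell C)) : F := \sum_i c 0 i *: b i.
have finj : injective f.
  move=> c c' e; apply/eqP; rewrite -subr_eq0; apply/eqP/ind.
  rewrite /zerosp; under eq_bigr => i _ do rewrite !mxE scalerBl.
  by rewrite sumrB; apply/eqP; rewrite subr_eq0; apply/eqP.
exists [seq f c | c <- enum 'rV[K]_(ell C)]; split.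
- by rewrite map_inj_uniq ?enum_uniq.
- by rewrite size_map -cardE card_mx mul1n.
move=> z; split=> [/mapP[c _ ->]|/span[c]]; first exact: subsp_comb (subsp_Ls hFF C) hb.
by rewrite /zerosp => /eqP; rewrite subr_eq0 => /eqP ->; apply/mapP; exists c; rewrite ?mem_enum.
Qed.

Section Classes.
Variable h : nat.
Hypothesis hh : class_number iota h.

Lemma lin_equivE (A D : (F -> Prop) -> int) : lin_equiv iota A D <-> exists2 z, z != 0 & dv z = restr A - restr D :> (place -> int).
Proof.
split=> [[z [z0 hz]]|[z z0 e]]; exists z => //.
  by apply/funext => P; exact: (val_ord hFF (svalP P) z0 (hz _ (svalP P))).
split=> // O hO; have -> : A O - D O = dv z (exist _ O hO) by rewrite e.
exact: (ordP hFF hO z0).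
Qed.

Lemma class_reps : exists Ds : 'I_h -> place -> int,
  [/\ forall i, fs (Ds i) /\ deg (Ds i) = 0,
    forall i i' z, z != 0 -> dv z = Ds i - Ds i' -> i = i' &
    forall D, fs D -> deg D = 0 -> exists i z, z != 0 /\ dv z = D - Ds i].
Proof.
have [Ds [h1 h2 h3]] := hh; exists (fun i => restr (Ds i)); split=> [i|i i' z z0 e|D fD dD].
- by have [a b] := h1 i; split; [exact: fs_restr|rewrite -(div_degreeE hFF a b)].
- by apply: h2; apply/lin_equivE; exists z.
have := ext_degree hFF fD; rewrite dD => /(h3 _ (ext_divisor fD))[i /lin_equivE[z z0]].
by rewrite restr_ext => e; exists i, z.
Qed.

Lemma h_gt0 : (0 < h)%N.
Proof. by have [Ds [_ _ h3]] := class_reps; have [[i hi] _] := h3 0 (@fs0 _ _ iota) (deg0 iota); exact: leq_ltn_trans hi. Qed.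

Lemma dv_eq_const z z' : z != 0 -> z' != 0 -> dv z = dv z' :> (place -> int) -> exists2 a, a != 0 & z = iota a * z'.
Proof.
move=> z0 z0' e; have n0 : z / z' != 0 by rewrite mulf_neq0 ?invr_eq0.
have [|a ea] := @Ls0 _ _ _ hFF hfull _ hg (z / z').
  apply/(LsE _ n0) => P; rewrite add0r (dv_mul hFF) ?invr_eq0 // (dvV hFF) // e subrr //.
by exists a; [rewrite -(fmorph_eq0 iota) -ea|rewrite -ea mulfVK].
Qed.

(** Sending a nonzero [z] in [L(Cs i)] to the divisor [Cs i + dv z] reaches every effective divisor
    of degree [n]. Each fibre has [q - 1] elements, since [z] is determined up to a nonzero constant
    and the class up to equality. *)
Lemma class_count n D0 s : fs D0 -> deg D0 = n%:Z -> uniq s -> (forall P, (dg P <= n)%N -> P \in s) ->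
  exists Cs : 'I_h -> place -> int, (forall i, fs (Cs i) /\ deg (Cs i) = n%:Z) /\
  ((q - 1) * size (exps s n) = \sum_(i < h) (q ^ ell (Cs i) - 1))%N.
Proof.
move=> fD0 dD0 us hs; have [Ds [hD1 hD2 hD3]] := class_reps; pose Cs i := Ds i + D0.
have hC i : fs (Cs i) /\ deg (Cs i) = n%:Z.
  by have [a b] := hD1 i; split; [exact: fsD|rewrite degD // b add0r].
exists Cs; split=> //.
have /choice[Z hZ] i := Ls_list (hC i).1.
pose Z' i := rem 0 (Z i).
have mZ' i z : (z \in Z' i) <-> (z != 0) /\ Ls (Cs i) z.
  have [uZ _ hz] := hZ i; rewrite /Z' mem_rem_uniq // inE; split=> [/andP[a /hz b]|[-> /hz]] //.
have sZ' i : size (Z' i) = (q ^ ell (Cs i) - 1)%N.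
  have [uZ sZ hz] := hZ i; rewrite /Z' size_rem ?sZ ?subn1 //; apply/hz => P; exact: vge0.
pose lst := [seq (i, z) | i <- enum 'I_h, z <- Z' i].
have mlst i z : ((i, z) \in lst) <-> (z != 0) /\ Ls (Cs i) z.
  rewrite -mZ'; split=> [/allpairsPdep[i1 [z1 [_ h1 [-> ->]]]]//|h1].
  by apply/allpairsPdep; exists i, z; rewrite mem_enum.
have ulst : uniq lst.
  apply: allpairs_uniq_dep => [|i _|]; [exact: enum_uniq|by apply: rem_uniq; case: (hZ i)|].
  by move=> [i1 z1] [i2 z2] /= _ _ [-> ->].
pose f (x : 'I_h * F) := Cs x.1 + dv x.2 : place -> int.
have flst x : x \in lst -> f x \in exps s n.
  case: x => i z /mlst[z0 /(LsE _ z0) le]; have [fC dC] := hC i; have fz := fs_dv hFF hB z0.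
  have fD := fsD fC fz; have dD : deg (f (i, z)) = n%:Z by rewrite degD // (deg_dv hFF hB hg z0) addr0.
  by apply/mem_exps; split=> // P DP; apply: hs; have := eff_dg fD le DP; rewrite dD.
have slst : size lst = (\sum_(i < h) (q ^ ell (Cs i) - 1))%N.
  rewrite size_allpairs_dep sumnE big_map big_enum; apply: eq_bigr => i _; exact: sZ'.
rewrite -slst (size_fibers (uniq_exps n us) flst) big_seq.
rewrite (eq_bigr (fun=> (q - 1)%N)) => [|D /mem_exps[D1 D2 D3]].
  by rewrite -big_seq big_const_seq count_predT iter_addn_0.
have fD : fs D by exists s.
have [|i0 [z0 [z00 e0]]] := hD3 (D - D0) (fsB fD fD0); first by rewrite degB // D3 dD0 subrr.
have eD : f (i0, z0) = D by rewrite /f /= e0 /Cs; apply/funext => P; rewrite !(addfE, oppfE); lia.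
rewrite -size_filter.
have -> : (q - 1)%N = size [seq (i0, iota a * z0) | a <- rem 0 (enum K)].
  by rewrite size_map size_rem ?mem_enum // -cardE subn1.
apply/perm_size/uniq_perm; first exact: filter_uniq.
  rewrite map_inj_uniq ?rem_uniq ?enum_uniq // => a b [/(mulIf z00)]; exact: fmorph_inj.
case=> i z; rewrite mem_filter; apply/andP/mapP => [[/eqP e /mlst[zn _]]|[a]].
  have ii : i = i0.
    apply: (@hD2 i i0 (z0 / z)); first by rewrite mulf_neq0 ?invr_eq0.
    rewrite (dv_mul hFF) ?invr_eq0 // (dvV hFF) //; apply/funext => P.
    have := congr1 (fun D => D P) e; have := congr1 (fun D => D P) eD.
    by rewrite /f /Cs /= !(addfE, oppfE); lia.
  subst i0; have ez : dv z = dv z0 :> (place -> int).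
    apply/funext => P; have := congr1 (fun D => D P) e; have := congr1 (fun D => D P) eD.
    by rewrite /f /Cs /= !(addfE, oppfE); lia.
  have [a a0 ->] := dv_eq_const zn z00 ez; exists a => //.
  by rewrite mem_rem_uniq ?enum_uniq // inE a0 mem_enum.
rewrite mem_rem_uniq ?enum_uniq // inE => /andP[a0 _] [-> ->].
have a0' : iota a != 0 by rewrite fmorph_eq0.
have e : f (i0, iota a * z0) = D by rewrite -eD /f /= (dv_mul hFF) // (dv_const hFF) // add0r.
split; first by rewrite e.
apply/mlst; have zn : iota a * z0 != 0 by rewrite mulf_neq0.
by split=> //; apply/(LsE _ zn); rewrite -[Cs i0 + _]/(f (i0, iota a * z0)) e.
Qed.

Theorem divisor_count_bound : exists A : nat -> nat,
  ((q - 1) ^ 2 * (\sum_(n < g) A n + \sum_(n < g - 1) q ^ (g - 1 - n) * A n) + h * B 1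
    <= h * ((g + 1) * (q + 1)))%N /\
  forall (D : seq nat) n, uniq D -> (forall r, r \in D -> (1 <= r)%N) ->
    (cnt (flatten [seq nseq (B r) r | r <- D]) n <= A n)%N.
Proof.
have /choice[S hS] N := places_upto hFF hB N.
have uS N : uniq (S N) := (hS N).1; have mS N P : (P \in S N) = (dg P <= N)%N := (hS N).2 P.
pose A n := size (exps (S n) n); pose N n := (\sum_(P <- S n | dg P %| n) dg P)%N.
have AE M n : (n <= M)%N -> size (exps (S M) n) = A n.
  move=> le; apply/eqP; rewrite eqn_leq !exps_all // => P hP; rewrite mS ?(leq_trans hP) //.
exists A; split; last first.
  (* The list [sD] of all places with degree in [D] turns [cnt] into the number of effective
     divisors supported on [sD]. *)
  move=> D n uD hD.
  have /choice[ps hps] r : exists s, (1 <= r)%N -> [/\ uniq s, size s = B r & forall P, (P \in s) = (dg P == r)].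
    by case: r => [|r]; [exists [::]|have [s h1] := places_of hFF hB (ltn0Sn r); exists s].
  pose sD := flatten [seq ps r | r <- D].
  have msD P : P \in sD -> dg P \in D.
    by case/flattenP => t /mapP[r hr ->]; have [_ _ ->] := hps r (hD r hr) => /eqP ->.
  have [udD eD] : uniq sD /\ flatten [seq nseq (B r) r | r <- D] = map (@dg _ _ iota) sD.
    rewrite /sD in msD *; elim: D uD hD {msD sD} => [|r D IH] //= /andP[nr uD] hD.
    have [|u1 e1] := IH uD; first by move=> r' h'; apply: hD; rewrite inE h' orbT.
    have [ur sr mr] := hps r (hD r (mem_head _ _)).
    rewrite cat_uniq ur u1 andbT map_cat e1; split.
      apply/hasPn => P /flattenP[t /mapP[r' hr' ->]].
      have [|_ _ ->] := hps r' (hD r' _); first by rewrite inE hr' orbT.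
      by move=> /eqP e /=; rewrite mr e; apply: contraNneq nr => <-.
    congr (_ ++ _); rewrite -sr -(size_map (@dg _ _ iota)); apply/esym/all_pred1P/allP.
    by move=> x /mapP[P]; rewrite mr => /eqP <- ->; rewrite /= eqxx.
  by rewrite eD -size_exps; apply: exps_all => // P; rewrite mS.
have [P0 _] := exists_place hFF hfull hg g2.
(* [dl] is the least positive degree of a divisor; by Euclidean division it divides every degree. *)
pose isd n := `[< (0 < n)%N /\ exists2 D : place -> int, fs D & deg D = n%:Z >].
have exd : exists n, isd n.
  by exists (dg P0); apply/asboolP; split; [exact: dg_gt0|exists (pt P0); [exact: fs_pt|exact: deg_pt]].
pose dl := ex_minn exd.
have [dl0 [Dd fDd dDd]] : (0 < dl)%N /\ exists2 D : place -> int, fs D & deg D = dl%:Z.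
  by rewrite /dl; case: ex_minnP => n /asboolP.
have dlmin n : (0 < n)%N -> (exists2 D : place -> int, fs D & deg D = n%:Z) -> (dl <= n)%N.
  by move=> n0 hn; rewrite /dl; case: ex_minnP => m _; apply; apply/asboolP.
have dldvd n (D : place -> int) : fs D -> deg D = n%:Z -> (dl %| n)%N.
  move=> fD dD; rewrite /dvdn; apply/negPn/negP; rewrite -lt0n => m0.
  have := ltn_pmod n dl0; rewrite ltnNge => /negP; apply; apply: dlmin => //.
  have f1 := fsMn (n %/ dl) fDd; exists (D - Dd *+ (n %/ dl)); first exact: fsB.
  rewrite degB // degMn // dD dDd; have := divn_eq n dl; move: (n %/ dl)%N (n %% dl)%N => a b; nia.
have degn n : (dl %| n)%N -> exists2 D : place -> int, fs D & deg D = n%:Z.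
  by case/dvdnP=> a ->; exists (Dd *+ a); [exact: fsMn|rewrite degMn // dDd; nia].
have [C [r0 hw]] := hasse_weil_weak hFF hfull hB hg g2 P0.
have N1 : N 1%N = B 1%N.
  have [s [us ss ms]] := places_of hFF hB (leqnn 1).
  rewrite /N -ss -sum1_size -big_filter; transitivity (\sum_(P <- s) dg P)%N.
    apply: perm_big; apply: uniq_perm => [||P]; rewrite ?filter_uniq //.
    by rewrite mem_filter mS ms dvdn1; case: eqP => [->|].
  by rewrite big_seq [RHS]big_seq; apply: eq_bigr => P; rewrite ms => /eqP.
have q1 := card_gt1 K.
(* The bound [r0.+1] excludes [r = 0], for which every degree divides the exponent. *)
rewrite -N1; apply: (@zeta_bound q g h dl (dg P0) C r0.+1 A N) => //.
- exact: h_gt0.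
- by rewrite /A size_exps cnt0.
- move=> n; rewrite /A size_exps cnt_euler; last by apply/allP => x /mapP[P _ ->]; exact: dg_gt0.
  apply: eq_bigr => i _; rewrite -size_exps AE ?leq_subr //; congr (_ * _)%N.
  rewrite /divsum big_map /N -big_filter -[RHS]big_filter; apply: perm_big; apply: uniq_perm => [||P]; rewrite ?filter_uniq //.
  rewrite !mem_filter !mS; case: (boolP (_ %| _)%N) => //= dv; have := dvdn_leq (ltn0Sn i) dv.
  by move=> le; rewrite le (leq_trans le).
- move=> n; apply: contraNeq; rewrite /A => ne.
  case: (exps (S n) n) (fun D => (mem_exps (S n) n D).1) ne => //= D t hD _.
  by have [_ h2 h3] := hD D (mem_head _ _); apply: (dldvd n D) => //; exists (S n).
- move=> n dn le; have [D0 fD0 dD0] := degn n dn.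
  have [|Cs [hC e]] := class_count fD0 dD0 (uS n); first by move=> P; rewrite mS.
  rewrite [A n]/(size _) e (eq_bigr (fun=> (q ^ (n + 1 - g) - 1)%N)) => [|i _].
    rewrite sum_nat_const card_ord; have : (0 < q ^ (n + 1 - g))%N by rewrite expn_gt0 ltnW.
    by move: (q ^ (n + 1 - g))%N => Q; nia.
  have [fC dC] := hC i; have := ell_large hFF hfull hB hg g2 fC; rewrite dC => e1.
  by congr (q ^ _ - 1)%N; have := e1 ltac:(lia); lia.
- exact: dg_gt0.
- by apply: (dldvd _ (pt P0)); [exact: fs_pt|exact: deg_pt].
move=> r ler; rewrite /N -big_filter; apply: (hw r) => //; [exact: ltnW|exact: filter_uniq|].
move=> P'; rewrite mem_filter mS; case: (boolP (_ %| _)%N) => //= dv; apply: dvdn_leq => //.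
by rewrite !muln_gt0 (dg_gt0 hFF) (leq_ltn_trans (leq0n r0) ler).
Qed.

End Classes.
End Counting.

(* Assembling the bound *)
Local Close Scope ring_scope.
Unset Implicit Arguments.
Set Strict Implicit.

Theorem theorem1p6 (K : finFieldType) (F : fieldType) (iota : {rmorphism K -> F})
  (hFF : function_field iota) (hfull : full_constant_field iota)
  (g : nat) (hg : genus iota g) (hg2 : (2 <= g)%N)
  (h : nat) (hh : class_number iota h)
  (B : nat -> nat)
  (hB : forall r : nat, (1 <= r)%N -> has_card (places_of_degree iota r) (B r))
  (D1 D2 : seq nat) (hD1u : uniq D1) (hD2u : uniq D2)
  (hD1 : forall r, r \in D1 -> [/\ (1 <= r)%N, (r <= g - 1)%N & (1 <= B r)%N])
  (hD2 : forall r, r \in D2 -> [/\ (1 <= r)%N, (r <= g - 2)%N & (1 <= B r)%N])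
  (l m : nat -> nat)
  (hl : (\sum_(r <- D1) r * l r <= g - 1)%N)
  (hm : (\sum_(r <- D2) r * m r <= g - 2)%N) :
  Rge (INR h) (hBRT #|K| g B D1 D2 l m).
Proof.
have q1 : (1 < #|K|)%N := card_gt1 K.
have [A [hA hsub]] := divisor_count_bound hFF hfull hB hg hg2 hh.
apply: Rle_ge; apply: (real_bound _ _ _ _ _ _ _ _ q1 hA).
- rewrite prodRE (eq_bigr (fun r => negbin (1 : R)%R r (B r) (l r))) => [|r _]; last by rewrite negbin1 INRE.
  split; apply/RleP; first by apply: prodr_ge0 => r _; apply: sumr_ge0 => k _; rewrite mulr_ge0 ?ler0n ?exprn_ge0.
  have pos r : r \in D1 -> (0 < r)%N by case/hD1.
  apply: le_trans (@wcnt_prod R _ ler01 B _ _ _ pos hl) _.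
  rewrite wcnt1 (_ : (g - 1).+1 = g); last by lia.
  apply/RleP/le_INR/ssrnat.leP/leq_sum => n _; exact: hsub.
- have iq : (0 <= / INR #|K| :> R)%R by rewrite RinvE invr_ge0 INRE ler0n.
  rewrite prodRE big_seq (eq_bigr (fun r => negbin (/ INR #|K| : R)%R r (B r) (m r))) => [|r hr]; last first.
    by have [r1 _ b1] := hD2 r hr; rewrite -taylor_factor.
  rewrite -big_seq.
  have p0 : (0 <= \prod_(r <- D2) negbin (/ INR #|K| : R)%R r (B r) (m r))%R.
    by apply: prodr_ge0 => r _; apply: sumr_ge0 => k _; rewrite mulr_ge0 ?ler0n ?exprn_ge0.
  have Q0 : (0 <= INR #|K| ^+ (g - 1) :> R)%R by rewrite exprn_ge0 // INRE ler0n.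
  rewrite RpowE; split; apply/RleP; first exact: mulr_ge0.
  have pos r : r \in D2 -> (0 < r)%N by case/hD2.
  apply: le_trans (ler_wpM2l Q0 (@wcnt_prod R _ iq B _ _ _ pos hm)) _.
  (* Weights at most [g - 2] are the indices [n < g - 1] of the second sum, and [q ^ (g - 1)] turns
     each weight [q ^ (- n)] into [q ^ (g - 1 - n)]. *)
  have eg : (g - 2).+1 = (g - 1)%N by lia.
  rewrite -RpowE -eg [X in (X <= _)%R](wcnt_inv _ _ _ (ltnW q1)) eg.
  apply/RleP/le_INR/ssrnat.leP/leq_sum => n _; by rewrite leq_mul2l hsub ?orbT.
Qed.
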